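(* (Concentration inequality.) Let $F\in\mathrm{Dom}(\mathcal{D})\cap L^\infty(\mathcal{C})$ be self-adjoint with $\int_0^\infty\|\mathcal{D}_tF\|^2_{L^\infty(\mathcal{C})}\,dt<\infty$, and let $F=\int_{-\infty}^\infty\lambda\,dE_\lambda$ be its spectral decomposition, with projection-valued measure $E$. If $$h(s)=\int_0^\infty\|\mathcal{D}_tF\|_{L^\infty(\mathcal{C})}\,\big\|e^{-sF}\,\mathcal{D}_te^{sF}\big\|_{L^\infty(\mathcal{C})}\,dt$$ is a monotonic function of $s$ on $[0,\infty)$, then for every $x\ge0$ $$m\big(E([m(F)+x,\infty))\big)\le\exp\Big(-\int_0^xh^{-1}(s)\,ds\Big).$$
   Context: $L^2(\mathbb{R}_+)$ is the complex $L^2$ space for Lebesgue measure (inner products linear in the second variable), with complex conjugation $J$. For $h\in L^2(\mathbb{R}_+^n)$ its anti-symmetrization is $\hat h(t_1,\dots,t_n)=\frac1{n!}\sum_{\sigma\in S_n}\mathrm{sgn}(\sigma)h(t_{\sigma(1)},\dots,t_{\sigma(n)})$. $\Lambda_n$ is the space of anti-symmetric functions in $L^2(\mathbb{R}_+^n)$ with inner product $\langle f,g\rangle_{\Lambda_n}=n!\int\overline{f}g\,d\mathbf{x}$, and $\Lambda_0=\mathbb{C}$. $\Gamma_a=\bigoplus_{n\ge0}\Lambda_n$ is the anti-symmetric Fock space (Hilbert direct sum) with vacuum vector $\Omega=1\in\Lambda_0$. For $z\in L^2(\mathbb{R}_+)$, $b^*(z)$ is the bounded operator with $b^*(z)w=\widehat{z\otimes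 w}$ for $w\in\Lambda_n$, $b(z)$ is its adjoint, and $\Psi(z)=b^*(z)+b(Jz)$. $\mathcal{C}$ is the von Neumann algebra generated by $\{\Psi(z)\}$, and $m(u)=\langle\Omega,u\Omega\rangle$ is a faithful normal tracial state on it; $L^2(\mathcal{C})$ is the completion of $\mathcal{C}$ for the inner product $m(u^*v)$, and $L^\infty(\mathcal{C})=\mathcal{C}$ with the operator norm. The map $u\mapsto u\Omega$ extends to a unitary $L^2(\mathcal{C})\to\Gamma_a$, and for $f\in\Lambda_n$, $J_n(f)\in L^2(\mathcal{C})$ denotes the element mapped to $f$ by this unitary; $J_{-1}(\cdot)=0$. On finite sums of $J_n(v_n)$, $v_n\in\Lambda_n$, $\mathcal{D}$ is defined by linearity and $\mathcal{D}_t(J_n(v_n))=nJ_{n-1}(v_n(t,\cdot))$, as an operator into $L^2(\mathbb{R}_+)\otimes L^2(\mathcal{C})\cong L^2(\mathbb{R}_+;L^2(\mathcal{C}))$; it is closable, and $\mathcal{D}$ also denotes its closure, with domain $\mathrm{Dom}(\mathcal{D})$. $\|\mathcal{D}_tF\|_{L^\infty(\mathcal{C})}$ is the operator norm ($+\infty$ if $\mathcal{D}_tF\notin\mathcal{C}$). $h^{-1}$ denotes the inverse function of $h$, in general understood as $h^{-1}(y)=\sup\{s\ge0:h(s)\le y\}\in[0,\infty]$, with $e^{-\infty}=0$ (note $h(0)=0$). *)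

(* Defs.v *)
From HB Require Import structures.
From mathcomp Require Import all_boot all_order all_algebra perm complex.
From mathcomp Require Import all_classical all_reals all_analysis.
Set Implicit Arguments.
Unset Strict Implicit.
Unset Printing Implicit Defensive.
Import Order.TTheory GRing.Theory Num.Theory.
Import numFieldNormedType.Exports.
Local Open Scope classical_set_scope.
Local Open Scope ring_scope.
Local Open Scope complex_scope.

(******************************************************************************)
(* Conventions.                                                               *)
(* - Elements of L^2 spaces are represented by functions, and are equal when  *)
(*   they agree almost everywhere; operators are functions on these           *)
(*   representatives.                                                         *)
(* - R_+ carries Lebesgue measure on R restricted to [0, +oo[; values of      *)
(*   functions at negative arguments are irrelevant.                          *)
(* - A sequence (v_n)_n of functions of n variables is one function v on      *)
(*   finite sequences; v_n is its restriction to n.-tuple R.                  *)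
(******************************************************************************)

Section ConsMeasure.
Context d (T : measurableType d) (R : realType) (n : nat).
Variables (mu : {sigma_finite_measure set T -> \bar R})
  (nu : {sigma_finite_measure set (n.-tuple T) -> \bar R}).

Definition pair_cons (p : T * n.-tuple T) : n.+1.-tuple T :=
  [tuple of p.1 :: p.2].

Lemma measurable_pair_cons : measurable_fun [set: T * n.-tuple T] pair_cons.
Proof. exact: measurable_cons. Qed.

(* the product measure of mu and nu, on T^(n+1) *)
Definition cons_measure : set (n.+1.-tuple T) -> \bar R :=
  pushforward (mu \x nu)%E pair_cons.

Let measurable_pre A : measurable A -> measurable (pair_cons @^-1` A).
Proof.
by move=> mA; rewrite -[X in measurable X]setTI; exact: measurable_pair_cons.
Qed.

Let cons_measure0 : cons_measure set0 = 0%E.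
Proof. by rewrite /cons_measure /pushforward preimage_set0 measure0. Qed.

Let cons_measure_ge0 A : (0 <= cons_measure A)%E.
Proof. by rewrite /cons_measure /pushforward; apply: measure_ge0. Qed.

Let cons_measure_sigma_additive : semi_sigma_additive cons_measure.
Proof.
move=> F mF tF mUF; rewrite /cons_measure /pushforward preimage_bigcup.
apply: measure_semi_sigma_additive.
- by move=> i; exact: measurable_pre.
- apply/trivIsetP => /= i j _ _ ij; rewrite -preimage_setI.
  by move/trivIsetP : tF => /(_ _ _ _ _ ij) ->//; rewrite preimage_set0.
- by rewrite -preimage_bigcup; exact: measurable_pre.
Qed.

HB.instance Definition _ := isMeasure.Build _ _ _ cons_measure
  cons_measure0 cons_measure_ge0 cons_measure_sigma_additive.

Let cons_measure_sigma_finite : sigma_finite setT cons_measure.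
Proof.
have /sigma_finiteP[F [TF ndF Foo]] := sigma_finiteT mu.
have /sigma_finiteP[G [TG ndG Goo]] := sigma_finiteT nu.
pose uncons (x : n.+1.-tuple T) := (thead x, behead_tuple x).
have consK : cancel pair_cons uncons.
  by case=> t s; rewrite /uncons theadE; congr pair; exact/val_inj.
have muncons : measurable_fun [set: _] uncons.
  apply/measurable_fun_pair; first exact: measurable_tnth.
  exact: measurable_behead.
exists (fun k => uncons @^-1` (F k `*` G k)).
  rewrite -preimage_bigcup (_ : \bigcup_i _ = setT) ?preimage_setT//.
  rewrite -subTset => -[x y] _.
  have [k _ Fkx] : (\bigcup_k F k) x by rewrite -TF.
  have [l _ Gly] : (\bigcup_k G k) y by rewrite -TG.
  exists (maxn k l) => //; split.
    by move: x Fkx; exact/subsetPset/ndF/leq_maxl.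
  by move: y Gly; exact/subsetPset/ndG/leq_maxr.
move=> k; have [mF Fk] := Foo k; have [mG Gk] := Goo k; split.
  rewrite -[X in measurable X]setTI.
  by apply: muncons => //; exact: measurableX.
rewrite /cons_measure /pushforward -comp_preimage.
rewrite (_ : uncons \o _ = id) ?preimage_id; last first.
  by apply/funext => p /=; rewrite consK.
by rewrite product_measure1E// lte_mul_pinfty// ge0_fin_numE.
Qed.

HB.instance Definition _ := Measure_isSigmaFinite.Build _ _ _ cons_measure
  cons_measure_sigma_finite.
End ConsMeasure.

Section LebesgueMeasure.
Variable R : realType.

Definition leb_pos : set (measurableTypeR R) -> \bar R :=
  mrestr (@lebesgue_measure R) (measurable_itv `[0, +oo[).

HB.instance Definition _ := Measure.on leb_pos.

Lemma leb_pos_sigma_finite : sigma_finite setT leb_pos.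
Proof.
have [F TF Foo] := sigma_finiteT (@lebesgue_measure R).
exists F => // n; have [mF Fn] := Foo n; split => //.
apply: le_lt_trans Fn; rewrite /leb_pos /mrestr.
by apply: le_measure; rewrite ?inE//; exact: measurableI.
Qed.

HB.instance Definition _ := Measure_isSigmaFinite.Build _ _ _ leb_pos
  leb_pos_sigma_finite.

End LebesgueMeasure.

(* Lebesgue measure on R_+^n *)
Fixpoint leb_tuple (R : realType) n :
    {sigma_finite_measure set (n.-tuple (measurableTypeR R)) -> \bar R} :=
  if n is m.+1 then cons_measure (@leb_pos R) (leb_tuple R m) else \d_ [tuple].

Notation vect R := (seq R -> R[i]^o).
Notation operator R := (vect R -> vect R).

Section FockSpace.
Variable R : realType.
Local Notation rT := (measurableTypeR R).
Local Notation Re := (@complex.Re R).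
Local Notation Im := (@complex.Im R).
Implicit Types (z : R -> R[i]) (u v w h : vect R) (S T : operator R).

Definition cmeasurable d (X : measurableType d) (f : X -> R[i]) :=
  measurable_fun [set: X] (Re \o f) /\ measurable_fun [set: X] (Im \o f).

Definition cintegral d (X : measurableType d) (mu : {measure set X -> \bar R})
    (f : X -> R[i]) : R[i] :=
  (\int[mu]_x Re (f x)) +i* (\int[mu]_x Im (f x)).

Definition sqmod (c : R[i]) : \bar R := (Normc.normc c ^+ 2)%:E.

Definition L2_pos z :=
  cmeasurable (z : rT -> R[i]) /\ (\int[@leb_pos R]_t sqmod (z t) < +oo)%E.

Definition permute n (p : 'S_n) (x : n.-tuple R) : n.-tuple R :=
  [tuple tnth x (p i) | i < n].

Definition antisym_fun v := forall n (p : 'S_n),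
  {ae leb_tuple R n, forall x : n.-tuple rT, v (permute p x) = (-1) ^+ p * v x}.

(* the square norm of Gamma_a *)
Definition norm2 v : \bar R :=
  (\sum_(0 <= n <oo)
     n`!%:R%:E * \int[leb_tuple R n]_(x in [set: n.-tuple rT]) sqmod (v x))%E.

Definition fock_norm v : R := Num.sqrt (fine (norm2 v)).

Definition fock v :=
  [/\ forall n, cmeasurable (fun x : n.-tuple rT => v x),
      antisym_fun v & (norm2 v < +oo)%E].

Definition fock_eq u v := forall n,
  {ae leb_tuple R n, forall x : n.-tuple rT, u x = v x}.

Definition inner_term u v n : R[i] :=
  n`!%:R * cintegral (leb_tuple R n) (fun x => conjc (u x) * v x).

(* absolutely convergent when u and v are in the Fock space *)
Definition inner u v : R[i] :=
  limn (series (Re \o inner_term u v)) +i* limn (series (Im \o inner_term u v)).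

Definition vacuum : vect R := fun s => (nilp s)%:R.

Definition bounded_op T := [/\ forall u, fock u -> fock (T u),
  forall (a : R[i]) u v, fock u -> fock v ->
    fock_eq (T (a *: u + v)) (a *: T u + T v) &
  exists M : R, forall u, fock u -> fock_norm (T u) <= M * fock_norm u].

Definition adjoint T : operator R := fun u =>
  xget 0 [set v | fock v /\ forall w, fock w -> inner v w = inner u (T w)].

Definition selfadjoint T := forall u v, fock u -> fock v ->
  inner (T u) v = inner u (T v).

Definition op_norm T : \bar R :=
  ereal_sup
    [set (fock_norm (T u))%:E | u in [set u | fock u /\ fock_norm u <= 1]].

(* the exponential series, converging in norm *)
Definition op_exp T : operator R := fun u =>
  xget 0 [set v | fock v /\
    norm2 (v - \sum_(k < n) k`!%:R^-1 *: iter k T u) @[n --> \oo] --> 0%E].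

Definition antisymmetrize h : vect R := fun s =>
  (size s)`!%:R^-1 *
  \sum_(p : 'S_(size s)) (-1) ^+ p * h (permute p (in_tuple s)).

Definition tensor z w : vect R := fun s =>
  if s is t :: s' then z t * w s' else 0.

Definition creation z : operator R := fun w => antisymmetrize (tensor z w).
Definition annihilation z : operator R := adjoint (creation z).
Definition Psi z : operator R := creation z + annihilation (conjc \o z).

(* closedness for the weak operator topology *)
Definition weakly_closed (M : set (operator R)) := forall T, bounded_op T ->
  (forall n (u v : 'I_n -> vect R) (e : R),
     (forall i, fock (u i)) -> (forall i, fock (v i)) -> 0 < e ->
     exists2 S, M S &
       forall i, Normc.normc (inner (u i) (T (v i) - S (v i))) < e) ->
  M T.

Record von_neumann_algebra (M : set (operator R)) : Prop := {
  vna_bounded : forall T, M T -> bounded_op T;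
  vna_id : M id;
  vna_lin : forall (a : R[i]) S T, M S -> M T -> M (a *: S + T);
  vna_comp : forall S T, M S -> M T -> M (S \o T);
  vna_adjoint : forall T, M T -> M (adjoint T);
  vna_closed : weakly_closed M }.

Definition clifford : set (operator R) := [set T | forall M : set (operator R),
  von_neumann_algebra M -> (forall z, L2_pos z -> M (Psi z)) -> M T].

Definition state T : R[i] := inner vacuum (T vacuum).

(* L^2(C) is identified with the Fock space by the unitary extending
   T |-> T vacuum; J_n is then the inclusion of Lambda_n, and left
   multiplication by T in C is the action of T.  The infimum below is over at
   most one value, since the vacuum is separating for C, and is +oo when v is
   not in the image of C. *)
Definition Linf_norm v : \bar R :=
  ereal_inf [set op_norm T | T in [set T | clifford T /\ fock_eq (T vacuum) v]].

(* D_t on finite sums: the component of order n of D_t v is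
   (n + 1) v_(n+1)(t, .) *)
Definition malliavin_finite v (t : R) : vect R :=
  fun s => (size s).+1%:R * v (t :: s).

Definition finite_chaos v :=
  fock v /\ exists N, forall n, (N <= n)%N ->
    {ae leb_tuple R n, forall x : n.-tuple rT, v x = 0}.

Definition field_norm2 (G : R -> vect R) : \bar R :=
  (\int[@leb_pos R]_t norm2 (G t))%E.

(* L^2(R_+; L^2(C)), by jointly measurable representatives *)
Definition L2_field (G : R -> vect R) := [/\
  forall n, cmeasurable (fun x : n.+1.-tuple rT => G (thead x) (behead x)),
  {ae @leb_pos R, forall t, fock (G t)} & (field_norm2 G < +oo)%E].

(* the closure of the graph of malliavin_finite *)
Definition is_malliavin v (G : R -> vect R) := [/\ fock v, L2_field G &
  forall e : R, 0 < e -> exists w, [/\ finite_chaos w,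
    (norm2 (v - w)%R < e%:E)%E &
    (field_norm2 (fun t => G t - malliavin_finite w t)%R < e%:E)%E]].

(* Unique as an element of L^2(R_+; L^2(C)), because malliavin_finite is
   closable; malliavin v is meaningful only when malliavin_dom v. *)
Definition malliavin_dom v := exists G, is_malliavin v G.
Definition malliavin v : R -> vect R := xget 0 [set G | is_malliavin v G].

Definition orthogonal_projection P := [/\ bounded_op P, selfadjoint P &
  forall u, fock u -> fock_eq (P (P u)) (P u)].

(* E is a projection-valued measure, and F is the integral of lambda dE in the
   weak sense: A |-> <u, E(A) u> is a measure against which lambda integrates
   to <u, F u>.  Off-diagonal matrix elements follow by polarization. *)
Definition spectral_decomposition (F : operator R)
    (E : set R -> operator R) := [/\
  forall A, measurable (A : set rT) -> orthogonal_projection (E A),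
  forall u, fock u -> fock_eq (E setT u) u &
  forall u, fock u -> exists mu : {measure set rT -> \bar R}, [/\
    forall A, measurable A -> mu A = (Re (inner u (E A u)))%:E,
    mu.-integrable [set: rT] (fun l : rT => (l : R)%:E) &
    inner u (F u) = (\int[mu]_l (l : R))%:C]].

Definition conc_fun (F : operator R) (s : R) : \bar R :=
  (\int[@leb_pos R]_t
     (Linf_norm (malliavin (F vacuum) t) *
      Linf_norm (op_exp ((- s)%:C *: F)%R
                   (malliavin (op_exp (s%:C *: F)%R vacuum) t))))%E.

Definition gen_inverse (h : R -> \bar R) (y : R) : \bar R :=
  ereal_sup [set s%:E | s in [set s : R | 0 <= s /\ (h s <= y%:E)%E]].

End FockSpace.

Arguments vacuum {R}.

(* Main.v *)
(* The Chernoff bound m(E[a, oo[) <= e^{-sa} L(s), with L(s) = m(e^{sF}), reduces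
   the theorem to the differential inequality L' - m(F) L <= h L: it says that
   the derivative of log L - s m(F) is at most h, and for monotonic h the
   Legendre transform of log L - s m(F) at x is at least the integral of h^{-1}.

   For the differential inequality, let K = (N + 1)^{-1} with N the number
   operator.  Disintegrating the inner product of the Fock space gives
     m(F e^{sF}) - m(F) m(e^{sF}) = int <D_t F, K D_t e^{sF}> dt,
   the subtracted term being the component of order 0.  The operator K is a
   limit of convex combinations of the multipliers w |-> prod_i e(t_i) w with
   e = 1 or -1, which come from automorphisms of the algebra preserving m.  For
   such a G, traciality bounds <G A Omega, e^{sF} B Omega> by |A| |B| m(e^{sF});
   take A = D_t F and B = e^{-sF} D_t e^{sF}.  The same sign flips show that
   e^{sF} Omega is in the domain of D: the Dirichlet form of a single flip does
   not grow by more than a constant under the exponential, and averaging flips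
   gives the multipliers r^N, hence the number operator as r increases to 1. *)
Require Import Defs.
From HB Require Import structures.
From mathcomp Require Import all_boot all_order all_algebra perm complex.
From mathcomp Require Import all_classical all_reals all_analysis.
From mathcomp Require Import measurable_realfun ring lra.
Set Implicit Arguments.
Unset Strict Implicit.
Unset Printing Implicit Defensive.
Import Order.TTheory GRing.Theory Num.Theory.
Import numFieldNormedType.Exports.
Local Open Scope classical_set_scope.
Local Open Scope ring_scope.

(** * The Fock space as an L^2 space of finite sequences *)

Definition chain (R : realType) : Type := seq (measurableTypeR R).
HB.instance Definition _ (R : realType) := Choice.on (chain R).
HB.instance Definition _ (R : realType) := isPointed.Build (chain R) [::].

Section chain.
Variable R : realType.
Local Notation rT := (measurableTypeR R).

Definition tchain n (x : n.-tuple rT) : chain R := x.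

Definition chain_measurable (A : set (chain R)) :=
  forall n, measurable (tchain (n:=n) @^-1` A).

Lemma chain_measurable0 : chain_measurable set0.
Proof. by move=> n; rewrite preimage_set0. Qed.

Lemma chain_measurableC A : chain_measurable A -> chain_measurable (~` A).
Proof. by move=> mA n; rewrite preimage_setC; exact: measurableC (mA n). Qed.

Lemma chain_measurable_bigcup (F : (set (chain R))^nat) :
  (forall i, chain_measurable (F i)) -> chain_measurable (\bigcup_i (F i)).
Proof.
move=> mF n; rewrite preimage_bigcup.
by apply: bigcup_measurable => i _; exact: mF.
Qed.

Definition chain_display : measure_display := default_measure_display.

HB.instance Definition _ := @isMeasurable.Build chain_display (chain R)
  chain_measurable chain_measurable0 chain_measurableC chain_measurable_bigcup.

Lemma measurable_tchain n : measurable_fun [set: n.-tuple rT] (@tchain n).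
Proof. by move=> _ A mA; rewrite setTI; exact: mA. Qed.

HB.instance Definition _ n := @isMeasurableFun.Build _ _ _ _ (@tchain n)
  (@measurable_tchain n).

Lemma measurable_fun_chainP d (T : measurableType d) (f : chain R -> T) :
  measurable_fun setT f <-> forall n, measurable_fun setT (f \o tchain (n:=n)).
Proof.
split=> [mf n|mf _ A mA]; first exact: measurableT_comp.
rewrite setTI; suff: chain_measurable (f @^-1` A) by [].
move=> n; have := mf n measurableT A mA.
by rewrite setTI comp_preimage.
Qed.

Definition to_tuple n (s : chain R) : n.-tuple rT := [tuple nth (0 : R) s i | i < n].

Lemma tchain_to_tuple n (s : chain R) : size s = n -> tchain (to_tuple n s) = s.
Proof.
move=> <-; apply: (@eq_from_nth _ (0 : R)); first by rewrite size_tuple.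
move=> i; rewrite size_tuple => ilt.
by rewrite -(tnth_nth _ _ (Ordinal ilt)) tnth_mktuple.
Qed.

Lemma measurable_to_tuple n : measurable_fun setT (@to_tuple n).
Proof.
apply/measurable_fun_chainP => m; apply/measurable_fun_tnthP => i.
have [im|mi] := ltnP i m.
  rewrite (_ : _ \o _ = (fun x : m.-tuple rT => tnth x (Ordinal im))).
    exact: measurable_tnth.
  by apply/funext => x /=; rewrite tnth_mktuple (tnth_nth 0).
rewrite (_ : _ \o _ = cst 0); first exact: measurable_cst.
by apply/funext => x /=; rewrite tnth_mktuple nth_default// size_tuple.
Qed.

Lemma measurable_size n : measurable [set s : chain R | size s = n].
Proof.
suff: chain_measurable [set s : chain R | size s = n] by [].
move=> m; have [->|mn] := eqVneq m n.
  rewrite (_ : _ @^-1` _ = setT); first exact: measurableT.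
  by apply/seteqP; split=> // x _ /=; rewrite size_tuple.
rewrite (_ : _ @^-1` _ = set0); first exact: measurable0.
by apply/seteqP; split=> // x /=; rewrite size_tuple => /eqP; rewrite (negbTE mn).
Qed.

Lemma measurable_size_fun d (T : measurableType d) (f : nat -> T) :
  measurable_fun setT (fun s : chain R => f (size s)).
Proof.
apply/measurable_fun_chainP => n; rewrite (_ : _ \o _ = cst (f n)).
  exact: measurable_cst.
by apply/funext => x /=; rewrite size_tuple.
Qed.

Lemma measurable_prod_chainP d d' (X : measurableType d) (T : measurableType d')
    (f : X * chain R -> T) :
  (forall n, measurable_fun setT (fun p : X * n.-tuple rT => f (p.1, tchain p.2))) ->
  measurable_fun setT f.
Proof.
move=> mf _ A mA; rewrite setTI.
rewrite (_ : f @^-1` A = \bigcup_n ((setT `*` [set s : chain R | size s = n]) `&`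
   (fun p : X * chain R => (p.1, to_tuple n p.2)) @^-1`
     ((fun p : X * n.-tuple rT => f (p.1, tchain p.2)) @^-1` A))).
  apply: bigcup_measurable => n _; apply: measurableI.
    by apply: measurableX => //; exact: measurable_size.
  rewrite -[X in measurable X]setTI.
  have mg : measurable_fun setT (fun p : X * chain R => (p.1, to_tuple n p.2)).
    apply/measurable_fun_pair => //=.
    by apply: (measurableT_comp (@measurable_to_tuple n)).
  apply: mg => //.
  by rewrite -[X in measurable X]setTI; exact: mf.
apply/seteqP; split=> [[t s] Af|[t s] [n _ [/= [_ sn]]]]; last first.
  move=> Af; exact: (eq_ind _ (fun u => A (f (t, u))) Af _ (tchain_to_tuple sn)).
exists (size s) => //; split=> //.
exact: (eq_ind _ (fun u => A (f (t, u))) Af _ (esym (tchain_to_tuple erefl))).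
Qed.

Lemma measurable_chain_cons :
  measurable_fun setT (fun p : rT * chain R => (p.1 :: p.2 : chain R)).
Proof.
apply: measurable_prod_chainP => n /=.
have /= := measurableT_comp (@measurable_tchain n.+1) (@measurable_pair_cons _ rT n).
by [].
Qed.

Definition chain_push n : {measure set (chain R) -> \bar R} :=
  measure_function_pushforward__canonical__measure_function_Measure
    (leb_tuple R n) (@measurable_tchain n).

Definition level_measure n : {measure set (chain R) -> \bar R} :=
  mscale (n`!%:R)%:nng (chain_push n).

Definition chain_measure : set (chain R) -> \bar R := mseries level_measure 0.
HB.instance Definition _ := Measure.on chain_measure.

Lemma integral_level n (f : chain R -> \bar R) :
  (forall s, 0 <= f s)%E -> measurable_fun [set: chain R] f ->
  (\int[level_measure n]_s f s =
   n`!%:R%:E * \int[leb_tuple R n]_(x in [set: n.-tuple rT]) f (tchain x))%E.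
Proof.
move=> f0 mf; rewrite ge0_integral_mscale//; congr (_ * _)%E.
by rewrite ge0_integral_pushforward//.
Qed.

Lemma integral_chain (f : chain R -> \bar R) :
  (forall s, 0 <= f s)%E -> measurable_fun [set: chain R] f ->
  (\int[chain_measure]_s f s =
   \sum_(0 <= n <oo)
     n`!%:R%:E * \int[leb_tuple R n]_(x in [set: n.-tuple rT]) f (tchain x))%E.
Proof.
move=> f0 mf; rewrite ge0_integral_measure_series//.
by apply: eq_eseriesr => n _; rewrite integral_level.
Qed.

Lemma integral_leb_tupleS n (f : n.+1.-tuple rT -> \bar R) :
  (forall x, 0 <= f x)%E -> measurable_fun setT f ->
  (\int[leb_tuple R n.+1]_x f x =
   \int[@leb_pos R]_t \int[leb_tuple R n]_y f (pair_cons (t, y)))%E.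
Proof.
move=> f0 mf.
have mp := @measurable_pair_cons _ rT n.
transitivity (\int[pushforward (@leb_pos R \x leb_tuple R n)%E (@pair_cons _ rT n)]_x f x)%E.
  by [].
rewrite (@ge0_integral_pushforward _ _ _ _ _ _ mp)//=.
rewrite preimage_setT fubini_tonelli1//=.
exact: (measurableT_comp mf mp).
Qed.

End chain.

Section chain2.
Variable R : realType.
Local Notation rT := (measurableTypeR R).
Local Notation mu := (@chain_measure R).

Definition level_set n (A : set (n.-tuple rT)) : set (chain R) :=
  [set s | size s = n] `&` @to_tuple R n @^-1` A.

Lemma measurable_level_set n (A : set (n.-tuple rT)) :
  measurable A -> measurable (level_set A).
Proof.
move=> mA; apply: measurableI; first exact: measurable_size.
by rewrite -[X in measurable X]setTI; exact: measurable_to_tuple.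
Qed.

Lemma to_tupleK n (x : n.-tuple rT) : to_tuple n (tchain x) = x.
Proof. by apply/eq_from_tnth => i; rewrite tnth_mktuple (tnth_nth 0). Qed.

Lemma level_setK n (A : set (n.-tuple rT)) : (@tchain R n) @^-1` level_set A = A.
Proof.
apply/seteqP; split=> x; rewrite /preimage /level_set/=; last first.
  by rewrite size_tuple to_tupleK.
by case=> _; rewrite to_tupleK.
Qed.

Lemma level_set_neq n m (A : set (n.-tuple rT)) :
  m != n -> (@tchain R m) @^-1` level_set A = set0.
Proof.
move=> mn; apply/seteqP; split=> x //; rewrite /preimage /level_set/= => -[].
by rewrite size_tuple => /eqP; rewrite (negbTE mn).
Qed.

Lemma level_measureE n (A : set (chain R)) :
  level_measure R n A = (n`!%:R%:E * leb_tuple R n ((@tchain R n) @^-1` A))%E.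
Proof. by []. Qed.

Lemma measure_level_set n (A : set (n.-tuple rT)) : measurable A ->
  mu (level_set A) = (n`!%:R%:E * leb_tuple R n A)%E.
Proof.
move=> mA; rewrite /chain_measure /mseries (nneseriesD1 (n := n))//= level_measureE level_setK.
rewrite eseries0 ?adde0// => i _ ni.
by rewrite level_measureE level_set_neq// measure0 mule0.
Qed.

Lemma chain_measure_sigma_finite : sigma_finite setT mu.
Proof.
pose F n := s2val (cid2 (sigma_finiteT (leb_tuple R n))).
have FP n : \bigcup_k F n k = setT /\
    forall k, measurable (F n k) /\ (leb_tuple R n (F n k) < +oo)%E.
  by rewrite /F; case: cid2 => G /= ->.
exists (fun i => if unpickle i is Some (n, k) then level_set (F n k) else set0).
  apply/esym; rewrite -subTset => s _.
  have [k _ Fk] : (\bigcup_k F (size s) k) (to_tuple (size s) s).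
    by rewrite (FP _).1.
  by exists (pickle (size s, k)) => //; rewrite pickleK.
move=> i; case: (unpickle i) => [[n k]|]; last by rewrite measure0.
have [mF Fk] := (FP n).2 k; split; first exact: measurable_level_set.
by rewrite measure_level_set// lte_mul_pinfty// ge0_fin_numE.
Qed.

HB.instance Definition _ := Measure_isSigmaFinite.Build _ _ _ mu
  chain_measure_sigma_finite.

Global Instance ae_chain_filter : Filter (almost_everywhere mu).
Proof. exact: (ae_filter_ringOfSetsType mu). Qed.

Global Instance ae_leb_pos_filter : Filter (almost_everywhere (@leb_pos R)).
Proof. exact: (ae_filter_ringOfSetsType (@leb_pos R)). Qed.

Lemma ae_chainP (P : chain R -> Prop) :
  {ae mu, forall s, P s} <->
  (forall n, {ae leb_tuple R n, forall x : n.-tuple rT, P (tchain x)}).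
Proof.
split=> [[A [mA A0 PA]] n|H].
  exists (@tchain R n @^-1` A); split => [|| x Px]; first exact: (mA n); last first.
    exact: PA.
  move: A0; rewrite /chain_measure /mseries (nneseriesD1 (n := n))//= => /eqP.
  rewrite padde_eq0; first last.
  - by apply: nneseries_ge0 => k _ _; exact: measure_ge0.
  - exact: measure_ge0.
  rewrite level_measureE => /andP[+ _].
  by rewrite mule_eq0 eqe pnatr_eq0 -leqn0 leqNgt fact_gt0/= => /eqP.
suff : {ae mu, forall s, forall n, size s = n -> P s}.
  by apply: filterS => s /(_ _ erefl).
apply: ae_foralln => n; have [A [mA A0 PA]] := H n.
exists (level_set A); split; first exact: measurable_level_set.
  by apply: (eq_trans (measure_level_set mA)); rewrite A0 mule0.
move=> s /= /not_implyP[sn Ps]; split=> //=; apply: PA => /= Ps'; apply: Ps.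
by rewrite -(tchain_to_tuple sn).
Qed.

(* The Mecke formula: the annihilation kernel [D_t v = (|s|+1) v(t :: s)] is
   disintegrated by prepending one point. *)
Lemma integral_chain_cons (f : chain R -> \bar R) :
  (forall s, 0 <= f s)%E -> measurable_fun [set: chain R] f -> f [::] = 0%E ->
  (\int[@leb_pos R]_t \int[mu]_s ((size s).+1%:R%:E * f (t :: s)) =
   \int[mu]_s f s)%E.
Proof.
move=> f0 mf fnil.
have mcons n : measurable_fun setT
    (fun p : rT * n.-tuple rT => f (p.1 :: p.2)).
  apply: (measurableT_comp mf).
  exact: (measurableT_comp (@measurable_tchain R n.+1) (@measurable_pair_cons _ rT n)).
have mconst t n : measurable_fun setT (fun y : n.-tuple rT => f (t :: y)).
  exact: (measurableT_comp (mcons n) (measurable_pair1 t)).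
have mconsc t : measurable_fun [set: chain R] (fun s => (size s).+1%:R%:E * f (t :: s))%E.
  apply/measurable_fun_chainP => n.
  rewrite (_ : _ \o _ = fun y : n.-tuple rT => (n.+1%:R%:E * f (t :: y))%E).
    by apply: measurable_funeM; exact: mconst.
  by apply/funext => y /=; rewrite size_tuple.
have mint n : measurable_fun setT
    (fun t : rT => \int[leb_tuple R n]_(y in [set: n.-tuple rT]) f (t :: y))%E.
  exact: (measurable_fun_fubini_tonelli_F (m2 := leb_tuple R n) (fun p : rT * n.-tuple rT => f (p.1 :: p.2)) (mcons n) (fun p => f0 _)).
have int0 t n : (0 <= \int[leb_tuple R n]_(y in [set: n.-tuple rT]) f (t :: y))%E.
  exact: integral_ge0.
transitivity (\int[@leb_pos R]_t \sum_(n <oo) (n.+1`!%:R%:E *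
    \int[leb_tuple R n]_(y in [set: n.-tuple rT]) f (t :: y)))%E.
  apply: eq_integral => t _; rewrite integral_chain//; last first.
    by move=> s; rewrite mule_ge0.
  apply: eq_eseriesr => n _.
  under eq_integral => x _ do rewrite size_tuple.
  rewrite ge0_integralZl_EFin//; last exact: mconst.
  by rewrite muleA -EFinM -natrM mulnC -factS.
rewrite integral_nneseries//; last 2 first.
- by move=> n; exact: measurable_funeM.
- by move=> n t _; exact: mule_ge0.
rewrite [RHS]integral_chain// [RHS]nneseries_recl//; last first.
  by move=> n _; apply: mule_ge0 => //; apply: integral_ge0.
rewrite [X in _ = (_ * X + _)%E](_ : _ = 0)%E; last first.
  by apply: integral0_eq => x _; rewrite tuple0.
rewrite mule0 add0e -(nneseries_addn 1); last first.
  by move=> n; apply: mule_ge0 => //; apply: integral_ge0.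
apply: eq_eseriesr => n _; rewrite addn1 integral_leb_tupleS//; last first.
  exact: measurableT_comp (measurable_tchain (n:=n.+1)).
by rewrite ge0_integralZl_EFin.
Qed.

End chain2.

Section permutation_invariance.
Variable R : realType.
Local Notation rT := (measurableTypeR R).
Local Notation leb n := (leb_tuple R n).

Definition tuple_drop n (j : 'I_n.+1) (x : n.+1.-tuple rT) : n.-tuple rT :=
  [tuple tnth x (lift j i) | i < n].

Definition tuple_extract n (j : 'I_n.+1) (x : n.+1.-tuple rT) : n.+1.-tuple rT :=
  pair_cons (tnth x j, tuple_drop j x).

Lemma measurable_tuple_drop n (j : 'I_n.+1) :
  measurable_fun setT (tuple_drop j).
Proof.
apply/measurable_fun_tnthP => i.
rewrite (_ : _ \o _ = @tnth _ rT ^~ (lift j i)); first exact: measurable_tnth.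
by apply/funext => x /=; rewrite tnth_mktuple.
Qed.

Lemma measurable_tuple_extract n (j : 'I_n.+1) :
  measurable_fun setT (tuple_extract j).
Proof.
apply: measurable_cons; first exact: measurable_tnth.
exact: measurable_tuple_drop.
Qed.

Lemma measurable_permute n (p : 'S_n) :
  measurable_fun setT (permute p : n.-tuple rT -> n.-tuple rT).
Proof.
apply/measurable_fun_tnthP => i.
rewrite (_ : _ \o _ = @tnth _ rT ^~ (p i)); first exact: measurable_tnth.
by apply/funext => x /=; rewrite tnth_mktuple.
Qed.

Lemma tuple_extract0 n (x : n.+1.-tuple rT) : tuple_extract ord0 x = x.
Proof.
apply/eq_from_tnth => i; case: (unliftP ord0 i) => [k ->|->].
  by rewrite tnthS tnth_mktuple.
by rewrite (tnth_nth 0).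
Qed.

Lemma tuple_extractS n (j : 'I_n.+1) t (y : n.+1.-tuple rT) :
  tuple_extract (lift ord0 j) (pair_cons (t, y)) =
  let z := tuple_extract j y in pair_cons (thead z, pair_cons (t, [tuple of behead z])).
Proof.
apply/eq_from_tnth => i; case: (unliftP ord0 i) => [k ->|->].
  rewrite !tnthS tnth_mktuple; case: (unliftP ord0 k) => [l ->|->].
    rewrite (_ : lift (lift ord0 j) (lift ord0 l) = lift ord0 (lift j l)); last first.
      by apply/val_inj; rewrite /= /bump !leq0n !add1n ltnS addnS.
    rewrite !tnthS -[LHS](tnth_mktuple (fun i => tnth y (lift j i))).
    by rewrite !(tnth_nth 0).
  rewrite (_ : lift (lift ord0 j) ord0 = ord0); last exact/val_inj.
  by rewrite !(tnth_nth 0).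
by rewrite !tnth0 tnthS theadE.
Qed.

Lemma measurable_pair_cons2 n :
  measurable_fun setT (fun p : (rT * rT) * n.-tuple rT =>
    pair_cons (p.1.1, pair_cons (p.1.2, p.2))).
Proof.
apply: measurable_cons; first exact: (measurableT_comp measurable_fst measurable_fst).
apply: measurable_cons; first exact: (measurableT_comp measurable_snd measurable_fst).
exact: measurable_snd.
Qed.

Lemma integral_leb_tuple_swap n (f : n.+2.-tuple rT -> \bar R) :
  (forall x, 0 <= f x)%E -> measurable_fun setT f ->
  (\int[@leb_pos R]_t \int[@leb_pos R]_u \int[leb n]_y
      f (pair_cons (u, pair_cons (t, y))) = \int[leb n.+2]_x f x)%E.
Proof.
move=> f0 mf.
have mF := measurableT_comp mf (@measurable_pair_cons2 n).
have := fubini_tonelli (m1 := @leb_pos R) (m2 := @leb_pos R) (fubini_F (leb n)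
  (f \o (fun p : (rT * rT) * n.-tuple rT => pair_cons (p.1.1, pair_cons (p.1.2, p.2))))).
move=> <-; last 2 first.
- exact: (measurable_fun_fubini_tonelli_F (m2 := leb n) _ mF (fun p => f0 _)).
- by move=> p; apply: integral_ge0 => y _; exact: f0.
rewrite integral_leb_tupleS//; apply: eq_integral => t _.
rewrite integral_leb_tupleS//.
apply: (measurableT_comp mf).
exact: (measurableT_comp (@measurable_pair_cons _ rT n.+1) (measurable_pair1 t)).
Qed.

Lemma integral_tuple_extract n (j : 'I_n.+1) (f : n.+1.-tuple rT -> \bar R) :
  (forall x, 0 <= f x)%E -> measurable_fun setT f ->
  (\int[leb n.+1]_x f (tuple_extract j x) = \int[leb n.+1]_x f x)%E.
Proof.
elim: n j f => [|n IH] j f f0 mf.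
  by apply: eq_integral => x _; rewrite (ord1 j) tuple_extract0.
case: (unliftP ord0 j) => [{}j ->|->]; last first.
  by apply: eq_integral => x _; rewrite tuple_extract0.
rewrite integral_leb_tupleS//; last first.
  exact: (measurableT_comp mf (@measurable_tuple_extract _ _)).
have mswap : measurable_fun setT (fun p : rT * n.+1.-tuple rT =>
    f (pair_cons (thead p.2, pair_cons (p.1, [tuple of behead p.2])))).
  apply: (measurableT_comp mf); apply: measurable_cons.
    exact: (measurableT_comp (@measurable_tnth _ rT n.+1 ord0)).
  apply: measurable_cons; first exact: measurable_fst.
  exact: (measurableT_comp (@measurable_behead _ rT n) measurable_snd).
transitivity (\int[@leb_pos R]_t \int[leb n.+1]_z
    f (pair_cons (thead z, pair_cons (t, [tuple of behead z]))))%E.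
  apply: eq_integral => t _.
  under eq_integral => y _ do rewrite tuple_extractS.
  rewrite (IH j (fun z => f (pair_cons (thead z, pair_cons (t, [tuple of behead z])))))//.
  exact: (measurableT_comp mswap (measurable_pair1 t)).
rewrite -integral_leb_tuple_swap//; apply: eq_integral => t _.
rewrite integral_leb_tupleS//; last first.
  exact: (measurableT_comp mswap (measurable_pair1 t)).
apply: eq_integral => u _; apply: eq_integral => y _.
rewrite theadE; congr (f (pair_cons (_, pair_cons (_, _)))).
exact/val_inj.
Qed.

Lemma lift_permP n (p : 'S_n.+1) : exists s, p = lift_perm ord0 (p ord0) s.
Proof.
pose f k := odflt k (unlift (p ord0) (p (lift ord0 k))).
have fE k : lift (p ord0) (f k) = p (lift ord0 k).
  rewrite /f; have /unlift_some[l -> ->] // : p ord0 != p (lift ord0 k).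
  by rewrite (inj_eq perm_inj) neq_lift.
have f_inj : injective f.
  move=> k l /(congr1 (lift (p ord0))); rewrite !fE.
  by move/perm_inj/lift_inj.
exists (perm f_inj); apply/permP => k; case: (unliftP ord0 k) => [l ->|->].
  by rewrite lift_perm_lift permE fE.
by rewrite lift_perm_id.
Qed.

Lemma permute_lift n (j : 'I_n.+1) (s : 'S_n) (x : n.+1.-tuple rT) :
  permute (lift_perm ord0 j s) x = pair_cons (tnth x j, permute s (tuple_drop j x)).
Proof.
apply/eq_from_tnth => i; rewrite tnth_mktuple; case: (unliftP ord0 i) => [k ->|->].
  by rewrite lift_perm_lift tnthS !tnth_mktuple.
by rewrite lift_perm_id tnth0.
Qed.

Lemma integral_permute n (p : 'S_n) (f : n.-tuple rT -> \bar R) :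
  (forall x, 0 <= f x)%E -> measurable_fun setT f ->
  (\int[leb n]_x f (permute p x) = \int[leb n]_x f x)%E.
Proof.
elim: n p f => [|n IH] p f f0 mf.
  by apply: eq_integral => x _; rewrite tuple0 [in RHS]tuple0.
have [s ->] := lift_permP p; set j := p ord0.
pose g (z : n.+1.-tuple rT) := f (pair_cons (thead z, permute s [tuple of behead z])).
have mg : measurable_fun setT g.
  apply: (measurableT_comp mf); apply: measurable_cons.
    exact: (@measurable_tnth _ rT n.+1 ord0).
  exact: (measurableT_comp (@measurable_permute _ s) (@measurable_behead _ rT n)).
transitivity (\int[leb n.+1]_x g (tuple_extract j x))%E.
  apply: eq_integral => x _; rewrite permute_lift /g theadE.
  by congr (f (pair_cons (_, permute s _))); exact/val_inj.
rewrite (@integral_tuple_extract _ j g)//; last by move=> x; exact: f0.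
rewrite integral_leb_tupleS//; last by move=> x; exact: f0.
rewrite [RHS]integral_leb_tupleS//.
apply: eq_integral => t _; rewrite -[RHS](IH s)//; last first.
  apply: (measurableT_comp mf).
  exact: (measurableT_comp (@measurable_pair_cons _ rT n) (measurable_pair1 t)).
apply: eq_integral => y _; rewrite /g theadE; congr (f (pair_cons (_, permute s _))).
exact/val_inj.
Qed.

Lemma leb_tuple_preimage n m (g : n.-tuple rT -> m.-tuple rT)
    (A : set (m.-tuple rT)) :
  measurable_fun setT g -> measurable A ->
  leb n (g @^-1` A) = (\int[leb n]_x (\1_A (g x))%:E)%E.
Proof.
move=> mg mA.
have mgA : measurable (g @^-1` A) by rewrite -[X in measurable X]setTI; exact: mg.
by rewrite -[in LHS](setIT (_ @^-1` _)) -integral_indic.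
Qed.

Lemma ae_preimage n m (g : n.-tuple rT -> m.-tuple rT) (P : m.-tuple rT -> Prop) :
  measurable_fun setT g ->
  (forall A, measurable A -> leb m A = 0%E -> leb n (g @^-1` A) = 0%E) ->
  {ae leb m, forall x, P x} -> {ae leb n, forall x, P (g x)}.
Proof.
move=> mg g0 [A [mA A0 PA]]; exists (g @^-1` A); split.
- by rewrite -[X in measurable X]setTI; exact: mg.
- exact: g0.
- by move=> x /= Px; exact: PA.
Qed.

Lemma ae_permute n (p : 'S_n) (P : n.-tuple rT -> Prop) :
  {ae leb n, forall x, P x} -> {ae leb n, forall x, P (permute p x)}.
Proof.
apply: ae_preimage => [|A mA A0]; first exact: measurable_permute.
rewrite leb_tuple_preimage//; last exact: measurable_permute.
rewrite (integral_permute p (f := fun x => (\1_A x)%:E))//; last first.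
  by apply/measurable_EFinP; exact: measurable_indic.
by rewrite -A0 integral_indic// setIT.
Qed.

Lemma ae_behead n (P : n.-tuple rT -> Prop) :
  {ae leb n, forall x, P x} -> {ae leb n.+1, forall x : n.+1.-tuple rT, P [tuple of behead x]}.
Proof.
apply: ae_preimage => [|A mA A0]; first exact: measurable_behead.
rewrite leb_tuple_preimage//; last exact: measurable_behead.
rewrite integral_leb_tupleS//; last first.
  apply/measurable_EFinP; apply: (measurableT_comp (measurable_indic mA)).
  exact: measurable_behead.
apply: integral0_eq => t _.
rewrite -A0 -[in RHS](setIT A) -integral_indic//; apply: eq_integral => y _.
by congr (\1_A _)%:E; exact/val_inj.
Qed.

Lemma ae_tuple_drop n (j : 'I_n.+1) (P : n.-tuple rT -> Prop) :
  {ae leb n, forall x, P x} -> {ae leb n.+1, forall x : n.+1.-tuple rT, P (tuple_drop j x)}.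
Proof.
move=> /ae_behead aeP.
have {aeP} : {ae leb n.+1, forall x : n.+1.-tuple rT, P [tuple of behead (tuple_extract j x)]}.
  apply: (ae_preimage (P := fun x : n.+1.-tuple rT => P [tuple of behead x])) aeP.
    exact: measurable_tuple_extract.
  move=> A mA A0; rewrite leb_tuple_preimage//; last exact: measurable_tuple_extract.
  rewrite (integral_tuple_extract j (f := fun x => (\1_A x)%:E))//; last first.
    by apply/measurable_EFinP; exact: measurable_indic.
  by rewrite -A0 integral_indic// setIT.
have E (x : n.+1.-tuple rT) : [tuple of behead (tuple_extract j x)] = tuple_drop j x :> n.-tuple rT by exact/val_inj.
by apply: filterS => x; rewrite E.
Qed.

End permutation_invariance.

Local Open Scope complex_scope.

Section complex_L2.
Context d (X : measurableType d) (R : realType) (m : {measure set X -> \bar R}).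
Implicit Types (f g h : X -> R[i]) (a b c : R[i]).
Local Notation Re := (@complex.Re R).
Local Notation Im := (@complex.Im R).

Definition sqn (c : R[i]) : R := Re c ^+ 2 + Im c ^+ 2.

Lemma sqmodE c : sqmod c = (sqn c)%:E.
Proof. by case: c => x y; rewrite /sqmod /sqn/= sqr_sqrtr// addr_ge0// sqr_ge0. Qed.

Lemma sqn_ge0 c : 0 <= sqn c. Proof. by rewrite addr_ge0// sqr_ge0. Qed.

Lemma sqn_normc c : Normc.normc c ^+ 2 = sqn c.
Proof. by case: c => x y; rewrite /sqn/= sqr_sqrtr// addr_ge0// sqr_ge0. Qed.

Lemma normc_ge0 c : 0 <= Normc.normc c.
Proof. by case: c => x y /=; exact: sqrtr_ge0. Qed.

Lemma conjc_mulK c : conjc c * c = (sqn c)%:C.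
Proof. by case: c => x y; rewrite /sqn; apply/eqP; rewrite eq_complex/=; apply/andP; split; apply/eqP; ring. Qed.

Lemma sqnM a b : sqn (a * b) = sqn a * sqn b.
Proof. by case: a b => ? ? [? ?]; rewrite /sqn/=; ring. Qed.

Lemma sqnD_le a b : sqn (a + b) <= 2 * sqn a + 2 * sqn b.
Proof.
case: a b => x y [z t]; rewrite /sqn/=.
by have := sqr_ge0 (x - z); have := sqr_ge0 (y - t); nra.
Qed.

Lemma sqnN a : sqn (- a) = sqn a.
Proof. by case: a => x y; rewrite /sqn/=; ring. Qed.

Lemma sqn0 : sqn 0 = 0. Proof. by rewrite /sqn/=; ring. Qed.

Lemma sqn_eq0 c : sqn c = 0 -> c = 0.
Proof.
case: c => x y; rewrite /sqn/= => /eqP; rewrite paddr_eq0 ?sqr_ge0//.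
by rewrite !sqrf_eq0 => /andP[/eqP-> /eqP->].
Qed.

Lemma ReM_le a b : `|Re (conjc a * b)| <= sqn a + sqn b.
Proof.
case: a b => x y [z t]; rewrite /sqn/= ler_norml.
have := sqr_ge0 (x - z); have := sqr_ge0 (y - t).
have := sqr_ge0 (x + z); have := sqr_ge0 (y + t).
by move=> *; apply/andP; split; nra.
Qed.

Lemma ImM_le a b : `|Im (conjc a * b)| <= sqn a + sqn b.
Proof.
case: a b => x y [z t]; rewrite /sqn/= ler_norml.
have := sqr_ge0 (x - t); have := sqr_ge0 (y - z).
have := sqr_ge0 (x + t); have := sqr_ge0 (y + z).
by move=> *; apply/andP; split; nra.
Qed.

Lemma cmeasurableD f g : cmeasurable f -> cmeasurable g ->
  cmeasurable (fun x => f x + g x).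
Proof.
move=> [fr fi] [gr gi]; split.
  rewrite (_ : _ \o _ = (Re \o f) \+ (Re \o g)); first exact: measurable_funD.
  by apply/funext => x /=; case: (f x) (g x) => ? ? [? ?].
rewrite (_ : _ \o _ = (Im \o f) \+ (Im \o g)); first exact: measurable_funD.
by apply/funext => x /=; case: (f x) (g x) => ? ? [? ?].
Qed.

Lemma cmeasurableM f g : cmeasurable f -> cmeasurable g ->
  cmeasurable (fun x => f x * g x).
Proof.
move=> [fr fi] [gr gi]; split.
  rewrite (_ : _ \o _ = ((Re \o f) \* (Re \o g)) \- ((Im \o f) \* (Im \o g))).
    by apply: measurable_funB; exact: measurable_funM.
  by apply/funext => x /=; case: (f x) (g x) => ? ? [? ?].
rewrite (_ : _ \o _ = ((Re \o f) \* (Im \o g)) \+ ((Im \o f) \* (Re \o g))).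
  by apply: measurable_funD; exact: measurable_funM.
by apply/funext => x /=; case: (f x) (g x) => ? ? [? ?].
Qed.

Lemma cmeasurable_cst c : cmeasurable (fun _ : X => c).
Proof. by split; exact: measurable_cst. Qed.

Lemma cmeasurable_conj f : cmeasurable f -> cmeasurable (fun x => conjc (f x)).
Proof.
move=> [fr fi]; split.
  by rewrite (_ : _ \o _ = Re \o f)//; apply/funext => x /=; case: (f x).
rewrite (_ : _ \o _ = \- (Im \o f)); first exact: measurable_funN.
by apply/funext => x /=; case: (f x).
Qed.

Lemma measurable_sqn f : cmeasurable f -> measurable_fun setT (fun x => sqn (f x)).
Proof. by move=> [fr fi]; apply: measurable_funD; exact: measurable_funX. Qed.

Definition csummable f := cmeasurable f /\ m.-integrable setT (fun x => (sqn (f x))%:E).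

Definition cintegrable f :=
  m.-integrable setT (EFin \o Re \o f) /\ m.-integrable setT (EFin \o Im \o f).

Lemma csummableP f : cmeasurable f ->
  (\int[m]_x sqmod (f x) < +oo)%E <-> m.-integrable setT (fun x => (sqn (f x))%:E).
Proof.
move=> mf; rewrite (_ : (\int[m]_x _)%E = \int[m]_x `|(sqn (f x))%:E|)%E; last first.
  by apply: eq_integral => x _; rewrite sqmodE gee0_abs// lee_fin sqn_ge0.
split=> [foo|/integrableP[]//]; apply/integrableP; split => //.
by apply/measurable_EFinP; exact: measurable_sqn.
Qed.

Lemma csummableZD a f g : csummable f -> csummable g ->
  csummable (fun x => a * f x + g x).
Proof.
move=> [mf sf] [mg sg].
have mh : cmeasurable (fun x => a * f x + g x).
  by apply: cmeasurableD => //; apply: cmeasurableM => //; exact: cmeasurable_cst.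
split => //.
apply: (@le_integrable _ _ _ m setT measurableT _
   (fun x => (2 * sqn a)%:E * (sqn (f x))%:E + 2%:E * (sqn (g x))%:E)%E).
- by apply/measurable_EFinP; exact: measurable_sqn.
- move=> x _; have h0 : 0 <= 2 * sqn a * sqn (f x) + 2 * sqn (g x).
    by apply: addr_ge0; rewrite !mulr_ge0// sqn_ge0.
  rewrite !gee0_abs ?lee_fin ?sqn_ge0//.
  by rewrite (le_trans (sqnD_le _ _))// sqnM mulrA.
- by apply: integrableD => //; exact: integrableZl.
Qed.

Lemma csummable_dot f g : csummable f -> csummable g ->
  cintegrable (fun x => conjc (f x) * g x).
Proof.
move=> [mf sf] [mg sg].
have [m1 m2] := cmeasurableM (cmeasurable_conj mf) mg.
have ih := integrableD measurableT sf sg.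
have fg0 x : 0 <= sqn (f x) + sqn (g x) by apply: addr_ge0; exact: sqn_ge0.
split; apply: le_integrable ih => //.
- exact/measurable_EFinP.
- move=> x _; rewrite [leRHS]gee0_abs ?lee_fin//.
  exact: ReM_le.
- exact/measurable_EFinP.
- move=> x _; rewrite [leRHS]gee0_abs ?lee_fin//.
  exact: ImM_le.
Qed.

Lemma cintegralZD a f g : cintegrable f -> cintegrable g ->
  cintegral m (fun x => a * f x + g x) = a * cintegral m f + cintegral m g.
Proof.
case: a => a b [fr fi] [gr gi]; rewrite /cintegral.
have E1 x : Re ((a +i* b) * f x + g x) = a * Re (f x) - b * Im (f x) + Re (g x).
  by case: (f x) (g x) => ? ? [? ?].
have E2 x : Im ((a +i* b) * f x + g x) = a * Im (f x) + b * Re (f x) + Im (g x).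
  by case: (f x) (g x) => ? ? [? ?].
under eq_Rintegral do rewrite E1.
under [X in _ +i* X]eq_Rintegral do rewrite E2.
have iZ (c : R) (h : X -> R) : m.-integrable setT (EFin \o h) -> m.-integrable setT (EFin \o (fun x => c * h x)).
  exact: integrableZl.
have ih1 : m.-integrable setT (EFin \o (fun x => a * Re (f x) - b * Im (f x))).
  have := integrableB measurableT (iZ a _ fr) (iZ b _ fi); exact: eq_integrable.
have ih2 : m.-integrable setT (EFin \o (fun x => a * Im (f x) + b * Re (f x))).
  have := integrableD measurableT (iZ a _ fi) (iZ b _ fr); exact: eq_integrable.
rewrite RintegralD// RintegralB ?RintegralZl//; try exact: iZ.
by rewrite RintegralD// RintegralD ?RintegralZl//; try exact: iZ.
Qed.

Lemma cintegral_conj f : cintegrable f ->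
  cintegral m (fun x => conjc (f x)) = conjc (cintegral m f).
Proof.
move=> [fr fi]; rewrite /cintegral /=.
congr Complex; first by apply: eq_Rintegral => x _; case: (f x).
transitivity (\int[m]_x (-1 * Im (f x))); last by rewrite RintegralZl// mulN1r.
by apply: eq_Rintegral => x _; case: (f x) => ? ? /=; rewrite mulN1r.
Qed.

Lemma ae_eq_cintegral f g : cmeasurable f -> cmeasurable g ->
  {ae m, forall x, f x = g x} -> cintegral m f = cintegral m g.
Proof.
move=> [f1 f2] [g1 g2] fg; rewrite /cintegral /Rintegral.
by congr (fine _ +i* fine _); apply: ae_eq_integral => //;
  try (exact/measurable_EFinP); apply: filterS fg => x -> .
Qed.

Definition cdot f g := cintegral m (fun x => conjc (f x) * g x).

Lemma cdotZD a f g h : csummable f -> csummable g -> csummable h ->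
  cdot h (fun x => a * f x + g x) = a * cdot h f + cdot h g.
Proof.
move=> sf sg sh; rewrite /cdot -cintegralZD; [|exact: csummable_dot..].
by congr cintegral; apply/funext => x; rewrite mulrDr mulrCA.
Qed.

Lemma cdot_conj f g : csummable f -> csummable g -> cdot g f = conjc (cdot f g).
Proof.
move=> sf sg; rewrite /cdot -cintegral_conj; last exact: csummable_dot.
by congr cintegral; apply/funext => x; rewrite rmorphM/= conjcK mulrC.
Qed.

Lemma cdot_self f : cdot f f = (\int[m]_x sqn (f x))%:C.
Proof.
rewrite /cdot /cintegral; congr Complex.
  by apply: eq_Rintegral => x _; rewrite conjc_mulK.
under eq_Rintegral do rewrite conjc_mulK.
by rewrite /Rintegral/= integral0.
Qed.

(* From [0 <= |f - t conj(c) g|^2] with [c = <f, g>], for every real [t]. *)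
Lemma cdot_CauchySchwarz f g : csummable f -> csummable g ->
  sqn (cdot f g) <= (\int[m]_x sqn (f x)) * (\int[m]_x sqn (g x)).
Proof.
move=> sf sg; set c := cdot f g.
set A := \int[m]_x sqn (f x); set B := \int[m]_x sqn (g x).
have B0 : 0 <= B by apply: Rintegral_ge0 => x _; exact: sqn_ge0.
have A0 : 0 <= A by apply: Rintegral_ge0 => x _; exact: sqn_ge0.
have H t : 0 <= A - 2 * t * sqn c + t ^+ 2 * sqn c * B.
  pose l := (- t%:C) * conjc c.
  have sh : csummable (fun x => l * g x + f x) by exact: csummableZD.
  have : cdot (fun x => l * g x + f x) (fun x => l * g x + f x) =
      (A - 2 * t * sqn c + t ^+ 2 * sqn c * B)%:C.
    rewrite cdotZD// (cdot_conj sg sh) (cdot_conj sf sh) !cdotZD// !cdot_self.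
    rewrite -/A -/B (cdot_conj sf sg) -/c /l.
    by case: (c) => x y; rewrite /sqn/=; apply/eqP; rewrite eq_complex/=;
      apply/andP; split; apply/eqP; ring.
  rewrite cdot_self => -[<-]; apply: Rintegral_ge0 => x _; exact: sqn_ge0.
have c0 := sqn_ge0 c.
have [B00|Bn0] := eqVneq B 0.
  rewrite B00 mulr0 leNgt; apply/negP => cp.
  have := H ((A + 1) / (2 * sqn c)); rewrite B00 mulr0 addr0.
  rewrite (_ : _ - _ = - 1) ?oppr_ge0 ?ler10//.
  by field; rewrite gt_eqF.
have Bp : 0 < B by rewrite lt_neqAle eq_sym Bn0.
have := H B^-1.
rewrite (_ : _ + _ = A - sqn c / B); last by field.
by rewrite subr_ge0 ler_pdivrMr.
Qed.

End complex_L2.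

Section fock_L2.
Variable R : realType.
Local Notation rT := (measurableTypeR R).
Local Notation mu := (@chain_measure R).
Local Notation leb n := (leb_tuple R n).
Local Notation Re := (@complex.Re R).
Local Notation Im := (@complex.Im R).
Implicit Types (u v w : vect R) (a : R[i]).

Definition L2v u := csummable mu (u : chain R -> R[i]).

Lemma cmeasurable_level u :
  (forall n, cmeasurable (fun x : n.-tuple rT => u x)) <->
  cmeasurable (u : chain R -> R[i]).
Proof.
split=> [H|[H1 H2] n].
  by split; apply/measurable_fun_chainP => n; case: (H n).
by split; [move/measurable_fun_chainP : H1|move/measurable_fun_chainP : H2]; exact.
Qed.

Lemma norm2E u : cmeasurable (u : chain R -> R[i]) ->
  norm2 u = (\int[mu]_s sqmod (u s))%E.
Proof.
move=> mu_; rewrite integral_chain//.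
  by move=> s; rewrite sqmodE lee_fin sqn_ge0.
under eq_fun do rewrite sqmodE.
by apply/measurable_EFinP; exact: measurable_sqn.
Qed.

Lemma L2vP u : L2v u <->
  (forall n, cmeasurable (fun x : n.-tuple rT => u x)) /\ (norm2 u < +oo)%E.
Proof.
split=> [[mu_ su]|[/cmeasurable_level mu_ un]].
  by split; [exact/cmeasurable_level|rewrite norm2E//; exact/(csummableP mu mu_)].
by split => //; apply/(csummableP mu mu_); rewrite -norm2E.
Qed.

Lemma fockP u : fock u <-> L2v u /\ antisym_fun u.
Proof.
split=> [[m1 au n1]|[/L2vP[m1 n1] au]]; last by split.
by split=> //; apply/L2vP.
Qed.

Lemma L2v_norm2 u : L2v u -> norm2 u = (fock_norm u ^+ 2)%:E /\
  fock_norm u ^+ 2 = \int[mu]_s sqn (u s).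
Proof.
move=> /[dup] /L2vP[_ n1] [mu_ _].
have n0 : (0 <= norm2 u)%E.
  by rewrite norm2E//; apply: integral_ge0 => s _; rewrite sqmodE lee_fin sqn_ge0.
rewrite /fock_norm sqr_sqrtr ?fine_ge0//; split; first by rewrite fineK// ge0_fin_numE.
by rewrite norm2E//; congr fine; apply: eq_integral => s _; rewrite sqmodE.
Qed.

Lemma integrable_level n (f : chain R -> R) :
  mu.-integrable setT (EFin \o f) -> (leb n).-integrable setT (EFin \o f \o @tchain R n).
Proof.
move=> /integrableP[mf foo]; apply/integrableP; split.
  exact: measurableT_comp (@measurable_tchain R n).
move: foo; rewrite (@integral_chain R (fun s => `|(f s)%:E|)%E)//; last first.
  exact: measurableT_comp.
rewrite (nneseriesD1 (n := n))//; last first.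
  by move=> k _; apply: mule_ge0 => //; exact: integral_ge0.
set a := (\int[leb n]__ _)%E => aoo.
rewrite ltey; apply: contraTN aoo => /eqP ->.
rewrite gt0_muley ?lte_fin ?ltr0n ?fact_gt0// addye ?ltxx//.
by rewrite -ltNye (lt_le_trans (ltNyr 0))// nneseries_ge0// => k _ _;
  apply: mule_ge0 => //; exact: integral_ge0.
Qed.

Lemma cvg_level_series_ge0 (f : chain R -> R) : (forall s, 0 <= f s) ->
  mu.-integrable setT (EFin \o f) ->
  series (fun n => n`!%:R * \int[leb n]_x f (tchain x)) @ \oo --> \int[mu]_s f s.
Proof.
move=> f0 /[dup] fi /integrableP[mf _].
pose a n := n`!%:R * \int[leb n]_x f (tchain x).
have aE n : (n`!%:R%:E * \int[leb n]_x (f (tchain x))%:E)%E = (a n)%:E.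
  by rewrite /a EFinM fineK//; apply: integrable_fin_num => //; exact: integrable_level.
have a0 n : 0 <= a n by rewrite mulr_ge0// Rintegral_ge0.
have intE : (\int[mu]_s (f s)%:E)%E = (\int[mu]_s f s)%:E.
  by rewrite fineK//; exact: integrable_fin_num.
have := intE; rewrite (@integral_chain R (fun s => (f s)%:E))//.
under eq_eseriesr do rewrite aE.
move=> lE.
have cv : (\sum_(0 <= k < n) (a k)%:E)%E @[n --> \oo] --> (\int[mu]_s f s)%:E.
  by rewrite -lE; apply: is_cvg_nneseries => n _ _; rewrite lee_fin.
rewrite (_ : series _ = fine \o (fun n => (\sum_(0 <= k < n) (a k)%:E)%E)).
  exact: fine_cvg cv.
by apply/funext => n /=; rewrite sumEFin.
Qed.

Lemma cvg_level_series (f : chain R -> R) :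
  mu.-integrable setT (EFin \o f) ->
  series (fun n => n`!%:R * \int[leb n]_x f (tchain x)) @ \oo --> \int[mu]_s f s.
Proof.
move=> /[dup] fi /integrableP[/measurable_EFinP mf _].
pose fp s := Num.max (f s) 0; pose fm s := Num.max (- f s) 0.
have fE s : f s = fp s - fm s.
  by rewrite /fp /fm; case: (ltrP 0 (f s)) => h; case: (ltrP 0 (- f s)) => h'; lra.
have ifp : mu.-integrable setT (EFin \o fp).
  apply: le_integrable fi => //.
    by apply/measurable_EFinP; apply: measurable_maxr => //; exact: measurable_cst.
  move=> s _ /=; rewrite lee_fin /fp; case: (ltrP 0 (f s)) => // h.
  by rewrite normr0.
have ifm : mu.-integrable setT (EFin \o fm).
  apply: le_integrable fi => //.
    apply/measurable_EFinP; apply: measurable_maxr; last exact: measurable_cst.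
    exact: measurable_funN.
  move=> s _ /=; rewrite lee_fin /fm; case: (ltrP 0 (- f s)) => // h.
    by rewrite normrN.
  by rewrite normr0.
rewrite (_ : \int[mu]_s f s = \int[mu]_s fp s - \int[mu]_s fm s); last first.
  by rewrite -RintegralB//; apply: eq_Rintegral => s _; exact: fE.
rewrite (_ : series _ = series (fun n => n`!%:R * \int[leb n]_x fp (tchain x)) -
   series (fun n => n`!%:R * \int[leb n]_x fm (tchain x))); last first.
  apply/funext => n; rewrite /series/= !fctE -sumrB; apply: eq_bigr => k _.
  rewrite -mulrBr -RintegralB//; [|exact: integrable_level..].
  by congr (_ * _); apply: eq_Rintegral => s _; exact: fE.
by apply: cvgB; apply: cvg_level_series_ge0 => // s; rewrite le_max lexx orbT.
Qed.

Lemma natCE n (c : R[i]) : n%:R * c = (n%:R * Re c) +i* (n%:R * Im c).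
Proof.
rewrite -(rmorph_nat (real_complex R)); case: c => x y.
by apply/eqP; rewrite eq_complex/= !mul0r subr0 addr0 !eqxx.
Qed.

Lemma innerE u v : L2v u -> L2v v ->
  inner u v = cdot mu (u : chain R -> R[i]) (v : chain R -> R[i]).
Proof.
move=> su sv; have [i1 i2] := csummable_dot su sv.
rewrite /inner /cdot /cintegral; congr Complex.
  rewrite -(cvg_lim (@Rhausdorff R) (cvg_level_series i1)).
  by congr (limn (series _)); apply/funext => n /=; rewrite /inner_term natCE.
rewrite -(cvg_lim (@Rhausdorff R) (cvg_level_series i2)).
by congr (limn (series _)); apply/funext => n /=; rewrite /inner_term natCE.
Qed.

End fock_L2.

Section fock_space.
Variable R : realType.
Local Notation rT := (measurableTypeR R).
Local Notation mu := (@chain_measure R).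
Local Notation leb n := (leb_tuple R n).
Local Notation Re := (@complex.Re R).
Local Notation Im := (@complex.Im R).
Implicit Types (u v w : vect R) (a : R[i]).

Lemma L2vZD a u v : L2v u -> L2v v -> L2v (a *: u + v).
Proof. exact: csummableZD. Qed.

Lemma L2v0 : L2v (0 : vect R).
Proof.
split; first exact: (cmeasurable_cst _ 0).
apply: (@eq_integrable _ _ _ _ _ measurableT (cst 0%E)); last exact: integrable0.
by move=> s _ /=; rewrite sqn0.
Qed.

Lemma antisymZD a u v : antisym_fun u -> antisym_fun v -> antisym_fun (a *: u + v).
Proof.
move=> au av n p; have := au n p; have := av n p; apply: filterS2 => x hv hu.
by rewrite !fctE hu hv mulrDr mulrCA.
Qed.

Lemma antisym0 : antisym_fun (0 : vect R).
Proof. by move=> n p; apply: aeW => x; rewrite /= mulr0. Qed.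

Lemma fock_L2v u : fock u -> L2v u.
Proof. by case/fockP. Qed.

Lemma fockZD a u v : fock u -> fock v -> fock (a *: u + v).
Proof.
move=> /fockP[su au] /fockP[sv av].
by apply/fockP; split; [exact: L2vZD|exact: antisymZD].
Qed.

Lemma fock0 : fock (0 : vect R).
Proof. by apply/fockP; split; [exact: L2v0|exact: antisym0]. Qed.

Lemma fockB u v : fock u -> fock v -> fock (u - v).
Proof. by move=> fu fv; rewrite (addrC u) -scaleN1r; exact: fockZD. Qed.

Lemma inner_L2ZDr a u v w : L2v u -> L2v v -> L2v w ->
  inner w (a *: u + v) = a * inner w u + inner w v.
Proof.
move=> fu fv fw; rewrite !innerE//; last exact: L2vZD.
exact: cdotZD.
Qed.

Lemma inner_L2conj u v : L2v u -> L2v v -> inner v u = conjc (inner u v).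
Proof. by move=> fu fv; rewrite !innerE//; exact: cdot_conj. Qed.

Lemma inner_L2self u : L2v u -> inner u u = (fock_norm u ^+ 2)%:C.
Proof. by move=> fu; rewrite innerE// cdot_self (L2v_norm2 fu).2. Qed.

Lemma innerZDr a u v w : fock u -> fock v -> fock w ->
  inner w (a *: u + v) = a * inner w u + inner w v.
Proof. by move=> /fock_L2v ? /fock_L2v ? /fock_L2v ?; exact: inner_L2ZDr. Qed.

Lemma inner_conj u v : fock u -> fock v -> inner v u = conjc (inner u v).
Proof. by move=> /fock_L2v ? /fock_L2v ?; exact: inner_L2conj. Qed.

Lemma inner_self u : fock u -> inner u u = (fock_norm u ^+ 2)%:C.
Proof. by move=> /fock_L2v ?; exact: inner_L2self. Qed.

Lemma fock_norm_ge0 u : 0 <= fock_norm u.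
Proof. exact: sqrtr_ge0. Qed.

Lemma norm2_fock u : fock u -> norm2 u = (fock_norm u ^+ 2)%:E.
Proof. by move=> /fock_L2v /L2v_norm2[]. Qed.

Lemma fock_eq_ae u v : fock_eq u v <-> {ae mu, forall s, u s = v s}.
Proof. by rewrite (ae_chainP (fun s => u s = v s)). Qed.

Lemma fock_eq_norm u v : fock u -> fock v ->
  fock_eq u v <-> fock_norm (u - v) = 0.
Proof.
move=> fu fv; rewrite fock_eq_ae.
have suv := fock_L2v (fockB fu fv).
have [_ nE] := L2v_norm2 suv; have [muv iuv] := suv.
have mf : measurable_fun setT (fun s : chain R => (sqn ((u - v) s))%:E).
  by apply/measurable_EFinP; exact: measurable_sqn.
have := (ae_eq_integral_abs mu measurableT mf).
rewrite (_ : (\int[mu]_s `|_|)%E = (fock_norm (u - v) ^+ 2)%:E); last first.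
  rewrite nE fineK; last exact: integrable_fin_num.
  by apply: eq_integral => s _; rewrite gee0_abs// lee_fin sqn_ge0.
move=> H; split => [uv|/eqP].
  apply/eqP; rewrite -(sqrf_eq0 (fock_norm _)); apply/eqP.
  suff /H [] : ae_eq mu setT (fun s : chain R => (sqn ((u - v) s))%:E) (cst 0%E) by [].
  by apply: filterS uv => s us _ /=; rewrite !fctE us subrr sqn0.
rewrite -sqrf_eq0 => /eqP n0; have /H : (fock_norm (u - v) ^+ 2)%:E = 0%E by rewrite n0.
apply: filterS => s /(_ I)[] /sqn_eq0; rewrite !fctE => /eqP; rewrite subr_eq0.
by move=> /eqP.
Qed.

Lemma fock_eq_refl u : fock_eq u u. Proof. by move=> n; apply: aeW. Qed.

Lemma fock_eq_trans u v w : fock_eq u v -> fock_eq v w -> fock_eq u w.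
Proof. by move=> uv vw n; apply: filterS2 (uv n) (vw n) => x -> ->. Qed.

Lemma fock_ae u v : fock u -> cmeasurable (v : chain R -> R[i]) -> fock_eq u v -> fock v.
Proof.
move=> /fockP[[mu_ iu] au] mv uv; apply/fockP; split; last first.
  move=> n p; have := ae_permute p (uv n); have := uv n; have := au n p.
  by apply: filterS3 => x ux xe pe; rewrite -pe ux xe.
split => //; move: uv => /fock_eq_ae uv; apply/integrableP; split.
  by apply/measurable_EFinP; exact: measurable_sqn.
move: iu => /integrableP[m1]; rewrite (ge0_ae_eq_integral measurableT _ _ _ _ _ (g := fun s : chain R => `|(sqn (v s))%:E|%E))//.
- exact: measurableT_comp.
- by apply: measurableT_comp => //; apply/measurable_EFinP; exact: measurable_sqn.
- by apply: filterS uv => s ->.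
Qed.

Lemma cauchy_subsequence (u : nat -> vect R) :
  (forall e : R, 0 < e -> exists N, forall m n, (N <= m)%N -> (N <= n)%N ->
     fock_norm (u m - u n) ^+ 2 < e) ->
  exists phi : nat -> nat, forall k i j, (phi k <= i)%N -> (k <= j)%N ->
     fock_norm (u (phi j) - u i) ^+ 2 < 8^-1 ^+ k.
Proof.
move=> cu; have /choice[N PN] : forall k, exists N, forall m n, (N <= m)%N -> (N <= n)%N ->
     fock_norm (u m - u n) ^+ 2 < 8^-1 ^+ k.
  by move=> k; apply: cu; rewrite exprn_gt0// invr_gt0.
pose phi k := (\sum_(l < k.+1) N l)%N.
have phiS k j : (k <= j)%N -> (N k <= phi j)%N.
  move=> kj; have kj' : (k < j.+1)%N by [].
  by rewrite /phi (bigD1 (Ordinal kj'))//= leq_addr.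
exists phi => k i j ki kj; apply: PN; first exact: phiS.
exact: leq_trans (phiS _ _ (leqnn k)) ki.
Qed.

(* Pointwise, [|d| <= 2^-k + 2^k |d|^2]: square summability with weights [2^k]
   gives absolute convergence of the increments. *)
Lemma cvg_of_weighted_increments (x : nat -> R) (y : nat -> R) :
  (forall k, (x k.+1 - x k) ^+ 2 <= y k) ->
  (\sum_(0 <= k <oo) (2 ^+ k * y k)%:E < +oo)%E -> cvgn x.
Proof.
move=> xy yoo.
have y0 k : 0 <= y k by apply: le_trans (xy k); exact: sqr_ge0.
have cy : cvgn (series (fun k => 2 ^+ k * y k)).
  apply: nondecreasing_is_cvgn.
    apply/nondecreasing_seqP => n; rewrite /series/= big_nat_recr//= lerDl.
    by rewrite mulr_ge0// exprn_ge0.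
  exists (fine (\sum_(0 <= k <oo) (2 ^+ k * y k)%:E)%E) => _ [n _ <-].
  rewrite -lee_fin fineK; last first.
    by rewrite ge0_fin_numE// nneseries_ge0// => k _ _; rewrite lee_fin mulr_ge0// exprn_ge0.
  rewrite /series/= -sumEFin; apply: nneseries_lim_ge => k _ _.
  by rewrite lee_fin mulr_ge0// exprn_ge0.
have cg : cvgn (series (fun k => (2^-1 : R) ^+ k)).
  have := @cvg_geometric_series R 1 2^-1; rewrite ger0_norm ?invr_ge0//.
  rewrite invf_lt1// ltr1n => /(_ isT) c.
  apply/cvg_ex; eexists; move: c; rewrite (_ : geometric _ _ = fun k => 2^-1 ^+ k)//.
    exact.
  by apply/funext => k /=; rewrite mul1r.
have cd : cvgn (series (fun k => `|x k.+1 - x k|)).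
  apply: (series_le_cvg (v_ := fun k => 2^-1 ^+ k + 2 ^+ k * y k)) => //.
  - by move=> n; rewrite addr_ge0 ?mulr_ge0 ?exprn_ge0// ?invr_ge0.
  - move=> k; have := xy k; set d := x k.+1 - x k; rewrite -(real_normK (num_real d)).
    move: (normr_ge0 d); move: `|d| => {}d d0 dy.
    have c0 : 0 < 2 ^+ k :> R by exact: exprn_gt0.
    rewrite exprVn -(ler_pM2l c0) mulrDr divff ?gt_eqF// mulrA -expr2.
    have := sqr_ge0 (1 - 2 ^+ k * d); have := mulr_ge0 (ltW c0) d0.
    have : (2 ^+ k) ^+ 2 * d ^+ 2 <= (2 ^+ k) ^+ 2 * y k by rewrite ler_pM2l// exprn_gt0.
    by move: (2 ^+ k) => c; nra.
  rewrite (_ : series _ = series (fun k => 2^-1 ^+ k) + series (fun k => 2 ^+ k * y k)).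
    exact: is_cvgD.
  by apply/funext => n; rewrite /series/= big_split.
have := normed_cvg cd.
rewrite (_ : series _ = fun n => x n - x 0%N); last first.
  by apply/funext => n; rewrite /series/= telescope_sumr.
move=> c; rewrite (_ : x = (fun n => x n - x 0%N) + cst (x 0%N)).
  by apply: is_cvgD => //; exact: is_cvg_cst.
by apply/funext => n; rewrite fctE/= subrK.
Qed.

Lemma sqn_Re (c : R[i]) : Re c ^+ 2 <= sqn c. Proof. by rewrite lerDl sqr_ge0. Qed.
Lemma sqn_Im (c : R[i]) : Im c ^+ 2 <= sqn c. Proof. by rewrite lerDr sqr_ge0. Qed.

Lemma fock_norm_integral u : L2v u ->
  ((fock_norm u ^+ 2)%:E = \int[mu]_s (sqn (u s))%:E)%E.
Proof.
move=> su; rewrite (L2v_norm2 su).2 fineK//; apply: integrable_fin_num => //.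
by case: su.
Qed.

Lemma ae_cvg_increments (w : nat -> vect R) : (forall k, fock (w k)) ->
  (forall k, fock_norm (w k.+1 - w k) ^+ 2 <= 8^-1 ^+ k) ->
  {ae mu, forall s : chain R, cvgn (fun k => Re (w k s)) /\ cvgn (fun k => Im (w k s))}.
Proof.
move=> fw wd.
have sd k : L2v (w k.+1 - w k) by apply: fock_L2v; exact: fockB.
have md k : measurable_fun setT (fun s : chain R => (2 ^+ k * sqn ((w k.+1 - w k) s))%:E).
  by apply/measurable_EFinP; apply: measurable_funM => //; apply: measurable_sqn; case: (sd k).
have d0 k (s : chain R) : (0 <= (2 ^+ k * sqn ((w k.+1 - w k) s))%:E)%E.
  by rewrite lee_fin mulr_ge0// ?exprn_ge0// sqn_ge0.
pose g (s : chain R) := (\sum_(0 <= k <oo) (2 ^+ k * sqn ((w k.+1 - w k) s))%:E)%E.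
have ig : mu.-integrable setT g.
  apply/integrableP; split.
    by apply: ge0_emeasurable_sum => //.
  under eq_integral => s _ do rewrite gee0_abs ?nneseries_ge0//.
  rewrite integral_nneseries//.
  apply: le_lt_trans (ltry (2 : R)).
  apply: le_trans (epsilon_trick0 xpredT (ler0n _ 2)).
  apply: lee_nneseries => k _; first by move=> _; exact: integral_ge0.
  under eq_integral => s _ do rewrite EFinM.
  rewrite ge0_integralZl_EFin//; last 2 first.
  - by move=> s _; rewrite lee_fin sqn_ge0.
  - by apply/measurable_EFinP; apply: measurable_sqn; case: (sd k).
  rewrite -fock_norm_integral// -EFinM lee_fin.
  apply: le_trans (ler_wpM2l _ (wd k)) _ => //.
  rewrite -exprMn natrX exprS invfM mulrA divff// mul1r -exprVn.
  rewrite lerXn2r// ?nnegrE//; lra.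
have := integrable_ae measurableT ig; apply: filterS => s /(_ I) gs.
have goo : (g s < +oo)%E by rewrite ltey_eq gs.
by split; apply: (cvg_of_weighted_increments (y := fun k => sqn ((w k.+1 - w k) s))) => // k;
  [rewrite -raddfB; exact: sqn_Re|rewrite -raddfB; exact: sqn_Im].
Qed.

Lemma limn_einf_le_bound (f : nat -> \bar R) (c : \bar R) :
  (forall n, f n <= c)%E -> (limn_einf f <= c)%E.
Proof.
move=> fc; rewrite limn_einf_lim; apply: lime_le; first exact: is_cvg_einfs.
apply: nearW => n; apply: le_trans (fc n); apply: ereal_inf_lbound.
by exists n => //=.
Qed.

Lemma cmeasurableB (f g : chain R -> R[i]) : cmeasurable f -> cmeasurable g ->
  cmeasurable (fun x => f x - g x).
Proof.
move=> mf mg; apply: cmeasurableD => //.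
rewrite (_ : (fun x => _) = (fun x => (-1) * g x)).
  by apply: cmeasurableM => //; exact: cmeasurable_cst.
by apply/funext => s; rewrite mulN1r.
Qed.

Lemma complexE_pair (c : R[i]) : c = Re c +i* Im c. Proof. by case: c. Qed.

Lemma cvg_cmul (x : nat -> R) (y c : R) :
  x @ \oo --> y -> (fun k => c * x k) @ \oo --> c * y.
Proof. by move=> xy; apply: cvgM => //; exact: cvg_cst. Qed.

Lemma cvg_sqnB (c : nat -> R[i]) (l b : R[i]) :
  (fun k => Re (c k)) @ \oo --> Re l -> (fun k => Im (c k)) @ \oo --> Im l ->
  (fun k => sqn (c k - b)) @ \oo --> sqn (l - b).
Proof.
move=> cr ci.
have E (x : R[i]) : sqn (x - b) = (Re x - Re b) * (Re x - Re b) + (Im x - Im b) * (Im x - Im b).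
  by case: x b => ? ? [? ?]; rewrite /sqn/=; ring.
rewrite E; under eq_fun do rewrite E.
have cb (x : nat -> R) y z : x @ \oo --> y -> (fun k => x k - z) @ \oo --> y - z.
  by move=> xy; apply: cvgB => //; exact: cvg_cst.
by apply: cvgD; apply: cvgM; exact: cb.
Qed.

Lemma fock_complete (u : nat -> vect R) : (forall k, fock (u k)) ->
  (forall e : R, 0 < e -> exists N, forall m n, (N <= m)%N -> (N <= n)%N ->
     fock_norm (u m - u n) ^+ 2 < e) ->
  exists2 v, fock v & forall e : R, 0 < e -> exists N, forall n, (N <= n)%N ->
     fock_norm (v - u n) ^+ 2 < e.
Proof.
move=> fu /cauchy_subsequence[phi phiP].
pose w k := u (phi k).
have fw k : fock (w k) by exact: fu.
have [k|N [mN N0 NP]] := ae_cvg_increments fw.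
  by apply/ltW/phiP.

pose i0 (s : chain R) : R[i] := (\1_(~` N) s)%:C.
have mi0 : cmeasurable i0.
  split; first by apply: measurable_indic; exact: measurableC.
  exact: measurable_cst.
pose wk k (s : chain R) : R[i] := w k s * i0 s.
have mw k : cmeasurable (w k : chain R -> R[i]) by case: (fock_L2v (fw k)).
have mwk k : cmeasurable (wk k) by exact: cmeasurableM.
have wkE k s : ~ N s -> wk k s = w k s.
  by move=> Ns; rewrite /wk /i0 indicE mem_set// mulr1.
have wk0 k s : N s -> wk k s = 0.
  by move=> Ns; rewrite /wk /i0 indicE memNset ?mulr0// => /(_ Ns).
pose v (s : chain R) : R[i] := limn (fun k => Re (wk k s)) +i* limn (fun k => Im (wk k s)).
have cvRe s : (fun k => Re (wk k s)) @ \oo --> Re (v s).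
  have [Ns|Ns] := pselect (N s).
    rewrite /= (_ : (fun k => _) = cst (0 : R)); last by apply/funext => k; rewrite wk0.
    exact: (@is_cvg_cst R).
  have [] // : cvgn (fun k => Re (w k s)) /\ cvgn (fun k => Im (w k s)).
    by apply: contrapT => h; apply: Ns; exact: NP.
  by move=> c _; rewrite /= (_ : (fun k => _) = (fun k => Re (w k s)))//;
     apply/funext => k; rewrite wkE.
have cvIm s : (fun k => Im (wk k s)) @ \oo --> Im (v s).
  have [Ns|Ns] := pselect (N s).
    rewrite /= (_ : (fun k => _) = cst (0 : R)); last by apply/funext => k; rewrite wk0.
    exact: (@is_cvg_cst R).
  have [] // : cvgn (fun k => Re (w k s)) /\ cvgn (fun k => Im (w k s)).
    by apply: contrapT => h; apply: Ns; exact: NP.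
  by move=> _ c; rewrite /= (_ : (fun k => _) = (fun k => Im (w k s)))//;
     apply/funext => k; rewrite wkE.
have mv : cmeasurable v.
  split.
    by apply: (measurable_fun_cvg (h := fun k s => Re (wk k s))) => // k; case: (mwk k).
  by apply: (measurable_fun_cvg (h := fun k s => Im (wk k s))) => // k; case: (mwk k).
have aeN : {ae mu, forall s, ~ N s}.
  by exists N; split => // s /= /contrapT.
have bnd k i : (phi k <= i)%N ->
    (\int[mu]_s (sqn (v s - u i s))%:E <= (8^-1 ^+ k)%:E)%E.
  move=> ki.
  have mf j : measurable_fun setT (fun s => (sqn (wk (j + k)%N s - u i s))%:E).
    apply/measurable_EFinP; apply: measurable_sqn.
    apply: cmeasurableB => //; by case: (fock_L2v (fu i)).
  have f0 j (s : chain R) : setT s -> (0 <= (sqn (wk (j + k)%N s - u i s))%:E)%E.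
    by move=> _; rewrite lee_fin sqn_ge0.
  have := fatou mu measurableT mf f0.
  rewrite [X in (X <= _)%E -> _](_ : _ = \int[mu]_s (sqn (v s - u i s))%:E)%E; last first.
    apply: eq_integral.
    move=> s _; apply: (cvg_limn_einf_sup _).1.
    apply: cvg_EFin; first exact: nearW.
    apply: cvg_sqnB.
      by rewrite (cvg_shiftn k (fun j => Re (wk j s))); exact: cvRe.
    by rewrite (cvg_shiftn k (fun j => Im (wk j s))); exact: cvIm.
  move=> /le_trans; apply; apply: limn_einf_le_bound => j.
  rewrite (_ : (\int[mu]_s _)%E = \int[mu]_s (sqn ((w (j + k)%N - u i) s))%:E)%E.
    rewrite -fock_norm_integral; last by apply: fock_L2v; exact: fockB.
    by rewrite lee_fin ltW// phiP// leq_addl.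
  apply: ge0_ae_eq_integral => //.
  - apply/measurable_EFinP; apply: measurable_sqn.
    by have [] := fock_L2v (fockB (fw (j + k)%N) (fu i)).
  - by move=> s _; rewrite lee_fin sqn_ge0.
  - by move=> s _; rewrite lee_fin sqn_ge0.
  - by apply: filterS aeN => s Ns _; rewrite wkE.
have sv i : (phi 0%N <= i)%N -> L2v ((v : vect R) - u i).
  move=> ki; apply/L2vP.
  have mvu : cmeasurable ((v : vect R) - u i : chain R -> R[i]).
    apply: cmeasurableB => //; by case: (fock_L2v (fu i)).
  split; first exact/cmeasurable_level.
  rewrite norm2E//; under eq_integral => s _ do rewrite sqmodE.
  exact: le_lt_trans (bnd _ _ ki) (ltry _).
have fv : fock (v : vect R).
  apply/fockP; split.
    rewrite -[v : vect R](subrK (u (phi 0%N))) -[X in X + _]scale1r.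
    by apply: L2vZD; [exact: sv|exact: fock_L2v].
  move=> n p.
  have a1 := (ae_chainP _).1 aeN n.
  have a2 := ae_permute p a1.
  have a3 : {ae leb n, forall x : n.-tuple rT, forall k,
      w k (permute p x) = (-1) ^+ p * w k x}.
    by apply: ae_foralln => k; have /fockP[_ ] := fw k; exact.
  apply: filterS3 a1 a2 a3 => x x1 x2 x3.
  have E k : wk k (permute p x) = (-1) ^+ p * wk k x.
    by rewrite wkE// [in RHS]wkE.
  have sg z : (-1) ^+ p * z = ((-1) ^+ p * Re z) +i* ((-1) ^+ p * Im z).
    case: (p : bool) z => -[a b] /=; rewrite ?expr1 ?expr0 ?mulN1r ?mul1r//.
  have E1 : (fun k => Re (wk k (permute p x))) = (fun k => (-1) ^+ p * Re (wk k x)).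
    by apply/funext => k; rewrite E sg.
  have E2 : (fun k => Im (wk k (permute p x))) = (fun k => (-1) ^+ p * Im (wk k x)).
    by apply/funext => k; rewrite E sg.
  rewrite sg; have c1 := cvRe (permute p x); have c2 := cvIm (permute p x).
  rewrite E1 in c1; rewrite E2 in c2.
  have d1 := @cvg_cmul _ _ ((-1) ^+ p) (cvRe x).
  have d2 := @cvg_cmul _ _ ((-1) ^+ p) (cvIm x).
  have -> := complexE_pair (v (permute p x)).
  by rewrite (cvg_unique (@Rhausdorff R) c1 d1) (cvg_unique (@Rhausdorff R) c2 d2).
exists (v : vect R) => // e e0.
have [k ke] : exists k, 8^-1 ^+ k < e.
  have : (fun k => (8^-1 : R) ^+ k) @ \oo --> (0 : R).
    by apply: cvg_expr; rewrite ger0_norm ?invr_ge0// invf_lt1// ltr1n.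
  move=> /cvgr_lt/(_ e e0)[k _ ke]; by exists k; exact: ke (leqnn k).
exists (phi k + phi 0%N)%N => n kn.
rewrite -lte_fin fock_norm_integral; last first.
  by apply: sv; apply: leq_trans kn; exact: leq_addl.
apply: le_lt_trans (bnd k n _) _; last by rewrite lte_fin.
by apply: leq_trans kn; exact: leq_addr.
Qed.

End fock_space.

(** * Hilbert spaces and tracial von Neumann algebras *)

Section semi_hilbert.
Variables (R : realType) (V : lmodType R[i]) (H : V -> Prop).
Variables (ip : V -> V -> R[i]) (nm : V -> R) (eqv : V -> V -> Prop).
Local Notation Re := (@complex.Re R).
Implicit Types (u v w : V) (a c : R[i]) (S T : V -> V).

(* A Hilbert space presented by representatives: equality of vectors is the
   relation [eqv], i.e. vanishing of the semi-norm of the difference. *)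
Record hilbert_axioms : Prop := {
  hilb0 : H 0;
  hilbZD : forall a u v, H u -> H v -> H (a *: u + v);
  hilb_ipZDr : forall a u v w, H u -> H v -> H w ->
    ip w (a *: u + v) = a * ip w u + ip w v;
  hilb_ip_conj : forall u v, H u -> H v -> ip v u = conjc (ip u v);
  hilb_ip_self : forall u, H u -> ip u u = (nm u ^+ 2)%:C;
  hilb_nm_ge0 : forall u, 0 <= nm u;
  hilb_eqv : forall u v, H u -> H v -> eqv u v <-> nm (u - v) = 0;
  hilb_complete : forall u : nat -> V, (forall k, H (u k)) ->
    (forall e : R, 0 < e -> exists N, forall m n, (N <= m)%N -> (N <= n)%N ->
       nm (u m - u n) ^+ 2 < e) ->
    exists2 v, H v & forall e : R, 0 < e -> exists N, forall n, (N <= n)%N ->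
       nm (v - u n) ^+ 2 < e }.

Hypothesis ax : hilbert_axioms.

Let H0 := hilb0 ax.
Let HZD := hilbZD ax.
Let nm_ge0 := hilb_nm_ge0 ax.
Let ipZDr := hilb_ipZDr ax.
Let ip_conj := hilb_ip_conj ax.

Lemma HD u v : H u -> H v -> H (u + v).
Proof. by move=> Hu Hv; rewrite -(scale1r u); exact: HZD. Qed.

Lemma HZ a u : H u -> H (a *: u).
Proof. by move=> Hu; rewrite -[_ *: u]addr0; apply: HZD => //; exact: H0. Qed.

Lemma HN u : H u -> H (- u).
Proof. by move=> Hu; rewrite -scaleN1r; exact: HZ. Qed.

Lemma HB u v : H u -> H v -> H (u - v).
Proof. by move=> Hu Hv; apply: HD => //; exact: HN. Qed.

Lemma Hsum n (F : 'I_n -> V) : (forall i, H (F i)) -> H (\sum_(i < n) F i).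
Proof. by move=> fF; elim/big_ind: _ => //; exact: HD. Qed.

Lemma ipr0 u : H u -> ip u 0 = 0.
Proof.
move=> Hu; have := ipZDr 1 H0 H0 Hu; rewrite scale1r addr0 mul1r => /eqP.
by rewrite -subr_eq subrr => /eqP/esym.
Qed.

Lemma ipDr u v w : H u -> H v -> H w -> ip w (u + v) = ip w u + ip w v.
Proof. by move=> Hu Hv Hw; have := ipZDr 1 Hu Hv Hw; rewrite scale1r mul1r. Qed.

Lemma ipZr a u w : H u -> H w -> ip w (a *: u) = a * ip w u.
Proof.
by move=> Hu Hw; have := ipZDr a Hu H0 Hw; rewrite addr0 ipr0// addr0.
Qed.

Lemma ipNr u w : H u -> H w -> ip w (- u) = - ip w u.
Proof. by move=> Hu Hw; rewrite -scaleN1r ipZr// mulN1r. Qed.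

Lemma ipBr u v w : H u -> H v -> H w -> ip w (u - v) = ip w u - ip w v.
Proof. by move=> Hu Hv Hw; rewrite ipDr ?ipNr//; exact: HN. Qed.

Lemma ip_sumr n (F : 'I_n -> V) w : (forall i, H (F i)) -> H w ->
  ip w (\sum_(i < n) F i) = \sum_(i < n) ip w (F i).
Proof.
move=> fF fw; elim: n F fF => [|n IH] F fF; first by rewrite !big_ord0 ipr0.
by rewrite !big_ord_recr/= ipDr ?IH//; exact: Hsum.
Qed.

Lemma conjcM (a b : R[i]) : conjc (a * b) = conjc a * conjc b.
Proof. exact: rmorphM. Qed.

Lemma conjcD (a b : R[i]) : conjc (a + b) = conjc a + conjc b.
Proof. exact: rmorphD. Qed.

Lemma ipZDl a u v w : H u -> H v -> H w ->
  ip (a *: u + v) w = conjc a * ip u w + ip v w.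
Proof.
move=> Hu Hv Hw; rewrite (ip_conj Hw (HZD a Hu Hv)) ipZDr//.
by rewrite conjcD conjcM -(ip_conj Hw Hu) -(ip_conj Hw Hv).
Qed.

Lemma ipDl u v w : H u -> H v -> H w -> ip (u + v) w = ip u w + ip v w.
Proof. by move=> Hu Hv Hw; have := ipZDl 1 Hu Hv Hw; rewrite scale1r conjc1 mul1r. Qed.

Lemma ipNl u w : H u -> H w -> ip (- u) w = - ip u w.
Proof.
move=> Hu Hw; rewrite (ip_conj Hw (HN Hu)) ipNr// (ip_conj Hu Hw).
by case: (ip u w) => x y; apply/eqP; rewrite eq_complex/= opprK !eqxx.
Qed.

Lemma ipBl u v w : H u -> H v -> H w -> ip (u - v) w = ip u w - ip v w.
Proof. by move=> Hu Hv Hw; rewrite ipDl ?ipNl//; exact: HN. Qed.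

Lemma nm_sqrZD a u v : H u -> H v -> nm (a *: u + v) ^+ 2 =
  sqn a * nm u ^+ 2 + 2 * Re (a * ip v u) + nm v ^+ 2.
Proof.
move=> Hu Hv; have := hilb_ip_self ax (HZD a Hu Hv).
rewrite ipZDr ?ipZDl//; try exact: HZD.
rewrite !(hilb_ip_self ax)// (ip_conj Hv Hu) => /(congr1 Re).
by case: (ip v u) a => x y [a b] /= <-; rewrite /sqn/=; ring.
Qed.

Lemma nmZ a u : H u -> nm (a *: u) = Normc.normc a * nm u.
Proof.
move=> Hu; apply/eqP; rewrite -(@eqrXn2 _ 2)// ?mulr_ge0 ?nm_ge0 ?normc_ge0//.
rewrite exprMn sqn_normc; have := nm_sqrZD a Hu H0.
have -> : nm 0 ^+ 2 = 0.
  by have := hilb_ip_self ax H0; rewrite ipr0 ?H0// => /(congr1 Re).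
rewrite addr0 (ip_conj Hu H0) ipr0// conjc0 mulr0 => ->.
by rewrite /= mulr0 !addr0.
Qed.

Lemma nm0 : nm 0 = 0.
Proof.
have := hilb_ip_self ax H0; rewrite ipr0 ?H0// => /(congr1 Re)/= /esym/eqP.
by rewrite sqrf_eq0 => /eqP.
Qed.

Lemma nmN u : H u -> nm (- u) = nm u.
Proof.
have n1 : Normc.normc (-1 : R[i]) = 1 by rewrite /= oppr0 expr0n addr0 sqrrN expr1n sqrtr1.
by move=> Hu; rewrite -scaleN1r nmZ// n1 mul1r.
Qed.

Lemma nm_sqrD u v : H u -> H v ->
  nm (u + v) ^+ 2 = nm u ^+ 2 + 2 * Re (ip v u) + nm v ^+ 2.
Proof.
by move=> Hu Hv; have := nm_sqrZD 1 Hu Hv;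
  rewrite scale1r mul1r /sqn/= expr1n expr0n addr0 mul1r.
Qed.

Lemma nm_sqrB u v : H u -> H v ->
  nm (u - v) ^+ 2 = nm u ^+ 2 - 2 * Re (ip v u) + nm v ^+ 2.
Proof.
move=> Hu Hv; rewrite nm_sqrD ?nmN ?ipNl//; last exact: HN.
by rewrite raddfN mulrN.
Qed.

Lemma Re_normc (c : R[i]) : `|Re c| <= Normc.normc c.
Proof.
case: c => x y /=; rewrite -sqrtr_sqr ler_sqrt ?addr_ge0 ?sqr_ge0//.
by rewrite lerDl sqr_ge0.
Qed.

Lemma ip_CS u v : H u -> H v -> Normc.normc (ip u v) <= nm u * nm v.
Proof.
move=> Hu Hv; set c := ip u v.
rewrite -(@ler_pXn2r _ 2)// ?nnegrE ?normc_ge0 ?mulr_ge0 ?nm_ge0//.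
rewrite sqn_normc exprMn.
set A := nm u ^+ 2; set B := nm v ^+ 2.
have A0 : 0 <= A by exact: sqr_ge0.
have B0 : 0 <= B by exact: sqr_ge0.
have K t : 0 <= A - 2 * t * sqn c + t ^+ 2 * sqn c * B.
  have := sqr_ge0 (nm ((- t%:C * conjc c) *: v + u)).
  rewrite nm_sqrZD// -/A -/B -/c.
  rewrite (_ : sqn _ = t ^+ 2 * sqn c); last by case: (c) => x y; rewrite /sqn/=; ring.
  rewrite (_ : Re _ = - t * sqn c); last by case: (c) => x y; rewrite /sqn/=; ring.
  by move=> h; apply: le_trans h _; lra.
have c0 := sqn_ge0 c.
have [B00|Bn0] := eqVneq B 0.
  rewrite B00 mulr0 leNgt; apply/negP => cp.
  have := K ((A + 1) / (2 * sqn c)); rewrite B00 mulr0 addr0.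
  rewrite (_ : _ - _ = - 1) ?oppr_ge0 ?ler10//.
  by field; rewrite gt_eqF.
have Bp : 0 < B by rewrite lt_neqAle eq_sym Bn0.
have := K B^-1.
rewrite (_ : _ + _ = A - sqn c / B); last by field.
by rewrite subr_ge0 ler_pdivrMr.
Qed.

Lemma Re_ip_CS u v : H u -> H v -> `|Re (ip u v)| <= nm u * nm v.
Proof. by move=> Hu Hv; apply: le_trans (Re_normc _) (ip_CS Hu Hv). Qed.

Lemma nmD u v : H u -> H v -> nm (u + v) <= nm u + nm v.
Proof.
move=> Hu Hv; rewrite -(@ler_pXn2r _ 2)// ?nnegrE ?addr_ge0 ?nm_ge0//.
rewrite nm_sqrD// sqrrD lerD2r lerD2l -[leRHS]mulr_natl ler_pM2l// mulrC.
by apply: le_trans (ler_norm _) _; exact: Re_ip_CS.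
Qed.

Lemma nmBC u v : H u -> H v -> nm (u - v) = nm (v - u).
Proof. by move=> Hu Hv; rewrite -(opprB v u) nmN//; exact: HB. Qed.

Lemma eqv_ip u v : H u -> H v -> eqv u v <-> (forall w, H w -> ip w u = ip w v).
Proof.
move=> Hu Hv; rewrite (hilb_eqv ax)//; have Huv := HB Hu Hv.
split=> [n0 w Hw|E].
  have : Normc.normc (ip w (u - v)) = 0.
    by apply/eqP; rewrite eq_le normc_ge0 andbT (le_trans (ip_CS Hw Huv))// n0 mulr0.
  by move=> /Normc.eq0_normc; rewrite ipBr// => /eqP; rewrite subr_eq0 => /eqP.
have : ip (u - v) (u - v) = 0 by rewrite (ipBr Hu Hv Huv) E// subrr.
by rewrite (hilb_ip_self ax)// => /(congr1 Re) /= /eqP; rewrite sqrf_eq0 => /eqP.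
Qed.

Lemma ip_eqr u v w : H u -> H v -> H w -> eqv u v -> ip w u = ip w v.
Proof. by move=> Hu Hv Hw /eqv_ip -> . Qed.

Lemma ip_eql u v w : H u -> H v -> H w -> eqv u v -> ip u w = ip v w.
Proof.
by move=> Hu Hv Hw uv; rewrite (ip_conj Hw Hu) (ip_eqr Hu Hv Hw uv) -(ip_conj Hw Hv).
Qed.

Lemma nm_eqv u v : H u -> H v -> eqv u v -> nm u = nm v.
Proof.
move=> Hu Hv uv; have := hilb_ip_self ax Hu; rewrite (ip_eqr Hu Hv Hu uv).
rewrite (ip_eql Hu Hv Hv uv) (hilb_ip_self ax)// => /(congr1 Re)/= /eqP.
by rewrite eqrXn2// => /eqP.
Qed.

Lemma eqv_sym u v : H u -> H v -> eqv u v -> eqv v u.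
Proof. by move=> Hu Hv /eqv_ip E; apply/eqv_ip => // w Hw; rewrite E. Qed.

Lemma eqv_trans u v w : H u -> H v -> H w -> eqv u v -> eqv v w -> eqv u w.
Proof.
move=> Hu Hv Hw /eqv_ip E /eqv_ip E'; apply/eqv_ip => // x Hx; rewrite E//; exact: E'.
Qed.

Lemma eqv_nm0 u : H u -> nm u = 0 -> eqv u 0.
Proof. by move=> Hu n0; apply/(hilb_eqv ax) => //; rewrite subr0. Qed.

Lemma le0_of_small (x K : R) : 0 <= K -> (forall e, 0 < e -> x <= e * K) -> x <= 0.
Proof.
move=> K0 xe; rewrite leNgt; apply/negP => x0.
have K1 : 0 < K + 1 by rewrite ltr_wpDl.
have := xe (x / (2 * (K + 1))); rewrite divr_gt0 ?mulr_gt0// => /(_ isT).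
apply/negP; rewrite -ltNge -mulrA gtr_pMr// mulrC ltr_pdivrMr ?mulr_gt0//; lra.
Qed.

(* Minimize [|u|^2 - 2 Re f(u)]; the parallelogram law makes a minimizing
   sequence Cauchy. *)
Lemma riesz (f : V -> R[i]) (M : R) :
  (forall a u v, H u -> H v -> f (a *: u + v) = a * f u + f v) ->
  (forall u, H u -> Normc.normc (f u) <= M * nm u) ->
  exists2 v, H v & forall w, H w -> ip v w = f w.
Proof.
move=> fZD fM.
pose J u := nm u ^+ 2 - 2 * Re (f u).
have JM u : H u -> - M ^+ 2 <= J u.
  move=> Hu; have := fM _ Hu; have := Re_normc (f u); rewrite /J ler_norml.
  by move=> /andP[_ h1] h2; have := sqr_ge0 (nm u - M); nra.
have f0 : f 0 = 0.
  have := fZD 1 0 0 H0 H0; rewrite scale1r addr0 mul1r => /eqP.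
  by rewrite -subr_eq subrr => /eqP/esym.
have JZD c u w : H u -> H w ->
    J (c *: w + u) = J u + sqn c * nm w ^+ 2 + 2 * Re (c * (ip u w - f w)).
  move=> Hu Hw; rewrite /J nm_sqrZD// fZD// !raddfD/= mulrBr raddfB/=.
  by ring.
pose A := [set J u | u in [set u | H u]].
have Ainf : has_inf A.
  split; first by exists (J 0), 0.
  by exists (- M ^+ 2) => _ [u Hu <-]; exact: JM.
pose I := inf A.
have IJ u : H u -> I <= J u by move=> Hu; apply: inf_lbound; [exact: Ainf.2|exists u].
have /choice[u uP] : forall n, exists u, H u /\ J u < I + n.+1%:R^-1.
  move=> n; have [] := @inf_adherent _ A n.+1%:R^-1 _ Ainf; first by rewrite invr_gt0.
  by move=> _ [u Hu <-] h; exists u.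
have Hu n : H (u n) by case: (uP n).
have dist m n : nm (u m - u n) ^+ 2 <= 2 * (m.+1%:R^-1 + n.+1%:R^-1).
  pose w := u m - u n; have Hw : H w by exact: HB.
  have E1 : u m = 2^-1 *: w + (2^-1 *: w + u n).
    have hh : 2^-1 + 2^-1 = 1 :> R[i] by field.
    by rewrite addrA -scalerDl hh scale1r /w subrK.
  have Hv : H (2^-1 *: w + u n) by exact: HZD.
  have JI := IJ _ Hv.
  have Jm := (uP m).2; have Jn := (uP n).2.
  have E2 : u n = (- 2^-1) *: w + (2^-1 *: w + u n).
    by rewrite addrA -scalerDl addNr scale0r add0r.
  have j1 := JZD 2^-1 _ _ Hv Hw; have j2 := JZD (- 2^-1) _ _ Hv Hw.
  rewrite -E1 in j1; rewrite -E2 in j2; move: Jm Jn; rewrite j1 j2.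
  move: (2^-1 *: w + u n) JI {Hv E1 E2 j1 j2} => z JI.
  have -> : sqn (2^-1 : R[i]) = 4^-1.
    by rewrite /sqn (_ : 2^-1 = (2^-1 : R)%:C) /=; [field|rewrite fmorphV rmorph_nat].
  have -> : sqn (- 2^-1 : R[i]) = 4^-1.
    by rewrite sqnN /sqn (_ : 2^-1 = (2^-1 : R)%:C) /=; [field|rewrite fmorphV rmorph_nat].
  have nr (q : R[i]) : Re (- q) = - Re q by case: q.
  rewrite mulNr nr -/w; move: (Re _) (nm w ^+ 2) (m.+1%:R^-1) (n.+1%:R^-1) => r W p q Jm Jn.
  by move: (J z) Jm Jn JI => j Jm Jn JI; lra.
have small e : 0 < e -> exists N, forall n, (N <= n)%N -> n.+1%:R^-1 < e :> R.
  move=> e0; exists (Num.bound e^-1) => n Nn.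
  rewrite -[e]invrK ltf_pV2 ?posrE ?invr_gt0//.
  apply: lt_le_trans (archi_boundP _) _; first by rewrite invr_ge0 ltW.
  by rewrite ler_nat ltnW.
have [v Hv vP] : exists2 v, H v & forall e : R, 0 < e -> exists N, forall n, (N <= n)%N ->
       nm (v - u n) ^+ 2 < e.
  apply: (hilb_complete ax) => // e e0.
  have [N NP] := small (e / 4) (divr_gt0 e0 (ltr0n _ 4)).
  exists N => m n Nm Nn; apply: le_lt_trans (dist m n) _.
  by have := NP _ Nm; have := NP _ Nn; move: (m.+1%:R^-1) (n.+1%:R^-1) => p q; lra.
exists v => // w Hw; apply/eqP; rewrite -subr_eq0; apply/eqP.
set d := ip v w - f w.
apply: sqn_eq0; apply/eqP; rewrite eq_le sqn_ge0 andbT.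
pose t := (nm w ^+ 2 + 1)^-1.
have t0 : 0 < t by rewrite invr_gt0 ltr_wpDl// sqr_ge0.
have tw : t * nm w ^+ 2 <= 1 by rewrite mulrC ler_pdivrMr ?mul1r ?lerDl// ltr_wpDl// sqr_ge0.
have nd := normc_ge0 d; have nw := nm_ge0 w.
apply: (@le0_of_small _ (t^-1 * (1 + 2 * t * Normc.normc d * nm w))).
  by rewrite mulr_ge0 ?invr_ge0 ?(ltW t0)// addr_ge0// !mulr_ge0// ltW.
move=> e e0; rewrite mulrCA -(ler_pM2l t0) mulVKf ?gt_eqF//.
have [N1 N1P] := small e e0.
have [N2 N2P] := vP (e ^+ 2) (exprn_gt0 2 e0).
pose n := (N1 + N2)%N.
have h1 := N1P n (leq_addr _ _); have h2 := N2P n (leq_addl _ _).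
have {}h2 : nm (v - u n) < e by move: h2; rewrite ltr_pXn2r// ?nnegrE// ltW.
have Hc : H ((- t%:C * conjc d) *: w + u n) by exact: HZD.
have := IJ _ Hc; rewrite JZD//; have := (uP n).2.
rewrite (_ : sqn (- t%:C * conjc d) = t ^+ 2 * sqn d); last first.
  by case: (d) => x y; rewrite /sqn/=; ring.
rewrite (_ : ip (u n) w - f w = d - ip (v - u n) w); last first.
  by rewrite ipBl// /d; ring.
have k := ip_CS (HB Hv (Hu n)) Hw.
rewrite (_ : Re _ = - t * sqn d + t * Re (conjc d * ip (v - u n) w)); last first.
  by case: (d) (ip _ w) => x y [z z']; rewrite /sqn/=; ring.
have : `|Re (conjc d * ip (v - u n) w)| <= Normc.normc d * (e * nm w).
  apply: le_trans (Re_normc _) _; rewrite Normc.normcM.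
  rewrite (_ : Normc.normc (conjc d) = Normc.normc d); last first.
    by case: (d) => x y /=; rewrite sqrrN.
  apply: ler_wpM2l => //; apply: le_trans k _; apply: ler_wpM2r => //; exact: ltW.
rewrite ler_norml => /andP[_ h3] Jn.
have := ler_wpM2l (ltW t0) h3; have := sqn_ge0 d.
have : t ^+ 2 * sqn d * nm w ^+ 2 <= t * sqn d.
  rewrite (_ : _ * _ * _ = (t * nm w ^+ 2) * (t * sqn d)); last by ring.
  by rewrite ler_piMl// mulr_ge0 ?sqn_ge0 ?ltW.
clearbody t; move: (n.+1%:R^-1 : R) (Re (conjc d * _)) (J (u n)) h1 Jn => q r j h1 Jn.
move: (sqn d) (Normc.normc d) (nm w) => D N W K1 K2 K3 K4.
have K5 : t * (N * (e * W)) = e * (t * N * W) by ring.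
have K6 : e * (1 + 2 * t * N * W) = e + 2 * (e * (t * N * W)) by ring.
rewrite K6; rewrite K5 in K3; move: (e * _) K3 => y K3; lra.
Qed.

End semi_hilbert.

Lemma normcD_le (R : realType) (a b : R[i]) :
  Normc.normc (a + b) <= Normc.normc a + Normc.normc b.
Proof.
rewrite -(@ler_pXn2r _ 2)// ?nnegrE ?addr_ge0 ?normc_ge0// sqrrD !sqn_normc.
rewrite (_ : sqn (a + b) = sqn a + complex.Re (conjc a * b) *+ 2 + sqn b); last first.
  by case: a b => x y [z t]; rewrite /sqn/=; ring.
rewrite lerD2r lerD2l lerMn2r/=; apply: le_trans (ler_norm _) _.
apply: le_trans (Re_normc _) _; rewrite Normc.normcM ler_wpM2r ?normc_ge0//.
by case: a => x y /=; rewrite sqrrN.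
Qed.

Section semi_hilbert_operators.
Variables (R : realType) (V : lmodType R[i]) (H : V -> Prop).
Variables (ip : V -> V -> R[i]) (nm : V -> R) (eqv : V -> V -> Prop).
Local Notation Re := (@complex.Re R).
Implicit Types (u v w : V) (a c : R[i]) (S T : V -> V).
Hypothesis ax : hilbert_axioms H ip nm eqv.

Let H0 := hilb0 ax.
Let HZD := hilbZD ax.
Let nm_ge0 := hilb_nm_ge0 ax.
Let ip_conj := hilb_ip_conj ax.

Definition hbounded T := [/\ forall u, H u -> H (T u),
  forall a u v, H u -> H v -> eqv (T (a *: u + v)) (a *: T u + T v) &
  exists M : R, forall u, H u -> nm (T u) <= M * nm u].

Definition hadjoint T : V -> V := fun u =>
  xget 0 [set v | H v /\ forall w, H w -> ip v w = ip u (T w)].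

Definition le_op T (M : R) := forall u, H u -> nm (T u) <= M * nm u.

Lemma hbounded_H T u : hbounded T -> H u -> H (T u).
Proof. by move=> [h _ _]; exact: h. Qed.

Lemma hbounded_le T : hbounded T -> exists2 M, 0 <= M & le_op T M.
Proof.
move=> [h _ [M TM]]; exists `|M|; first exact: normr_ge0.
by move=> u Hu; apply: le_trans (TM u Hu) _; rewrite ler_wpM2r// ler_norm.
Qed.

Lemma op_ZD T a u v w : hbounded T -> H u -> H v -> H w ->
  ip w (T (a *: u + v)) = a * ip w (T u) + ip w (T v).
Proof.
move=> bT Hu Hv Hw; have [_ /(_ a u v Hu Hv) E _] := bT.
have h u := @hbounded_H T u bT.
by rewrite (ip_eqr ax _ _ Hw E) ?(hilb_ipZDr ax)//; try apply: h => //; apply: HZD => //; exact: h.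
Qed.

Lemma op_0 T : hbounded T -> forall w, H w -> ip w (T 0) = 0.
Proof.
move=> bT w Hw; have := op_ZD 1 bT H0 H0 Hw; rewrite scale1r addr0 mul1r => /eqP.
by rewrite -subr_eq subrr => /eqP/esym.
Qed.

Lemma op_Z T a u w : hbounded T -> H u -> H w -> ip w (T (a *: u)) = a * ip w (T u).
Proof. by move=> bT Hu Hw; have := op_ZD a bT Hu H0 Hw; rewrite addr0 op_0// addr0. Qed.

Lemma op_D T u v w : hbounded T -> H u -> H v -> H w ->
  ip w (T (u + v)) = ip w (T u) + ip w (T v).
Proof. by move=> bT Hu Hv Hw; have := op_ZD 1 bT Hu Hv Hw; rewrite scale1r mul1r. Qed.

Lemma op_B T u v w : hbounded T -> H u -> H v -> H w ->
  ip w (T (u - v)) = ip w (T u) - ip w (T v).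
Proof.
move=> bT Hu Hv Hw; have := op_ZD (-1) bT Hv Hu Hw.
by rewrite scaleN1r addrC => ->; rewrite mulN1r addrC.
Qed.

Lemma op_nmB T u v : hbounded T -> H u -> H v -> nm (T (u - v)) = nm (T u - T v).
Proof.
move=> bT Hu Hv; have h x := @hbounded_H T x bT.
apply: (nm_eqv ax); [by apply/h/(HB ax)|by apply: (HB ax); exact: h|].
apply/(eqv_ip ax); [by apply/h/(HB ax)|by apply: (HB ax); exact: h|].
by move=> w Hw; rewrite op_B// (ipBr ax)//; exact: h.
Qed.

Lemma op_eqv T u v : hbounded T -> H u -> H v -> eqv u v -> eqv (T u) (T v).
Proof.
move=> bT Hu Hv /(hilb_eqv ax) E; have h x := @hbounded_H T x bT.
apply/(hilb_eqv ax); [exact: h|exact: h|]; rewrite -op_nmB//.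
have [M _ /(_ _ (HB ax Hu Hv))] := hbounded_le bT; rewrite E// mulr0 => n0.
by apply/eqP; rewrite eq_le n0 nm_ge0.
Qed.

Lemma op_ip_eqv T u v w : hbounded T -> H u -> H v -> H w -> eqv u v ->
  ip w (T u) = ip w (T v).
Proof.
by move=> bT Hu Hv Hw uv; apply: (ip_eqr ax) => //; try exact: hbounded_H; exact: op_eqv.
Qed.

Lemma hbounded_build T (M : R) : (forall u, H u -> H (T u)) ->
  (forall a u v w, H u -> H v -> H w ->
     ip w (T (a *: u + v)) = a * ip w (T u) + ip w (T v)) ->
  le_op T M -> hbounded T.
Proof.
move=> TH TZD TM; split => //; last by exists M.
move=> a u v Hu Hv; apply/(eqv_ip ax).
- by apply/TH/HZD.
- by apply: HZD; exact: TH.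
- by move=> w Hw; rewrite TZD// (hilb_ipZDr ax)//; exact: TH.
Qed.

Lemma adjP T u : hbounded T -> H u ->
  H (hadjoint T u) /\ forall w, H w -> ip (hadjoint T u) w = ip u (T w).
Proof.
move=> bT Hu; rewrite /hadjoint; case: xgetP => [v -> []//|/(_ _)] nex; exfalso.
have [M M0 TM] := hbounded_le bT.
have [||v Hv vP] := @riesz _ _ _ _ _ _ ax (fun w => ip u (T w)) (nm u * M).
- by move=> a x y Hx Hy; rewrite op_ZD.
- move=> w Hw; apply: le_trans (ip_CS ax Hu (hbounded_H bT Hw)) _.
  by rewrite -mulrA; apply: ler_wpM2l => //; exact: TM.
by apply: (nex v).
Qed.

Lemma adjH T u : hbounded T -> H u -> H (hadjoint T u).
Proof. by move=> bT /(adjP bT)[]. Qed.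

Lemma adjl T u w : hbounded T -> H u -> H w -> ip (hadjoint T u) w = ip u (T w).
Proof. by move=> bT /(adjP bT)[_]; exact. Qed.

Lemma adjr T u w : hbounded T -> H u -> H w -> ip w (hadjoint T u) = ip (T w) u.
Proof.
move=> bT Hu Hw; rewrite (ip_conj (adjH bT Hu) Hw) adjl//.
by rewrite -(ip_conj Hu (hbounded_H bT Hw)).
Qed.

Lemma le_op_adj T M : hbounded T -> 0 <= M -> le_op T M -> le_op (hadjoint T) M.
Proof.
move=> bT M0 TM u Hu; have Ha := adjH bT Hu.
have [->|n0] := eqVneq (nm (hadjoint T u)) 0; first by rewrite mulr_ge0.
have np : 0 < nm (hadjoint T u) by rewrite lt_neqAle eq_sym n0 nm_ge0.
rewrite -(ler_pM2r np) -expr2.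
have := hilb_ip_self ax Ha; rewrite adjl// => /(congr1 Re)/= <-.
apply: le_trans (ler_norm _) _.
apply: le_trans (Re_ip_CS ax Hu (hbounded_H bT Ha)) _.
by rewrite [M * _]mulrC -mulrA ler_wpM2l// TM.
Qed.

Lemma hbounded_adj T : hbounded T -> hbounded (hadjoint T).
Proof.
move=> bT; have [M M0 TM] := hbounded_le bT.
apply: (@hbounded_build _ M); last exact: le_op_adj.
- by move=> u; exact: adjH.
move=> a u v w Hu Hv Hw; rewrite !adjr//; last exact: HZD.
by rewrite (hilb_ipZDr ax)//; exact: hbounded_H.
Qed.

Lemma hbounded_id : hbounded id.
Proof.
apply: (@hbounded_build _ 1) => //; last by move=> u _; rewrite mul1r.
by move=> a u v w Hu Hv Hw; exact: (hilb_ipZDr ax).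
Qed.

Lemma le_op_comp S T M N : hbounded S -> hbounded T -> 0 <= M ->
  le_op S M -> le_op T N -> le_op (S \o T) (M * N).
Proof.
move=> bS bT M0 SM TN u Hu /=; apply: le_trans (SM _ (hbounded_H bT Hu)) _.
by rewrite -mulrA ler_wpM2l// TN.
Qed.

Lemma hbounded_comp S T : hbounded S -> hbounded T -> hbounded (S \o T).
Proof.
move=> bS bT; have [M M0 SM] := hbounded_le bS; have [N N0 TN] := hbounded_le bT.
have h u := @hbounded_H T u bT; have h' u := @hbounded_H S u bS.
apply: (@hbounded_build _ (M * N)); last exact: le_op_comp.
  by move=> u Hu; apply/h'/h.
move=> a u v w Hu Hv Hw /=; have [_ /(_ a u v Hu Hv) E _] := bT.
rewrite (op_ip_eqv bS _ _ _ E) ?op_ZD//; try (exact: h);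
  [by apply/h/HZD|by apply: HZD; exact: h].
Qed.

Lemma hbounded_ZD a S T : hbounded S -> hbounded T ->
  hbounded (fun u => a *: S u + T u).
Proof.
move=> bS bT; have [M M0 SM] := hbounded_le bS; have [N N0 TN] := hbounded_le bT.
have h u := @hbounded_H T u bT; have h' u := @hbounded_H S u bS.
apply: (@hbounded_build _ (Normc.normc a * M + N)).
- by move=> u Hu; apply: HZD; [exact: h'|exact: h].
- move=> c u v w Hu Hv Hw; have Hcuv : H (c *: u + v) by exact: HZD.
  rewrite !(hilb_ipZDr ax) ?op_ZD//; try (exact: h); try (exact: h').
  by ring.
- move=> u Hu; apply: le_trans (nmD ax (HZ ax a (h' _ Hu)) (h _ Hu)) _.
  rewrite mulrDl lerD ?TN// (nmZ ax)//; last exact: h'.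
  by rewrite -mulrA ler_wpM2l ?normc_ge0// SM.
Qed.

Lemma hbounded_iter T k : hbounded T -> hbounded (iter k T).
Proof. by move=> bT; elim: k => [|k IH]; [exact: hbounded_id|exact: hbounded_comp]. Qed.

Lemma le_op_iter T M k : hbounded T -> 0 <= M -> le_op T M -> le_op (iter k T) (M ^+ k).
Proof.
move=> bT M0 TM; elim: k => [|k IH] u Hu; first by rewrite expr0 mul1r.
have Hk := hbounded_H (hbounded_iter k bT) Hu.
rewrite iterS exprS -mulrA; apply: le_trans (TM _ Hk) _.
by rewrite ler_wpM2l// IH.
Qed.

Definition weak_approx (M : set (V -> V)) T := forall n (u v : 'I_n -> V) (e : R),
  (forall i, H (u i)) -> (forall i, H (v i)) -> 0 < e ->
  exists2 S, M S & forall i, Normc.normc (ip (u i) (T (v i) - S (v i))) < e.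

Lemma weak_approx_eq (M : set (V -> V)) T (x y z t : V) :
  (forall S, M S -> hbounded S) -> hbounded T -> weak_approx M T ->
  H x -> H y -> H z -> H t ->
  (forall S, M S -> ip x (S y) = ip z (S t)) -> ip x (T y) = ip z (T t).
Proof.
move=> Mb bT MT Hx Hy Hz Ht E; apply/eqP; rewrite -subr_eq0; apply/eqP.
apply: Normc.eq0_normc; apply/eqP; rewrite eq_le normc_ge0 andbT.
apply: (@le0_of_small _ _ 2) => // e e0.
pose f (a b : V) (i : 'I_2) := if i == ord0 then a else b.
have [i|i|S MS SP] := MT 2%N (f x z) (f y t) e _ _ e0; try by rewrite /f; case: ifP.
have := SP ord0; have := SP (lift ord0 ord0); rewrite /f/=.
have hS u := @hbounded_H S u (Mb S MS); have hT u := @hbounded_H T u bT.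
rewrite !(ipBr ax)//; try (by apply: hS); try (by apply: hT).
move=> h1 h2.
have -> : ip x (T y) - ip z (T t) = (ip x (T y) - ip x (S y)) - (ip z (T t) - ip z (S t)).
  by rewrite (E S MS) opprB addrA subrK.
apply: le_trans (normcD_le _ _) _.
rewrite (_ : Normc.normc (- (ip z (T t) - ip z (S t))) = Normc.normc (ip z (T t) - ip z (S t))).
  by apply: ltW; lra.
by case: (_ - _) => a b /=; rewrite !sqrrN.
Qed.

Record hvna (M : set (V -> V)) : Prop := {
  hvna_bounded : forall T, M T -> hbounded T;
  hvna_id : M id;
  hvna_lin : forall a S T, M S -> M T -> M (fun u => a *: S u + T u);
  hvna_comp : forall S T, M S -> M T -> M (S \o T);
  hvna_adjoint : forall T, M T -> M (hadjoint T);
  hvna_closed : forall T, hbounded T -> weak_approx M T -> M T }.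

Section commutant.
Variables (Z : Type) (Rz : Z -> V -> V) (star : Z -> Z) (Om : V).
Hypothesis HOm : H Om.
Hypothesis bR : forall z, hbounded (Rz z).
Hypothesis Rstar : forall z u v, H u -> H v -> ip (Rz z u) v = ip u (Rz (star z) v).
Hypothesis starK : involutive star.

Definition commutant : set (V -> V) := [set T | hbounded T /\
  forall z u v, H u -> H v -> ip u (T (Rz z v)) = ip u (Rz z (T v))].

(* Being a von Neumann algebra, it contains the one generated by any of its
   subsets; this is how the trace property reaches all of [clifford]. *)
Definition tracial : set (V -> V) := [set S | commutant S /\
  forall T, commutant T -> ip Om (S (T Om)) = ip Om (T (S Om))].

Lemma commutant_vna : hvna commutant.
Proof.
have RH z u : H u -> H (Rz z u) by exact: hbounded_H.
split.
- by move=> T [].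
- by split=> //; exact: hbounded_id.
- move=> a S T [bS cS] [bT cT]; split; first exact: hbounded_ZD.
  move=> z u v Hu Hv; have hS x := @hbounded_H S x bS; have hT x := @hbounded_H T x bT.
  rewrite op_ZD//; [|exact: hS|exact: hT].
  by rewrite (hilb_ipZDr ax) ?cS ?cT//; [apply/hS/RH|apply/hT/RH].
- move=> S T [bS cS] [bT cT]; split; first exact: hbounded_comp.
  move=> z u v Hu Hv /=; have hS x := @hbounded_H S x bS; have hT x := @hbounded_H T x bT.
  rewrite (@op_ip_eqv S _ (Rz z (T v)))//.
  + by rewrite cS//; exact: hT.
  + by apply/hT/RH.
  + by apply/RH/hT.
  + apply/(eqv_ip ax); [by apply/hT/RH|by apply/RH/hT|].
    by move=> w Hw; exact: cT.
- move=> T [bT cT]; split; first exact: hbounded_adj.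
  move=> z u v Hu Hv; have hT x := @hbounded_H T x bT.
  rewrite adjr//; last exact: RH.
  have -> : ip (T u) (Rz z v) = ip (Rz (star z) (T u)) v.
    by rewrite Rstar ?starK//; exact: hT.
  have HTR := hT _ (RH (star z) _ Hu).
  rewrite (ip_conj Hv (RH (star z) _ (hT _ Hu))) -cT// -(ip_conj Hv HTR).
  rewrite -adjr//; last exact: RH.
  by rewrite Rstar ?starK//; exact: adjH.
- move=> T bT aT; split => // z u v Hu Hv.
  have hT x := @hbounded_H T x bT.
  have -> : ip u (Rz z (T v)) = ip (Rz (star z) u) (T v).
    by rewrite Rstar ?starK//; exact: hT.
  apply: (weak_approx_eq _ bT aT) => //; try exact: RH.
    by move=> S [].
  move=> S [bS cS]; rewrite cS// Rstar ?starK//.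
  exact: hbounded_H.
Qed.

Lemma tracial_vna : hvna tracial.
Proof.
have [Cb Cid Clin Ccomp Cadj Cclosed] := commutant_vna.
have HT T u : commutant T -> H u -> H (T u) by move=> [bT _]; exact: hbounded_H.
split.
- by move=> T [[]].
- by split=> //.
- move=> a S S' [cS tS] [cS' tS']; split; first exact: Clin.
  move=> T cT; have h1 := HT _ _ cS (HT _ _ cT HOm); have h2 := HT _ _ cS' (HT _ _ cT HOm).
  rewrite (hilb_ipZDr ax)//.
  by rewrite tS// tS'// op_ZD//; [case: cT|exact: HT|exact: HT].
- move=> S S' [cS tS] [cS' tS']; split; first exact: Ccomp.
  move=> T cT /=; rewrite (tS (S' \o T))/=; last exact: Ccomp.
  have := tS' (T \o S) (Ccomp _ _ cT cS).
  by move=> /= ->.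
- move=> S [cS tS]; split; first exact: Cadj.
  move=> T cT; have bS := Cb _ cS; have bT := Cb _ cT.
  have HTO := HT _ _ cT HOm; have HSO := HT _ _ cS HOm.
  rewrite adjr//.
  have cTa := Cadj _ cT.
  have := tS _ cTa; rewrite adjr// => E.
  have -> : ip (S Om) (T Om) = conjc (ip (T Om) (S Om)).
    by rewrite -(ip_conj HTO HSO).
  have HTa := HT _ _ cTa HOm; have HSTa := HT _ _ cS HTa.
  by rewrite -E -(ip_conj HOm HSTa) -adjr// adjl//; exact: adjH.
- move=> S bS aS.
  have cS : commutant S.
    apply: Cclosed => // n u v e Hu Hv e0.
    by have [S' [cS' _] S'P] := aS n u v e Hu Hv e0; exists S'.
  split => // T cT; have bT := Cb _ cT.
  rewrite -(adjl bT HOm (hbounded_H bS HOm)).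
  apply: (weak_approx_eq _ bS aS) => //; try exact: HT; try exact: adjH.
    by move=> ? [[]].
  move=> S' [cS' tS']; rewrite tS'// adjl//; exact: HT.
Qed.

End commutant.
End semi_hilbert_operators.

Section tracial_bounds.
Variables (R : realType) (V : lmodType R[i]) (H : V -> Prop).
Variables (ip : V -> V -> R[i]) (nm : V -> R) (eqv : V -> V -> Prop).
Local Notation Re := (@complex.Re R).
Implicit Types (u v w : V) (a c : R[i]) (S T : V -> V).
Hypothesis ax : hilbert_axioms H ip nm eqv.
Variables (Z : Type) (Rz : Z -> V -> V) (star : Z -> Z) (Om : V).
Hypothesis HOm : H Om.
Hypothesis bR : forall z, hbounded H nm eqv (Rz z).
Hypothesis Rstar : forall z u v, H u -> H v -> ip (Rz z u) v = ip u (Rz (star z) v).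
Hypothesis starK : involutive star.
Local Notation comm := (commutant H ip nm eqv Rz).
Local Notation trac := (tracial H ip nm eqv Rz Om).
Local Notation adj := (hadjoint H ip).
Let vC := commutant_vna ax bR Rstar starK.
Let vT := tracial_vna ax HOm bR Rstar starK.
Let ip_conj := hilb_ip_conj ax.

Lemma tracial_adj_norm S : trac S -> nm (adj S Om) = nm (S Om).
Proof.
move=> tS; have bS := hvna_bounded vT tS.
have HSO := hbounded_H bS HOm; have HaO := adjH ax bS HOm.
apply/eqP; rewrite -(@eqrXn2 _ 2) ?(hilb_nm_ge0 ax)//; apply/eqP/complexI.
rewrite -!(hilb_ip_self ax)// (adjl ax)// tS.2.
  by rewrite (adjr ax).
exact: (hvna_adjoint vT tS).1.
Qed.

(* By traciality, right multiplication by [T] is as bounded as [T]. *)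
Lemma tracial_right_bound S T M : trac S -> trac T -> 0 <= M -> le_op H nm T M ->
  nm (S (T Om)) <= M * nm (S Om).
Proof.
move=> tS tT M0 TM.
have tSa := hvna_adjoint vT tS; have tTa := hvna_adjoint vT tT.
have bS := hvna_bounded vT tS; have bT := hvna_bounded vT tT.
have bSa := hvna_bounded vT tSa; have bTa := hvna_bounded vT tTa.
have hS u := @hbounded_H _ _ _ _ _ S u bS; have hT u := @hbounded_H _ _ _ _ _ T u bT.
have hSa u := @hbounded_H _ _ _ _ _ _ u bSa; have hTa u := @hbounded_H _ _ _ _ _ _ u bTa.
suff : nm (S (T Om)) ^+ 2 = nm (adj T (adj S Om)) ^+ 2.
  move=> /eqP; rewrite eqrXn2 ?(hilb_nm_ge0 ax)// => /eqP ->.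
  rewrite -(tracial_adj_norm tS); apply: (le_op_adj ax bT) => //; exact: hSa.
apply: complexI; rewrite -!(hilb_ip_self ax); [|exact/hTa/hSa|exact/hS/hT].
rewrite -(adjr ax) ?(adjl ax)//; try (exact: hT); try (exact: hSa); try (exact/hS/hT);
  try exact/hTa/hSa.
rewrite -(adjr ax)//; last by apply/hSa/hS/hT.
have cX : comm (adj S \o S \o T).
  by apply: (hvna_comp vC); [apply: (hvna_comp vC)|]; [exact: tSa.1|exact: tS.1|exact: tT.1].
have := tTa.2 _ cX => /= ->.
have cY : comm (S \o T \o adj T).
  by apply: (hvna_comp vC); [apply: (hvna_comp vC)|]; [exact: tS.1|exact: tT.1|exact: tTa.1].
have := tSa.2 _ cY => /= -> //.
exact/hT/hTa/hSa.
Qed.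

Section sign_conjugation.
Variable G : V -> V.
Hypothesis bG : hbounded H nm eqv G.
Hypothesis GG : forall u, H u -> eqv (G (G u)) u.
Hypothesis Gsa : forall u v, H u -> H v -> ip (G u) v = ip u (G v).
Hypothesis GOm : eqv (G Om) Om.
Hypothesis GR : forall z, exists z', forall u, H u -> eqv (G (Rz z u)) (Rz z' (G u)).
Let hG u := @hbounded_H _ _ _ _ _ G u bG.

Lemma sign_norm u : H u -> nm (G u) = nm u.
Proof.
move=> Hu; apply/eqP; rewrite -(@eqrXn2 _ 2) ?(hilb_nm_ge0 ax)//; apply/eqP/complexI.
rewrite -!(hilb_ip_self ax) ?Gsa//; try exact: hG.
by apply: (ip_eqr ax) => //; [exact/hG/hG|exact: GG].
Qed.

Lemma commutant_conj T : comm T -> comm (G \o T \o G).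
Proof.
move=> [bT cT]; split; first by do 2 apply: (hbounded_comp ax) => //.
move=> z u v Hu Hv /=; have hT x := @hbounded_H _ _ _ _ _ T x bT.
have hR z x := @hbounded_H _ _ _ _ _ (Rz z) x (bR z).
have [z' zz'] := GR z.
rewrite -Gsa//; last by apply/hT/hG/hR.
rewrite (op_ip_eqv ax bT _ _ _ (zz' v Hv)); [|exact/hG/hR|exact/hR/hG|exact: hG].
rewrite cT//; [|exact: hG|exact: hG].
have HTG := hT _ (hG Hv).
rewrite Gsa//; last exact: hR.
apply: (ip_eqr ax) => //; [exact/hG/hR|exact/hR/hG|].
have E1 : eqv (G (Rz z (G (T (G v))))) (Rz z' (T (G v))).
  apply: (eqv_trans ax _ _ _ (zz' _ (hG HTG))); [exact/hG/hR/hG|exact/hR/hG/hG|exact: hR|].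
  by apply: (op_eqv ax (bR z')) => //; [exact/hG/hG|exact: GG].
have E2 := op_eqv ax bG (hG (hR z _ (hG HTG))) (hR z' _ HTG) E1.
apply: (eqv_trans ax _ _ _ (eqv_sym ax _ _ E2)); try (exact/hG/hR); try (exact/hR/hG);
  try exact/hG/hG/hR/hG.
exact/GG/hR/hG.
Qed.

Lemma tracial_conj T : trac T -> trac (G \o T \o G).
Proof.
move=> [cT tT]; split; first exact: commutant_conj.
move=> X cX /=; have bT := hvna_bounded vC cT; have bX := hvna_bounded vC cX.
have hT x := @hbounded_H _ _ _ _ _ T x bT; have hX x := @hbounded_H _ _ _ _ _ X x bX.
have HGO := hG HOm.
have OmG : eqv Om (G Om) by exact: (eqv_sym ax).
have tr1 x : H x -> ip Om (G x) = ip Om x.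
  by move=> Hx; rewrite -Gsa//; exact: (ip_eql ax).
rewrite tr1; last exact/hT/hG/hX.
have -> : ip Om (T (G (X Om))) = ip Om (T ((G \o X \o G) Om)).
  apply: (op_ip_eqv ax bT) => //=; [exact/hG/hX|exact/hG/hX/hG|].
  by apply: (op_eqv ax bG); [exact: hX|exact/hX/hG|exact: (op_eqv ax bX)].
rewrite tT; last exact: commutant_conj.
rewrite /= tr1; last exact/hX/hG/hT.
apply: (op_ip_eqv ax bX) => //; [exact/hG/hT|exact/hG/hT/hG|].
by apply: (op_eqv ax bG); [exact: hT|exact/hT/hG|exact: (op_eqv ax bT)].
Qed.

Lemma le_op_conj T M : hbounded H nm eqv T -> le_op H nm T M ->
  le_op H nm (G \o T \o G) M.
Proof.
move=> bT TM u Hu /=; rewrite sign_norm; last exact: (hbounded_H bT (hG Hu)).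
by rewrite -[in leRHS](sign_norm Hu); apply/TM/hG.
Qed.

(* The Dirichlet form of [G] does not increase under powers: [F^n Om - G F^n Om]
   telescopes, and traciality bounds each term. *)
Lemma sign_difference_iter F M n : trac F -> 0 <= M -> le_op H nm F M ->
  nm (iter n.+1 F Om - G (iter n.+1 F Om)) <= n.+1%:R * M ^+ n * nm (F Om - G (F Om)).
Proof.
move=> tF M0 FM.
have bF := hvna_bounded vT tF.
have hF x := @hbounded_H _ _ _ _ _ F x bF.
have HB := HB ax.
have hit k : H (iter k F Om) by exact: (hbounded_H (hbounded_iter ax k bF)).
pose F' := G \o F \o G.
have tF' : trac F' by exact: tracial_conj.
have bF' := hvna_bounded vT tF'.
have F'M : le_op H nm F' M by exact: le_op_conj.
have itF' k : trac (iter k F').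
  by elim: k => [|k IH]; [exact: (hvna_id vT)|exact: (hvna_comp vT)].
have bit' k := hvna_bounded vT (itF' k).
have hit' k x := @hbounded_H _ _ _ _ _ _ x (bit' k).
have Git k : eqv (G (iter k F Om)) (iter k F' Om).
  elim: k => [|k IH] /=; first exact: GOm.
  have e1 : eqv (G (F (iter k F Om))) (F' (G (iter k F Om))).
    rewrite /F' /=; apply: (op_eqv ax bG); [exact: hF|exact/hF/hG/hG|].
    by apply: (op_eqv ax bF) => //; [exact/hG/hG|apply: (eqv_sym ax); [exact/hG/hG| |exact: GG]].
  apply: (eqv_trans ax _ _ _ e1); [exact/hG/hF|exact/(hbounded_H bF')/hG|exact/(hbounded_H bF')/hit'|].
  by apply: (op_eqv ax bF') => //; [exact: hG|exact: hit'].
elim: n => [|n IH]; first by rewrite expr0 !mul1r.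
pose x := iter n.+1 F Om.
have E : nm (F x - G (F x)) <= nm (F (x - G x)) + nm ((F \o id) (iter n.+1 F' Om) - F' (iter n.+1 F' Om)).
  have Hx : H x by exact: hit.
  have e1 : eqv (G (F x)) (F' (iter n.+1 F' Om)).
    exact: (Git n.+2).
  have HF'i := hbounded_H bF' (hit' n.+1 _ HOm).
  have HGx := hG Hx.
  have -> : nm (F x - G (F x)) = nm (F (x - G x) + (F (iter n.+1 F' Om) - F' (iter n.+1 F' Om))).
    apply: (nm_eqv ax); [by apply: HB; [exact: hF|exact/hG/hF]| |].
      by apply: (HD ax); [exact/hF/HB|apply: HB => //; exact/hF/hit'].
    apply/(eqv_ip ax); [by apply: HB; [exact: hF|exact/hG/hF]| |].
      by apply: (HD ax); [exact/hF/HB|apply: HB => //; exact/hF/hit'].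
    move=> w Hw; rewrite [RHS](ipDr ax)//; last 2 first.
    - exact/hF/HB.
    - by apply: HB => //; exact/hF/hit'.
    rewrite (op_B ax)// !(ipBr ax)//; try (exact: hF); try (exact/hG/hF); try (exact/hF/hit').
    rewrite (ip_eqr ax _ _ Hw e1)//; last exact/hG/hF.
    rewrite (op_ip_eqv ax bF _ _ Hw (Git n.+1))//; last exact: hit'.
    by rewrite addrA subrK.
  by apply: (nmD ax); [exact/hF/HB|apply: HB => //; exact/hF/hit'].
rewrite iterS -/x; apply: le_trans E _.
have tD : trac (fun u => (-1) *: F' u + F u) by exact: (hvna_lin vT).
have := tracial_right_bound tD (itF' n.+1) (exprn_ge0 n.+1 M0)
  (le_op_iter ax n.+1 bF' M0 F'M).
rewrite !scaleN1r ![- _ + _]addrC => E2.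
have E3 : nm (F Om - F' Om) = nm (F Om - G (F Om)).
  apply: (nm_eqv ax); [by apply: HB; [exact: hF|exact/hG/hF/hG]|by apply: HB; [exact: hF|exact/hG/hF]|].
  have e : eqv (F' Om) (G (F Om)).
    by apply: (op_eqv ax bG); [exact/hF/hG|exact: hF|apply: (op_eqv ax bF) => //; exact: hG].
  apply/(eqv_ip ax); [by apply: HB; [exact: hF|exact/hG/hF/hG]|by apply: HB; [exact: hF|exact/hG/hF]|].
  move=> w Hw; rewrite !(ipBr ax)//; try (exact: hF); try (exact/hG/hF); try exact/hG/hF/hG.
  by rewrite (ip_eqr ax _ _ Hw e)//; [exact/hG/hF/hG|exact/hG/hF].
rewrite E3 in E2.
have HxG : H (x - G x) by apply: HB; [exact: hit|exact/hG/hit].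
apply: le_trans (lerD (FM _ HxG) E2) _.
have := ler_wpM2l M0 IH; rewrite -/x exprS -[n.+2%:R]natr1.
move: (n.+1%:R : R) (M ^+ n) (nm (x - G x)) (nm (F Om - _)) => a b c d h; lra.
Qed.

End sign_conjugation.
End tracial_bounds.

(** * Exponentials and spectral projections *)

Section scalar_exponential.
Variable R : realType.
Implicit Types (x y : R).

Lemma expR_partial_le x n : 0 <= x -> series (exp_coeff x) n <= expR x.
Proof.
move=> x0; apply: (nondecreasing_cvgn_le _ (is_cvg_series_exp_coeff x)).
apply/nondecreasing_seqP => k; rewrite /series/= big_nat_recr//= lerDl.
exact: exp_coeff_ge0.
Qed.

Lemma expR_partial_gap x n m : 0 <= x -> (n <= m)%N ->
  \sum_(n <= k < m) exp_coeff x k <= expR x - series (exp_coeff x) n.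
Proof.
move=> x0 nm; rewrite lerBrDr addrC.
by apply: le_trans (expR_partial_le m x0); rewrite /series/= [leRHS](big_cat_nat _ nm).
Qed.

Lemma cvg_expR_gap x : (fun n => expR x - series (exp_coeff x) n) @ \oo --> (0 : R).
Proof.
rewrite -(subrr (expR x)); apply: cvgB; first exact: cvg_cst.
exact: is_cvg_series_exp_coeff.
Qed.

Lemma exp_triangle (K : numFieldType) (c : nat -> K) (x y : K) n :
  \sum_(l < n) ((x + y) ^+ l / l`!%:R) * c l =
  \sum_(j < n) \sum_(k < n | (j + k < n)%N)
    ((x ^+ j / j`!%:R) * (y ^+ k / k`!%:R)) * c (j + k)%N.
Proof.
pose f j l := ((x ^+ j / j`!%:R) * (y ^+ (l - j) / (l - j)`!%:R)) * c l.
transitivity (\sum_(0 <= l < n) \sum_(0 <= j < n | (j <= l)%N) f j l).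
  rewrite big_mkord; apply: eq_bigr => l _.
  rewrite -mulr_suml; congr (_ * _); rewrite addrC exprDn mulr_suml.
  rewrite (big_ord_widen_cond n xpredT
    (fun j => (y ^+ (l - j) * x ^+ j *+ 'C(l, j)) / l`!%:R))//.
  rewrite [RHS]big_mkord; apply: eq_bigr => j; rewrite ltnS => /= jl.
  rewrite -[in LHS](bin_fact jl) !natrM -mulr_natr.
  field.
  by rewrite !pnatr_eq0 -!lt0n !fact_gt0 bin_gt0 jl.
rewrite (exchange_big_dep_nat xpredT)//= big_mkord; apply: eq_bigr => j _.
have -> : \sum_(0 <= l < n | (j <= l)%N) f j l = \sum_(j <= l < n) f j l.
  by rewrite [RHS](big_nat_widenl j 0)//; apply: eq_bigl => l; rewrite andbT.
rewrite -{1}[j : nat]add0n big_addn big_mkord.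
rewrite (big_ord_widen_cond n xpredT (fun k => f j (k + j)%N)) ?leq_subr//.
apply: eq_big => [k|k _]; first by rewrite /= ltn_subRL.
by rewrite /f addnK [(k + j)%N]addnC.
Qed.
End scalar_exponential.

Section operator_exponential.
Variables (R : realType) (V : lmodType R[i]) (H : V -> Prop).
Variables (ip : V -> V -> R[i]) (nm : V -> R) (eqv : V -> V -> Prop).
Local Notation Re := (@complex.Re R).
Implicit Types (u v w : V) (a c : R[i]) (S T F : V -> V).
Hypothesis ax : hilbert_axioms H ip nm eqv.
Local Notation hbd := (hbounded H nm eqv).
Local Notation leo := (le_op H nm).
Let HB := HB ax.
Let HZ := HZ ax.
Let nm_ge0 := hilb_nm_ge0 ax.

Definition expsum T n u : V := \sum_(k < n) (k`!%:R^-1 : R[i]) *: iter k T u.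

Definition exp_of T u v := H v /\ (fun n => nm (v - expsum T n u)) @ \oo --> (0 : R).

Definition exp_gap (M : R) n := expR M - series (exp_coeff M) n.

Lemma nm_sum_seq (I : Type) (r : seq I) (G : I -> V) : (forall i, H (G i)) ->
  nm (\sum_(i <- r) G i) <= \sum_(i <- r) nm (G i).
Proof.
move=> HG; elim: r => [|i r IH]; first by rewrite !big_nil (nm0 ax).
rewrite !big_cons; apply: le_trans (nmD ax _ _) _ => //; last by rewrite lerD2l.
by elim/big_ind: _ => //; [exact: (hilb0 ax)|exact: (HD ax)].
Qed.

Lemma expsum_H T n u : hbd T -> H u -> H (expsum T n u).
Proof.
move=> bT Hu; apply: (Hsum ax) => k; apply: HZ.
exact: (hbounded_H (hbounded_iter ax k bT)).
Qed.

Lemma normc_factV k : Normc.normc (k`!%:R^-1 : R[i]) = k`!%:R^-1.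
Proof.
rewrite -(rmorph_nat (real_complex R)) -fmorphV.
by rewrite /= expr0n addr0 sqrtr_sqr ger0_norm// invr_ge0.
Qed.

Lemma nm_exp_term T M k u : hbd T -> 0 <= M -> leo T M -> H u ->
  nm ((k`!%:R^-1 : R[i]) *: iter k T u) <= exp_coeff M k * nm u.
Proof.
move=> bT M0 TM Hu; rewrite (nmZ ax) ?normc_factV; last first.
  exact: (hbounded_H (hbounded_iter ax k bT)).
rewrite /exp_coeff/= [M ^+ k * _]mulrC -mulrA ler_wpM2l ?invr_ge0//.
exact: (le_op_iter ax k bT M0 TM).
Qed.

Lemma expsum_gap T M n m u : hbd T -> 0 <= M -> leo T M -> H u -> (n <= m)%N ->
  nm (expsum T m u - expsum T n u) <= exp_gap M n * nm u.
Proof.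
move=> bT M0 TM Hu nm'.
have -> : expsum T m u - expsum T n u =
    \sum_(n <= k < m) (k`!%:R^-1 : R[i]) *: iter k T u.
  rewrite /expsum -!(big_mkord xpredT (fun k => (k`!%:R^-1 : R[i]) *: iter k T u)).
  by rewrite (big_cat_nat _ nm')//= [LHS]addrC addKr.
apply: le_trans (nm_sum_seq _ _) _.
  by move=> k; apply: HZ; exact: (hbounded_H (hbounded_iter ax k bT)).
apply: (@le_trans _ _ (\sum_(n <= k < m) exp_coeff M k * nm u)).
  by apply: ler_sum => k _; exact: nm_exp_term.
by rewrite -mulr_suml ler_wpM2r// expR_partial_gap.
Qed.

Lemma exp_gap_ge0 M n : 0 <= M -> 0 <= exp_gap M n.
Proof. by move=> M0; rewrite subr_ge0 expR_partial_le. Qed.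

Lemma cvg_exp_gap_mul M (K : R) : (fun n => exp_gap M n * K) @ \oo --> (0 : R).
Proof. by rewrite -(mul0r K); apply: cvgM; [exact: cvg_expR_gap|exact: cvg_cst]. Qed.

Lemma cvg0_eventually_lt (x : nat -> R) (e : R) : x @ \oo --> (0 : R) -> 0 < e ->
  exists N, forall n, (N <= n)%N -> x n < e.
Proof. by move=> x0 e0; have [N _ NP] := cvgr_lt _ x0 _ e0; exists N. Qed.

Lemma exp_exists T u : hbd T -> H u -> exists v, exp_of T u v.
Proof.
move=> bT Hu; have [M M0 TM] := hbounded_le ax bT.
have HE n := expsum_H n bT Hu.
have [//|e e0|v Hv vP] := @hilb_complete _ _ _ _ _ _ ax (fun n => expsum T n u).
  have se0 : 0 < Num.sqrt e by rewrite sqrtr_gt0.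
  have [N NP] := cvg0_eventually_lt (@cvg_exp_gap_mul M (nm u)) se0.
  exists N => m n Nm Nn.
  wlog mn : m n Nm Nn / (n <= m)%N.
    move=> W; have [|/ltnW] := leqP n m; first exact: W.
    by move=> mn; rewrite (nmBC ax)//; exact: W.
  rewrite -[e]sqr_sqrtr ?(ltW e0)// ltr_pXn2r// ?nnegrE//.
  by apply: le_lt_trans (expsum_gap bT M0 TM Hu mn) _; exact: NP.
exists v; split => //; apply/cvgrPdist_lt => e e0.
have [N NP] := vP (e ^+ 2) (exprn_gt0 2 e0).
exists N => // n Nn; rewrite sub0r normrN ger0_norm//.
by have := NP n Nn; rewrite ltr_pXn2r// ?nnegrE// ltW.
Qed.

Lemma exp_ofE_gap T M u v n : hbd T -> 0 <= M -> leo T M -> H u -> exp_of T u v ->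
  nm (v - expsum T n u) <= exp_gap M n * nm u.
Proof.
move=> bT M0 TM Hu [Hv vc]; rewrite -subr_le0; apply: (@le0_of_small _ _ 1) => // e e0.
have [N NP] := cvg0_eventually_lt vc e0.
pose m := (N + n)%N.
have HE k := expsum_H k bT Hu.
have := NP m (leq_addr _ _); have := expsum_gap bT M0 TM Hu (leq_addl N n).
have : nm (v - expsum T n u) <= nm (v - expsum T m u) + nm (expsum T m u - expsum T n u).
  by rewrite -{1}(subrKA (expsum T m u)); apply: (nmD ax); exact: HB.
rewrite -/m; lra.
Qed.

Lemma normc_le_cvg0 (z : R[i]) (x : nat -> R) :
  (forall n, Normc.normc z <= x n) -> x @ \oo --> (0 : R) -> z = 0.
Proof.
move=> zx x0; apply: Normc.eq0_normc; apply/eqP; rewrite eq_le normc_ge0 andbT.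
apply: (@le0_of_small _ _ 1) => // e e0; rewrite mulr1.
by have [N NP] := cvg0_eventually_lt x0 e0; apply: le_trans (zx N) (ltW (NP N _)).
Qed.

Lemma ip_expsum_linear T n a u v w : hbd T -> H u -> H v -> H w ->
  ip w (expsum T n (a *: u + v)) = a * ip w (expsum T n u) + ip w (expsum T n v).
Proof.
move=> bT Hu Hv Hw; have Huv : H (a *: u + v) by exact: (hilbZD ax).
have bi k := hbounded_iter ax k bT.
have h k x : H x -> H (iter k T x) by move=> Hx; exact: (hbounded_H (bi k)).
rewrite /expsum !(ip_sumr ax)//; try by move=> i; apply: HZ; exact: h.
rewrite mulr_sumr -big_split; apply: eq_bigr => k _ /=.
rewrite !(ipZr ax)//; try exact: h.
by rewrite (op_ZD ax) //; ring.
Qed.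

Section one_exponential.
Variables (T ex : V -> V) (M : R).
Hypothesis bT : hbd T.
Hypothesis M0 : 0 <= M.
Hypothesis TM : leo T M.
Hypothesis exP : forall u, H u -> exp_of T u (ex u).

Let Hex u : H u -> H (ex u). Proof. by move=> /exP[]. Qed.

Lemma exp_le_op : leo ex (expR M).
Proof.
move=> u Hu; have := exp_ofE_gap 0 bT M0 TM Hu (exP Hu).
by rewrite /expsum big_ord0 subr0 /exp_gap /series/= big_nil subr0.
Qed.

Lemma exp_ip_diff n u w : H u -> H w ->
  Normc.normc (ip w (ex u) - ip w (expsum T n u)) <= exp_gap M n * (nm w * nm u).
Proof.
move=> Hu Hw; have HE := expsum_H n bT Hu; rewrite -(ipBr ax)//; last exact: Hex.
apply: le_trans (ip_CS ax Hw (HB (Hex Hu) HE)) _.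
by rewrite mulrCA ler_wpM2l// exp_ofE_gap//; exact: exP.
Qed.

Lemma exp_bounded : hbd ex.
Proof.
apply: (hbounded_build ax Hex _ exp_le_op) => a u v w Hu Hv Hw.
have Huv : H (a *: u + v) by exact: (hilbZD ax).
apply/eqP; rewrite -subr_eq0; apply/eqP.
pose K := nm w * nm (a *: u + v) + (Normc.normc a * (nm w * nm u) + nm w * nm v).
apply: (@normc_le_cvg0 _ (fun n => exp_gap M n * K)); last exact: cvg_exp_gap_mul.
move=> n.
have -> : ip w (ex (a *: u + v)) - (a * ip w (ex u) + ip w (ex v)) =
  (ip w (ex (a *: u + v)) - ip w (expsum T n (a *: u + v))) +
  (- a * (ip w (ex u) - ip w (expsum T n u)) + - 1 * (ip w (ex v) - ip w (expsum T n v))).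
  by rewrite ip_expsum_linear//; ring.
have nN (z : R[i]) : Normc.normc (- z) = Normc.normc z by case: z => p q /=; rewrite !sqrrN.
rewrite /K [leRHS]mulrDr; apply: le_trans (normcD_le _ _) _.
apply: lerD; first exact: exp_ip_diff.
rewrite [leRHS]mulrDr; apply: le_trans (normcD_le _ _) _.
rewrite mulN1r mulNr !nN Normc.normcM.
apply: lerD; last exact: exp_ip_diff.
by rewrite mulrCA ler_wpM2l ?normc_ge0// exp_ip_diff.
Qed.

Lemma expsum_vna (A : set (V -> V)) n : hvna H ip nm eqv A -> A T -> A (expsum T n).
Proof.
move=> vA AT; have iA k : A (iter k T).
  by elim: k => [|k IH]; [exact: (hvna_id vA)|exact: (hvna_comp vA)].
elim: n => [|n IH].
  rewrite (_ : expsum T 0 = fun u => (-1) *: u + u).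
    exact: (hvna_lin vA _ (hvna_id vA) (hvna_id vA)).
  by apply/funext => u; rewrite /expsum big_ord0 scaleN1r addNr.
rewrite (_ : expsum T n.+1 = fun u => (n`!%:R^-1 : R[i]) *: iter n T u + expsum T n u).
  exact: (hvna_lin vA).
by apply/funext => u; rewrite /expsum big_ord_recr/= addrC.
Qed.

Lemma exp_vna (A : set (V -> V)) : hvna H ip nm eqv A -> A T -> A ex.
Proof.
move=> vA AT; apply: (hvna_closed vA exp_bounded) => m u v e Hu Hv e0.
pose K := \sum_(i < m) nm (u i) * nm (v i).
have [N NP] := cvg0_eventually_lt (@cvg_exp_gap_mul M K) e0.
exists (expsum T N); first exact: expsum_vna.
move=> i; rewrite (ipBr ax)//; last 2 first.
- exact: Hex.
- exact: expsum_H.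
apply: le_lt_trans (NP N (leqnn N)); apply: le_trans (exp_ip_diff N (Hv i) (Hu i)) _.
rewrite ler_wpM2l ?exp_gap_ge0// /K (bigD1 i)//= lerDl sumr_ge0// => k _.
by rewrite mulr_ge0.
Qed.

End one_exponential.
End operator_exponential.

Lemma is_derive_quadratic (R : realType) (f : R -> R) (x l C : R) :
  (forall h, `|h| <= 1 -> `|f (x + h) - f x - h * l| <= C * h ^+ 2) ->
  is_derive x 1 f l.
Proof.
move=> fC; have C0 : 0 <= C.
  by have := fC 1; rewrite normr1 lexx expr1n mulr1 => /(_ isT); exact: le_trans.
have cv : h^-1 *: ((f \o shift x) (h *: (1 : R)) - f x) @[h --> 0^'] --> l.
  apply/cvgrPdist_le => e e0; near=> h.
  have h0 : h != 0 by near: h; exact: nbhs_dnbhs_neq.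
  have h1 : `|h| <= 1.
    by near: h; apply: dnbhs0_le.
  have he : (C + 1) * `|h| <= e.
    rewrite mulrC -ler_pdivlMr ?ltr_wpDl//.
    by near: h; apply: dnbhs0_le; rewrite divr_gt0// ltr_wpDl.
  rewrite /= [h *: 1]mulr1 distrC.
  have -> : h^-1 *: (f (h + x) - f x) - l = h^-1 * (f (x + h) - f x - h * l).
    by rewrite [h + x]addrC /GRing.scale/=; field.
  rewrite normrM normfV ler_pdivrMl ?normr_gt0//.
  apply: le_trans (fC h h1) _; rewrite -real_normK ?num_real// expr2 mulrA mulrC.
  rewrite ler_wpM2l// ; apply: le_trans he.
  by rewrite ler_wpM2r// lerDl.
apply: DeriveDef; first by apply/cvg_ex; exists l.
exact: cvg_lim cv.
Unshelve. all: by end_near. Qed.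

Section exponential_group.
Variables (R : realType) (V : lmodType R[i]) (H : V -> Prop).
Variables (ip : V -> V -> R[i]) (nm : V -> R) (eqv : V -> V -> Prop).
Local Notation Re := (@complex.Re R).
Implicit Types (u v w : V) (a c : R[i]) (s t : R).
Hypothesis ax : hilbert_axioms H ip nm eqv.
Local Notation hbd := (hbounded H nm eqv).
Local Notation leo := (le_op H nm).
Let HB := HB ax.
Let HZ := HZ ax.
Let nm_ge0 := hilb_nm_ge0 ax.

Variables (F : V -> V) (ex : R -> V -> V) (M : R).
Hypothesis bF : hbd F.
Hypothesis M0 : 0 <= M.
Hypothesis FM : leo F M.
Let Fs s : V -> V := fun u => s%:C *: F u.
Hypothesis exP : forall s u, H u -> exp_of H nm (Fs s) u (ex s u).

Let Hex s u : H u -> H (ex s u). Proof. by move=> /(exP s)[]. Qed.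
Let HF u : H u -> H (F u). Proof. by move=> Hu; exact: (hbounded_H bF Hu). Qed.
Let Hit k u : H u -> H (iter k F u).
Proof. by move=> Hu; exact: (hbounded_H (hbounded_iter ax k bF)). Qed.

Lemma normc_real s : Normc.normc s%:C = `|s|.
Proof. by rewrite /= expr0n addr0 sqrtr_sqr. Qed.

Lemma scaled_bounded s : hbd (Fs s).
Proof.
apply: (hbounded_build ax (M := `|s| * M)).
- by move=> u Hu; apply: HZ; exact: HF.
- move=> a u v w Hu Hv Hw; have Huv : H (a *: u + v) by exact: (hilbZD ax).
  by rewrite /Fs !(ipZr ax)//; [rewrite (op_ZD ax)//; ring|exact: HF..].
- by move=> u Hu; rewrite /Fs (nmZ ax) ?normc_real -?mulrA ?ler_wpM2l ?FM//; exact: HF.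
Qed.

Lemma scaled_le s : leo (Fs s) (`|s| * M).
Proof.
by move=> u Hu; rewrite /Fs (nmZ ax) ?normc_real -?mulrA ?ler_wpM2l ?FM//; exact: HF.
Qed.

Let sM0 s : 0 <= `|s| * M. Proof. exact: mulr_ge0. Qed.
Let bFs := scaled_bounded.

Lemma group_bounded s : hbd (ex s).
Proof. exact: (exp_bounded ax (bFs s) (sM0 s) (@scaled_le s) (exP s)). Qed.

Lemma group_le s : leo (ex s) (expR (`|s| * M)).
Proof. exact: (exp_le_op ax (bFs s) (sM0 s) (@scaled_le s) (exP s)). Qed.

Lemma ip_iter_scaled s k u w : H u -> H w ->
  ip w (iter k (Fs s) u) = (s ^+ k)%:C * ip w (iter k F u).
Proof.
move=> Hu; elim: k w => [|k IH] w Hw; first by rewrite expr0 mul1r.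
have Hk : H (iter k (Fs s) u) by exact: (hbounded_H (hbounded_iter ax k (bFs s))).
rewrite !iterS /Fs (ipZr ax) ?exprS//; last exact: HF.
rewrite -(adjl ax bF Hw Hk) IH//; last exact: (adjH ax).
by rewrite (adjl ax bF)// ?rmorphM ?mulrA//; exact: Hit.
Qed.

Lemma ip_expsum s n u w : H u -> H w ->
  ip w (expsum (Fs s) n u) = \sum_(k < n) (s%:C ^+ k / k`!%:R) * ip w (iter k F u).
Proof.
move=> Hu Hw; have Hk k : H (iter k (Fs s) u).
  exact: (hbounded_H (hbounded_iter ax k (bFs s))).
rewrite /expsum (ip_sumr ax)//; last by move=> k; apply: HZ; exact: Hk.
apply: eq_bigr => k _; rewrite (ipZr ax)// ip_iter_scaled// rmorphXn.
by rewrite mulrA [_^-1 * _]mulrC.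
Qed.

Lemma group_ip_diff s n u w : H u -> H w ->
  Normc.normc (ip w (ex s u) - ip w (expsum (Fs s) n u)) <=
  exp_gap (`|s| * M) n * (nm w * nm u).
Proof. exact: (exp_ip_diff ax (bFs s) (sM0 s) (@scaled_le s) (exP s)). Qed.

Let gap_ge0 s n : 0 <= exp_gap (`|s| * M) n.
Proof. exact: (exp_gap_ge0 _ (sM0 s)). Qed.

Lemma ip_ext u v : H u -> H v -> (forall w, H w -> ip w u = ip w v) -> eqv u v.
Proof. by move=> Hu Hv h; apply/(eqv_ip ax). Qed.

Lemma normc_sum (I : Type) (r : seq I) (P : pred I) (f : I -> R[i]) :
  Normc.normc (\sum_(i <- r | P i) f i) <= \sum_(i <- r | P i) Normc.normc (f i).
Proof.
elim/big_ind2: _ => //; first by rewrite Normc.normc0.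
by move=> x x' y y' hx hy; apply: le_trans (normcD_le _ _) _; exact: lerD.
Qed.

Lemma normc_coeff s k : Normc.normc (s%:C ^+ k / k`!%:R) = exp_coeff `|s| k.
Proof.
rewrite Normc.normcM normc_factV /exp_coeff/= -rmorphXn; congr (_ * _).
by rewrite normc_real normrX.
Qed.

Lemma expsum_product_diff s t n u w : H u -> H w ->
  Normc.normc (ip w (expsum (Fs s) n (expsum (Fs t) n u)) -
               ip w (expsum (Fs (s + t)) n u)) <=
  (series (exp_coeff (`|s| * M)) n * series (exp_coeff (`|t| * M)) n -
   series (exp_coeff (`|s| * M + `|t| * M)) n) * (nm w * nm u).
Proof.
move=> Hu Hw; have HE := expsum_H ax n (bFs t) Hu.
pose c k := ip w (iter k F u).
have -> : ip w (expsum (Fs s) n (expsum (Fs t) n u)) =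
    \sum_(j < n) \sum_(k < n) (s%:C ^+ j / j`!%:R) * (t%:C ^+ k / k`!%:R) * c (j + k)%N.
  rewrite ip_expsum//; apply: eq_bigr => j _; rewrite /expsum.
  have bj := hbounded_iter ax j bF.
  have Hk k : H (iter k (Fs t) u) by exact: (hbounded_H (hbounded_iter ax k (bFs t))).
  rewrite -(adjl ax bj Hw)//.
  rewrite -/(expsum (Fs t) n u) ip_expsum//; last exact: (adjH ax).
  rewrite mulr_sumr; apply: eq_bigr => k _; rewrite (adjl ax bj)//; last exact: Hit.
  by rewrite -iterD mulrA.
have tri2 := exp_triangle c s%:C t%:C n.
rewrite (ip_expsum (s + t))// rmorphD [X in _ - X]tri2 -sumrB.
have cM k : Normc.normc (c k) <= M ^+ k * (nm w * nm u).
  apply: le_trans (ip_CS ax Hw (Hit k Hu)) _; rewrite mulrCA ler_wpM2l//.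
  exact: (le_op_iter ax k bF M0 FM).
have coefM (x : R) k : exp_coeff x k * M ^+ k = exp_coeff (x * M) k.
  by rewrite /exp_coeff/= exprMn mulrAC.
have tri := @exp_triangle R (fun _ => 1) (`|s| * M) (`|t| * M) n.
rewrite [X in (_ - X) * _](_ : _ = \sum_(j < n) \sum_(k < n | (j + k < n)%N)
    exp_coeff (`|s| * M) j * exp_coeff (`|t| * M) k); last first.
  rewrite /series/= big_mkord.
  transitivity (\sum_(l < n) (`|s| * M + `|t| * M) ^+ l / l`!%:R * 1).
    by apply: eq_bigr => l _; rewrite mulr1.
  by rewrite tri; apply: eq_bigr => j _; apply: eq_bigr => k _; rewrite mulr1.
rewrite /series/= !big_mkord mulr_suml -sumrB mulr_suml.
apply: le_trans (normc_sum _ _ _) _; apply: ler_sum => j _.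
rewrite mulr_sumr (bigID (fun k : 'I_n => (j + k < n)%N))/= addrAC subrr add0r.
rewrite [X in (X - _) * _](bigID (fun k : 'I_n => (j + k < n)%N))/= addrAC subrr add0r.
rewrite mulr_suml; apply: le_trans (normc_sum _ _ _) _; apply: ler_sum => k _.
rewrite 2!Normc.normcM !normc_coeff -!coefM.
apply: le_trans (ler_wpM2l _ (cM _)) _; first by rewrite mulr_ge0 ?exp_coeff_ge0.
by rewrite exprD le_eqVlt; apply/orP; left; apply/eqP; ring.
Qed.

Lemma group_add s t u : H u -> eqv (ex s (ex t u)) (ex (s + t) u).
Proof.
move=> Hu; apply: ip_ext; [exact/Hex/Hex|exact: Hex|].
move=> w Hw; apply/eqP; rewrite -subr_eq0; apply/eqP.
pose K := nm w * nm u.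
pose P n := series (exp_coeff (`|s| * M)) n * series (exp_coeff (`|t| * M)) n -
   series (exp_coeff (`|s| * M + `|t| * M)) n.
apply: (@normc_le_cvg0 _ _ (fun n => exp_gap (`|t| * M) n * (expR (`|s| * M) * K) +
  (exp_gap (`|s| * M) n * (expR (`|t| * M) * K) + (P n * K + exp_gap (`|s + t| * M) n * K)))).
  move=> n; set Et := expsum (Fs t) n u.
  have HE : H Et by exact: (expsum_H ax n (bFs t) Hu).
  have -> : ip w (ex s (ex t u)) - ip w (ex (s + t) u) =
    (ip w (ex s (ex t u)) - ip w (ex s Et)) + ((ip w (ex s Et) - ip w (expsum (Fs s) n Et)) +
    ((ip w (expsum (Fs s) n Et) - ip w (expsum (Fs (s + t)) n u)) +
     (ip w (expsum (Fs (s + t)) n u) - ip w (ex (s + t) u)))) by rewrite !subrKA.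
  apply: le_trans (normcD_le _ _) _; apply: lerD.
    rewrite -(op_B ax (group_bounded s) (Hex t Hu) HE Hw).
    have HD := HB (Hex t Hu) HE.
    apply: le_trans (ip_CS ax Hw (Hex s HD)) _.
    rewrite (_ : _ * (expR _ * K) = nm w * (expR (`|s| * M) * (exp_gap (`|t| * M) n * nm u))).
      2: by rewrite /K; ring.
    rewrite ler_wpM2l//.
    apply: le_trans (group_le s HD) _; rewrite ler_wpM2l ?expR_ge0//.
    exact: (@exp_ofE_gap _ _ _ _ _ _ ax (Fs t) _ u (ex t u) n (bFs t) (sM0 t) (@scaled_le t) Hu (exP t Hu)).
  apply: le_trans (normcD_le _ _) _; apply: lerD.
    apply: le_trans (group_ip_diff s n HE Hw) _; rewrite ler_wpM2l// /K [leRHS]mulrCA ler_wpM2l//.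
    have := expsum_gap ax (bFs t) (sM0 t) (@scaled_le t) Hu (leq0n n).
    by rewrite {2}/expsum big_ord0 subr0 /exp_gap /series/= big_nil subr0.
  apply: le_trans (normcD_le _ _) _; apply: lerD; first exact: expsum_product_diff.
  rewrite (_ : Normc.normc _ = Normc.normc (ip w (ex (s + t) u) - ip w (expsum (Fs (s + t)) n u))).
    exact: group_ip_diff.
  by rewrite -opprB; case: (_ - _) => x y /=; rewrite !sqrrN.
have PP : P @ \oo --> (0 : R).
  rewrite -(subrr (expR (`|s| * M + `|t| * M))) {1}expRD.
  by apply: cvgB; [apply: cvgM|]; exact: is_cvg_series_exp_coeff.
rewrite -[0 : R]addr0; apply: cvgD; first exact: cvg_exp_gap_mul.
rewrite -[0 : R]addr0; apply: cvgD; first exact: cvg_exp_gap_mul.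
rewrite -[0 : R]addr0; apply: cvgD; last exact: cvg_exp_gap_mul.
by rewrite -(mul0r K); apply: cvgM => //; exact: cvg_cst.
Qed.

Lemma group0 u : H u -> eqv (ex 0 u) u.
Proof.
move=> Hu; apply: ip_ext => //; first exact: Hex.
move=> w Hw; apply/eqP; rewrite -subr_eq0; apply/eqP.
apply: (@normc_le_cvg0 _ _ (fun n => exp_gap (`|0| * M) n.+1 * (nm w * nm u))).
  move=> n; have := group_ip_diff 0 n.+1 Hu Hw; rewrite ip_expsum// big_ord_recl/=.
  rewrite expr0 fact0 divr1 mul1r; set r := \sum_(i < n) _.
  have -> : r = 0 by rewrite /r big1// => k _; rewrite -rmorphXn expr0n/= mul0r mul0r.
  move=> h; apply: le_trans h; rewrite le_eqVlt; apply/orP; left; apply/eqP.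
  by congr (Normc.normc (_ - _)); exact/esym/addr0.
by rewrite (cvg_shiftS (fun n => exp_gap (`|0| * M) n * (nm w * nm u)));
  exact: cvg_exp_gap_mul.
Qed.

Lemma group_inv s u : H u -> eqv (ex s (ex (- s) u)) u.
Proof.
move=> Hu; have := group_add s (- s) Hu; rewrite subrr => h.
by apply: (eqv_trans ax _ _ _ h (group0 Hu)) => //; [exact/Hex/Hex|exact: Hex].
Qed.

Hypothesis Fsa : forall u v, H u -> H v -> ip (F u) v = ip u (F v).

Lemma group_selfadjoint s u v : H u -> H v -> ip (ex s u) v = ip u (ex s v).
Proof.
move=> Hu Hv; have Fit k : ip (iter k F u) v = ip u (iter k F v).
  elim: k v Hv => [//|k IH] v Hv; rewrite iterS Fsa//; last exact: Hit.
  rewrite iterSr -IH//; exact: HF.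
apply/eqP; rewrite -subr_eq0; apply/eqP.
apply: (@normc_le_cvg0 _ _ (fun n => exp_gap (`|s| * M) n * (nm v * nm u) +
   exp_gap (`|s| * M) n * (nm u * nm v))); last first.
  by rewrite -[0 : R]addr0; apply: cvgD; exact: cvg_exp_gap_mul.
move=> n; have HEu := expsum_H ax n (bFs s) Hu; have HEv := expsum_H ax n (bFs s) Hv.
have E : ip (expsum (Fs s) n u) v = ip u (expsum (Fs s) n v).
  rewrite (hilb_ip_conj ax Hv HEu) !ip_expsum// rmorph_sum; apply: eq_bigr => k _.
  rewrite rmorphM/= -(hilb_ip_conj ax Hv (Hit k Hu)) Fit; congr (_ * _).
  by rewrite -rmorphXn -(rmorph_nat (real_complex R)) -fmorphV -rmorphM conjc_real.
have -> : ip (ex s u) v - ip u (ex s v) =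
   (ip (ex s u) v - ip (expsum (Fs s) n u) v) + (ip u (expsum (Fs s) n v) - ip u (ex s v)).
  by rewrite E subrKA.
apply: le_trans (normcD_le _ _) _; apply: lerD.
  have HexU := Hex s Hu.
  rewrite (hilb_ip_conj ax Hv HexU) (hilb_ip_conj ax Hv HEu) -rmorphB.
  rewrite (_ : Normc.normc (conjc _) = Normc.normc (ip v (ex s u) - ip v (expsum (Fs s) n u))).
    exact: group_ip_diff.
  by case: (_ - _) => x y /=; rewrite sqrrN.
rewrite (_ : Normc.normc _ = Normc.normc (ip u (ex s v) - ip u (expsum (Fs s) n v))).
  exact: group_ip_diff.
by rewrite -opprB; case: (_ - _) => x y /=; rewrite !sqrrN.
Qed.

Lemma group_derive s u w : H u -> H w ->
  is_derive s 1 (fun r => Re (ip w (ex r u))) (Re (ip w (F (ex s u)))).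
Proof.
move=> Hu Hw; have Hx := Hex s Hu; set x := ex s u in Hx *.
apply: (@is_derive_quadratic _ _ _ _ (expR M * (nm w * nm x))) => h h1.
have -> : ip w (ex (s + h) u) = ip w (ex h x).
  by rewrite addrC; apply/esym/(ip_eqr ax) => //; [exact/Hex/Hex|exact: Hex|exact: group_add].
rewrite -[Re (ip w x)]/(Re (ip w x)).
have E : Re (ip w (ex h x)) - Re (ip w x) - h * Re (ip w (F x)) =
   Re (ip w (ex h x) - (ip w x + h%:C * ip w (F x))).
  by case: (ip w (ex h x)) (ip w x) (ip w (F x)) => [? ?] [? ?] [? ?] /=; ring.
rewrite E; apply: le_trans (Re_normc _) _.
rewrite -subr_le0; apply: (@le0_of_small _ _ 1) => // e e0; rewrite mulr1.
have [N NP] := cvg0_eventually_lt (@cvg_exp_gap_mul _ (`|h| * M) (nm w * nm x)) e0.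
have := NP N.+2 (ltnW (ltnW (leqnn _))).
have := group_ip_diff h N.+2 Hx Hw.
rewrite ip_expsum// 2!big_ord_recl/= expr0 fact0 divr1 mul1r (_ : bump 0 0 = 1%N)// expr1 divr1.
rewrite addrA; set rest := \sum_(i < N) _; set A := ip w (ex h x) => g1 g2.
have restM : Normc.normc rest <= expR M * (nm w * nm x) * h ^+ 2.
  apply: le_trans (normc_sum _ _ _) _.
  apply: (@le_trans _ _ (\sum_(i < N) exp_coeff M i.+2 * (nm w * nm x) * h ^+ 2)).
    apply: ler_sum => i _; rewrite /bump !leq0n !add1n add0n -2!iterS Normc.normcM normc_coeff.
    apply: le_trans (ler_wpM2l _ (ip_CS ax Hw (Hit _ Hx))) _; first exact: exp_coeff_ge0.
    apply: le_trans (ler_wpM2l _ (ler_wpM2l (nm_ge0 w) (le_op_iter ax i.+2 bF M0 FM Hx))) _.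
      exact: exp_coeff_ge0.
    rewrite [leLHS](_ : _ = exp_coeff M i.+2 * (nm w * nm x) * `|h| ^+ i.+2); last first.
      by rewrite /exp_coeff/=; ring.
    apply: ler_wpM2l; first exact: (mulr_ge0 (exp_coeff_ge0 _ M0) (mulr_ge0 (nm_ge0 _) (nm_ge0 _))).
    rewrite -[h ^+ 2]real_normK ?num_real// -[i.+2]addn2 exprD.
    by rewrite ler_piMl ?sqr_ge0// exprn_ile1.
  rewrite -!mulr_suml ler_wpM2r ?sqr_ge0// ler_wpM2r ?mulr_ge0//.
  apply: le_trans (expR_partial_le N.+2 M0); rewrite /series/= big_mkord.
  by rewrite !big_ord_recl/= addrA lerDr addr_ge0// exp_coeff_ge0.
rewrite lerBlDr; apply: le_trans (_ : Normc.normc ((A - (ip w x + h%:C * ip w (F x) + rest)) + rest) <= _).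
  have aux (a b c : R[i]) : a - b = (a - (b + c)) + c by rewrite opprD addrA subrK.
  by rewrite {1}(aux A _ rest).
apply: le_trans (normcD_le _ _) _; apply: lerD => //; apply: le_trans g1 (ltW g2).
Qed.

End exponential_group.

Lemma derive_ge_increment (R : realType) (f df : R -> R) (a b c : R) : a <= b ->
  (forall x, a <= x <= b -> is_derive x 1 f (df x)) ->
  (forall x, a <= x <= b -> c <= df x) -> c * (b - a) <= f b - f a.
Proof.
rewrite le_eqVlt => /predU1P[->|ab] fd dfc; first by rewrite !subrr mulr0.
have ab' x : x \in `]a, b[ -> a <= x <= b by rewrite in_itv/= => /andP[/ltW-> /ltW->].
have [|x xab ->] := MVT ab (fun x xab => fd x (ab' x xab)).
  apply: derivable_within_continuous => x; rewrite in_itv/= => /fd h; exact: ex_derive.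
by apply: ler_wpM2r; [rewrite subr_ge0 ltW|exact/dfc/ab'].
Qed.

Lemma is_derive_exp_scale (R : realType) (c t : R) :
  is_derive t 1 (fun r => expR (c * r)) (c * expR (c * t)).
Proof.
have d0 : is_derive t (1 : R) (fun r => c * r) c.
  have := is_deriveZ c (is_derive_id t (1 : R)); rewrite /GRing.scale/= mulr1; exact.
have := is_derive1_comp (is_derive_expR (c * t)) d0.
by rewrite [_ * c]mulrC.
Qed.

Section spectral_below_bound.
Variables (R : realType) (V : lmodType R[i]) (H : V -> Prop).
Variables (ip : V -> V -> R[i]) (nm : V -> R) (eqv : V -> V -> Prop).
Local Notation Re := (@complex.Re R).
Implicit Types (u v w : V) (s t : R).
Hypothesis ax : hilbert_axioms H ip nm eqv.
Local Notation hbd := (hbounded H nm eqv).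
Local Notation leo := (le_op H nm).
Let HB := HB ax.
Let HD := HD ax.
Let HZ := HZ ax.
Let nm_ge0 := hilb_nm_ge0 ax.
Let ip_conj := hilb_ip_conj ax.

Variables (F : V -> V) (ex : R -> V -> V) (M : R).
Hypothesis bF : hbd F.
Hypothesis M0 : 0 <= M.
Hypothesis FM : leo F M.
Hypothesis exP : forall s u, H u -> exp_of H nm (fun u => s%:C *: F u) u (ex s u).
Hypothesis Fsa : forall u v, H u -> H v -> ip (F u) v = ip u (F v).
Let Hex s u : H u -> H (ex s u). Proof. by move=> /(exP s)[]. Qed.
Let HF u : H u -> H (F u). Proof. by move=> Hu; exact: (hbounded_H bF Hu). Qed.
Let Hit k u : H u -> H (iter k F u).
Proof. by move=> Hu; exact: (hbounded_H (hbounded_iter ax k bF)). Qed.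

Lemma group_comm s u : H u -> eqv (F (ex s u)) (ex s (F u)).
Proof.
move=> Hu; apply: (ip_ext ax) => //; [exact/HF/Hex|exact/Hex/HF|move=> w Hw].
have Hx := Hex s Hu; rewrite -Fsa//; apply/eqP; rewrite -subr_eq0; apply/eqP.
apply: (@normc_le_cvg0 _ _ (fun n => exp_gap (`|s| * M) n * (nm (F w) * nm u) +
   exp_gap (`|s| * M) n * (nm w * nm (F u)))); last first.
  by rewrite -[0 : R]addr0; apply: cvgD; exact: cvg_exp_gap_mul.
move=> n; have E : ip (F w) (expsum (fun u => s%:C *: F u) n u) =
    ip w (expsum (fun u => s%:C *: F u) n (F u)).
  rewrite (ip_expsum ax bF FM)//; last exact: HF.
  rewrite (ip_expsum ax bF FM)//; last exact: HF.
  apply: eq_bigr => k _; rewrite Fsa//; last exact: Hit.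
  by rewrite -iterSr.
have -> : ip (F w) (ex s u) - ip w (ex s (F u)) =
   (ip (F w) (ex s u) - ip (F w) (expsum (fun u => s%:C *: F u) n u)) +
   (ip w (expsum (fun u => s%:C *: F u) n (F u)) - ip w (ex s (F u))).
  by rewrite E subrKA.
apply: le_trans (normcD_le _ _) _; apply: lerD.
  by apply: (group_ip_diff ax bF M0 FM exP s n Hu); exact: HF.
rewrite (_ : Normc.normc _ = Normc.normc (ip w (ex s (F u)) - ip w (expsum (fun u => s%:C *: F u) n (F u)))).
  by apply: (group_ip_diff ax bF M0 FM exP s n _ Hw); exact: HF.
by rewrite -opprB; case: (_ - _) => x y /=; rewrite !sqrrN.
Qed.

Lemma group_orthogonal s u z : H u -> H z ->
  (forall k, ip z (iter k F u) = 0) -> ip z (ex s u) = 0.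
Proof.
move=> Hu Hz zk.
apply: (@normc_le_cvg0 _ _ (fun n => exp_gap (`|s| * M) n * (nm z * nm u))); last first.
  exact: cvg_exp_gap_mul.
move=> n; have := group_ip_diff ax bF M0 FM exP s n Hu Hz.
by rewrite (ip_expsum ax bF FM)// big1 ?subr0// => k _; rewrite zk mulr0.
Qed.

Variable E : set R -> V -> V.
Hypothesis Eb : forall A, measurable (A : set (measurableTypeR R)) -> hbd (E A).
Hypothesis Esa : forall A, measurable (A : set (measurableTypeR R)) ->
  forall u v, H u -> H v -> ip (E A u) v = ip u (E A v).
Hypothesis EE : forall A, measurable (A : set (measurableTypeR R)) ->
  forall u, H u -> eqv (E A (E A u)) (E A u).
Hypothesis ET : forall u, H u -> eqv (E setT u) u.
Hypothesis Emu : forall u, H u -> exists mu : {measure set (measurableTypeR R) -> \bar R}, [/\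
    forall A, measurable A -> mu A = (Re (ip u (E A u)))%:E,
    mu.-integrable [set: measurableTypeR R] (fun l : measurableTypeR R => (l : R)%:E) &
    ip u (F u) = (\int[mu]_l (l : R))%:C].

Let HE A u : measurable (A : set (measurableTypeR R)) -> H u -> H (E A u).
Proof. by move=> /Eb bE Hu; exact: (hbounded_H bE Hu). Qed.

Lemma proj_sqr A u : measurable (A : set (measurableTypeR R)) -> H u ->
  Re (ip u (E A u)) = nm (E A u) ^+ 2.
Proof.
move=> mA Hu; have HEu := HE mA Hu.
rewrite -[RHS]/(Re (nm (E A u) ^+ 2)%:C) -(hilb_ip_self ax)// Esa//.
by congr Re; apply/esym/(ip_eqr ax) => //; [exact: HE|exact: EE].
Qed.

Lemma proj_additive A B u : measurable (A : set (measurableTypeR R)) ->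
  measurable (B : set (measurableTypeR R)) -> [disjoint A & B] -> H u ->
  Re (ip u (E (A `|` B) u)) = Re (ip u (E A u)) + Re (ip u (E B u)).
Proof.
move=> mA mB /eqP AB Hu; have [mu [muE _ _]] := Emu Hu.
apply: EFin_inj; rewrite EFinD -!muE//; last exact: measurableU.
exact: measureU.
Qed.

Lemma proj_le A B u : measurable (A : set (measurableTypeR R)) ->
  measurable (B : set (measurableTypeR R)) -> A `<=` B -> H u ->
  nm (E A u) <= nm (E B u).
Proof.
move=> mA mB AB Hu; have [mu [muE _ _]] := Emu Hu.
rewrite -(@ler_pXn2r _ 2)// ?nnegrE//; rewrite -!proj_sqr// -lee_fin -!muE//.
by apply: le_measure; rewrite ?inE.
Qed.

Variable a : R.
Local Notation I := (`[a, +oo[ : set R).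
Local Notation J := (`]-oo, a[ : set R).
Let P := E `[a, +oo[%classic.
Let mI : measurable (`[a, +oo[%classic : set (measurableTypeR R)).
Proof. exact: measurable_itv. Qed.
Let mJ : measurable (`]-oo, a[%classic : set (measurableTypeR R)).
Proof. exact: measurable_itv. Qed.

Let IJ : `[a, +oo[%classic `&` `]-oo, a[%classic = set0 :> set R.
Proof.
rewrite -subset0 => x /= [].
by rewrite !in_itv/= andbT => ax' xa; have := le_lt_trans ax' xa; rewrite ltxx.
Qed.

Let IUJ : `[a, +oo[%classic `|` `]-oo, a[%classic = [set: R].
Proof.
apply/seteqP; split => // x _ /=; rewrite !in_itv/= andbT.
by case: (leP a x) => ?; [left|right].
Qed.

Lemma proj_split u : H u -> nm u ^+ 2 = nm (P u) ^+ 2 + nm (E `]-oo, a[%classic u) ^+ 2.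
Proof.
move=> Hu; rewrite /P -!proj_sqr// -proj_additive//; last by apply/eqP; exact: IJ.
rewrite IUJ (ip_eqr ax _ _ _ (ET Hu))//; last exact: HE.
by rewrite (hilb_ip_self ax).
Qed.

Definition above u := H u /\ eqv (P u) u.
Definition below v := H v /\ nm (P v) = 0.

Lemma above_proj u : H u -> above (P u).
Proof. by move=> Hu; split; [exact: HE|exact: EE]. Qed.

Lemma below_proj u : H u -> below (u - P u).
Proof.
move=> Hu; have HPu := HE mI Hu; split; first exact: HB.
rewrite (op_nmB ax (Eb mI))//.
by apply/(hilb_eqv ax); [exact: HE|exact/HE/HE|apply: (eqv_sym ax) => //; [exact/HE/HE|exact/EE]].
Qed.

Lemma belowZ (c : R[i]) v : below v -> below (c *: v).
Proof.
move=> [Hv v0]; split; first exact: HZ.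
have HPv := HE mI Hv; have Hcv := HZ c Hv; have HPcv := HE mI Hcv.
have H0 := hilb0 ax; suff h : eqv (P (c *: v)) 0 by rewrite (nm_eqv ax _ _ h)// (nm0 ax).
apply: (ip_ext ax) => //.
move=> w Hw; rewrite (op_Z ax c (Eb mI))// (ip_eqr ax HPv H0 Hw (eqv_nm0 ax HPv v0)).
by rewrite !(ipr0 ax) ?mulr0.
Qed.

Lemma above_low u : above u -> nm (E `]-oo, a[%classic u) = 0.
Proof.
move=> [Hu Pu]; have := proj_split Hu; rewrite (nm_eqv ax (HE mI Hu) Hu Pu).
by rewrite -[X in X = _]addr0 => /addrI/esym/eqP; rewrite sqrf_eq0 => /eqP.
Qed.

Lemma ip_nm0 u v : H u -> H v -> nm v = 0 -> ip u v = 0.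
Proof.
move=> Hu Hv v0; rewrite (ip_eqr ax Hv (hilb0 ax) Hu (eqv_nm0 ax Hv v0)).
exact: (ipr0 ax).
Qed.

Lemma Re_ip_sym u v : H u -> H v -> Re (ip u v) = Re (ip v u).
Proof. by move=> Hu Hv; rewrite (ip_conj Hu Hv); case: (ip u v). Qed.

Lemma quad_sum u v A : measurable (A : set (measurableTypeR R)) -> H u -> H v ->
  Re (ip (u + v) (E A (u + v))) =
  Re (ip u (E A u)) + Re (ip v (E A v)) + 2 * Re (ip u (E A v)).
Proof.
move=> mA Hu Hv; have HEu := HE mA Hu; have HEv := HE mA Hv; have Huv := HD Hu Hv.
rewrite (op_D ax (Eb mA))// !(ipDl ax)// (Re_ip_sym Hu HEv) Esa//.
have := Re_ip_sym Hv HEu; rewrite (Esa mA)// => h.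
have := Re_ip_sym Hu HEv; rewrite (Esa mA)//.
move: (ip u (E A u)) (ip v (E A v)) (ip u (E A v)) (ip v (E A u)) h => [? ?] [? ?] [? ?] [? ?] /=; lra.
Qed.

Lemma above_below_quad u v A : measurable (A : set (measurableTypeR R)) ->
  above u -> below v -> Re (ip u (E A v)) = 0.
Proof.
move=> mA uu [Hv v0]; have Hu := uu.1; have u0 := above_low uu.
set B1 := A `&` `[a, +oo[%classic; set B2 := A `&` `]-oo, a[%classic.
have mB1 : measurable (B1 : set (measurableTypeR R)) by exact: measurableI.
have mB2 : measurable (B2 : set (measurableTypeR R)) by exact: measurableI.
have AB : A = B1 `|` B2 by rewrite /B1 /B2 -setIUr IUJ setIT.
have B12 : [disjoint B1 & B2].
  by apply/eqP; rewrite /B1 /B2 setIACA IJ setI0.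
have h1 : ip u (E B1 v) = 0.
  apply: ip_nm0 => //; first exact: HE.
  apply/eqP; rewrite eq_le nm_ge0 andbT -v0; apply: proj_le => //; exact: subIsetr.
have h2 : Re (ip u (E B2 v)) = 0.
  rewrite -(Esa mB2)// Re_ip_sym//; last exact: HE.
  rewrite ip_nm0//; first exact: HE.
  apply/eqP; rewrite eq_le nm_ge0 andbT -u0; apply: proj_le => //; exact: subIsetr.
have := proj_additive mB1 mB2 B12 (HD Hu Hv); rewrite -AB !quad_sum// h1 h2.
rewrite {1 2}AB !proj_additive// (_ : Re 0 = 0)//; lra.
Qed.

Lemma above_below_F_Re u v : above u -> below v -> Re (ip u (F v)) = 0.
Proof.
move=> uu lv; have Hu := uu.1; have Hv := lv.1; have Huv := HD Hu Hv.
have [m1 [m1E i1 F1]] := Emu Hu; have [m2 [m2E i2 F2]] := Emu Hv.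
have [m3 [m3E i3 F3]] := Emu Huv.
have E3 : (\int[m3]_l ((l : measurableTypeR R) : R)%:E = \int[m1]_l (l : R)%:E + \int[m2]_l (l : R)%:E)%E.
  rewrite -integral_measure_add//; apply: eq_measure_integral => A mA _.
  transitivity (m1 A + m2 A)%E; last exact/esym/measure_addE.
  by rewrite m1E// m2E// m3E// -EFinD quad_sum// (above_below_quad mA uu lv) mulr0 addr0.
have E4 : Re (ip (u + v) (F (u + v))) = Re (ip u (F u)) + Re (ip v (F v)).
  rewrite F1 F2 F3/= /Rintegral E3 fineD//; exact: integrable_fin_num.
move: E4; have HFu := HF Hu; have HFv := HF Hv.
rewrite (op_D ax bF)// !(ipDl ax)//.
have := Re_ip_sym Hv HFu; rewrite Fsa//.
move: (ip u (F u)) (ip v (F v)) (ip u (F v)) (ip v (F u)) => [? ?] [? ?] [? ?] [? ?] /=; lra.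
Qed.

Lemma above_below_F u v : above u -> below v -> ip u (F v) = 0.
Proof.
move=> uu lv; have Hu := uu.1; have Hv := lv.1.
have := above_below_F_Re uu lv; have := above_below_F_Re uu (belowZ 'i lv).
rewrite (op_Z ax _ bF)//; case: (ip u (F v)) => x y /=.
rewrite mul0r mul1r sub0r => /eqP; rewrite oppr_eq0 => /eqP-> ->.
by [].
Qed.

Lemma above_below_ip u v : above u -> below v -> ip v u = 0.
Proof.
move=> [Hu Pu] [Hv v0]; rewrite -(ip_eqr ax (HE mI Hu) Hu Hv Pu) -(Esa mI)//.
have HPv := HE mI Hv; rewrite (ip_conj Hu HPv) ip_nm0//; exact: conjc0.
Qed.

Lemma above_stable x : H x -> (forall z, below z -> ip z x = 0) -> above x.
Proof.
move=> Hx zx; split => //; have lx := below_proj Hx; have HPx := HE mI Hx.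
have : ip (x - P x) (x - P x) = 0.
  by rewrite (ipBr ax) ?zx ?(above_below_ip (above_proj Hx) lx) ?subr0//; exact: lx.1.
rewrite (hilb_ip_self ax); last exact: lx.1.
move=> /(congr1 Re)/= /eqP; rewrite sqrf_eq0 => /eqP h.
by apply/(eqv_sym ax) => //; apply/(hilb_eqv ax).
Qed.

Lemma above_F u : above u -> above (F u).
Proof.
move=> uu; have Hu := uu.1; apply: above_stable; first exact: HF.
move=> z lz; have Hz := lz.1; have HFz := HF Hz.
by rewrite -Fsa// (ip_conj Hu HFz) above_below_F// conjc0.
Qed.

Lemma above_iter k u : above u -> above (iter k F u).
Proof. by move=> uu; elim: k => [//|k IH] /=; exact: above_F. Qed.

Lemma above_ex_ip s u z : above u -> below z -> ip z (ex s u) = 0.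
Proof.
move=> uu lz; apply: group_orthogonal; [exact: uu.1|exact: lz.1|move=> k].
by apply: above_below_ip => //; exact: above_iter.
Qed.

Lemma above_ex s u : above u -> above (ex s u).
Proof.
move=> uu; apply: above_stable; first exact/Hex/uu.1.
by move=> z lz; exact: above_ex_ip.
Qed.

Lemma above_ge u : above u -> a * nm u ^+ 2 <= Re (ip u (F u)).
Proof.
move=> uu; have Hu := uu.1; have [mu [muE imu ->]] := Emu Hu.
have muT : mu setT = (nm u ^+ 2)%:E.
  rewrite muE//; congr _%:E; rewrite (ip_eqr ax _ _ _ (ET Hu))//; last exact: HE.
  by rewrite (hilb_ip_self ax).
have mmax : measurable_fun setT (fun l : measurableTypeR R => (Num.max a l)%:E).
  apply/measurable_EFinP; apply: measurable_maxr => //; exact: measurable_cst.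
have mid : measurable_fun setT (fun l : measurableTypeR R => (l : R)%:E).
  exact: measurable_int imu.
have aeE : ae_eq mu setT (fun l : measurableTypeR R => (l : R)%:E)
    (fun l : measurableTypeR R => (Num.max a l)%:E).
  exists `]-oo, a[%classic; split => //.
    by rewrite muE// proj_sqr// above_low// expr0n.
  move=> l /=; rewrite in_itv/=; apply: contra_notT; rewrite -leNgt => al _.
  by rewrite max_r.
rewrite /= /Rintegral (ae_eq_integral _ _ _ _ _ aeE)//.
have icst (c : R) : mu.-integrable setT (fun _ : measurableTypeR R => c%:E).
  by apply/integrableP; split => //; rewrite integral_cst// muT -EFinM ltry.
have imax : mu.-integrable setT (fun l : measurableTypeR R => (Num.max a l)%:E).
  have ia : mu.-integrable setT (fun l : measurableTypeR R => (`|l : R| + `|a|)%:E).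
    under eq_fun do rewrite EFinD.
    by apply: integrableD => //; exact: integrable_abse imu.
  apply: le_integrable ia => // l _ /=; rewrite lee_fin [leRHS]ger0_norm ?addr_ge0//.
  by rewrite /Num.max; case: ifP => _; rewrite ?lerDl ?lerDr.
have imc : mu.-integrable setT (EFin \o cst a : measurableTypeR R -> \bar R).
  exact: icst.
have -> : a * nm u ^+ 2 = fine (\int[mu]_l (a%:E)).
  by rewrite integral_cst// muT.
rewrite fine_le//; try exact: integrable_fin_num.
by apply: le_integral => // l _; rewrite lee_fin le_max lexx.
Qed.

Theorem spectral_chernoff Om s : H Om -> 0 <= s ->
  Re (ip Om (P Om)) * expR (s * a) <= Re (ip Om (ex s Om)).
Proof.
move=> HO s0; set p := P Om; set q := Om - p.
have up : above p by exact: above_proj. have lq : below q by exact: below_proj.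
have Hp := up.1; have Hq := lq.1.
have Opq : Om = p + q by rewrite /q addrC subrK.
clearbody q.
have half t u : H u -> Re (ip u (ex t u)) = nm (ex (t / 2) u) ^+ 2.
  move=> Hu; rewrite -[RHS]/(Re (nm (ex (t / 2) u) ^+ 2)%:C) -(hilb_ip_self ax); last exact: Hex.
  rewrite (group_selfadjoint ax bF M0 FM exP Fsa)//; last exact: Hex.
  congr Re; apply: (ip_eqr ax) => //; [exact: Hex|exact/Hex/Hex|].
  apply: (eqv_sym ax); [exact/Hex/Hex|exact: Hex|].
  by have := group_add ax bF M0 FM exP (t / 2) (t / 2) Hu; rewrite -splitr.
have split_ip : Re (ip Om (ex s Om)) = Re (ip p (ex s p)) + Re (ip q (ex s q)).
  have Hxp := Hex s Hp; have Hxq := Hex s Hq.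
  have bex := group_bounded ax bF M0 FM exP s.
  rewrite Opq (op_D ax bex)//; last exact: HD.
  rewrite !(ipDl ax)// (above_ex_ip s up lq).
  rewrite -(group_selfadjoint ax bF M0 FM exP Fsa s Hp Hq).
  rewrite (ip_conj Hq Hxp) (above_ex_ip s up lq) conjc0.
  by rewrite addr0 add0r; case: (ip p _) (ip q _) => ? ? [? ?].
have derp t : is_derive t 1 (fun r => Re (ip p (ex r p))) (Re (ip p (F (ex t p)))).
  exact: (group_derive ax bF M0 FM exP).
have ge_der t : a * Re (ip p (ex t p)) <= Re (ip p (F (ex t p))).
  have ut := above_ex (t / 2) up; have Ht := ut.1; have HFt := HF Ht.
  rewrite half//; apply: le_trans (above_ge ut) _.
  rewrite le_eqVlt; apply/orP; left; apply/eqP; congr Re.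
  rewrite (group_selfadjoint ax bF M0 FM exP Fsa)//.
  apply: (ip_eqr ax) => //; [exact: Hex|exact/HF/Hex|].
  have Htt := Hex (t / 2) Ht.
  apply: (eqv_trans ax (v := F (ex (t / 2) (ex (t / 2) p)))); [exact: Hex|exact: HF|exact/HF/Hex| |].
    apply: (eqv_sym ax); [exact: HF|exact: Hex|exact: group_comm].
  apply: (op_eqv ax bF) => //; first exact: Hex.
  by have := group_add ax bF M0 FM exP (t / 2) (t / 2) Hp; rewrite -splitr.
pose f r := expR (- (a * r)) * Re (ip p (ex r p)).
have derf t : is_derive t 1 f (expR (- (a * t)) * (Re (ip p (F (ex t p))) - a * Re (ip p (ex t p)))).
  have d1 : is_derive t (1 : R) (fun r => expR (- (a * r))) (- a * expR (- (a * t))).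
    by rewrite -mulNr; under eq_fun do rewrite -mulNr; exact: is_derive_exp_scale.
  apply: is_derive_eq (is_deriveM d1 (derp t)) _.
  by rewrite /GRing.scale/=; ring.
have := @derive_ge_increment _ f _ 0 s 0 s0 (fun t _ => derf t) (fun t _ => _).
have f0 : f 0 = Re (ip Om p).
  rewrite /f mulr0 oppr0 expR0 mul1r (ip_eqr ax (Hex 0 Hp) Hp Hp (group0 ax bF M0 FM exP Hp)).
  rewrite /p (Esa mI)//.
  by congr Re; apply: (ip_eqr ax) => //; [exact/HE/HE|exact: EE].
have -> : Re (ip Om (ex s Om)) = expR (s * a) * f s + nm (ex (s / 2) q) ^+ 2.
  rewrite split_ip (half s q Hq) /f mulrA -expRD [s * a]mulrC subrr expR0 mul1r.
  by [].
rewrite -/p -f0 => h.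
have : f 0 <= f s.
  rewrite -subr_ge0; rewrite mul0r in h; apply: h => t.
  by rewrite mulr_ge0 ?expR_ge0 ?subr_ge0.
move=> {}h; rewrite [X in X <= _]mulrC; apply: le_trans (ler_wpM2l (expR_ge0 _) h) _.
by rewrite lerDl sqr_ge0.
Qed.

End spectral_below_bound.

(** * Creation, annihilation and the trace *)

Section complex_measurability.
Variable R : realType.
Local Notation Re := (@complex.Re R).
Local Notation Im := (@complex.Im R).

Lemma cmeasurable_comp d d' (X : measurableType d) (Y : measurableType d')
    (f : Y -> R[i]) (g : X -> Y) :
  cmeasurable f -> measurable_fun setT g -> cmeasurable (fun x => f (g x)).
Proof. by move=> [fr fi] mg; split; [exact: (measurableT_comp fr)|exact: (measurableT_comp fi)]. Qed.

Lemma cmeasurable_sum d (X : measurableType d) (I : Type) (r : seq I) (P : pred I)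
    (F : I -> X -> R[i]) : (forall i, cmeasurable (F i)) ->
  cmeasurable (fun x => \sum_(i <- r | P i) F i x).
Proof.
move=> mF; elim: r => [|i r IH].
  by under eq_fun do rewrite big_nil; exact: cmeasurable_cst.
under eq_fun do rewrite big_cons; case: (P i) => //.
exact: cmeasurableD.
Qed.

Lemma cmeasurable_real d (X : measurableType d) (f : X -> R) :
  measurable_fun setT f -> cmeasurable (fun x => (f x)%:C).
Proof. by move=> mf; split => //; exact: measurable_cst. Qed.

Lemma measurable_Rintegral_section d d' (X : measurableType d) (Y : measurableType d')
    (m : {sigma_finite_measure set X -> \bar R}) (f : X * Y -> R) :
  measurable_fun setT f -> measurable_fun setT (fun y => \int[m]_x f (x, y)).
Proof.
move=> mf; apply: (measurableT_comp (@fine_measurable R setT measurableT)).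
have mfe : measurable_fun setT (EFin \o f) by exact/measurable_EFinP.
rewrite (_ : (fun y => _) = fun y => (\int[m]_x (EFin \o f)^\+ (x, y) - \int[m]_x (EFin \o f)^\- (x, y))%E).
  apply: emeasurable_funB; apply: (measurable_fun_fubini_tonelli_G (m1 := m)) => //.
    exact: measurable_funepos.
  exact: measurable_funeneg.
apply/funext => y; rewrite integralE.
by congr (_ - _)%E; apply: eq_integral => x _; rewrite ?funeposE ?funenegE.
Qed.

Lemma cmeasurable_integral_section d d' (X : measurableType d) (Y : measurableType d')
    (m : {sigma_finite_measure set X -> \bar R}) (f : X * Y -> R[i]) :
  cmeasurable f -> cmeasurable (fun y => cintegral m (fun x => f (x, y))).
Proof.
by move=> [fr fi]; split; [exact: (measurable_Rintegral_section m fr)|exact: (measurable_Rintegral_section m fi)].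
Qed.

Section sums.
Context d (X : measurableType d) (m : {measure set X -> \bar R}).

Lemma cintegrable0 : cintegrable m (fun _ => 0 : R[i]).
Proof. by split; exact: (@integrable0 _ _ _ m setT). Qed.

Lemma cintegral0 : cintegral m (fun _ => 0 : R[i]) = 0.
Proof. by rewrite /cintegral !Rintegral_cst//= !mul0r. Qed.

Lemma cintegrableZD a (f g : X -> R[i]) : cintegrable m f -> cintegrable m g ->
  cintegrable m (fun x => a * f x + g x).
Proof.
case: a => a b [fr fi] [gr gi].
have iZ (c : R) (h : X -> R) : m.-integrable setT (EFin \o h) ->
  m.-integrable setT (EFin \o (fun x => c * h x)) by exact: integrableZl.
split.
- have := integrableD measurableT (integrableB measurableT (iZ a _ fr) (iZ b _ fi)) gr.
  by apply: eq_integrable => // x _ /=; case: (f x) (g x) => ? ? [? ?] /=; rewrite -EFinB -EFinD.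
- have := integrableD measurableT (integrableD measurableT (iZ a _ fi) (iZ b _ fr)) gi.
  by apply: eq_integrable => // x _ /=; case: (f x) (g x) => ? ? [? ?] /=; rewrite -!EFinD.
Qed.

Lemma cintegral_sum (I : Type) (r : seq I) (a : I -> R[i]) (F : I -> X -> R[i]) :
  (forall i, cintegrable m (F i)) ->
  cintegrable m (fun x => \sum_(i <- r) a i * F i x) /\
  cintegral m (fun x => \sum_(i <- r) a i * F i x) = \sum_(i <- r) a i * cintegral m (F i).
Proof.
move=> iF; elim: r => [|i r [i1 IH]].
  under eq_fun do rewrite big_nil; rewrite big_nil cintegral0; split => //.
  exact: cintegrable0.
under eq_fun do rewrite big_cons; rewrite big_cons; split; first exact: cintegrableZD.
by rewrite cintegralZD// IH.
Qed.

Lemma Rintegral_invariant (g : X -> X) (f : X -> R) :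
  (forall h : X -> \bar R, (forall x, 0 <= h x)%E -> measurable_fun setT h ->
    (\int[m]_x h (g x) = \int[m]_x h x)%E) ->
  measurable_fun setT f -> \int[m]_x f (g x) = \int[m]_x f x.
Proof.
move=> gm mf; rewrite /Rintegral; congr fine.
have mfe : measurable_fun setT (EFin \o f) by exact/measurable_EFinP.
rewrite integralE [RHS]integralE; congr (_ - _)%E.
  transitivity (\int[m]_x (EFin \o f)^\+ (g x))%E.
    by apply: eq_integral => x _; rewrite !funeposE.
  by rewrite gm//; exact: measurable_funepos.
transitivity (\int[m]_x (EFin \o f)^\- (g x))%E.
  by apply: eq_integral => x _; rewrite !funenegE.
by rewrite gm//; exact: measurable_funeneg.
Qed.

Lemma cintegral_invariant (g : X -> X) (f : X -> R[i]) :
  (forall h : X -> \bar R, (forall x, 0 <= h x)%E -> measurable_fun setT h ->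
    (\int[m]_x h (g x) = \int[m]_x h x)%E) ->
  cmeasurable f -> cintegral m (fun x => f (g x)) = cintegral m f.
Proof.
move=> gm [fr fi]; rewrite /cintegral; congr Complex.
  exact: (Rintegral_invariant gm fr).
exact: (Rintegral_invariant gm fi).
Qed.

End sums.
End complex_measurability.

Section disintegration.
Variable R : realType.
Local Notation rT := (measurableTypeR R).
Local Notation mu := (@chain_measure R).
Local Notation nu := (@leb_pos R).
Local Notation Re := (@complex.Re R).
Local Notation Im := (@complex.Im R).

Lemma measurable_cons_weight (f : chain R -> \bar R) : measurable_fun setT f ->
  measurable_fun setT (fun p : rT * chain R => ((size p.2).+1%:R%:E * f (p.1 :: p.2))%E).
Proof.
move=> mf; apply: emeasurable_funM.
  apply/measurable_EFinP.
  exact: (measurableT_comp (measurable_size_fun (fun n => n.+1%:R : R)) measurable_snd).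
exact: (measurableT_comp mf (@measurable_chain_cons R)).
Qed.

Lemma integral_chain_cons_swap (f : chain R -> \bar R) :
  (forall s, 0 <= f s)%E -> measurable_fun setT f -> f [::] = 0%E ->
  (\int[mu]_s ((size s).+1%:R%:E * \int[nu]_t f (t :: s)) = \int[mu]_s f s)%E.
Proof.
move=> f0 mf fn; rewrite -[RHS]integral_chain_cons//.
rewrite (fubini_tonelli (m1 := nu) (m2 := mu) (fun p : rT * chain R => ((size p.2).+1%:R%:E * f (p.1 :: p.2))%E))//=.
- apply: eq_integral => s _; rewrite ge0_integralZl_EFin//.
  apply: (measurableT_comp mf).
  exact: (measurableT_comp (@measurable_chain_cons R) (measurable_pair2 s)).
- exact: measurable_cons_weight.
- by move=> p; exact: mule_ge0.
Qed.

Lemma ae_chain_cons_both (P : chain R -> Prop) : {ae mu, forall s, P s} ->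
  {ae nu, forall t, {ae mu, forall s, P (t :: s)}} /\
  {ae mu, forall s, {ae nu, forall t, P (t :: s)}}.
Proof.
move=> [N [mN N0 PN]]; pose N' := N `\` [set s | size s = 0%N].
have mN' : measurable N' by apply: measurableD => //; exact: measurable_size.
have N'0 : mu N' = 0%E.
  by apply/eqP; rewrite eq_le measure_ge0 andbT -N0; apply: le_measure; rewrite ?inE//; exact: subDsetl.
pose f (s : chain R) : \bar R := (\1_N' s)%:E.
have mf : measurable_fun setT f by exact/measurable_EFinP/measurable_indic.
have f0 s : (0 <= f s)%E by rewrite lee_fin.
have fn : f [::] = 0%E by rewrite /f indicE; case: (boolP (_ \in _)) => //; rewrite inE => -[_] /=.
have If : (\int[mu]_s f s = 0)%E by rewrite integral_indic// setIT.
have fP t s : f (t :: s) = 0%E -> P (t :: s).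
  rewrite /f indicE => /eqP; rewrite eqe pnatr_eq0 eqb0 => /negP h.
  by apply: contrapT => nP; apply: h; rewrite inE; split => //; exact: PN.
have mw := measurable_cons_weight mf.
have h0 (p : rT * chain R) : (0 <= (size p.2).+1%:R%:E * f (p.1 :: p.2))%E by exact: mule_ge0.
have wP t s : ((size s).+1%:R%:E * f (t :: s) = 0)%E -> P (t :: s).
  by move=> /eqP; rewrite mule_eq0 eqe pnatr_eq0/= => /eqP; exact: fP.
split.
- have := integral_chain_cons f0 mf fn; rewrite If.
  have mI : measurable_fun setT (fun t => \int[mu]_s ((size s).+1%:R%:E * f (t :: s)))%E.
    exact: (measurable_fun_fubini_tonelli_F (m2 := mu) (fun p : rT * chain R => ((size p.2).+1%:R%:E * f (p.1 :: p.2))%E)).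
  move=> I0.
  have : (\int[nu]_t `|\int[mu]_s ((size s).+1%:R%:E * f (t :: s))| = 0)%E.
    rewrite -[RHS]I0; apply: eq_integral => t _; rewrite gee0_abs//.
    by apply: integral_ge0 => s _; exact: (h0 (t, s)).
  move/(ae_eq_integral_abs nu measurableT mI); apply: filterS => t /(_ I)/= It.
  have mt : measurable_fun setT (fun s : chain R => ((size s).+1%:R%:E * f (t :: s))%E).
    exact: (measurableT_comp mw (measurable_pair1 t)).
  have : (\int[mu]_s `|(size s).+1%:R%:E * f (t :: s)| = 0)%E.
    by rewrite -[RHS]It; apply: eq_integral => s _; rewrite gee0_abs//; exact: (h0 (t, s)).
  move/(ae_eq_integral_abs mu measurableT mt); apply: filterS => s /(_ I)/=; exact: wP.
- have := integral_chain_cons_swap f0 mf fn; rewrite If.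
  have mI : measurable_fun setT (fun s : chain R => (size s).+1%:R%:E * \int[nu]_t (f (t :: s)))%E.
    apply: emeasurable_funM; first by apply/measurable_EFinP; exact: (measurable_size_fun (fun n => n.+1%:R : R)).
    apply: (measurable_fun_fubini_tonelli_G (m1 := nu) (fun p : rT * chain R => f (p.1 :: p.2))) => //.
    exact: (measurableT_comp mf (@measurable_chain_cons R)).
  move=> I0.
  have : (\int[mu]_s `|(size s).+1%:R%:E * \int[nu]_t (f (t :: s))| = 0)%E.
    rewrite -[RHS]I0; apply: eq_integral => s _; rewrite gee0_abs//.
    by apply: mule_ge0 => //; apply: integral_ge0 => t _; exact: f0.
  move/(ae_eq_integral_abs mu measurableT mI); apply: filterS => s /(_ I)/= /eqP.
  rewrite mule_eq0 eqe pnatr_eq0/= => /eqP It.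
  have mt : measurable_fun setT (fun t : rT => f (t :: s)).
    apply: (measurableT_comp mf).
    exact: (measurableT_comp (@measurable_chain_cons R) (measurable_pair2 s)).
  have : (\int[nu]_t `|f (t :: s)| = 0)%E.
    by rewrite -[RHS]It; apply: eq_integral => t _; rewrite gee0_abs.
  move/(ae_eq_integral_abs nu measurableT mt); apply: filterS => t /(_ I)/=; exact: fP.
Qed.

Lemma Rintegral_chain_cons (f : chain R -> R) :
  mu.-integrable setT (EFin \o f) -> f [::] = 0 ->
  \int[mu]_s f s = \int[mu]_s ((size s).+1%:R * \int[nu]_t f (t :: s)).
Proof.
move=> intf fn; have mfe := measurable_int _ intf.
have mf : measurable_fun setT f by exact/measurable_EFinP.
pose F (p : rT * chain R) : \bar R := ((size p.2).+1%:R%:E * (f (p.1 :: p.2))%:E)%E.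
have mF : measurable_fun setT F by exact: (measurable_cons_weight mfe).
have Fp : F^\+%E = fun p : rT * chain R => ((size p.2).+1%:R%:E * (EFin \o f)^\+ (p.1 :: p.2))%E.
  by apply/funext => p; rewrite /F !funeposE maxe_pMr ?mule0.
have Fm : F^\-%E = fun p : rT * chain R => ((size p.2).+1%:R%:E * (EFin \o f)^\- (p.1 :: p.2))%E.
  by apply/funext => p; rewrite /F !funenegE maxe_pMr// mule0 muleN.
have iF : (nu \x mu)%E.-integrable setT F.
  apply/(integrable12ltyP _ _ mF); case/integrableP: intf => _.
  rewrite -[X in (X < _)%E](integral_chain_cons (f := fun s => `|(f s)%:E|%E)); last 3 first.
  - by move=> s; exact: abse_ge0.
  - exact: (measurableT_comp (@abse_measurable R setT)).
  - by rewrite fn abse0.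
  rewrite [X in (X < _)%E -> _](_ : _ = \int[nu]_x \int[mu]_y `|F (x, y)|)%E//.
  by apply: eq_integral => t _; apply: eq_integral => s _; rewrite /F/= normrM ger0_norm.
have E1 : (\int[mu]_s (f s)%:E = \int[(nu \x mu)%E]_p F p)%E.
  rewrite integralE [RHS]integralE; congr (_ - _)%E.
    rewrite fubini_tonelli1//; last exact: measurable_funepos.
    rewrite -[LHS](integral_chain_cons)//; last 2 first.
    - exact: measurable_funepos.
    - by rewrite funeposE/= fn maxxx.
    by rewrite Fp.
  rewrite fubini_tonelli1//; last exact: measurable_funeneg.
  rewrite -[LHS](integral_chain_cons)//; last 2 first.
  - exact: measurable_funeneg.
  - by rewrite funenegE/= fn oppr0 maxxx.
  by rewrite Fm.
rewrite /Rintegral E1 -integral21_prod_meas1//; congr fine.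
have m1 : measurable_fun setT (fun s : chain R => \int[nu]_t f (t :: s)).
  apply: (measurable_Rintegral_section nu (f := fun p : rT * chain R => f (p.1 :: p.2))).
  exact: (measurableT_comp mf (@measurable_chain_cons R)).
apply: ae_eq_integral => //.
- exact: (measurable_fubini_G (m1 := nu) (m2 := mu) iF).
- apply/measurable_EFinP; apply: measurable_funM => //; exact: (measurable_size_fun (fun n => n.+1%:R : R)).
- apply: filterS (ae_integrable2 iF) => s is_ _.
  have is' : nu.-integrable setT (fun t : rT => (f (t :: s))%:E).
    have := integrableZl measurableT (size s).+1%:R^-1 is_; apply: eq_integrable => // t _.
    by rewrite /F/= -!EFinM mulrA mulVf ?mul1r// pnatr_eq0.
  rewrite /fubini_G /F/= integralZl// EFinM; congr (_ * _)%E.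
  by rewrite /Rintegral fineK//; exact: integrable_fin_num.
Qed.

Lemma cintegral_chain_cons (f : chain R -> R[i]) : cintegrable mu f -> f [::] = 0 ->
  cintegral mu f = cintegral mu (fun s => (size s).+1%:R * cintegral nu (fun t => f (t :: s))).
Proof.
move=> [fr fi] fn; rewrite /cintegral.
under [X in _ = X +i* _]eq_Rintegral do rewrite natCE/=.
under [X in _ = _ +i* X]eq_Rintegral do rewrite natCE/=.
by congr Complex; apply: Rintegral_chain_cons => //=; rewrite fn.
Qed.

End disintegration.

Section raising.
Variable R : realType.
Local Notation rT := (measurableTypeR R).
Local Notation mu := (@chain_measure R).
Local Notation nu := (@leb_pos R).
Local Notation leb n := (leb_tuple R n).
Local Notation Re := (@complex.Re R).
Local Notation Im := (@complex.Im R).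
Implicit Types (z : R -> R[i]) (u v w h : vect R).

(* [raise z w s] is the alternating sum of [z s_i * w (s without s_i)]. *)
Fixpoint raise z w (s : seq R) : R[i] :=
  if s is t :: s' then z t * w s' - raise z (fun r => w (t :: r)) s' else 0.

Lemma raise_sum n z w (x : n.+1.-tuple rT) :
  raise z w x = \sum_(j < n.+1) (-1) ^+ j * z (tnth x j) * w (tuple_drop j x).
Proof.
elim: n w x => [|n IH] w x.
  rewrite big_ord1 expr0 mul1r; case/tupleP: x => t y.
  by rewrite [tuple_drop _ _]tuple0 [y]tuple0 /= subr0.
case/tupleP: x => t y; rewrite big_ord_recl expr0 mul1r [LHS]/= IH -sumrN.
have -> : tuple_drop ord0 [tuple of t :: y] = y :> seq R.
  by have /(congr1 (fun x : n.+2.-tuple R => behead x)) := tuple_extract0 [tuple of t :: y].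
congr (_ + _); apply: eq_bigr => j _; rewrite exprS mulN1r !mulNr.
congr (- (_ * _ * w _)).
  by rewrite tnthS.
have /(congr1 (fun x : n.+2.-tuple R => behead x)) := tuple_extractS j t y.
by rewrite /= => <-.
Qed.

Lemma raise_ext z w w' s : (forall r, size r = (size s).-1 -> w r = w' r) ->
  raise z w s = raise z w' s.
Proof.
elim: s w w' => [//|t s IH] w w' ww' /=; rewrite ww'//; congr (_ - _).
case: s IH ww' => [//|t' s] IH ww'; apply: IH => r rs; apply: ww' => /=.
by rewrite rs.
Qed.

Lemma raiseZD z a w w' s : raise z (fun r => a * w r + w' r) s = a * raise z w s + raise z w' s.
Proof.
elim: s w w' => [|t s IH] w w' /=; first by rewrite mulr0 addr0.
by rewrite (IH (fun r => w (t :: r)) (fun r => w' (t :: r))); ring.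
Qed.

Lemma raise_anticommute (z w : R -> R[i]) v s : raise z (raise w v) s + raise w (raise z v) s = 0.
Proof.
elim: s v => [|t s IH] v /=; first by rewrite addr0.
have E y x : raise y (fun r => raise x v (t :: r)) s =
    x t * raise y v s - raise y (raise x (fun r => v (t :: r))) s.
  rewrite (_ : (fun r => _) = fun r => (x t) * v r + (- raise x (fun r => v (t :: r)) r))//.
  rewrite raiseZD; congr (_ + _).
  rewrite (_ : (fun r => - _) = fun r => -1 * raise x (fun r => v (t :: r)) r + 0); last first.
    by apply/funext => r; rewrite addr0 mulN1r.
  rewrite (raiseZD _ _ _ (fun=> 0)) mulN1r (_ : raise y (fun=> 0) s = 0) ?addr0//.
  by elim: (s) => [//|t' s' IH'] /=; rewrite IH' mulr0 subr0.
rewrite !E; have := IH (fun r => v (t :: r)) => h.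
rewrite [RHS](_ : 0 = raise z (raise w (fun r => v (t :: r))) s + raise w (raise z (fun r => v (t :: r))) s)//.
by ring.
Qed.

Lemma sum_lift_perm n (f : 'S_n.+1 -> R[i]) :
  \sum_(p : 'S_n.+1) f p = \sum_(j < n.+1) \sum_(s : 'S_n) f (lift_perm ord0 j s).
Proof.
rewrite pair_bigA/= (reindex (fun q : 'I_n.+1 * 'S_n => lift_perm ord0 q.1 q.2))//.
apply: onW_bij; apply: inj_card_bij.
  move=> [j s] [j' s'] /= E.
  have jj : j = j' by rewrite -[j](lift_perm_id ord0 j s) E lift_perm_id.
  subst j'; congr (_, _); apply/permP => i; apply: (@lift_inj _ j).
  by rewrite -!(lift_perm_lift ord0) E.
by rewrite card_prod card_ord !card_Sn factS.
Qed.

Lemma antisymmetrizeE n h (x : n.-tuple R) :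
  antisymmetrize h x = n`!%:R^-1 * \sum_(p : 'S_n) (-1) ^+ p * h (permute p x).
Proof.
case: x => s /= e; have e' := eqP e; subst n.
rewrite /antisymmetrize; congr (_ * _); apply: eq_bigr => p _.
by rewrite (_ : in_tuple s = Tuple e)//; exact/val_inj.
Qed.

Definition normalized_raise z w : vect R := fun s => (size s)%:R^-1 * raise z w s.

Lemma creation_raise z w : antisym_fun w -> fock_eq (creation z w) (normalized_raise z w).
Proof.
move=> aw [|n].
  apply: aeW => x; rewrite /creation antisymmetrizeE /normalized_raise [in RHS]tuple0 mulr0.
  by rewrite big1 ?mulr0// => p _; rewrite [permute p x]tuple0 mulr0.
have : {ae leb n.+1, forall x : n.+1.-tuple rT, forall j (s : 'S_n),
    w (permute s (tuple_drop j x)) = (-1) ^+ s * w (tuple_drop j x)}.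
  apply: filter_forall => j; apply: filter_forall => s.
  exact: (ae_tuple_drop j (aw n s)).
apply: filterS => x wx; rewrite /creation antisymmetrizeE sum_lift_perm.
rewrite /normalized_raise raise_sum size_tuple.
transitivity ((n.+1)`!%:R^-1 * \sum_(j < n.+1) n`!%:R * ((-1) ^+ j * z (tnth x j) * w (tuple_drop j x))).
  congr (_ * _); apply: eq_bigr => j _.
  rewrite -card_Sn -sum1_card natr_sum mulr_suml; apply: eq_bigr => s _.
  rewrite permute_lift /= wx odd_lift_perm /= mul1r.
  rewrite signr_addb signr_odd.
  have : ((-1) ^+ s * (-1) ^+ s = 1 :> R[i]) by rewrite -signr_addb addbb.
  move: ((-1) ^+ s) ((-1) ^+ j) (z _) (w _) => a b c d aa.
  by transitivity (b * c * d * (a * a)); [ring|rewrite aa mulr1].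
rewrite -mulr_sumr mulrA; congr (_ * _).
have n0 : n`!%:R != 0 :> R[i] by rewrite pnatr_eq0 -lt0n fact_gt0.
by rewrite factS natrM invfM -mulrA mulVf// mulr1.
Qed.

Lemma cmeasurable_raise z w : cmeasurable (z : rT -> R[i]) ->
  cmeasurable (w : chain R -> R[i]) -> cmeasurable (raise z w : chain R -> R[i]).
Proof.
move=> mz /cmeasurable_level mw; apply/cmeasurable_level => -[|n].
  rewrite (_ : (fun x => _) = fun=> 0); first exact: cmeasurable_cst.
  by apply/funext => x; rewrite [x]tuple0.
under eq_fun do rewrite raise_sum.
apply: cmeasurable_sum => j; apply: cmeasurableM.
  apply: cmeasurableM; first exact: cmeasurable_cst.
  exact: (cmeasurable_comp mz (@measurable_tnth _ rT n.+1 j)).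
exact: (cmeasurable_comp (mw n) (@measurable_tuple_drop _ n j)).
Qed.

Lemma cmeasurable_size (f : nat -> R[i]) : cmeasurable (fun s : chain R => f (size s)).
Proof. by split; [exact: (measurable_size_fun (Re \o f))|exact: (measurable_size_fun (Im \o f))]. Qed.

Lemma cmeasurable_normalized_raise z w : cmeasurable (z : rT -> R[i]) ->
  cmeasurable (w : chain R -> R[i]) -> cmeasurable (normalized_raise z w : chain R -> R[i]).
Proof.
move=> mz mw; apply: cmeasurableM; first exact: (cmeasurable_size (fun n => n%:R^-1)).
exact: cmeasurable_raise.
Qed.

Lemma permute_permute n (p q : 'S_n) (x : n.-tuple R) :
  permute p (permute q x) = permute (p * q)%g x.
Proof. by apply: eq_from_tnth => i; rewrite !tnth_mktuple permM. Qed.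

Lemma antisym_antisymmetrize h : antisym_fun (antisymmetrize h).
Proof.
move=> n q; apply: aeW => x; rewrite !antisymmetrizeE mulrCA; congr (_ * _).
rewrite mulr_sumr (reindex_inj (mulIg q^-1)%g); apply: eq_bigr => p _.
rewrite permute_permute mulgVK odd_permM odd_permV signr_addb.
by rewrite mulrA [_ * (-1) ^+ q]mulrC.
Qed.

Definition homogeneous n v := forall s : seq R, size s != n -> v s = 0.

Lemma norm2_homogeneous n v : homogeneous n v ->
  norm2 v = (n`!%:R%:E * \int[leb n]_(x in [set: n.-tuple rT]) sqmod (v x))%E.
Proof.
move=> hv; rewrite /norm2 (nneseriesD1 (n := n))//; last first.
  by move=> k _; apply: mule_ge0 => //; apply: integral_ge0 => x _; rewrite sqmodE lee_fin sqn_ge0.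
rewrite eseries0 ?adde0// => k _ /= kn.
by rewrite integral0_eq ?mule0// => x _; rewrite hv ?size_tuple// sqmodE sqn0.
Qed.

End raising.

Section levels.
Variable R : realType.
Local Notation rT := (measurableTypeR R).
Local Notation mu := (@chain_measure R).
Local Notation nu := (@leb_pos R).
Local Notation leb n := (leb_tuple R n).
Local Notation Re := (@complex.Re R).
Local Notation Im := (@complex.Im R).
Implicit Types (z : R -> R[i]) (u v h : vect R).

Lemma fock_hilbert : hilbert_axioms (@fock R) (@inner R) (@fock_norm R) (@fock_eq R).
Proof.
split.
- exact: fock0.
- by move=> *; exact: fockZD.
- by move=> *; exact: innerZDr.
- by move=> *; exact: inner_conj.
- by move=> *; exact: inner_self.
- exact: fock_norm_ge0.
- by move=> *; exact: fock_eq_norm.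
- exact: fock_complete.
Qed.

Definition level n v : vect R := fun s => if size s == n then v s else 0.

Lemma level_homogeneous n v : homogeneous n (level n v).
Proof. by move=> s /negbTE; rewrite /level => ->. Qed.

Lemma homogeneous_level n v : homogeneous n v -> level n v = v.
Proof. by move=> hv; apply/funext => s; rewrite /level; case: eqP => // /eqP /hv ->. Qed.

Lemma levelE n v (x : n.-tuple R) : level n v x = v x.
Proof. by rewrite /level size_tuple eqxx. Qed.

Lemma cmeasurable_level_proj n v : cmeasurable (fun x : n.-tuple rT => v x) -> cmeasurable (level n v : chain R -> R[i]).
Proof.
move=> mv; apply/cmeasurable_level => k; have [->|kn] := eqVneq k n.
  by under eq_fun do rewrite levelE.
rewrite (_ : (fun x => _) = fun=> 0); first exact: cmeasurable_cst.
by apply/funext => x; rewrite /level size_tuple (negbTE kn).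
Qed.

Lemma fock_level n v : fock v -> fock (level n v).
Proof.
move=> [mv av n2]; split.
- by apply/cmeasurable_level; apply: cmeasurable_level_proj.
- move=> k p; have := av k p; apply: filterS => x vx.
  by rewrite /level !size_tuple; case: eqP => // _; rewrite mulr0.
- rewrite (norm2_homogeneous (@level_homogeneous n v)).
  under eq_integral do rewrite levelE.
  apply: le_lt_trans n2; rewrite /norm2 (nneseriesD1 (n := n))//.
    rewrite leeDl//; apply: nneseries_ge0 => k _ _; apply: mule_ge0 => //.
    by apply: integral_ge0 => x _; rewrite sqmodE lee_fin sqn_ge0.
  by move=> k _; apply: mule_ge0 => //; apply: integral_ge0 => x _; rewrite sqmodE lee_fin sqn_ge0.
Qed.

Lemma creation_level n z v : creation z (level n v) = level n.+1 (creation z v).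
Proof.
apply/funext => s; rewrite /level /creation /antisymmetrize; case: eqP => [sn|/eqP sn].
  congr (_ * _); apply: eq_bigr => p _; congr (_ * _).
  have := size_tuple (permute p (in_tuple s)); rewrite /tensor.
  case: (tval _) => // t s' /= ts.
  by move: ts; rewrite sn => -[->]; rewrite eqxx.
rewrite big1 ?mulr0// => p _.
have := size_tuple (permute p (in_tuple s)); rewrite /tensor.
case: (tval _) => [|t s' /= ts]; first by rewrite mulr0.
rewrite ifF ?mulr0//; apply/negbTE; apply: contra sn => /eqP <-; by rewrite ts.
Qed.

Lemma creation_nil z v : creation z v [::] = 0.
Proof.
have := antisymmetrizeE (tensor z v) ([tuple] : 0.-tuple R); rewrite big1 ?mulr0// => p _.
by rewrite [permute p _]tuple0 mulr0.
Qed.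

Lemma level0_creation z v : level 0 (creation z v) = 0.
Proof.
by apply/funext => -[|t s]; rewrite /level//= creation_nil.
Qed.

Lemma inner_level n w v : homogeneous n v -> inner w v = inner (level n w) v.
Proof.
move=> hv; have E k : inner_term w v k = inner_term (level n w) v k.
  rewrite /inner_term; congr (_ * cintegral _ _); apply/funext => x.
  rewrite /level size_tuple; case: eqP => // /eqP kn.
  by rewrite hv ?size_tuple ?mulr0.
by rewrite /inner (_ : inner_term w v = inner_term (level n w) v)//; apply/funext.
Qed.

Lemma level_inner0 u v : (forall n, inner u (level n v) = 0) -> inner u v = 0.
Proof.
move=> uv; suff E n : inner_term u v n = 0.
  have S0 (f : R[i] -> R) : f 0 = 0 -> limn (series (f \o inner_term u v)) = 0.
    move=> f0; rewrite (_ : series _ = fun=> 0) ?lim_cst//.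
    by apply/funext => k; rewrite /series/= big1// => i _; rewrite E.
  by rewrite /inner !S0.
have E k : inner_term u (level n v) k = if k == n then inner_term u v n else 0.
  rewrite /inner_term; case: eqP => [->|/eqP kn].
    by congr (_ * cintegral _ _); apply/funext => x; rewrite levelE.
  rewrite (_ : (fun x => _) = fun=> 0) ?cintegral0 ?mulr0//.
  by apply/funext => x; rewrite /level size_tuple (negbTE kn) mulr0.
have S1 (f : R[i] -> R) : f 0 = 0 -> limn (series (f \o inner_term u (level n v))) = f (inner_term u v n).
  move=> f0; apply/cvg_lim => //; apply: cvg_near_cst; exists n.+1 => // k /= nk.
  rewrite /series/= (bigD1_seq n)//=; [|by rewrite mem_index_iota|exact: iota_uniq].
  by rewrite E eqxx big1 ?addr0// => i /negbTE ni; rewrite E ni.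
have := uv n; rewrite /inner !S1//; case: (inner_term u v n) => a b /= [-> ->].
by [].
Qed.

Lemma csummable_level n v : L2v v -> csummable (leb n) (fun x : n.-tuple rT => v x).
Proof.
move=> [mv sv]; split; first by move/cmeasurable_level : mv; exact.
exact: (@integrable_level R n (fun s => sqn (v s)) sv).
Qed.

Lemma csummable_sum d (X : measurableType d) (m : {measure set X -> \bar R})
    (I : Type) (r : seq I) (a : I -> R[i]) (F : I -> X -> R[i]) :
  (forall i, csummable m (F i)) -> csummable m (fun x => \sum_(i <- r) a i * F i x).
Proof.
move=> sF; elim: r => [|i r IH].
  under eq_fun do rewrite big_nil; split; first exact: cmeasurable_cst.
  under eq_fun do rewrite sqn0; exact: (@integrable0 _ _ _ m setT).
under eq_fun do rewrite big_cons; exact: csummableZD.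
Qed.

Lemma csummable_permute n (p : 'S_n) (f : n.-tuple rT -> R[i]) :
  csummable (leb n) f -> csummable (leb n) (fun x => f (permute p x)).
Proof.
move=> [mf sf].
have mp : cmeasurable (fun x => f (permute p x)) := cmeasurable_comp mf (measurable_permute p).
split=> //; apply/(csummableP (leb n) mp).
rewrite (integral_permute p (f := fun x => sqmod (f x)))//.
- exact/(csummableP (leb n) mf).
- by move=> x; rewrite sqmodE lee_fin sqn_ge0.
- under eq_fun do rewrite sqmodE; exact/measurable_EFinP/measurable_sqn.
Qed.

Lemma csummable_antisymmetrize n h : csummable (leb n) (fun x : n.-tuple rT => h x) ->
  csummable (leb n) (fun x : n.-tuple rT => antisymmetrize h x).
Proof.
move=> sh; under eq_fun do rewrite antisymmetrizeE mulr_sumr.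
under eq_fun do under eq_bigr do rewrite mulrA.
apply: (@csummable_sum _ _ _ _ _ (fun p : 'S_n => n`!%:R^-1 * (-1) ^+ p)
  (fun (p : 'S_n) (x : n.-tuple rT) => h (permute p x))) => p.
exact: (csummable_permute p sh).
Qed.

(* Antisymmetrization is a symmetric projection fixing [v]. *)
Lemma inner_antisymmetrize h v : L2v h -> fock v -> inner (antisymmetrize h) v = inner h v.
Proof.
move=> Lh fv; have Lv := fock_L2v fv; have [_ av _] := fv.
suff E n : inner_term (antisymmetrize h) v n = inner_term h v n.
  by rewrite /inner (_ : inner_term (antisymmetrize h) v = inner_term h v)//; apply/funext.
rewrite /inner_term; congr (_ * _).
have sh := csummable_level n Lh; have sv := csummable_level n Lv.
pose F (p : 'S_n) (x : n.-tuple rT) := conjc (h (permute p x)) * v x.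
pose a (p : 'S_n) : R[i] := n`!%:R^-1 * (-1) ^+ p.
have iF p : cintegrable (leb n) (F p).
  by apply: csummable_dot => //; exact: (csummable_permute p sh).
have EF p : cintegral (leb n) (F p) = (-1) ^+ p * cintegral (leb n) (fun x : n.-tuple rT => conjc (h x) * v x).
  have ig : cintegrable (leb n) (fun x : n.-tuple rT => conjc (h x) * v x) by exact: csummable_dot.
  have mg : cmeasurable (fun x : n.-tuple rT => conjc (h x) * v x).
    by apply: cmeasurableM; [exact/cmeasurable_conj/sh.1|exact: sv.1].
  transitivity (cintegral (leb n) (fun x : n.-tuple rT => (-1) ^+ p * (conjc (h (permute p x)) * v (permute p x)) + 0)).
    apply: ae_eq_cintegral.
    - by apply: cmeasurableM; [exact/cmeasurable_conj/(csummable_permute p sh).1|exact: sv.1].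
    - apply: cmeasurableD; last exact: cmeasurable_cst.
      apply: cmeasurableM; first exact: cmeasurable_cst.
      exact: (cmeasurable_comp mg (measurable_permute p)).
    - apply: filterS (av n p) => x ->; rewrite /F addr0.
      have : ((-1) ^+ p * (-1) ^+ p = 1 :> R[i]) by rewrite -signr_addb addbb.
      move: ((-1) ^+ p) (conjc _) (v x) => b c d bb.
      by transitivity ((b * b) * (c * d)); [rewrite bb mul1r|ring].
  have ip : cintegrable (leb n) (fun x : n.-tuple rT => conjc (h (permute p x)) * v (permute p x)).
    by apply: csummable_dot; [exact: (csummable_permute p sh)|exact: (csummable_permute p sv)].
  rewrite cintegralZD//; last exact: cintegrable0.
  rewrite cintegral0 addr0; congr (_ * _).
  apply: (@cintegral_invariant _ _ _ (leb n) (permute p) (fun x : n.-tuple rT => conjc (h x) * v x)) => //.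
  by move=> k k0 mk; exact: integral_permute.
have -> : (fun x : n.-tuple rT => conjc (antisymmetrize h x) * v x) =
    (fun x => \sum_(p : 'S_n) a p * F p x).
  apply/funext => x; rewrite antisymmetrizeE rmorphM rmorph_sum/= mulr_sumr mulr_suml.
  apply: eq_bigr => p _; rewrite rmorphM /a /F fmorphV rmorph_nat rmorphXn rmorphN1.
  by rewrite !mulrA.
rewrite (cintegral_sum _ _ iF).2; under eq_bigr do rewrite EF mulrA.
rewrite -mulr_suml (_ : \sum_i _ = 1) ?mul1r// /a.
under eq_bigr do rewrite -mulrA -signr_addb addbb expr0 mulr1.
by rewrite sumr_const card_Sn -[LHS]mulr_natr mulVf.
Qed.

Lemma fock_antisymmetrize n h : L2v h -> homogeneous n h -> fock (antisymmetrize h).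
Proof.
move=> Lh hh; have hA : homogeneous n (antisymmetrize h).
  move=> s sn; rewrite /antisymmetrize big1 ?mulr0// => p _.
  by rewrite hh ?mulr0// size_tuple.
split; last first.
- have [mA sA] := csummable_antisymmetrize (csummable_level n Lh).
  rewrite (norm2_homogeneous hA); have := (csummableP _ mA).2 sA.
  by move=> h1; rewrite lte_mul_pinfty.
- exact: antisym_antisymmetrize.
- by move=> k; exact: (csummable_antisymmetrize (csummable_level k Lh)).1.
Qed.

End levels.

Section lowering.
Variable R : realType.
Local Notation rT := (measurableTypeR R).
Local Notation mu := (@chain_measure R).
Local Notation nu := (@leb_pos R).
Local Notation leb n := (leb_tuple R n).
Local Notation Re := (@complex.Re R).
Local Notation Im := (@complex.Im R).
Implicit Types (z : R -> R[i]) (u v h : vect R).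

Definition lower z v : vect R := fun s =>
  (size s).+1%:R * cintegral nu (fun t => conjc (z t) * v (t :: s)).

Definition norm2_pos z : R := \int[nu]_t sqn (z t).

Lemma L2_posP z : L2_pos z <-> csummable nu (z : rT -> R[i]).
Proof.
split=> [[mz sz]|[mz sz]]; first by split => //; exact/(csummableP nu mz).
by split => //; exact/(csummableP nu mz).
Qed.

Lemma norm2_pos_ge0 z : 0 <= norm2_pos z.
Proof. by apply: Rintegral_ge0 => t _; exact: sqn_ge0. Qed.

Lemma norm2_posE z : L2_pos z -> (\int[nu]_t sqmod (z t))%E = (norm2_pos z)%:E.
Proof.
move=> /L2_posP[mz sz]; rewrite /norm2_pos /Rintegral fineK; last exact: integrable_fin_num.
by apply: eq_integral => t _; rewrite sqmodE.
Qed.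

Lemma cmeasurable_cons v : cmeasurable (v : chain R -> R[i]) ->
  cmeasurable (fun p : rT * chain R => v (p.1 :: p.2)).
Proof. by move=> mv; exact: (cmeasurable_comp mv (@measurable_chain_cons R)). Qed.

Lemma cmeasurable_section v (s : chain R) : cmeasurable (v : chain R -> R[i]) ->
  cmeasurable (fun t : rT => v (t :: s)).
Proof. by move=> mv; exact: (cmeasurable_comp (cmeasurable_cons mv) (measurable_pair2 s)). Qed.

Lemma cmeasurable_nat : cmeasurable (fun s : chain R => (size s).+1%:R : R[i]).
Proof. exact: (cmeasurable_size (fun n => n.+1%:R)). Qed.

Lemma cmeasurable_lower z v : cmeasurable (z : rT -> R[i]) ->
  cmeasurable (v : chain R -> R[i]) -> cmeasurable (lower z v : chain R -> R[i]).
Proof.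
move=> mz mv; apply: cmeasurableM; first exact: cmeasurable_nat.
apply: (cmeasurable_integral_section nu (f := fun p : rT * chain R => conjc (z p.1) * v (p.1 :: p.2))).
apply: cmeasurableM; last exact: cmeasurable_cons.
exact/cmeasurable_conj/(cmeasurable_comp mz measurable_fst).
Qed.

Lemma cintegralZ d (X : measurableType d) (m : {measure set X -> \bar R}) a (f : X -> R[i]) :
  cintegrable m f -> cintegral m (fun x => a * f x) = a * cintegral m f.
Proof.
move=> i; rewrite -[RHS]addr0 -[X in _ + X](cintegral0 m) -cintegralZD//; last exact: cintegrable0.
by congr cintegral; apply/funext => x; rewrite addr0.
Qed.

Lemma conj0M (c : R[i]) : conjc 0 * c = 0. Proof. by rewrite conjc0 mul0r. Qed.

Lemma measurable_sqn_e d (X : measurableType d) (f : X -> R[i]) : cmeasurable f ->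
  measurable_fun setT (fun x => (sqn (f x))%:E).
Proof. by move=> mf; exact/measurable_EFinP/measurable_sqn. Qed.

Lemma integral_sqn_cons (f : nat -> R) v : (forall n, 0 <= f n) -> f 0%N = 0 ->
  cmeasurable (v : chain R -> R[i]) ->
  (\int[mu]_s ((size s).+1%:R%:E * \int[nu]_t (f (size s).+1 * sqn (v (t :: s)))%:E) =
   \int[mu]_s (f (size s) * sqn (v s))%:E)%E.
Proof.
move=> f0 fn mv.
rewrite -(integral_chain_cons_swap (f := fun s => (f (size s) * sqn (v s))%:E))//.
- by move=> s; rewrite lee_fin mulr_ge0 ?sqn_ge0.
- apply/measurable_EFinP; apply: measurable_funM; last exact: measurable_sqn.
  exact: (measurable_size_fun f).
- by rewrite /= fn mul0r.
Qed.

Lemma ae_section v : L2v v -> {ae mu, forall s, csummable nu (fun t : rT => v (t :: s))}.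
Proof.
move=> [mv /integrableP[_ sv]].
pose f (n : nat) : R := (0 < n)%:R.
have f0 n : 0 <= f n by exact: ler0n.
have E := integral_sqn_cons f0 (erefl : f 0%N = 0) mv.
pose I (s : chain R) := ((size s).+1%:R%:E * \int[nu]_t (sqn (v (t :: s)))%:E)%E.
have I0 s : (0 <= I s)%E.
  by apply: mule_ge0 => //; apply: integral_ge0 => t _; rewrite lee_fin sqn_ge0.
have mI : measurable_fun setT I.
  apply: emeasurable_funM.
    by apply/measurable_EFinP; exact: (measurable_size_fun (fun n => n.+1%:R : R)).
  apply: (measurable_fun_fubini_tonelli_G (m1 := nu) (fun p : rT * chain R => (sqn (v (p.1 :: p.2)))%:E)).
    exact: (measurable_sqn_e (cmeasurable_cons mv)).
  by move=> p; rewrite lee_fin sqn_ge0.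
have iI : mu.-integrable setT I.
  apply/integrableP; split => //; under eq_integral do rewrite gee0_abs//.
  have -> : (\int[mu]_s I s = \int[mu]_s (f (size s) * sqn (v s))%:E)%E.
    rewrite -E; apply: eq_integral => s _; congr (_ * _)%E; apply: eq_integral => t _.
    by rewrite /f mul1r.
  apply: le_lt_trans sv; apply: ge0_le_integral => //.
  - by move=> s _; rewrite lee_fin mulr_ge0 ?sqn_ge0.
  - apply/measurable_EFinP; apply: measurable_funM; last exact: measurable_sqn.
    exact: (measurable_size_fun f).
  - exact: (measurableT_comp (@abse_measurable R setT) (measurable_sqn_e mv)).
  - move=> s _; rewrite lee_fin ger0_norm ?sqn_ge0//.
    by rewrite /f; case: (_ < _)%N; rewrite ?mul1r ?mul0r ?sqn_ge0.
have := integrable_ae measurableT iI; apply: filterS => s /(_ Logic.I) Is.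
have ms := cmeasurable_section s mv.
split => //; apply/(csummableP nu ms).
rewrite (_ : (\int[nu]_x sqmod (v (x :: s)) = \int[nu]_t (sqn (v (t :: s)))%:E)%E); last first.
  by apply: eq_integral => t _; rewrite sqmodE.
rewrite ltey; apply/negP => /eqP oo; move: Is; rewrite /I oo gt0_muley//.
Qed.

Lemma lower_nil0 z v : homogeneous 0 v -> lower z v = 0.
Proof.
move=> hv; apply/funext => s; rewrite /lower.
rewrite (_ : (fun t => _) = fun=> 0) ?cintegral0 ?mulr0//.
by apply/funext => t; rewrite hv ?mulr0.
Qed.

Lemma lower_homogeneous n z v : homogeneous n.+1 v -> homogeneous n (lower z v).
Proof.
move=> hv s sn; rewrite /lower (_ : (fun t => _) = fun=> 0) ?cintegral0 ?mulr0//.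
by apply/funext => t; rewrite hv ?mulr0.
Qed.

Lemma lower_ext z v v' : cmeasurable (z : rT -> R[i]) ->
  cmeasurable (v : chain R -> R[i]) -> cmeasurable (v' : chain R -> R[i]) ->
  fock_eq v v' -> fock_eq (lower z v) (lower z v').
Proof.
move=> mz mv mv' /fock_eq_ae /ae_chain_cons_both[_ vv]; apply/fock_eq_ae.
apply: filterS vv => s vs; rewrite /lower; congr (_ * _).
apply: ae_eq_cintegral.
- by apply: cmeasurableM; [exact: cmeasurable_conj|exact: cmeasurable_section].
- by apply: cmeasurableM; [exact: cmeasurable_conj|exact: cmeasurable_section].
- by apply: filterS vs => t ->.
Qed.

Lemma sqn_nat n (c : R[i]) : sqn (n%:R * c) = n%:R ^+ 2 * sqn c.
Proof. by rewrite natCE /sqn/=; case: c => x y /=; ring. Qed.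

Lemma lower_L2v n z v : L2_pos z -> L2v v -> homogeneous n.+1 v -> L2v (lower z v).
Proof.
move=> /L2_posP sz Lv hv; have [mv sv] := Lv; have mz := sz.1.
have ml := cmeasurable_lower mz mv.
split => //; apply/(csummableP mu ml); set Z := norm2_pos z.
have Z0 : 0 <= Z := norm2_pos_ge0 z.
pose J (s : chain R) := ((size s).+1%:R%:E * \int[nu]_t ((size s).+1%:R * sqn (v (t :: s)))%:E)%E.
have J0 s : (0 <= J s)%E.
  by apply: mule_ge0 => //; apply: integral_ge0 => t _; rewrite lee_fin mulr_ge0 ?sqn_ge0.
have mJ : measurable_fun setT J.
  apply: emeasurable_funM.
    by apply/measurable_EFinP; exact: (measurable_size_fun (fun n => n.+1%:R : R)).
  apply: (measurable_fun_fubini_tonelli_G (m1 := nu) (fun p : rT * chain R => ((size p.2).+1%:R * sqn (v (p.1 :: p.2)))%:E)).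
    apply/measurable_EFinP; apply: measurable_funM.
      exact: (measurableT_comp (measurable_size_fun (fun n => n.+1%:R : R)) measurable_snd).
    exact: (measurable_sqn (cmeasurable_cons mv)).
  by move=> p; rewrite lee_fin mulr_ge0 ?sqn_ge0.
apply: (@le_lt_trans _ _ (\int[mu]_s (Z%:E * J s))%E).
  apply: ae_ge0_le_integral => //.
  - by move=> s _; rewrite sqmodE lee_fin sqn_ge0.
  - by under eq_fun do rewrite sqmodE; exact: measurable_sqn_e.
  - by move=> s _; rewrite mule_ge0.
  - exact: measurable_funeM.
  - apply: filterS (ae_section Lv) => s ss _.
    rewrite sqmodE /lower sqn_nat /J.
    have := cdot_CauchySchwarz sz ss; rewrite /cdot -/Z => CS.
    have -> : (\int[nu]_t ((size s).+1%:R * sqn (v (t :: s)))%:E)%E =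
        ((size s).+1%:R * \int[nu]_t sqn (v (t :: s)))%:E.
      rewrite /Rintegral EFinM fineK; last exact: (integrable_fin_num _ ss.2).
      by rewrite -integralZl//; exact: ss.2.
    rewrite -!EFinM lee_fin.
    have k0 : 0 <= (size s).+1%:R ^+ 2 :> R by exact: sqr_ge0.
    apply: le_trans (ler_wpM2l k0 CS) _; rewrite le_eqVlt; apply/orP; left; apply/eqP.
    by rewrite -[\int[nu]_x sqn (z x)]/Z; ring.
rewrite ge0_integralZl_EFin// lte_mul_pinfty//.
have f0 k : 0 <= k%:R :> R by exact: ler0n.
rewrite (integral_sqn_cons f0 erefl mv).
apply: (@le_lt_trans _ _ (\int[mu]_s (n.+1%:R%:E * (sqn (v s))%:E))%E).
  apply: ge0_le_integral => //.
  - by move=> s _; rewrite lee_fin mulr_ge0 ?sqn_ge0.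
  - apply/measurable_EFinP; apply: measurable_funM; last exact: measurable_sqn.
    exact: (measurable_size_fun (fun k => k%:R : R)).
  - by apply: measurable_funeM; exact: measurable_sqn_e.
  - move=> s _; have [->|sn] := eqVneq (size s) n.+1; first by rewrite EFinM.
    by rewrite hv// sqn0 mulr0 mule0.
have nu_ := (csummableP mu mv).2 sv.
rewrite ge0_integralZl_EFin//; last exact: measurable_sqn_e.
  rewrite lte_mul_pinfty//.
  by rewrite (_ : (\int[mu]_x (sqn (v x))%:E)%E = (\int[mu]_x sqmod (v x))%E)//;
    apply: eq_integral => s _; rewrite sqmodE.
by move=> s _; rewrite lee_fin sqn_ge0.
Qed.

Lemma lower_antisym z v : L2_pos z -> fock v -> antisym_fun (lower z v).
Proof.
move=> /L2_posP sz fv; have Lv := fock_L2v fv; have [_ av _] := fv.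
have mz := sz.1; have mv := Lv.1; move=> n p.
have : {ae mu, forall s : chain R, size s = n.+1 ->
   v (permute (lift_perm ord0 ord0 p) (to_tuple n.+1 s)) = (-1) ^+ p * v s}.
  apply/ae_chainP => k; have [->|kn] := eqVneq k n.+1; last first.
    by apply: aeW => x /=; rewrite size_tuple => /eqP; rewrite (negbTE kn).
  have := av n.+1 (lift_perm ord0 ord0 p); apply: filterS => x vx _.
  by rewrite to_tupleK vx odd_lift_perm.
move=> /ae_chain_cons_both[_ /ae_chainP/(_ n)].
have /ae_chainP/(_ n) := ae_section Lv; apply: filterS2 => x sx vx.
rewrite /lower size_tuple [size x]size_tuple mulrCA; congr (_ * _).
have my : cmeasurable (fun t : rT => conjc (z t) * v (t :: x)).
  by apply: cmeasurableM; [exact: cmeasurable_conj|exact: cmeasurable_section].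
transitivity (cintegral nu (fun t => (-1) ^+ p * (conjc (z t) * v (t :: x)))).
  apply: ae_eq_cintegral.
  - by apply: cmeasurableM; [exact: cmeasurable_conj|exact: cmeasurable_section].
  - by apply: cmeasurableM => //; exact: cmeasurable_cst.
  - apply: filterS vx => t vt; rewrite mulrCA; congr (_ * _).
    have := vt; rewrite /tchain/= size_tuple => /(_ erefl) <-; congr v.
    rewrite (_ : to_tuple n.+1 (t :: x) = pair_cons (t, x)); last exact: (to_tupleK (pair_cons (t, x))).
    have E := congr1 (@tval _ _) (permute_lift ord0 p (pair_cons (t, x))).
    apply: etrans (esym E) => /=; congr (_ :: map _ _).
    by apply/funext => i; rewrite tnth_mktuple tnthS.
by apply: cintegralZ; exact: csummable_dot.
Qed.

Lemma lower_fock n z v : L2_pos z -> fock v -> homogeneous n.+1 v -> fock (lower z v).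
Proof.
move=> Lz fv hv; apply/fockP; split; first exact: (lower_L2v Lz (fock_L2v fv) hv).
exact: lower_antisym.
Qed.

Lemma tensor_homogeneous n z u : homogeneous n u -> homogeneous n.+1 (tensor z u).
Proof. by move=> hu [//|t s] /= sn; rewrite hu ?mulr0. Qed.

Lemma cmeasurable_tensor z u : cmeasurable (z : rT -> R[i]) ->
  cmeasurable (u : chain R -> R[i]) -> cmeasurable (tensor z u : chain R -> R[i]).
Proof.
move=> mz /cmeasurable_level mu_; apply/cmeasurable_level => -[|n].
  rewrite (_ : (fun x => _) = fun=> 0); first exact: cmeasurable_cst.
  by apply/funext => x; rewrite [x]tuple0.
rewrite (_ : (fun x => _) = fun x : n.+1.-tuple rT => z (tnth x ord0) * u [tuple of behead x]).
  apply: cmeasurableM; first exact: (cmeasurable_comp mz (@measurable_tnth _ rT n.+1 ord0)).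
  exact: (cmeasurable_comp (mu_ n) (@measurable_behead _ rT n)).
by apply/funext => x; case/tupleP: x => t y /=.
Qed.

Lemma tensor_L2v n z u : L2_pos z -> L2v u -> homogeneous n u -> L2v (tensor z u).
Proof.
move=> Lz [mu_ su] hu; have [mz sz] := (L2_posP z).1 Lz.
have mt := cmeasurable_tensor mz mu_; split => //; apply/(csummableP mu mt).
rewrite -(integral_chain_cons_swap (f := fun s => sqmod (tensor z u s))).
- apply: (@le_lt_trans _ _ (\int[mu]_s ((n.+1%:R * norm2_pos z)%:E * sqmod (u s)))%E).
    apply: ge0_le_integral => //.
    + by move=> s _; apply: mule_ge0 => //; apply: integral_ge0 => t _; rewrite sqmodE lee_fin sqn_ge0.
    + apply: emeasurable_funM.
        by apply/measurable_EFinP; exact: (measurable_size_fun (fun n => n.+1%:R : R)).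
      apply: (measurable_fun_fubini_tonelli_G (m1 := nu) (fun p : rT * chain R => sqmod (tensor z u (p.1 :: p.2)))).
        under eq_fun do rewrite sqmodE; exact: (measurable_sqn_e (cmeasurable_cons mt)).
      by move=> p; rewrite sqmodE lee_fin sqn_ge0.
    + by apply: measurable_funeM; under eq_fun do rewrite sqmodE; exact: measurable_sqn_e.
    + move=> s _; have [sn|sn] := eqVneq (size s) n; last first.
        rewrite hu// [X in (_ * X)%E]integral0_eq ?mule0 ?sqmodE ?sqn0 ?mule0//.
        by move=> t _; rewrite /tensor hu// mulr0 sqmodE sqn0.
      rewrite sn EFinM -muleA; apply: lee_wpmul2l => //.
      rewrite -norm2_posE// -ge0_integralZr//; last 3 first.
      * by under eq_fun do rewrite sqmodE; exact: measurable_sqn_e.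
      * by move=> t _; rewrite sqmodE lee_fin sqn_ge0.
      * by rewrite sqmodE lee_fin sqn_ge0.
      rewrite le_eqVlt; apply/orP; left; apply/eqP; apply: eq_integral => t _.
      by rewrite !sqmodE -EFinM -sqnM.
  have := (csummableP mu mu_).2 su => uoo.
  rewrite ge0_integralZl_EFin//.
  + by rewrite lte_mul_pinfty// lee_fin mulr_ge0// norm2_pos_ge0.
  + by move=> s _; rewrite sqmodE lee_fin sqn_ge0.
  + by under eq_fun do rewrite sqmodE; exact: measurable_sqn_e.
  + by rewrite mulr_ge0// norm2_pos_ge0.
- by move=> s; rewrite sqmodE lee_fin sqn_ge0.
- by under eq_fun do rewrite sqmodE; exact: measurable_sqn_e.
- by rewrite /= sqmodE sqn0.
Qed.

Lemma creation_adjoint_homogeneous n z u v : L2_pos z -> fock u -> homogeneous n u ->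
  fock v -> homogeneous n.+1 v -> inner (creation z u) v = inner u (lower z v).
Proof.
move=> Lz fu hu fv hv; have Lu := fock_L2v fu; have Lv := fock_L2v fv.
have Lt := tensor_L2v Lz Lu hu; have Ll := lower_L2v Lz Lv hv.
have sz := (L2_posP z).1 Lz.
rewrite (inner_antisymmetrize Lt fv) (innerE Lt Lv) (innerE Lu Ll) /cdot.
rewrite cintegral_chain_cons; [|exact: csummable_dot|exact: conj0M].
apply: ae_eq_cintegral.
- apply: cmeasurableM; first exact: cmeasurable_nat.
  apply: (cmeasurable_integral_section nu (f := fun p : rT * chain R => conjc (tensor z u (p.1 :: p.2)) * v (p.1 :: p.2))).
  apply: cmeasurableM; last exact: (cmeasurable_cons Lv.1).
  exact/cmeasurable_conj/(cmeasurable_cons Lt.1).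
- by apply: cmeasurableM; [exact: cmeasurable_conj Lu.1|exact: Ll.1].
- apply: filterS (ae_section Lv) => s ss; rewrite /lower mulrCA; congr (_ * _).
  rewrite -cintegralZ; last exact: csummable_dot.
  by congr cintegral; apply/funext => t; rewrite /tensor rmorphM/=; ring.
Qed.

Lemma creation_adjoint n z u v : L2_pos z -> fock u ->
  fock v -> homogeneous n.+1 v -> inner (creation z u) v = inner u (lower z v).
Proof.
move=> Lz fu fv hv; rewrite (inner_level _ hv) -creation_level.
rewrite (inner_level u (@lower_homogeneous n z v hv)).
exact: (creation_adjoint_homogeneous Lz (fock_level n fu) (@level_homogeneous _ n u) fv hv).
Qed.

Definition dot_pos (z w : R -> R[i]) : R[i] := cdot nu (z : rT -> R[i]) (w : rT -> R[i]).

Lemma anticommutator_pointwise (z w : R -> R[i]) v : L2_pos z -> L2_pos w -> fock v ->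
  {ae mu, forall s, lower z (normalized_raise w v) s + normalized_raise w (lower z v) s =
    dot_pos z w * v s}.
Proof.
move=> /L2_posP sz /L2_posP sw fv; have Lv := fock_L2v fv.
have izw := csummable_dot sz sw.
apply/ae_chainP => -[|n].
  apply: aeW => x; rewrite /tchain [x]tuple0 /lower /normalized_raise /= mulr0 addr0 mul1r.
  rewrite /dot_pos /cdot -[RHS]mulrC -cintegralZ//; congr cintegral; apply/funext => t.
  by rewrite invr1 mul1r subr0; ring.
have a1 : {ae leb n.+1, forall x : n.+1.-tuple rT, forall j : 'I_n.+1,
    csummable nu (fun t : rT => v (t :: tuple_drop j x))}.
  apply: filter_forall => j.
  have /ae_chainP/(_ n) h := ae_section Lv.
  exact: (ae_tuple_drop j h).
apply: filterS a1 => x sx; rewrite /tchain /normalized_raise raise_sum size_tuple.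
rewrite {1}/lower size_tuple.
pose F (j : 'I_n.+1) (t : rT) := conjc (z t) * v (t :: tuple_drop j x).
pose a (j : 'I_n.+1) : R[i] := - ((-1) ^+ j * w (tnth x j)).
have iF j : cintegrable nu (F j) by exact: csummable_dot.
have n0 : n.+2%:R != 0 :> R[i] by rewrite pnatr_eq0.
have n1 : n.+1%:R != 0 :> R[i] by rewrite pnatr_eq0.
have -> : (fun t : rT => conjc (z t) * ((size (t :: x))%:R^-1 * raise w v (t :: x))) =
    (fun t => n.+2%:R^-1 * (v x * (conjc (z t) * w t) + \sum_(j < n.+1) a j * F j t)).
  apply/funext => t; rewrite /= size_tuple (raise_sum w (fun r => v (t :: r)) x).
  rewrite mulrCA; congr (_ * _).
  rewrite mulrBr mulr_sumr -sumrN; congr (_ + _); first by ring.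
  by apply: eq_bigr => j _; rewrite /a /F; ring.
have [iS ES] := cintegral_sum (index_enum _) a iF.
rewrite cintegralZ; last exact: cintegrableZD.
rewrite mulrA divff// mul1r cintegralZD// ES.
transitivity (v x * dot_pos z w + 0); last by rewrite addr0 mulrC.
rewrite -addrA; congr (_ + _).
rewrite mulr_sumr -big_split/= big1// => j _.
rewrite /lower (size_tuple (tuple_drop j x)) -/(F j) /a.
move: (cintegral nu (F j)) ((-1) ^+ j) (w _) n1 => b c d; move: (n.+1%:R) => k k0.
have -> : - (c * d) * b + k^-1 * (c * d * (k * b)) = c * d * b * (k^-1 * k - 1) by ring.
by rewrite mulVf// subrr mulr0.
Qed.

Lemma creation_fock n z u : L2_pos z -> fock u -> homogeneous n u -> fock (creation z u).
Proof.
move=> Lz fu hu; apply: (fock_antisymmetrize (n := n.+1)); last exact: tensor_homogeneous.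
exact: (tensor_L2v Lz (fock_L2v fu) hu).
Qed.

Lemma creation_homogeneous n z u : homogeneous n u -> homogeneous n.+1 (creation z u).
Proof.
move=> hu; rewrite -(homogeneous_level hu) creation_level; exact: level_homogeneous.
Qed.

Lemma anticommutator_homogeneous n (z w : R -> R[i]) v : L2_pos z -> L2_pos w ->
  fock v -> homogeneous n.+1 v ->
  fock_eq (lower z (creation w v)) (dot_pos z w *: v - creation w (lower z v)).
Proof.
move=> Lz Lw fv hv; have Lv := fock_L2v fv; have mz := ((L2_posP z).1 Lz).1.
have mw := ((L2_posP w).1 Lw).1.
have fc := creation_fock Lw fv hv; have fl := lower_fock Lz fv hv.
have E1 : fock_eq (lower z (creation w v)) (lower z (normalized_raise w v)).
  apply: lower_ext => //; first exact: (fock_L2v fc).1.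
    exact: cmeasurable_normalized_raise mw Lv.1.
  by apply: creation_raise; case: fv.
have /fock_eq_ae E2 : fock_eq (creation w (lower z v)) (normalized_raise w (lower z v)).
  by apply: creation_raise; case: fl.
apply/fock_eq_ae; move/fock_eq_ae : E1 => E1.
have E3 := anticommutator_pointwise Lz Lw fv.
apply: filterS3 E1 E2 E3 => s e1 e2 e3.
change (lower z (creation w v) s = dot_pos z w * v s - creation w (lower z v) s).
by rewrite e1 e2 -e3 addrK.
Qed.

Lemma raise0 (w : R -> R[i]) (s : seq R) : raise w (0 : vect R) s = 0.
Proof.
elim: s => [//|t s IH]; change (w t * (0 : R[i]) - raise w (0 : vect R) s = 0).
by rewrite IH mulr0 subr0.
Qed.

Lemma lower_creation0 (z w : R -> R[i]) v : L2_pos z -> L2_pos w ->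
  fock v -> homogeneous 0 v -> fock_eq (lower z (creation w v)) (dot_pos z w *: v).
Proof.
move=> Lz Lw fv hv; have Lv := fock_L2v fv; have mz := ((L2_posP z).1 Lz).1.
have mw := ((L2_posP w).1 Lw).1.
have fc := creation_fock Lw fv hv.
have E1 : fock_eq (lower z (creation w v)) (lower z (normalized_raise w v)).
  apply: lower_ext => //; first exact: (fock_L2v fc).1.
    exact: cmeasurable_normalized_raise mw Lv.1.
  by apply: creation_raise; case: fv.
apply/fock_eq_ae; move/fock_eq_ae : E1 => E1.
have E3 := anticommutator_pointwise Lz Lw fv.
apply: filterS2 E1 E3 => s e1 e3.
rewrite e1 -[RHS]e3 (lower_nil0 z hv) (_ : normalized_raise w 0 s = 0) ?addr0//.
by rewrite /normalized_raise raise0 mulr0.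
Qed.

End lowering.

(* A fermionic field [c + c^*] commutes with its right version [Rz], which is
   twisted by the parity [P]; both create the same vector from the vacuum. *)
Section anticommutation.
Variables (R : realType) (V : lmodType R[i]) (H : V -> Prop).
Variables (ip : V -> V -> R[i]) (nm : V -> R) (eqv : V -> V -> Prop).
Implicit Types (u v w : V).
Hypothesis ax : hilbert_axioms H ip nm eqv.
Local Notation hbd := (hbounded H nm eqv).
Let HB := HB ax.
Let HD := HD ax.
Let HZ := HZ ax.
Let ip_conj := hilb_ip_conj ax.

Variables (Z : Type) (star : Z -> Z) (c : Z -> V -> V) (d : Z -> Z -> R[i]) (P : V -> V) (Om : V).
Local Notation a := (fun z => hadjoint H ip (c z)).
Hypothesis starK : involutive star.
Hypothesis bc : forall z, hbd (c z).
Hypothesis cc : forall (z w : Z) u v, H u -> H v -> ip u (c z (c w v)) = - ip u (c w (c z v)).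
Hypothesis ac : forall (z w : Z) u v, H u -> H v ->
  ip u (a z (c w v)) + ip u (c w (a z v)) = d z w * ip u v.
Hypothesis dstar : forall z w : Z, d (star z) w = d (star w) z.
Hypothesis HOm : H Om.
Hypothesis aOm : forall z u, H u -> ip u (a z Om) = 0.
Hypothesis bP : hbd P.
Hypothesis PP : forall u, H u -> eqv (P (P u)) u.
Hypothesis Psa : forall u v, H u -> H v -> ip (P u) v = ip u (P v).
Hypothesis POm : eqv (P Om) Om.
Hypothesis Pc : forall z u v, H u -> H v -> ip u (P (c z v)) = - ip u (c z (P v)).

Let ba z : hbd (a z). Proof. exact: (hbounded_adj ax). Qed.
Let Hc z u : H u -> H (c z u). Proof. by move=> Hu; exact: (hbounded_H (bc z)). Qed.
Let Ha z u : H u -> H (a z u). Proof. by move=> Hu; exact: (hbounded_H (ba z)). Qed.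
Let HP u : H u -> H (P u). Proof. by move=> Hu; exact: (hbounded_H bP). Qed.

Definition right_field z u : V := -1 *: a (star z) (P u) + c z (P u).
Definition left_field z u : V := c z u + a (star z) u.

Lemma right_field_bounded z : hbd (right_field z).
Proof. by apply: (hbounded_ZD ax (-1)); apply: (hbounded_comp ax). Qed.

Lemma left_field_bounded z : hbd (left_field z).
Proof.
have := hbounded_ZD ax 1 (bc z) (ba (star z)).
by rewrite (_ : (fun u => _) = left_field z)//; apply/funext => u; rewrite scale1r.
Qed.

Let HR z u : H u -> H (right_field z u).
Proof. by move=> Hu; exact: (hbounded_H (right_field_bounded z)). Qed.
Let HL z u : H u -> H (left_field z u).
Proof. by move=> Hu; exact: (hbounded_H (left_field_bounded z)). Qed.

Lemma ip_right_field z u v : H u -> H v ->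
  ip u (right_field z v) = ip u (c z (P v)) - ip u (a (star z) (P v)).
Proof.
move=> Hu Hv; have h1 := Ha (star z) (HP Hv); have h2 := Hc z (HP Hv).
by rewrite (hilb_ipZDr ax)//; ring.
Qed.

Lemma ip_left_field z u v : H u -> H v ->
  ip u (left_field z v) = ip u (c z v) + ip u (a (star z) v).
Proof. by move=> Hu Hv; rewrite (ipDr ax)//; [exact: Hc|exact: Ha]. Qed.

Lemma ip_c z u v : H u -> H v -> ip (c z u) v = ip u (a z v).
Proof. by move=> Hu Hv; rewrite (adjr ax). Qed.

Lemma ip_a z u v : H u -> H v -> ip (a z u) v = ip u (c z v).
Proof. by move=> Hu Hv; rewrite (adjl ax). Qed.

Lemma Pa z u v : H u -> H v -> ip u (P (a z v)) = - ip u (a z (P v)).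
Proof.
move=> Hu Hv; have h1 := Ha z Hv; have h2 := HP Hv; have h3 := HP Hu.
rewrite -Psa// -ip_c// -ip_c//.
have hc := Hc z Hu; have hcP := Hc z h3; have hPc := HP hc.
rewrite -(Psa hc Hv) (ip_conj Hv hcP) (ip_conj Hv hPc) Pc// rmorphN/=.
by rewrite opprK.
Qed.

Lemma right_field_star z u v : H u -> H v ->
  ip (right_field z u) v = ip u (right_field (star z) v).
Proof.
move=> Hu Hv; have h1 := HP Hu; have h2 := HP Hv.
have h3 := Ha (star z) h1; have h4 := Hc z h1.
rewrite ip_right_field// starK (ipZDl ax)// ip_a// ip_c//.
have h5 := Hc (star z) Hv; have h6 := Ha z Hv.
by rewrite !Psa// Pc// Pa// rmorphN rmorph1; ring.
Qed.

Lemma aa (z w : Z) u v : H u -> H v -> ip u (a z (a w v)) = - ip u (a w (a z v)).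
Proof.
move=> Hu Hv; have h1 := Hc w (Hc z Hu); have h2 := Hc z (Hc w Hu).
rewrite -!ip_c//; try exact: Hc; try exact: Ha.
by rewrite (ip_conj Hv h1) (ip_conj Hv h2) cc// rmorphN.
Qed.

Lemma field_anticommute (z w : Z) u v : H u -> H v ->
  ip u (c z (left_field w v)) - ip u (a (star z) (left_field w v)) =
  - (ip u (left_field w (c z v)) - ip u (left_field w (a (star z) v))).
Proof.
move=> Hu Hv; have h1 := Hc w Hv; have h2 := Ha (star w) Hv.
have h3 := Hc z Hv; have h4 := Ha (star z) Hv.
rewrite !ip_left_field// !(op_D ax (bc z))// !(op_D ax (ba (star z)))//.
have e1 := cc z w Hu Hv; have e2 := aa (star z) (star w) Hu Hv.
have e3 := ac (star z) w Hu Hv; have e4 := ac (star w) z Hu Hv.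
rewrite dstar in e3; rewrite e1 e2.
have -> : ip u (a (star z) (c w v)) = d (star w) z * ip u v - ip u (c w (a (star z) v)).
  by rewrite -e3 addrK.
have -> : ip u (c z (a (star w) v)) = d (star w) z * ip u v - ip u (a (star w) (c z v)).
  by rewrite -e4 addrC addKr.
by ring.
Qed.

Lemma left_field_commutant z : commutant H ip nm eqv right_field (left_field z).
Proof.
split; first exact: left_field_bounded.
move=> w u v Hu Hv; have h1 := HP Hv; have h2 := HL z Hv; have h3 := HL z h1.
have hPl : eqv (P (left_field z v)) (-1 *: left_field z (P v)).
  apply: (ip_ext ax); [exact: HP|exact: HZ|move=> t Ht].
  rewrite (ipZr ax)// ip_left_field// -Psa// ip_left_field//; last exact: HP.
  rewrite !Psa//; [|exact: Ha|exact: Hc].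
  by rewrite Pc// Pa//; ring.
have hm : H (-1 *: left_field z (P v)) by exact: HZ.
rewrite ip_right_field//.
rewrite (op_ip_eqv ax (bc w) _ _ Hu hPl)//; last exact: HP.
rewrite (op_ip_eqv ax (ba (star w)) _ _ Hu hPl)//; last exact: HP.
rewrite !(op_Z ax _ (bc w))// !(op_Z ax _ (ba (star w)))//.
have E := field_anticommute w z Hu h1.
rewrite /right_field (op_ZD ax _ (left_field_bounded z))//; [|exact: Ha|exact: Hc].
have -> : ip u (left_field z (c w (P v))) = ip u (left_field z (a (star w) (P v))) -
   (ip u (c w (left_field z (P v))) - ip u (a (star w) (left_field z (P v)))).
  by rewrite E; ring.
by ring.
Qed.

Lemma left_field_tracial z : tracial H ip nm eqv right_field Om (left_field z).
Proof.
split; first exact: left_field_commutant.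
move=> T [bT cT]; have hT x := @hbounded_H _ _ _ _ _ T x bT.
have HTO := hT _ HOm; have HPO := HP HOm.
have c0 y x : H x -> ip Om (c y x) = 0.
  move=> Hx; have hc := Hc y Hx; rewrite (ip_conj hc HOm) ip_c// aOm//; exact: conjc0.
have E1 : ip Om (left_field z (T Om)) = ip Om (right_field z (T Om)).
  have hPT := HP HTO; have hcO := Hc (star z) HOm.
  rewrite ip_left_field// ip_right_field// !c0// add0r sub0r.
  have ha : H (a (star z) (P (T Om))) by exact: Ha.
  have -> : ip Om (a (star z) (P (T Om))) = ip (c (star z) Om) (P (T Om)) by rewrite ip_c.
  have -> : ip Om (a (star z) (T Om)) = ip (c (star z) Om) (T Om) by rewrite ip_c.
  rewrite -Psa// (ip_conj HTO (HP hcO)) Pc// rmorphN opprK.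
  have hcP := Hc (star z) HPO.
  have -> : ip (T Om) (c (star z) (P Om)) = ip (T Om) (c (star z) Om).
    exact: (op_ip_eqv ax (bc (star z)) HPO HOm HTO POm).
  exact: (ip_conj HTO hcO).
rewrite E1 -cT//; have hR := HR z HOm; have hL := HL z HOm.
apply: (op_ip_eqv ax bT) => //.
apply: (ip_ext ax) => // t Ht; rewrite ip_right_field// ip_left_field// aOm//.
have -> : ip t (a (star z) (P Om)) = ip t (a (star z) Om).
  exact: (op_ip_eqv ax (ba (star z)) HPO HOm Ht POm).
have -> : ip t (c z (P Om)) = ip t (c z Om).
  exact: (op_ip_eqv ax (bc z) HPO HOm Ht POm).
by rewrite aOm// subr0 addr0.
Qed.

Section sign_covariance.
Variables (G : V -> V) (e : Z -> Z).
Hypothesis bG : hbd G.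
Hypothesis Gsa : forall u v, H u -> H v -> ip (G u) v = ip u (G v).
Hypothesis Gc : forall z u v, H u -> H v -> ip u (G (c z v)) = ip u (c (e z) (G v)).
Hypothesis ee : involutive e.
Hypothesis estar : forall z, star (e z) = e (star z).
Hypothesis GP : forall u, H u -> eqv (G (P u)) (P (G u)).

Lemma right_field_covariant z u : H u -> eqv (G (right_field z u)) (right_field (e z) (G u)).
Proof.
have HG x : H x -> H (G x) by move=> Hx; exact: (hbounded_H bG).
have Ga y w v : H w -> H v -> ip w (G (a y v)) = ip w (a (e y) (G v)).
  move=> Hw Hv; have h1 := Ha y Hv; have h2 := HG _ Hw; have h3 := HG _ Hv.
  have h4 := Hc y h2; have h5 := Hc (e y) Hw.
  rewrite -Gsa// -ip_c// -ip_c// -Gsa//.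
  rewrite (ip_conj Hv h4) (ip_conj Hv (HG _ h5)); congr conjc.
  by rewrite Gc// ee.
move=> Hu; have h1 := HR z Hu; have h2 := HG _ Hu; have h3 := HP Hu; have h4 := HP h2.
apply: (ip_ext ax); [exact: HG|exact: HR|move=> w Hw].
rewrite ip_right_field// (op_ZD ax _ bG)//; [|exact: Ha|exact: Hc].
rewrite Ga// Gc// estar.
have -> : ip w (a (e (star z)) (G (P u))) = ip w (a (e (star z)) (P (G u))).
  by apply: (op_ip_eqv ax (ba _)) => //; [exact: HG|exact: GP].
have -> : ip w (c (e z) (G (P u))) = ip w (c (e z) (P (G u))).
  by apply: (op_ip_eqv ax (bc _)) => //; [exact: HG|exact: GP].
by ring.
Qed.

End sign_covariance.
End anticommutation.

Lemma anticommutator_extend (R : realType) (V : lmodType R[i]) (H : V -> Prop)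
    (ip : V -> V -> R[i]) (nm : V -> R) (eqv : V -> V -> Prop)
    (ax : hilbert_axioms H ip nm eqv) (component : V -> V -> Prop) (a b : V -> V)
    (k : R[i]) (u v : V) :
  (forall T, hbounded H nm eqv T -> (forall x, component v x -> ip u (T x) = 0) -> ip u (T v) = 0) ->
  hbounded H nm eqv a -> hbounded H nm eqv b -> (forall x, component v x -> H x) ->
  H u -> H v ->
  (forall x, component v x -> ip u (a (b x)) + ip u (b (a x)) = k * ip u x) ->
  ip u (a (b v)) + ip u (b (a v)) = k * ip u v.
Proof.
move=> dense ba bb cH Hu Hv E.
have bS : hbounded H nm eqv (fun x => 1 *: (a \o b) x + (b \o a) x).
  by apply: (hbounded_ZD ax 1); apply: (hbounded_comp ax).
have bT := hbounded_ZD ax (- k) (hbounded_id ax) bS.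
have hab x : H x -> H (a (b x)) by move=> Hx; exact: (hbounded_H ba (hbounded_H bb Hx)).
have hba x : H x -> H (b (a x)) by move=> Hx; exact: (hbounded_H bb (hbounded_H ba Hx)).
have TE x : H x -> ip u (- k *: id x + (1 *: (a \o b) x + (b \o a) x)) =
    ip u (a (b x)) + ip u (b (a x)) - k * ip u x.
  move=> Hx; have h1 := hab _ Hx; have h2 := hba _ Hx.
  rewrite (hilb_ipZDr ax)//; last exact: (hilbZD ax).
  by rewrite (hilb_ipZDr ax)//; ring.
have := dense _ bT; rewrite TE// => h; apply/eqP; rewrite -subr_eq0; apply/eqP.
by apply: h => x vx; rewrite TE ?E ?subrr//; exact: cH.
Qed.

Section creation_operators.
Variable R : realType.
Local Notation rT := (measurableTypeR R).
Local Notation mu := (@chain_measure R).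
Local Notation nu := (@leb_pos R).
Local Notation leb n := (leb_tuple R n).
Local Notation Re := (@complex.Re R).
Implicit Types (z : R -> R[i]) (u v h : vect R).
Local Notation ax := (@fock_hilbert R).
Local Notation hbd := (hbounded (@fock R) (@fock_norm R) (@fock_eq R)).

Lemma dot_pos_self z : dot_pos z z = (norm2_pos z)%:C.
Proof. exact: cdot_self. Qed.

Lemma creation_norm_homogeneous n z u : L2_pos z -> fock u -> homogeneous n u ->
  fock_norm (creation z u) ^+ 2 <= norm2_pos z * fock_norm u ^+ 2.
Proof.
move=> Lz fu hu; have fc := creation_fock Lz fu hu; have hc := creation_homogeneous z hu.
have fl := lower_fock Lz fc hc.
have E : inner (creation z u) (creation z u) = inner u (lower z (creation z u)).
  exact: creation_adjoint Lz fu fc hc.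
have nE : fock_norm (creation z u) ^+ 2 = Re (inner u (lower z (creation z u))).
  by rewrite -E inner_self.
have fz : fock (dot_pos z z *: u) by exact: HZ ax _ _ fu.
have zE : inner u (dot_pos z z *: u) = (norm2_pos z * fock_norm u ^+ 2)%:C.
  rewrite (ipZr ax _ fu fu) (inner_self fu) dot_pos_self.
  exact: (esym (rmorphM (real_complex R) _ _)).
rewrite {}nE; case: n hu hc => [|n] hu hc.
  by rewrite (ip_eqr ax fl fz fu (lower_creation0 Lz Lz fu hu)) zE.
have fl' := lower_fock Lz fu hu; have hl' := @lower_homogeneous R n z u hu.
have fcl := creation_fock Lz fl' hl'.
rewrite (ip_eqr ax fl (HB ax fz fcl) fu (anticommutator_homogeneous Lz Lz fu hu)).
rewrite (ipBr ax fz fcl fu) zE (inner_conj fcl fu) (creation_adjoint Lz fl' fu hu) (inner_self fl').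
by rewrite /= lerBlDr lerDl sqr_ge0.
Qed.

Lemma norm2_levels v : (\sum_(0 <= n <oo) norm2 (level n v))%E = norm2 v.
Proof.
rewrite [RHS]/norm2; apply: eq_eseriesr => n _.
rewrite (norm2_homogeneous (@level_homogeneous R n v)); congr (_ * _)%E.
by apply: eq_integral => x _; rewrite levelE.
Qed.

Lemma norm2_ge0 v : (0 <= norm2 v)%E.
Proof.
apply: nneseries_ge0 => n _ _; apply: mule_ge0 => //.
by apply: integral_ge0 => x _; rewrite sqmodE lee_fin sqn_ge0.
Qed.

Lemma creation_norm2 z u : L2_pos z -> fock u ->
  fock (creation z u) /\ fock_norm (creation z u) ^+ 2 <= norm2_pos z * fock_norm u ^+ 2.
Proof.
move=> Lz fu; have Z0 := norm2_pos_ge0 z.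
have le2 : (norm2 (creation z u) <= (norm2_pos z)%:E * norm2 u)%E.
  rewrite -norm2_levels nneseries_recl//; last by move=> *; exact: norm2_ge0.
  rewrite level0_creation (norm2_fock (fock0 R)) (nm0 ax) expr0n add0e.
  rewrite -(nneseries_addn 1); last by move=> *; exact: norm2_ge0.
  rewrite -norm2_levels -nneseriesZl//; last by move=> *; exact: norm2_ge0.
  apply: lee_nneseries => [n _ _|n _]; first exact: norm2_ge0.
  rewrite addn1 -creation_level; have fl := fock_level n fu.
  have hl := @level_homogeneous R n u.
  rewrite (norm2_fock fl) (norm2_fock (creation_fock Lz fl hl)) -EFinM lee_fin.
  exact: creation_norm_homogeneous hl.
have fc : fock (creation z u).
  split.
  - move=> [|n].
      rewrite (_ : (fun x => _) = fun=> 0); first exact: cmeasurable_cst.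
      by apply/funext => x; rewrite [x]tuple0 creation_nil.
    have [mc _ _] := creation_fock Lz (fock_level n fu) (@level_homogeneous R n u).
    rewrite (_ : (fun x => _) = fun x : n.+1.-tuple rT => creation z (level n u) x)//.
    by apply/funext => x; rewrite creation_level levelE.
  - exact: antisym_antisymmetrize.
  - apply: le_lt_trans le2 _; rewrite (norm2_fock fu) -EFinM; exact: ltry.
by split=> //; move: le2; rewrite (norm2_fock fc) (norm2_fock fu) -EFinM lee_fin.
Qed.

Lemma creation_H z u : L2_pos z -> fock u -> fock (creation z u).
Proof. by move=> Lz fu; case: (creation_norm2 Lz fu). Qed.

Lemma sum_combination (I : finType) (k a : R[i]) (f g h : I -> R[i]) :
  (forall i, h i = a * f i + g i) ->
  k * \sum_i h i = a * (k * \sum_i f i) + k * \sum_i g i.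
Proof.
move=> E; rewrite (eq_bigr _ (fun i _ => E i)) big_split -mulr_sumr /=.
by move: (\sum_i f i) (\sum_i g i) => x y; ring.
Qed.

Lemma creationZD z (a : R[i]) u v : creation z (a *: u + v) = a *: creation z u + creation z v.
Proof.
apply/funext => s.
change (creation z (a *: u + v) s = a * creation z u s + creation z v s).
apply: sum_combination => p; rewrite mulrCA -mulrDr; congr (_ * _).
rewrite /tensor; case: (permute _ _) => -[_|t s' _] /=; first by rewrite mulr0 addr0.
by rewrite mulrCA -mulrDr.
Qed.

Lemma creation_bounded z : L2_pos z -> hbd (creation z).
Proof.
move=> Lz; split.
- by move=> u fu; exact: (creation_norm2 Lz fu).1.
- by move=> a u v _ _; rewrite creationZD; exact: fock_eq_refl.
- exists (Num.sqrt (norm2_pos z)) => u fu.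
  rewrite -(@ler_pXn2r _ 2)// ?nnegrE ?fock_norm_ge0//; last first.
    by rewrite mulr_ge0 ?sqrtr_ge0 ?fock_norm_ge0.
  rewrite exprMn [X in _ <= X * _](_ : _ = norm2_pos z); last exact/sqr_sqrtr/norm2_pos_ge0.
  exact: (creation_norm2 Lz fu).2.
Qed.

Lemma hbounded_level_eq T w v : hbd T -> fock w -> fock v ->
  (forall n, inner w (T (level n v)) = 0) -> inner w (T v) = 0.
Proof.
move=> bT fw fv E; rewrite -(adjl ax bT fw fv); apply: level_inner0 => n.
by rewrite (adjl ax bT fw (fock_level n fv)).
Qed.

Lemma annihilation_lower n z v : L2_pos z -> fock v -> homogeneous n.+1 v ->
  fock_eq (annihilation z v) (lower z v).
Proof.
move=> Lz fv hv; have bc := creation_bounded Lz.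
have fa : fock (annihilation z v) := adjH ax bc fv.
have fl := lower_fock Lz fv hv.
apply: (ip_ext ax fa fl) => w fw; rewrite (adjr ax bc fv fw).
exact: creation_adjoint Lz fw fv hv.
Qed.

Lemma annihilation_level0 z v w : L2_pos z -> fock v -> homogeneous 0 v -> fock w ->
  inner w (annihilation z v) = 0.
Proof.
move=> Lz fv hv fw; rewrite (adjr ax (creation_bounded Lz) fv fw) (inner_level _ hv).
by rewrite level0_creation (hilb_ip_conj ax fv (fock0 R)) (ipr0 ax fv) conjc0.
Qed.

Lemma anticommutator (z w : R -> R[i]) u v : L2_pos z -> L2_pos w -> fock u -> fock v ->
  inner u (annihilation z (creation w v)) + inner u (creation w (annihilation z v)) =
  dot_pos z w * inner u v.
Proof.
move=> Lz Lw fu fv; have bz := creation_bounded Lz; have bw := creation_bounded Lw.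
have ba : hbd (annihilation z) := hbounded_adj ax bz.
have Fa x : fock x -> fock (annihilation z x) by move=> fx; exact: (hbounded_H ba).
apply: (anticommutator_extend (component := fun v x => exists n, x = level n v) ax _ ba bw _ fu fv).
- move=> T bT vT; apply: (hbounded_level_eq bT fu fv) => n; apply: vT; by exists n.
- by move=> x [n ->]; exact: fock_level.
move=> x [n xE]; have fx : fock x by rewrite xE; exact: fock_level.
have hx : homogeneous n x by rewrite xE; exact: level_homogeneous.
move: {xE} fx hx => fx hx.
have fc := creation_H Lw fx; have hc := creation_homogeneous w hx.
have fl := lower_fock Lz fc hc; have fd : fock (dot_pos z w *: x) by exact: HZ ax _ _ fx.
have := annihilation_lower Lz fc hc => e1.
rewrite (ip_eqr ax (Fa _ fc) fl fu e1).
case: n hx hc => [|n] hx hc.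
  rewrite (ip_eqr ax fl fd fu (lower_creation0 Lz Lw fx hx)) (ipZr ax _ fx fu).
  rewrite -(adjl ax bw fu (Fa _ fx)).
  by rewrite (annihilation_level0 Lz fx hx (adjH ax bw fu)) addr0.
have flx := lower_fock Lz fx hx; have fcl := creation_H Lw flx.
rewrite (ip_eqr ax fl (HB ax fd fcl) fu (anticommutator_homogeneous Lz Lw fx hx)).
rewrite (ipBr ax fd fcl fu) (ipZr ax _ fx fu).
rewrite -(op_ip_eqv ax bw (Fa _ fx) flx fu (annihilation_lower Lz fx hx)).
exact: subrK.
Qed.

Lemma creation_anticommute (z w : R -> R[i]) u v : L2_pos z -> L2_pos w -> fock u -> fock v ->
  inner u (creation z (creation w v)) = - inner u (creation w (creation z v)).
Proof.
move=> Lz Lw fu fv.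
have mm (y : R -> R[i]) : L2_pos y -> cmeasurable (y : rT -> R[i]) by case.
have cr (y : R -> R[i]) (x : vect R) : L2_pos y -> fock x -> fock_eq (creation y x) (normalized_raise y x) /\ fock (normalized_raise y x).
  move=> Ly fx; have e : fock_eq (creation y x) (normalized_raise y x).
    by apply: creation_raise; case: fx.
  split; first exact: e; apply: (fock_ae (creation_H Ly fx)) e.
  by apply: cmeasurable_normalized_raise; [exact: mm|exact: (fock_L2v fx).1].
have E (y y' : R -> R[i]) : L2_pos y -> L2_pos y' ->
    fock_eq (creation y (creation y' v)) (fun s => (size s)%:R^-1 * ((size s).-1%:R^-1 * raise y (raise y' v) s)).
  move=> Ly Ly'; have [e1 f1] := cr y' v Ly' fv.
  have [e2 f2] := cr y _ Ly f1.
  have e3 := op_eqv ax (creation_bounded Ly) (creation_H Ly' fv) f1 e1.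
  apply: fock_eq_trans e3 _; apply: fock_eq_trans e2 _ => n; apply: aeW => x.
  rewrite /normalized_raise; congr (_ * _).
  rewrite -[RHS]addr0 -[X in _ + X](raise0 y (x : seq R)) -raiseZD.
  by apply: raise_ext => r ->; rewrite -[(0 : vect R) r]/(0 : R[i]) addr0.
have f1 := creation_H Lz (creation_H Lw fv); have f2 := creation_H Lw (creation_H Lz fv).
rewrite -(ipNr ax f2 fu); apply: (ip_eqr ax f1 (HN ax f2) fu).
apply/fock_eq_ae; move/fock_eq_ae : (E z w Lz Lw) => e1; move/fock_eq_ae : (E w z Lw Lz) => e2.
apply: filterS2 e1 e2 => s e1 e2.
change (creation z (creation w v) s = - creation w (creation z v) s).
rewrite e1 e2 -!mulrN; congr (_ * (_ * _)).
by apply/eqP; rewrite -addr_eq0 raise_anticommute.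
Qed.

End creation_operators.

Section signs.
Variable R : realType.
Local Notation rT := (measurableTypeR R).
Local Notation mu := (@chain_measure R).
Local Notation nu := (@leb_pos R).
Local Notation leb n := (leb_tuple R n).
Local Notation Re := (@complex.Re R).
Local Notation Im := (@complex.Im R).
Implicit Types (z : R -> R[i]) (u v h : vect R) (k : seq R -> R).
Local Notation ax := (@fock_hilbert R).
Local Notation hbd := (hbounded (@fock R) (@fock_norm R) (@fock_eq R)).

Definition multiplier k v : vect R := fun s => (k s)%:C * v s.

Lemma sqn_real (a : R) (c : R[i]) : sqn (a%:C * c) = a ^+ 2 * sqn c.
Proof. by rewrite sqnM /sqn/=; ring. Qed.

Lemma multiplierZD k a u v : multiplier k (a *: u + v) = a *: multiplier k u + multiplier k v.
Proof.
apply/funext => s.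
change ((k s)%:C * (a * u s + v s) = a * ((k s)%:C * u s) + (k s)%:C * v s).
by ring.
Qed.

Lemma inner_multiplier k u v : inner (multiplier k u) v = inner u (multiplier k v).
Proof.
suff E n : inner_term (multiplier k u) v n = inner_term u (multiplier k v) n.
  by rewrite /inner (_ : inner_term (multiplier k u) v = inner_term u (multiplier k v))//; apply/funext.
rewrite /inner_term; congr (_ * cintegral _ _); apply/funext => x.
by rewrite /multiplier conjcM conjc_real; ring.
Qed.

Definition contraction_multiplier k := [/\ measurable_fun setT (k : chain R -> R),
  (forall s, `|k s| <= 1) & (forall n (p : 'S_n) (x : n.-tuple R), k (permute p x) = k x)].

Lemma multiplier_norm2 k u : contraction_multiplier k -> cmeasurable (u : chain R -> R[i]) ->
  (norm2 (multiplier k u) <= norm2 u)%E.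
Proof.
move=> [mk k1 ks] mu_.
have mm : cmeasurable (multiplier k u : chain R -> R[i]).
  by apply: cmeasurableM => //; exact: cmeasurable_real.
rewrite !norm2E//; apply: ge0_le_integral => //.
- by move=> s _; rewrite sqmodE lee_fin sqn_ge0.
- by under eq_fun do rewrite sqmodE; exact: measurable_sqn_e.
- by under eq_fun do rewrite sqmodE; exact: measurable_sqn_e.
- move=> s _; rewrite !sqmodE lee_fin /multiplier sqn_real.
  rewrite ler_piMl ?sqn_ge0// -[k s ^+ 2]real_normK ?num_real//.
  by rewrite exprn_ile1.
Qed.

Lemma multiplier_fock k u : contraction_multiplier k -> fock u -> fock (multiplier k u).
Proof.
move=> ck fu; have Lu := fock_L2v fu; have [mk k1 ks] := ck; split.
- apply/cmeasurable_level; apply: cmeasurableM; first exact: cmeasurable_real.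
  exact: Lu.1.
- move=> n p; have [_ au _] := fu; apply: filterS (au n p) => x ux.
  by rewrite /multiplier ux ks mulrCA.
- have [_ _ u2] := fu; apply: le_lt_trans u2; apply: multiplier_norm2 => //; exact: Lu.1.
Qed.

Lemma fock_norm_le u v : fock u -> fock v -> (norm2 u <= norm2 v)%E -> fock_norm u <= fock_norm v.
Proof.
move=> fu fv; rewrite (norm2_fock fu) (norm2_fock fv) lee_fin ler_pXn2r// nnegrE; exact: fock_norm_ge0.
Qed.

Lemma multiplier_contraction k u : contraction_multiplier k -> fock u ->
  fock_norm (multiplier k u) <= fock_norm u.
Proof.
move=> ck fu; apply: (fock_norm_le (multiplier_fock ck fu) fu).
exact: multiplier_norm2 ck (fock_L2v fu).1.
Qed.

Lemma multiplier_bounded k : contraction_multiplier k -> hbd (multiplier k).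
Proof.
move=> ck; split.
- by move=> u fu; exact: multiplier_fock.
- by move=> a u v _ _; rewrite multiplierZD; exact: fock_eq_refl.
- by exists 1 => u fu; rewrite mul1r; exact: multiplier_contraction.
Qed.

Definition is_sign (e : R -> R) := measurable_fun setT (e : rT -> R) /\ forall t, e t * e t = 1.

Definition sign_product (e : R -> R) (s : seq R) : R := \prod_(t <- s) e t.

Lemma sign_product_sqr e s : is_sign e -> sign_product e s * sign_product e s = 1.
Proof.
move=> [_ ee]; rewrite /sign_product -big_split/= big1// => t _; exact: ee.
Qed.

Lemma sign_contraction e : is_sign e -> contraction_multiplier (sign_product e).
Proof.
move=> he; have [me ee] := he; split.
- apply/measurable_fun_chainP => n.
  rewrite (_ : _ \o _ = fun x : n.-tuple rT => \prod_(i < n) e (tnth x i)); last first.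
    by apply/funext => x /=; rewrite /sign_product (big_tuple _ _ x).
  apply: measurable_prod => i _.
  exact: (measurableT_comp me (@measurable_tnth _ rT n i)).
- move=> s; have h : `|sign_product e s| ^+ 2 <= 1 ^+ 2.
    by rewrite expr1n real_normK ?num_real// expr2 sign_product_sqr.
  by rewrite ler_pXn2r ?nnegrE in h.
- move=> n p x; rewrite /sign_product !big_tuple [RHS](reindex_inj (@perm_inj _ p)).
  by apply: eq_bigr => i _; rewrite tnth_mktuple.
Qed.

Definition sign_op e : operator R := multiplier (sign_product e).

Lemma sign_opK e : is_sign e -> involutive (sign_op e).
Proof.
move=> he v; apply/funext => s; rewrite /sign_op /multiplier mulrA -rmorphM.
by rewrite sign_product_sqr// mul1r.
Qed.

Lemma sign_op_vacuum e : sign_op e vacuum = vacuum.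
Proof.
apply/funext => -[|t s]; rewrite /sign_op /multiplier /sign_product /vacuum.
  by rewrite big_nil mul1r.
by rewrite mulr0.
Qed.

Lemma sign_op_comm e e' u : sign_op e (sign_op e' u) = sign_op e' (sign_op e u).
Proof. by apply/funext => s; rewrite /sign_op /multiplier mulrCA. Qed.

Definition sign_twist (e : R -> R) z : R -> R[i] := fun t => (e t)%:C * z t.

Lemma sign_op_creation e z u :
  sign_op e (creation z u) = creation (sign_twist e z) (sign_op e u).
Proof.
apply/funext => s; rewrite /sign_op /multiplier /creation /antisymmetrize mulrCA.
congr (_ * _); rewrite mulr_sumr; apply: eq_bigr => p _; rewrite mulrCA; congr (_ * _).
have -> : sign_product e s = sign_product e (permute p (in_tuple s)).
  rewrite /sign_product (big_tuple _ _ (in_tuple s)) big_tuple (reindex_inj (@perm_inj _ p))/=.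
  by apply: eq_bigr => i _; rewrite tnth_mktuple.
rewrite /tensor; case: (permute _ _) => -[_|t s' _] /=; first by rewrite mulr0.
by rewrite /sign_product big_cons rmorphM/= /sign_twist; ring.
Qed.

Lemma sign_twist_L2 e z : is_sign e -> L2_pos z -> L2_pos (sign_twist e z).
Proof.
move=> [me ee] [mz sz]; split.
  by apply: cmeasurableM => //; exact: cmeasurable_real.
rewrite (_ : (\int[nu]_t _)%E = (\int[nu]_t sqmod (z t))%E)//.
apply: eq_integral => t _; rewrite !sqmodE /sign_twist sqn_real expr2 ee mul1r.
by [].
Qed.

Lemma fock_vacuum : fock (@vacuum R).
Proof.
have hv : homogeneous 0 (@vacuum R) by move=> [|t s].
split.
- move=> n; case: n => [|n].
    rewrite (_ : (fun x => _) = fun=> 1); first exact: cmeasurable_cst.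
    by apply/funext => x; rewrite [x]tuple0.
  rewrite (_ : (fun x => _) = fun=> 0); first exact: cmeasurable_cst.
  by apply/funext => x; case/tupleP: x.
- move=> n p; apply: aeW => x; case: n p x => [|n] p x.
    rewrite [permute p x]tuple0 [in RHS]tuple0 /= (_ : p = 1%g) ?odd_perm1 ?mul1r//.
    by apply/permP => -[].
  have V0 (y : n.+1.-tuple R) : vacuum y = 0 :> R[i] by case/tupleP: y.
  by rewrite !V0 mulr0.
- rewrite (norm2_homogeneous hv) integral_dirac//; last first.
    rewrite (_ : (fun x => _) = fun=> sqmod (vacuum [::])); first exact: measurable_cst.
    by apply/funext => x; rewrite [x]tuple0.
  by rewrite diracE mem_set// mul1e sqmodE -EFinM ltry.
Qed.

End signs.

Section vacuum_trace.
Variable R : realType.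
Local Notation rT := (measurableTypeR R).
Local Notation nu := (@leb_pos R).
Implicit Types (u v : vect R).
Local Notation ax := (@fock_hilbert R).
Local Notation hbd := (hbounded (@fock R) (@fock_norm R) (@fock_eq R)).

Definition L2_fun := {z : R -> R[i] | L2_pos z}.

Lemma L2_fun_inj (z w : L2_fun) : sval z = sval w -> z = w.
Proof. by case: z w => z Lz [w Lw] /= zw; subst w; congr exist; exact: Prop_irrelevance. Qed.

Lemma L2_pos_conj (z : R -> R[i]) : L2_pos z -> L2_pos (conjc \o z).
Proof.
move=> [mz sz]; split; first exact: cmeasurable_conj.
rewrite (_ : (\int[nu]_t _)%E = (\int[nu]_t sqmod (z t))%E)//.
by apply: eq_integral => t _; rewrite !sqmodE /sqn /=; case: (z t) => a b /=; rewrite sqrrN.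
Qed.

Definition L2_star (z : L2_fun) : L2_fun := exist _ (conjc \o sval z) (L2_pos_conj (svalP z)).

Lemma L2_starK : involutive L2_star.
Proof. by move=> z; apply: L2_fun_inj; apply/funext => t /=; rewrite conjcK. Qed.

Lemma sign_opp : is_sign (fun _ : R => -1).
Proof. by split; [exact: measurable_cst|move=> t; rewrite mulrNN mulr1]. Qed.

Definition parity : operator R := sign_op (fun _ => -1).
Definition creation_L2 (z : L2_fun) : operator R := creation (sval z).
Definition right_Psi : L2_fun -> operator R :=
  right_field (@fock R) (@inner R) L2_star creation_L2 parity.

Let bc z : hbd (creation_L2 z). Proof. exact: creation_bounded (svalP z). Qed.

Let cc (z w : L2_fun) u v : fock u -> fock v ->
  inner u (creation_L2 z (creation_L2 w v)) = - inner u (creation_L2 w (creation_L2 z v)).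
Proof. exact: creation_anticommute (svalP z) (svalP w). Qed.

Definition dot_L2 (z w : L2_fun) := dot_pos (sval z) (sval w).

Let ac (z w : L2_fun) u v : fock u -> fock v ->
  inner u (hadjoint (@fock R) (@inner R) (creation_L2 z) (creation_L2 w v)) +
  inner u (creation_L2 w (hadjoint (@fock R) (@inner R) (creation_L2 z) v)) = dot_L2 z w * inner u v.
Proof. exact: anticommutator (svalP z) (svalP w). Qed.

Let dstar (z w : L2_fun) : dot_L2 (L2_star z) w = dot_L2 (L2_star w) z.
Proof.
rewrite /dot_L2 /dot_pos /cdot /=; congr cintegral; apply/funext => t.
by rewrite !conjcK mulrC.
Qed.

Let vac0 : homogeneous 0 (@vacuum R). Proof. by move=> [|t s]. Qed.

Let aOm (z : L2_fun) u : fock u -> inner u (hadjoint (@fock R) (@inner R) (creation_L2 z) vacuum) = 0.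
Proof. exact: annihilation_level0 (svalP z) (fock_vacuum R) vac0. Qed.

Lemma sign_op_bounded e : is_sign e -> hbd (sign_op e).
Proof. by move=> he; exact/multiplier_bounded/sign_contraction. Qed.

Let bP : hbd parity := sign_op_bounded sign_opp.
Let PP u : fock u -> fock_eq (parity (parity u)) u.
Proof. by move=> _; rewrite /parity (sign_opK sign_opp); exact: fock_eq_refl. Qed.
Let Psa u v : fock u -> fock v -> inner (parity u) v = inner u (parity v).
Proof. by move=> _ _; exact: inner_multiplier. Qed.
Let POm : fock_eq (parity vacuum) vacuum.
Proof. by rewrite /parity sign_op_vacuum; exact: fock_eq_refl. Qed.

Let Pc (z : L2_fun) u v : fock u -> fock v ->
  inner u (parity (creation_L2 z v)) = - inner u (creation_L2 z (parity v)).
Proof.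
move=> fu fv; have fp : fock (parity v) := hbounded_H bP fv.
have fc : fock (creation_L2 z (parity v)) := hbounded_H (bc z) fp.
rewrite /parity /creation_L2 sign_op_creation -(ipNr ax fc fu); congr inner.
have -> : sign_twist (fun _ => -1) (sval z) = fun t => - sval z t.
  by apply/funext => t; rewrite /sign_twist rmorphN1 mulN1r.
apply/funext => s.
change (creation (fun t => - sval z t) (parity v) s = - creation (sval z) (parity v) s).
rewrite /creation /antisymmetrize -mulrN -sumrN; congr (_ * _).
apply: eq_bigr => p _; rewrite -mulrN; congr (_ * _).
by rewrite /tensor; case: (permute _ _) => -[_|t s' _] /=; rewrite ?oppr0 ?mulNr.
Qed.

Lemma right_Psi_bounded z : hbd (right_Psi z).
Proof. exact: (right_field_bounded ax L2_star bc bP). Qed.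

Lemma right_Psi_star z u v : fock u -> fock v ->
  inner (right_Psi z u) v = inner u (right_Psi (L2_star z) v).
Proof. exact: (right_field_star ax L2_starK bc bP Psa Pc). Qed.

Definition vacuum_tracial : set (operator R) :=
  tracial (@fock R) (@inner R) (@fock_norm R) (@fock_eq R) right_Psi vacuum.

Lemma vacuum_tracial_vna : hvna (@fock R) (@inner R) (@fock_norm R) (@fock_eq R) vacuum_tracial.
Proof. exact: (tracial_vna ax (fock_vacuum R) right_Psi_bounded right_Psi_star L2_starK). Qed.

Lemma clifford_tracial T : clifford T -> vacuum_tracial T.
Proof.
apply; last first.
  move=> z Lz.
  exact: (left_field_tracial ax bc cc ac dstar (fock_vacuum R) aOm bP Psa POm Pc (exist _ z Lz)).
have [v1 v2 v3 v4 v5 v6] := vacuum_tracial_vna.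
split.
- exact: v1.
- exact: v2.
- exact: v3.
- exact: v4.
- exact: v5.
- exact: v6.
Qed.

Lemma right_Psi_covariant e z : is_sign e -> exists z', forall u, fock u ->
  fock_eq (sign_op e (right_Psi z u)) (right_Psi z' (sign_op e u)).
Proof.
move=> he; pose tw (y : L2_fun) : L2_fun := exist _ _ (sign_twist_L2 he (svalP y)).
exists (tw z) => u fu.
have Gsa x y : fock x -> fock y -> inner (sign_op e x) y = inner x (sign_op e y).
  by move=> _ _; exact: inner_multiplier.
have Gc y x x' : fock x -> fock x' ->
    inner x (sign_op e (creation_L2 y x')) = inner x (creation_L2 (tw y) (sign_op e x')).
  by move=> _ _; rewrite /creation_L2 sign_op_creation.
have tt : involutive tw.
  move=> y; apply: L2_fun_inj; apply/funext => t /=.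
  by rewrite /sign_twist mulrA -rmorphM he.2 mul1r.
have ts y : L2_star (tw y) = tw (L2_star y).
  apply: L2_fun_inj; apply/funext => t /=.
  by rewrite /sign_twist conjcM conjc_real.
have GP x : fock x -> fock_eq (sign_op e (parity x)) (parity (sign_op e x)).
  by move=> _; rewrite /parity sign_op_comm; exact: fock_eq_refl.
exact: (right_field_covariant ax bc bP (sign_op_bounded he) Gsa Gc tt ts GP z fu).
Qed.

Lemma clifford_vna : hvna (@fock R) (@inner R) (@fock_norm R) (@fock_eq R) (@clifford R).
Proof.
split.
- by move=> T /clifford_tracial; exact: (hvna_bounded vacuum_tracial_vna).
- by move=> M hM _; exact: vna_id hM.
- by move=> a S T cS cT M hM PM; exact: (vna_lin hM a (cS M hM PM) (cT M hM PM)).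
- by move=> S T cS cT M hM PM; exact: (vna_comp hM (cS M hM PM) (cT M hM PM)).
- by move=> T cT M hM PM; exact: (vna_adjoint hM (cT M hM PM)).
- move=> T bT aT M hM PM; apply: (vna_closed hM) => // n u v e fu fv e0.
  by have [S cS SP] := aT n u v e fu fv e0; exists S => //; exact: cS.
Qed.

End vacuum_trace.

Section tracial_exponential.
Variables (R : realType) (V : lmodType R[i]) (H : V -> Prop).
Variables (ip : V -> V -> R[i]) (nm : V -> R) (eqv : V -> V -> Prop).
Local Notation Re := (@complex.Re R).
Implicit Types (u v w : V).
Hypothesis ax : hilbert_axioms H ip nm eqv.
Variables (Z : Type) (Rz : Z -> V -> V) (star : Z -> Z) (Om : V).
Hypothesis HOm : H Om.
Hypothesis bR : forall z, hbounded H nm eqv (Rz z).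
Hypothesis Rstar : forall z u v, H u -> H v -> ip (Rz z u) v = ip u (Rz (star z) v).
Hypothesis starK : involutive star.
Local Notation trac := (tracial H ip nm eqv Rz Om).
Local Notation leo := (le_op H nm).
Let vT := tracial_vna ax HOm bR Rstar starK.
Let HB := HB ax.
Let nm_ge0 := hilb_nm_ge0 ax.

Variables (F : V -> V) (ex : R -> V -> V) (M : R).
Hypothesis tF : trac F.
Hypothesis M0 : 0 <= M.
Hypothesis FM : leo F M.
Hypothesis Fsa : forall u v, H u -> H v -> ip (F u) v = ip u (F v).
Hypothesis exP : forall s u, H u -> exp_of H nm (fun u => s%:C *: F u) u (ex s u).
Let bF := hvna_bounded vT tF.
Let Hex s u : H u -> H (ex s u). Proof. by move=> /(exP s)[]. Qed.
Let Hit k u : H u -> H (iter k F u).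
Proof. by move=> Hu; exact: (hbounded_H (hbounded_iter ax k bF)). Qed.

Lemma group_half s u v : H u -> H v -> ip u (ex s v) = ip (ex (s / 2) u) (ex (s / 2) v).
Proof.
move=> Hu Hv; have h := Hex (s / 2) Hv.
rewrite (group_selfadjoint ax bF M0 FM exP Fsa)//.
apply: (ip_eqr ax) => //; [exact: Hex|exact: Hex|apply: (eqv_sym ax); [exact: Hex|exact: Hex|]].
by have := group_add ax bF M0 FM exP (s / 2) (s / 2) Hv; rewrite -splitr.
Qed.

Lemma group_tracial s : trac (ex s).
Proof.
have ts : trac (fun u => s%:C *: F u).
  have := hvna_lin vT s%:C tF (hvna_lin vT (-1) (hvna_id vT) (hvna_id vT)).
  by congr trac; apply/funext => u; rewrite scaleN1r addNr addr0.
apply: (exp_vna ax (hvna_bounded vT ts) _ _ (exP s) vT ts (M := `|s| * M)).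
  by rewrite mulr_ge0.
exact: (scaled_le ax bF FM).
Qed.

Lemma group_state s : ip Om (ex s Om) = (nm (ex (s / 2) Om) ^+ 2)%:C.
Proof. by rewrite group_half// (hilb_ip_self ax)//; exact: Hex. Qed.

Lemma group_pairing_bound s A B a b : trac A -> trac B -> 0 <= a -> 0 <= b ->
  leo A a -> leo B b ->
  Normc.normc (ip (A Om) (ex s (B Om))) <= a * b * Re (ip Om (ex s Om)).
Proof.
move=> tA tB a0 b0 Aa Bb; have bA := hvna_bounded vT tA; have bB := hvna_bounded vT tB.
have hA := hbounded_H bA HOm; have hB := hbounded_H bB HOm.
rewrite group_half// group_state /=; apply: le_trans (ip_CS ax (Hex _ hA) (Hex _ hB)) _.
have te := group_tracial (s / 2).
have h1 := tracial_right_bound ax HOm bR Rstar starK te tA a0 Aa.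
have h2 := tracial_right_bound ax HOm bR Rstar starK te tB b0 Bb.
apply: le_trans (ler_pM _ _ h1 h2) _ => //.
by rewrite le_eqVlt; apply/orP; left; apply/eqP; ring.
Qed.

Lemma group_state_gt0 s : 0 < nm Om -> 0 < Re (ip Om (ex s Om)).
Proof.
move=> O0; rewrite group_state /= lt_neqAle sqr_ge0 andbT eq_sym sqrf_eq0.
apply: contraTneq O0 => n0; rewrite -leNgt -n0.
have e := group_inv ax bF M0 FM exP (- (s / 2)) HOm; rewrite opprK in e.
have h := Hex (s / 2) HOm; have h' := Hex (- (s / 2)) h.
rewrite -(nm_eqv ax h' HOm e).
apply: le_trans (group_le ax bF M0 FM exP (- (s / 2)) h) _.
by rewrite n0 mulr0.
Qed.

Section with_sign.
Variable G : V -> V.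
Hypothesis bG : hbounded H nm eqv G.
Hypothesis GG : forall u, H u -> eqv (G (G u)) u.
Hypothesis Gsa : forall u v, H u -> H v -> ip (G u) v = ip u (G v).
Hypothesis GOm : eqv (G Om) Om.
Hypothesis GR : forall z, exists z', forall u, H u -> eqv (G (Rz z u)) (Rz z' (G u)).
Let hG u := @hbounded_H _ _ _ _ _ G u bG.

Lemma sign_energy v : H v -> 2 * (nm v ^+ 2 - Re (ip v (G v))) = nm (v - G v) ^+ 2.
Proof.
move=> Hv; have HGv := hG Hv; rewrite (nm_sqrB ax)// (sign_norm ax bG GG Gsa)//.
have -> : Re (ip (G v) v) = Re (ip v (G v)) by rewrite Gsa.
by move: (Re _) (nm v ^+ 2) => a b; ring.
Qed.

Lemma sign_pairing_bound s A B a b : trac A -> trac B -> 0 <= a -> 0 <= b ->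
  leo A a -> leo B b ->
  Normc.normc (ip (G (A Om)) (ex s (B Om))) <= a * b * Re (ip Om (ex s Om)).
Proof.
move=> tA tB a0 b0 Aa Bb; have bA := hvna_bounded vT tA; have bB := hvna_bounded vT tB.
have hA x := @hbounded_H _ _ _ _ _ A x bA.
have tA' := tracial_conj ax HOm bR Rstar starK bG GG Gsa GOm GR tA.
have A'a := le_op_conj ax bG GG Gsa bA Aa.
have := group_pairing_bound s tA' tB a0 b0 A'a Bb.
have e : eqv ((G \o A \o G) Om) (G (A Om)).
  by apply: (op_eqv ax bG); [exact/hA/hG|exact: hA|apply: (op_eqv ax bA) => //; exact: hG].
rewrite (ip_eql ax _ _ _ e)//; [exact/hG/hA/hG|exact/hG/hA|].
exact/Hex/(hbounded_H bB).
Qed.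

Lemma exp_sign_difference s :
  nm (ex s Om - G (ex s Om)) <= `|s| * expR (`|s| * M) * nm (F Om - G (F Om)).
Proof.
set v := ex s Om; set dl := nm (F Om - G (F Om)).
have Hv : H v by exact: Hex.
have Hd : H (v - G v) by apply: HB => //; exact: hG.
have K0 : 0 <= `|s| * expR (`|s| * M) * dl.
  exact: (mulr_ge0 (mulr_ge0 (normr_ge0 s) (expR_ge0 _)) (nm_ge0 _)).
have weak w : H w -> Normc.normc (ip w (v - G v)) <= `|s| * expR (`|s| * M) * dl * nm w.
  move=> Hw; have Hw' : H (w - G w) by apply: HB => //; exact: hG.
  have -> : ip w (v - G v) = ip (w - G w) v.
    by rewrite (ipBr ax)//; [rewrite (ipBl ax) ?Gsa//; exact: hG|exact: hG].
  rewrite -subr_le0; apply: (@le0_of_small _ _ 1) => // e e0; rewrite mulr1.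
  have [N NP] := cvg0_eventually_lt (@cvg_exp_gap_mul _ (`|s| * M) (nm (w - G w) * nm Om)) e0.
  have := NP N.+1 (leqnSn _); have := group_ip_diff ax bF M0 FM exP s N.+1 HOm Hw'.
  rewrite (ip_expsum ax bF FM)//; set S := \sum_(k < N.+1) _ => g1 g2.
  have SE : Normc.normc S <= `|s| * expR (`|s| * M) * dl * nm w.
    rewrite /S; apply: le_trans (normc_sum _ _ _) _.
    rewrite big_ord_recl /=.
    have -> : ip (w - G w) Om = 0.
      rewrite (ipBl ax)// ?Gsa//; last exact: hG.
      by rewrite (ip_eqr ax _ _ _ GOm) ?subrr//; exact: hG.
    rewrite mulr0 Normc.normc0 add0r.
    apply: (@le_trans _ _ (\sum_(k < N) exp_coeff (`|s| * M) k * (`|s| * dl * nm w))).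
      apply: ler_sum => k _; rewrite /bump leq0n add1n Normc.normcM normc_coeff.
      have HF : H (iter k.+1 F Om) by exact: Hit.
      have HGF := hG HF.
      have -> : ip (w - G w) (F (iter (0 + k) F Om)) = ip w (iter k.+1 F Om - G (iter k.+1 F Om)).
        rewrite add0n -iterS (ipBr ax)// (ipBl ax)//; last exact: hG.
        by rewrite Gsa.
      have CS := ip_CS ax Hw (HB HF HGF).
      have SD := sign_difference_iter ax HOm bR Rstar starK bG GG Gsa GOm GR k tF M0 FM.
      apply: le_trans (ler_wpM2l (exp_coeff_ge0 _ (normr_ge0 s)) CS) _.
      apply: le_trans (ler_wpM2l (exp_coeff_ge0 _ (normr_ge0 s)) (ler_wpM2l (nm_ge0 w) SD)) _.
      rewrite le_eqVlt; apply/orP; left; apply/eqP.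
      rewrite /exp_coeff/= exprMn factS natrM invfM exprS -/dl.
      have n0 : k.+1%:R != 0 :> R by rewrite pnatr_eq0.
      move: n0; move: (k.+1%:R) (k`!%:R^-1) (M ^+ k) (`|s| ^+ k) => x y p q x0.
      transitivity ((x^-1 * x) * (`|s| * q * y * p * dl * nm w)); first by ring.
      by rewrite mulVf// mul1r; ring.
    rewrite -mulr_suml [leRHS](_ : _ = expR (`|s| * M) * (`|s| * dl * nm w)); last by ring.
    apply: ler_wpM2r; first exact: (mulr_ge0 (mulr_ge0 (normr_ge0 s) (nm_ge0 _)) (nm_ge0 w)).
    have := expR_partial_le N (mulr_ge0 (normr_ge0 s) M0).
    by rewrite /series/= big_mkord.
  rewrite lerBlDr; apply: le_trans (_ : Normc.normc ((ip (w - G w) v - S) + S) <= _).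
    by rewrite subrK.
  apply: le_trans (normcD_le _ _) _; apply: lerD => //.
  by apply: le_trans g1 _; exact: ltW.
have := weak _ Hd; rewrite (hilb_ip_self ax)// normc_real ger0_norm ?sqr_ge0// expr2.
have := nm_ge0 (v - G v); rewrite le_eqVlt => /predU1P[<-//|np].
by rewrite ler_pM2r.
Qed.

End with_sign.
End tracial_exponential.

(** * Averages of sign flips *)

Section distinct_points.
Variable R : realType.
Local Notation rT := (measurableTypeR R).
Local Notation mu := (@chain_measure R).
Local Notation nu := (@leb_pos R).
Local Notation leb n := (leb_tuple R n).

Lemma ae_leb_tuple_cons n (N : set (n.+1.-tuple rT)) : measurable N ->
  (forall y : n.-tuple rT, nu [set t : rT | N (pair_cons (t, y))] = 0%E) ->
  {ae leb n.+1, forall x, ~ N x}.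
Proof.
move=> mN N0; exists N; split => //; last by move=> x /= /contrapT.
have mI : measurable_fun setT (fun x => (\1_N x : R)%:E) by exact/measurable_EFinP/measurable_indic.
rewrite -[N]setIT -integral_indic// integral_leb_tupleS//.
rewrite (fubini_tonelli (m1 := nu) (m2 := leb n) (fun p : rT * n.-tuple rT => (\1_N (pair_cons p))%:E))//.
  apply: integral0_eq => y _; rewrite -[RHS](N0 y).
  have mNy : measurable [set t : rT | N (pair_cons (t, y))].
    rewrite -[X in measurable X]setTI.
    exact: (measurableT_comp (@measurable_pair_cons _ rT n) (measurable_pair2 y)).
  by rewrite -[in RHS](setIT [set t | _]) -integral_indic//; apply: eq_integral.
by apply: (measurableT_comp mI); exact: measurable_pair_cons.
Qed.

Lemma leb_pos_set1 (a : R) : nu [set a] = 0%E.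
Proof.
apply/eqP; rewrite eq_le measure_ge0 andbT -[X in (_ <= X)%E](lebesgue_measure_set1 a).
rewrite /leb_pos /mrestr; apply: le_measure; rewrite ?inE//.
by apply: measurableI; [exact: measurable_set1|exact: measurable_itv].
Qed.

Lemma leb_pos_mem (y : seq R) : nu [set t : rT | (t < 0) || (t \in y)] = 0%E.
Proof.
have m0 : measurable ([set t : rT | t < 0] : set rT).
  rewrite (_ : [set t | _] = `]-oo, 0[%classic); first exact: measurable_itv.
  by apply/seteqP; split => t /=; rewrite in_itv.
elim: y => [|a y IH].
  rewrite (_ : [set t | _] = [set t : rT | t < 0]); last first.
    by apply/seteqP; split => t /=; rewrite orbF.
  rewrite /leb_pos /mrestr (_ : _ `&` _ = set0) ?measure0//.
  rewrite -subset0 => t [/= t0]; rewrite in_itv/= andbT.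
  by move=> /le_lt_trans/(_ t0); rewrite ltxx.
have my (z : seq R) : measurable ([set t : rT | (t < 0) || (t \in z)] : set rT).
  elim: z => [|b z IHz].
    by rewrite (_ : [set t | _] = [set t : rT | t < 0])//; apply/seteqP; split => t /=; rewrite orbF.
  rewrite (_ : [set t | _] = [set t : rT | (t < 0) || (t \in z)] `|` [set b]).
    by apply: measurableU => //; exact: measurable_set1.
  apply/seteqP; split => t /=; rewrite inE.
    by case/or3P => [->|/eqP->|->]; [left|right|left; rewrite orbT].
  by move=> [/orP[->|->]|->]; rewrite ?eqxx ?orbT.
apply/eqP; rewrite eq_le measure_ge0 andbT.
rewrite (_ : [set t | _] = [set t : rT | (t < 0) || (t \in y)] `|` [set a]); last first.
  apply/seteqP; split => t /=; rewrite inE.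
    by case/or3P => [->|/eqP->|->]; [left|right|left; rewrite orbT].
  by move=> [/orP[->|->]|->]; rewrite ?eqxx ?orbT.
have m1 : measurable ([set a] : set rT) by exact: measurable_set1.
apply: le_trans (measureU2 _ (my y) m1) _.
rewrite le_eqVlt; apply/orP; left; apply/eqP; transitivity (0 + 0 : \bar R)%E; last exact: adde0.
by congr (_ + _)%E; [exact: IH|exact: leb_pos_set1].
Qed.

Lemma ae_distinct : {ae mu, forall s : chain R, uniq s /\ all (fun t => 0 <= t) s}.
Proof.
apply/ae_chainP; elim=> [|n IH]; first by apply: aeW => x; rewrite /tchain [x]tuple0.
pose N : set (n.+1.-tuple rT) := [set x | (thead x < 0) || (thead x \in behead x)].
have mh : measurable_fun setT (fun x : n.+1.-tuple rT => thead x : R).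
  exact: (@measurable_tnth _ rT n.+1 ord0).
have mN : measurable N.
  rewrite (_ : N = [set x | thead x < 0] `|` \bigcup_(i in [set i : nat | (i < n)%N])
     [set x : n.+1.-tuple rT | thead x = nth 0 (behead x) i]).
    apply: measurableU.
      rewrite -[X in measurable X]setTI; apply: (measurable_fun_ltr mh (@measurable_cst _ _ _ _ setT (0 : R))) => //.
    apply: bigcup_measurable => i /= ni; rewrite -[X in measurable X]setTI.
    have mi : measurable_fun setT (fun x : n.+1.-tuple rT => nth 0 (behead x) i : R).
      rewrite (_ : (fun x => _) = fun x : n.+1.-tuple rT => tnth x (lift ord0 (Ordinal ni))).
        exact: measurable_tnth.
      by apply/funext => x; case/tupleP: x => t y; rewrite tnthS (tnth_nth 0).
    rewrite (_ : [set x | _] = (fun x : n.+1.-tuple rT => thead x == nth 0 (behead x) i) @^-1` [set true]).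
      exact: (measurable_fun_eqr mh mi).
    by apply/seteqP; split => x /= /eqP.
  apply/seteqP; split => x /=.
    move=> /orP[->|h]; first by left.
    right; exists (index (thead x) (behead x)) => /=; last by rewrite nth_index.
    by rewrite -[X in (_ < X)%N](_ : size (behead x) = n) ?index_mem// size_behead size_tuple.
  rewrite /N /= => -[->//|[i ni e]]; apply/orP; right; rewrite e; apply: mem_nth.
  by rewrite size_behead size_tuple.
have h1 : {ae leb n.+1, forall x, ~ N x}.
  apply: ae_leb_tuple_cons => // y.
  rewrite (_ : [set t : rT | _] = [set t : rT | (t < 0) || (t \in y)]); first exact: leb_pos_mem.
  by apply/seteqP; split => t; rewrite /N /= theadE.
have h2 := ae_behead IH.
apply: filterS2 h1 h2 => x; rewrite /N /tchain /=; case/tupleP: x => t y /=.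
rewrite theadE => /negP; rewrite negb_or -leNgt => /andP[t0 ty] [uy ay].
by rewrite ty uy t0 ay.
Qed.

End distinct_points.

Section sign_hull.
Variable R : realType.
Local Notation rT := (measurableTypeR R).
Local Notation mu := (@chain_measure R).
Local Notation Re := (@complex.Re R).
Implicit Types (k : seq R -> R) (u v : vect R).

Inductive sign_hull : (seq R -> R) -> Prop :=
| hull_sign e : is_sign e -> sign_hull (sign_product e)
| hull_convex p k k' : 0 <= p <= 1 -> sign_hull k -> sign_hull k' ->
    sign_hull (fun s => p * k s + (1 - p) * k' s)
| hull_limit (ks : nat -> seq R -> R) k : (forall m, sign_hull (ks m)) ->
    contraction_multiplier k ->
    {ae mu, forall s : chain R, ks m s @[m --> \oo] --> k s} -> sign_hull k.

Lemma hull_contraction k : sign_hull k -> contraction_multiplier k.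
Proof.
elim=> {k} [e he|p k k' /andP[p0 p1] _ [mk k1 ks] _ [mk' k'1 ks']|//].
  exact: sign_contraction.
split.
- apply: measurable_funD; apply: measurable_funM => //; exact: measurable_cst.
- move=> s; apply: le_trans (ler_normD _ _) _; rewrite !normrM (ger0_norm p0).
  rewrite [`|1 - p|]ger0_norm ?subr_ge0//.
  have := ler_wpM2l p0 (k1 s); have q0 : 0 <= 1 - p by rewrite subr_ge0.
  have := ler_wpM2l q0 (k'1 s); lra.
- by move=> n q x; rewrite ks ks'.
Qed.

Lemma contraction_size (f : nat -> R) : (forall n, `|f n| <= 1) ->
  contraction_multiplier (fun s => f (size s)).
Proof.
move=> f1; split; first exact: (measurable_size_fun f).
  by move=> s.
by move=> n p x; rewrite !size_tuple.
Qed.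

Definition cell (m j : nat) (t : R) := (j%:R <= t * m%:R) && (t * m%:R < j.+1%:R).

Definition odd_weight (r : R) (As : seq (R -> bool)) (s : seq R) : R :=
  \prod_(A <- As) (if odd (count A s) then r else 1).

Lemma hull_odd_weight r As e : 0 <= r <= 1 -> is_sign e ->
  (forall A, (exists m j, A = cell m j) \/ ~ List.In A As) ->
  sign_hull (fun s => sign_product e s * odd_weight r As s).
Proof.
move=> /andP[r0 r1]; elim: As e => [|A As IH] e he hA.
  rewrite (_ : (fun s => _) = sign_product e); first exact: hull_sign.
  by apply/funext => s; rewrite /odd_weight big_nil mulr1.
have [[m [j AE]]|] := hA A; last by case; left.
have hA' : forall B, (exists m j, B = cell m j) \/ ~ List.In B As.
  by move=> B; have [|h] := hA B; [left|right => h'; apply: h; right].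
pose eA t : R := if A t then -1 else 1.
have heA : is_sign eA.
  split; last by move=> t; rewrite /eA; case: (A t); rewrite ?mulrNN mulr1.
  have mA : measurable_fun setT (A : rT -> bool).
    have mt : measurable_fun setT (fun t : rT => (t : R) * m%:R).
      by apply: measurable_funM => //; exact: measurable_cst.
    rewrite AE; apply: measurable_and.
      by apply: measurable_fun_ler => //; exact: measurable_cst.
    by apply: measurable_fun_ltr => //; exact: measurable_cst.
  by apply: measurable_fun_ifT => //; exact: measurable_cst.
have he' : is_sign (fun t => e t * eA t).
  split; first by apply: measurable_funM; [exact: he.1|exact: heA.1].
  by move=> t; rewrite mulrACA he.2 heA.2 mulr1.
pose p := (1 + r) / 2.
have p01 : 0 <= p <= 1 by rewrite /p; apply/andP; split; lra.
have := hull_convex p01 (IH e he hA') (IH _ he' hA').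
congr sign_hull; apply/funext => s.
have -> : sign_product (fun t => e t * eA t) s = sign_product e s * (-1) ^+ (count A s).
  rewrite /sign_product big_split /=; congr (_ * _).
  rewrite /eA -big_mkcond /= big_const_seq iter_mulr mulr1.
  by [].
rewrite /odd_weight big_cons -signr_odd; case: (odd _); rewrite ?expr1 ?expr0 /p.
  by field.
by field.
Qed.

Definition cells (m : nat) : seq (R -> bool) := [seq cell m j | j <- iota 0 (m * m)].

Lemma odd_weight_cells r m s : uniq s -> all (fun t => 0 <= t) s ->
  (forall t, t \in s -> t < m%:R) ->
  (forall t t', t \in s -> t' \in s -> t != t' -> 1 <= `|t - t'| * m%:R) ->
  odd_weight r (cells m) s = r ^+ size s.
Proof.
move=> us /allP s0 sm sd.
pose idx (t : R) := Num.truncn (t * m%:R).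
have cellE j t : t \in s -> cell m j t = (idx t == j).
  move=> ts; have t0 : 0 <= t * m%:R by rewrite mulr_ge0// s0.
  have /andP[h1 h2] := truncn_itv t0; rewrite /cell -/(idx t).
  apply/idP/eqP => [/andP[h3 h4]|<-]; last by rewrite h1 h2.
  have a1 : (idx t < j.+1)%N by rewrite -(@ltr_nat R); exact: le_lt_trans h1 h4.
  have a2 : (j < (idx t).+1)%N by rewrite -(@ltr_nat R); exact: le_lt_trans h3 h2.
  by apply/eqP; rewrite eqn_leq -ltnS a1 -ltnS a2.
have idx_inj : {in s &, injective idx}.
  move=> t t' ts t's E; apply/eqP; apply: contraT => /(sd _ _ ts t's).
  have t0 : 0 <= t * m%:R by rewrite mulr_ge0// s0.
  have t'0 : 0 <= t' * m%:R by rewrite mulr_ge0// s0.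
  have /andP[h1 h2] := truncn_itv t0; have /andP[h3 h4] := truncn_itv t'0.
  rewrite -/(idx t) E in h1 h2; rewrite -/(idx t') in h3 h4.
  rewrite -[m%:R]ger0_norm// -normrM mulrBl leNgt => /negP; case.
  rewrite ltr_norml -natr1 in h2 h4 *.
  by apply/andP; split; lra.
have uidx : uniq [seq idx t | t <- s] by rewrite map_inj_in_uniq.
have ridx j : j \in [seq idx t | t <- s] -> (j < m * m)%N.
  move=> /mapP[t ts ->]; rewrite -(ltr_nat R); have t0 : 0 <= t * m%:R by rewrite mulr_ge0// s0.
  have /andP[h1 _] := truncn_itv t0; apply: le_lt_trans h1 _.
  have mp : 0 < m%:R :> R by apply: le_lt_trans (s0 _ ts) (sm _ ts).
  by rewrite natrM ltr_pM2r// sm.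
have cE j : count (cell m j) s = (j \in [seq idx t | t <- s]) :> nat.
  rewrite -(count_uniq_mem _ uidx) count_map; apply: eq_in_count => t ts /=.
  exact: cellE.
rewrite /odd_weight /cells big_map.
rewrite (eq_bigr (fun j => if j \in [seq idx t | t <- s] then r else 1)); last first.
  by move=> j _; rewrite cE oddb.
rewrite -big_mkcond /= big_const_seq iter_mulr mulr1; congr (r ^+ _).
rewrite -(size_map idx s) -size_filter; apply/perm_size/uniq_perm => //.
  by apply: filter_uniq; exact: iota_uniq.
move=> j; rewrite mem_filter mem_iota add0n /=.
by apply/andP/idP => [[]//|h]; split => //; exact: ridx.
Qed.

Lemma near_all_seq (T : eqType) (s : seq T) (P : T -> nat -> Prop) :
  (forall x, x \in s -> \forall m \near \oo, P x m) ->
  \forall m \near \oo, forall x, x \in s -> P x m.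
Proof.
elim: s => [|a s IH] h; first by apply: nearW => m x; rewrite in_nil.
have h1 := h a (mem_head _ _); have h2 := IH (fun x xs => h x (mem_behead (s := a :: s) xs)).
by apply: filterS2 h1 h2 => m pa ps x; rewrite inE => /predU1P[->|]; [|exact: ps].
Qed.

Lemma hull_power r : 0 <= r <= 1 -> sign_hull (fun s => r ^+ size s).
Proof.
move=> /[dup] r01 /andP[r0 r1].
have he1 : is_sign (fun _ : R => 1) by split; [exact: measurable_cst|move=> t; rewrite mulr1].
apply: (@hull_limit (fun m s => sign_product (fun=> 1) s * odd_weight r (cells m) s)).
- move=> m; apply: hull_odd_weight => // A.
  case: (pselect (List.In A (cells m))) => h; [left|by right].
  move: h; rewrite /cells; elim: (iota _ _) => [//|j js IHj] /= [<-|//].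
  by exists m, j.
- apply: (contraction_size (f := fun n => r ^+ n)) => n.
  by rewrite ger0_norm ?exprn_ge0// exprn_ile1.
- apply: filterS (ae_distinct R) => s [us ps].
  apply: cvg_near_cst.
  have h1 : \forall m \near \oo, forall t, t \in s -> t < m%:R.
    apply: near_all_seq => t _; have := nbhs_infty_ger (t + 1); apply: filterS => m.
    by apply: lt_le_trans; rewrite ltrDl.
  have h2 : \forall m \near \oo, forall t, t \in s -> forall t', t' \in s ->
      t != t' -> 1 <= `|t - t'| * m%:R.
    apply: near_all_seq => t _; apply: near_all_seq => t' _.
    have [->|tt'] := eqVneq t t'; first exact: nearW.
    have d0 : 0 < `|t - t'| by rewrite normr_gt0 subr_eq0.
    have := nbhs_infty_ger (`|t - t'|^-1); apply: filterS => m hm _.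
    by rewrite -ler_pdivrMl// mulr1.
  apply: filterS2 h1 h2 => m a1 a2.
  rewrite (_ : sign_product _ _ = 1) ?mul1r; last by rewrite /sign_product big1.
  by apply: odd_weight_cells => // t t' ts t's; exact: a2.
Qed.

Lemma hull_average (ks : nat -> seq R -> R) m : (forall j, sign_hull (ks j)) ->
  sign_hull (fun s => m.+1%:R^-1 * \sum_(j < m.+1) ks j s).
Proof.
move=> hk; elim: m => [|m IH].
  rewrite (_ : (fun s => _) = ks 0%N)//.
  by apply/funext => s; rewrite big_ord1 invr1 mul1r.
pose p : R := m.+1%:R / m.+2%:R.
have n1 : m.+1%:R != 0 :> R by rewrite pnatr_eq0.
have n2 : m.+2%:R != 0 :> R by rewrite pnatr_eq0.
have p01 : 0 <= p <= 1.
  by rewrite /p divr_ge0//= ler_pdivrMr ?ltr0n// mul1r ler_nat.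
have := hull_convex p01 IH (hk m.+1); congr sign_hull; apply/funext => s.
rewrite [in RHS]big_ord_recr /= /p.
move: (\sum_(j < m.+1) _) (ks _ s) => a b; move: n1 n2; rewrite -[m.+2%:R]natr1.
move: (m.+1%:R) => x x0 x1.
by field; rewrite x0 x1.
Qed.

Lemma power_increment (x : R) (k : nat) : 0 <= x ->
  k.+1%:R * x ^+ k <= (x + 1) ^+ k.+1 - x ^+ k.+1 <= k.+1%:R * (x + 1) ^+ k.
Proof.
move=> x0; have x1 : 0 <= x + 1 by rewrite addr_ge0.
elim: k => [|k /andP[IH1 IH2]]; first by rewrite !expr1 !expr0; apply/andP; split; lra.
have E : (x + 1) ^+ k.+2 - x ^+ k.+2 = x * ((x + 1) ^+ k.+1 - x ^+ k.+1) + (x + 1) ^+ k.+1.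
  by rewrite (exprS (x + 1) k.+1) (exprS x k.+1); ring.
have m1 : x ^+ k.+1 <= (x + 1) ^+ k.+1 by rewrite ler_pXn2r ?nnegrE// lerDl.
have m2 : x * (x + 1) ^+ k <= (x + 1) ^+ k.+1.
  by rewrite exprS ler_wpM2r ?exprn_ge0// lerDl.
rewrite E -[k.+2%:R]natr1; apply/andP; split.
  have := ler_wpM2l x0 IH1; rewrite !exprS in m1 *.
  move: (x ^+ k) ((x + 1) ^+ k) (k.+1%:R) m1 => a b c m1 h; nra.
have h1 := ler_wpM2l x0 IH2; have h2 := ler_wpM2l (ler0n R k.+1) m2.
rewrite mulrCA in h1; apply: le_trans (lerD h1 (lexx _)) _.
by rewrite mulrDl mul1r lerD2r.
Qed.

Lemma cvg_riemann_power (k : nat) :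
  m.+1%:R^-1 * \sum_(j < m.+1) (j%:R / m.+1%:R) ^+ k @[m --> \oo] --> (k.+1%:R^-1 : R).
Proof.
have k0 : 0 < k.+1%:R :> R by rewrite ltr0n.
have bound m : `|k.+1%:R^-1 - m.+1%:R^-1 * \sum_(j < m.+1) (j%:R / m.+1%:R) ^+ k| <= m.+1%:R^-1 :> R.
  set x : R := m.+1%:R; have x0 : 0 < x by rewrite ltr0n.
  pose S := \sum_(j < m.+1) j%:R ^+ k : R; pose S' := \sum_(j < m.+1) (j%:R + 1) ^+ k : R.
  have ES : x^-1 * \sum_(j < m.+1) (j%:R / x) ^+ k = S / x ^+ k.+1.
    under eq_bigr do rewrite exprMn exprVn.
    by rewrite -mulr_suml exprS invfM -/S mulrCA mulrC.
  have T1 : \sum_(j < m.+1) ((j%:R + 1) ^+ k.+1 - j%:R ^+ k.+1) = x ^+ k.+1 :> R.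
    under eq_bigr do rewrite natr1.
    rewrite -(big_mkord xpredT (fun j => j.+1%:R ^+ k.+1 - j%:R ^+ k.+1 : R)).
    by rewrite telescope_sumr// expr0n subr0.
  have h1 : k.+1%:R * S <= x ^+ k.+1.
    rewrite -T1 /S mulr_sumr; apply: ler_sum => j _.
    by have /andP[] := power_increment k (ler0n R j).
  have h2 : x ^+ k.+1 <= k.+1%:R * S'.
    rewrite -T1 /S' mulr_sumr; apply: ler_sum => j _.
    by have /andP[] := power_increment k (ler0n R j).
  have h3 : S' - S <= x ^+ k.
    rewrite /S /S' -sumrB; under eq_bigr do rewrite natr1.
    rewrite -(big_mkord xpredT (fun j => j.+1%:R ^+ k - j%:R ^+ k : R)).
    rewrite telescope_sumr// lerBlDr lerDl; exact: exprn_ge0.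
  have xk : 0 < x ^+ k.+1 by exact: exprn_gt0.
  rewrite ES; have a1 : S / x ^+ k.+1 <= k.+1%:R^-1.
    by rewrite ler_pdivrMr// mulrC ler_pdivlMr// mulrC.
  rewrite ger0_norm ?subr_ge0// lerBlDr.
  have a2 : k.+1%:R^-1 <= S' / x ^+ k.+1.
    by rewrite ler_pdivlMr// mulrC ler_pdivrMr// mulrC.
  apply: le_trans a2 _; rewrite ler_pdivrMr// mulrDl mulfVK ?gt_eqF//.
  rewrite exprS mulKf ?gt_eqF//; lra.
apply/cvgrPdist_le => e e0.
have := nbhs_infty_ger (e^-1); apply: filterS => m hm.
apply: le_trans (bound m) _.
rewrite -[e]invrK lef_pV2 ?posrE ?ltr0n ?invr_gt0//.
by apply: le_trans hm _; rewrite ler_nat.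
Qed.

Lemma hull_inverse_number : sign_hull (fun s => (size s).+1%:R^-1).
Proof.
apply: (@hull_limit (fun m s => m.+1%:R^-1 * \sum_(j < m.+1) (j%:R / m.+1%:R) ^+ size s)).
- move=> m.
  have := @hull_average (fun j s => ((minn j m)%:R / m.+1%:R) ^+ size s) m _.
  rewrite (_ : (fun s => _) = (fun s => m.+1%:R^-1 * \sum_(j < m.+1) (j%:R / m.+1%:R) ^+ size s)).
    apply=> j; apply: hull_power; rewrite divr_ge0//= ler_pdivrMr ?ltr0n// mul1r ler_nat.
    by rewrite ltnW// ltnS geq_minr.
  apply/funext => s; congr (_ * _); apply: eq_bigr => j _.
  by rewrite (minn_idPl _)// -ltnS.
- apply: (contraction_size (f := fun n => n.+1%:R^-1)) => n.
  by rewrite ger0_norm ?invr_ge0// invf_le1 ?ltr0n// ler1n.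
- by apply: aeW => s; exact: cvg_riemann_power.
Qed.

End sign_hull.

Local Opaque inner fock_norm norm2.

Section exponential_operator.
Variable R : realType.
Local Notation rT := (measurableTypeR R).
Local Notation mu := (@chain_measure R).
Local Notation Re := (@complex.Re R).
Implicit Types (u v w : vect R) (k : seq R -> R).
Local Notation ax := (@fock_hilbert R).
Local Notation hbd := (hbounded (@fock R) (@fock_norm R) (@fock_eq R)).
Local Notation leo := (le_op (@fock R) (@fock_norm R)).

Lemma norm2_cvg0 (w : nat -> vect R) : (forall n, fock (w n)) ->
  (norm2 (w n) @[n --> \oo] --> 0%E) <-> (fock_norm (w n) @[n --> \oo] --> (0 : R)).
Proof.
move=> fw; have E : (fun n => norm2 (w n)) = (fun n => (fock_norm (w n) ^+ 2)%:E).
  by apply/funext => n; rewrite norm2_fock.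
rewrite E; split=> h.
  have h2 : fock_norm (w n) ^+ 2 @[n --> \oo] --> (0 : R).
    exact: (fine_cvg h).
  have -> : (fun n => fock_norm (w n)) = (fun n => Num.sqrt (fock_norm (w n) ^+ 2)).
    by apply/funext => n; rewrite sqrtr_sqr ger0_norm ?fock_norm_ge0.
  rewrite -[X in _ --> X](@sqrtr0 R).
  exact: (continuous_cvg _ (@sqrt_continuous R 0) h2).
apply: cvg_EFin; first exact: nearW.
have -> : fine \o (fun n => (fock_norm (w n) ^+ 2)%:E) = (fun n => fock_norm (w n) * fock_norm (w n)).
  by apply/funext => n /=; rewrite expr2.
by rewrite -[X in _ --> X](mulr0 (0 : R)); exact: cvgM.
Qed.

Lemma op_expP (T : operator R) u : hbd T -> fock u ->
  exp_of (@fock R) (@fock_norm R) T u (op_exp T u).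
Proof.
move=> bT fu; rewrite /op_exp.
have E v : fock v -> forall n, fock (v - expsum T n u).
  by move=> fv n; apply: (HB ax fv); exact: (expsum_H ax n bT fu).
case: (xgetPex 0 (P := [set v : vect R | fock v /\
    norm2 (v - \sum_(k < n) k`!%:R^-1 *: iter k T u) @[n --> \oo] --> 0%E])).
  have [v [fv cv]] := exp_exists ax bT fu; exists v; split => //.
  exact: ((norm2_cvg0 (E v fv)).2 cv).
move=> fx cx; split => //.
exact: ((norm2_cvg0 (E _ fx)).1 cx).
Qed.

End exponential_operator.

Section hull_estimates.
Variable R : realType.
Local Notation rT := (measurableTypeR R).
Local Notation mu := (@chain_measure R).
Local Notation Re := (@complex.Re R).
Implicit Types (u v w : vect R) (k : seq R -> R).
Local Notation ax := (@fock_hilbert R).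

Lemma multiplier_cvg (ks : nat -> seq R -> R) k v :
  (forall m, contraction_multiplier (ks m)) -> contraction_multiplier k ->
  {ae mu, forall s : chain R, ks m s @[m --> \oo] --> k s} -> fock v ->
  fock_norm (multiplier (ks m) v - multiplier k v) @[m --> \oo] --> (0 : R).
Proof.
move=> cks ck kk fv; have [mv sv] := fock_L2v fv.
have ff m : fock (multiplier (ks m) v - multiplier k v).
  by apply: fockB; exact: multiplier_fock.
apply: (norm2_cvg0 ff).1.
pose f m (s : chain R) : \bar R := ((ks m s - k s) ^+ 2 * sqn (v s))%:E.
have mk m : measurable_fun setT (ks m : chain R -> R) by case: (cks m).
have mk0 : measurable_fun setT (k : chain R -> R) by case: ck.
have nE m : norm2 (multiplier (ks m) v - multiplier k v) = (\int[mu]_s f m s)%E.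
  rewrite norm2E; last exact: (fock_L2v (ff m)).1.
  apply: eq_integral => s _; rewrite sqmodE /f.
  rewrite (_ : (_ - _) s = (ks m s - k s)%:C * v s) ?sqn_real//.
  change ((ks m s)%:C * v s - (k s)%:C * v s = (ks m s - k s)%:C * v s).
  by rewrite rmorphB mulrBl.
have mf m : measurable_fun setT (f m).
  apply/measurable_EFinP; apply: measurable_funM; last exact: measurable_sqn.
  by apply: measurable_funX; exact: measurable_funB.
have [] := @dominated_convergence _ _ _ mu setT measurableT f (cst 0%E)
   (fun s => (4 * sqn (v s))%:E) mf (@measurable_cst _ _ _ _ setT 0%E).
- apply: filterS kk => s ks_ _; apply: cvg_EFin; first exact: nearW.
  have h : (ks m s - k s) @[m --> \oo] --> (0 : R).
    by rewrite -(subrr (k s)); apply: cvgB => //; exact: cvg_cst.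
  have -> : fine \o f^~ s = (fun m => (ks m s - k s) * (ks m s - k s) * sqn (v s)).
    by apply/funext => m; rewrite /f /= expr2.
  rewrite -[X in _ --> X](mul0r (sqn (v s))); apply: cvgM; last exact: cvg_cst.
  by rewrite -[X in _ --> X](mulr0 (0 : R)); exact: cvgM.
- have := integrableZl measurableT (4 : R) sv; exact: eq_integrable.
- apply: aeW => s m _; rewrite /f lee_fin.
  rewrite (ger0_norm (mulr_ge0 (sqr_ge0 (ks m s - k s)) (sqn_ge0 (v s)))).
  apply: ler_wpM2r; first exact: sqn_ge0.
  have [_ k1 _] := ck; have [_ ks1 _] := cks m.
  have := k1 s; have := ks1 s; rewrite !ler_norml => /andP[a1 a2] /andP[a3 a4]; nra.
move=> _ _; rewrite integral0 => h.
rewrite (_ : (fun n => _) = (fun m => \int[mu]_s f m s)%E)//.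
by apply/funext => m; exact: nE.
Qed.

Lemma multiplier_convex p k k' v :
  multiplier (fun s => p * k s + (1 - p) * k' s) v =
  p%:C *: multiplier k v + ((1 - p)%:C *: multiplier k' v).
Proof.
apply/funext => s.
change ((p * k s + (1 - p) * k' s)%:C * v s =
  p%:C * ((k s)%:C * v s) + (1 - p)%:C * ((k' s)%:C * v s)).
by rewrite rmorphD !rmorphM; ring.
Qed.

Record hull_functional (phi : (seq R -> R) -> R) : Prop := {
  hull_functional_convex : forall p k k', sign_hull k -> sign_hull k' ->
    phi (fun s => p * k s + (1 - p) * k' s) = p * phi k + (1 - p) * phi k';
  hull_functional_limit : forall (ks : nat -> seq R -> R) k, (forall m, sign_hull (ks m)) ->
    contraction_multiplier k -> {ae mu, forall s : chain R, ks m s @[m --> \oo] --> k s} ->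
    phi (ks m) @[m --> \oo] --> phi k }.

Lemma hull_ineq (phi psi : (seq R -> R) -> R) (A B C : R) :
  hull_functional phi -> hull_functional psi -> 0 <= C ->
  (forall e, is_sign e -> A - phi (sign_product e) <= C * (B - psi (sign_product e))) ->
  forall k, sign_hull k -> A - phi k <= C * (B - psi k).
Proof.
move=> [pc pl] [qc ql] C0 hs k; elim=> {k} [//|p k k' /andP[p0 p1] hk IH hk' IH'|ks k hks IH ck kk].
- rewrite pc// qc//; have h1 := ler_wpM2l p0 IH.
  have q0 : 0 <= 1 - p by rewrite subr_ge0.
  have h2 := ler_wpM2l q0 IH'; have := lerD h1 h2; move=> {pc pl qc ql hs h1 h2 IH IH'}.
  move: (phi k) (phi k') (psi k) (psi k') => x y z t; lra.
- apply: (@ler_cvg_to _ \oo _ _ (fun m => A - phi (ks m)) (fun m => C * (B - psi (ks m)))).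
  + by apply: cvgB; [exact: cvg_cst|exact: pl].
  + by apply: cvgM; [exact: cvg_cst|apply: cvgB; [exact: cvg_cst|exact: ql]].
  + by apply: nearW => m; exact: IH.
Qed.

Lemma hull_upper_bound (phi : (seq R -> R) -> R) (c : R) : hull_functional phi ->
  (forall e, is_sign e -> phi (sign_product e) <= c) ->
  forall k, sign_hull k -> phi k <= c.
Proof.
move=> [hc hl] hs k hk.
have z0 : hull_functional (fun k => 0).
  by split=> [p k0 k1 _ _|*]; [rewrite !mulr0 addr0|exact: cvg_cst].
have hN : hull_functional (fun k => - phi k).
  split => [p k0 k1 h0 h1|ks k0 h0 h1 h2]; last by apply: cvgN; exact: hl.
  by rewrite (hc _ _ _ h0 h1) opprD !mulrN.
have H := @hull_ineq _ _ (- c) 0 1 hN z0 ler01.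
have : - c - - phi k <= 1 * (0 - 0).
  by apply: H => // e he; rewrite mul1r subr0 opprK addrC subr_le0; exact: hs.
by rewrite mul1r subr0 opprK addrC subr_le0.
Qed.

Lemma hull_functional_inner u y : fock u -> fock y ->
  hull_functional (fun k => Re (inner u (multiplier k y))).
Proof.
move=> fu fy; split=> [p k k' hk hk'|ks k hks ck kk].
  have f1 := multiplier_fock (hull_contraction hk) fy.
  have f2 := multiplier_fock (hull_contraction hk') fy.
  rewrite multiplier_convex (innerZDr _ f1 (HZ ax _ f2) fu) (ipZr ax _ f2 fu).
  by case: (inner u (multiplier k y)) (inner u (multiplier k' y)) => a b [a' b'] /=; ring.
have cks m := hull_contraction (hks m).
have c0 := multiplier_cvg cks ck kk fy.
apply/cvgrPdist_le => e e0.
have c1 : fock_norm u * fock_norm (multiplier (ks m) y - multiplier k y) @[m --> \oo] --> (0 : R).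
  by rewrite -(mulr0 (fock_norm u)); apply: cvgM => //; exact: cvg_cst.
have [N NP] := cvg0_eventually_lt c1 e0.
exists N => // m /= Nm; apply: le_trans (ltW (NP m Nm)).
have f1 := multiplier_fock (cks m) fy; have f2 := multiplier_fock ck fy.
have f3 := HB ax f1 f2; rewrite distrC.
have E := ipBr ax f1 f2 fu.
apply: le_trans (Re_ip_CS ax fu f3); rewrite E.
by case: (inner u _) (inner u _) => ? ? [].
Qed.

Lemma sign_op_energy e v : is_sign e -> fock v ->
  2 * (fock_norm v ^+ 2 - Re (inner v (sign_op e v))) = fock_norm (v - sign_op e v) ^+ 2.
Proof.
move=> he fv.
have GG x : fock x -> fock_eq (sign_op e (sign_op e x)) x.
  by move=> _; rewrite (sign_opK he); exact: fock_eq_refl.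
have Gsa x y : fock x -> fock y -> inner (sign_op e x) y = inner x (sign_op e y).
  by move=> _ _; exact: inner_multiplier.
exact: (sign_energy ax (sign_op_bounded he) GG Gsa fv).
Qed.

Lemma energy_transfer (a b x y C : R) : 2 * a = x ^+ 2 -> 2 * b = y ^+ 2 ->
  x <= C * y -> 0 <= x -> 0 <= y -> 0 <= C -> a <= C ^+ 2 * b.
Proof.
move=> ax_ by_ xy x0 y0 C0; have : x ^+ 2 <= (C * y) ^+ 2.
  by rewrite ler_pXn2r// nnegrE mulr_ge0.
by rewrite exprMn -ax_ -by_ mulrCA ler_pM2l.
Qed.

Lemma hull_energy v w (C : R) : fock v -> fock w -> 0 <= C ->
  (forall e, is_sign e -> fock_norm (v - sign_op e v) <= C * fock_norm (w - sign_op e w)) ->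
  forall k, sign_hull k -> fock_norm v ^+ 2 - Re (inner v (multiplier k v)) <=
     C ^+ 2 * (fock_norm w ^+ 2 - Re (inner w (multiplier k w))).
Proof.
move=> fv fw C0 hs k; apply: (hull_ineq (hull_functional_inner fv fv) (hull_functional_inner fw fw)).
  exact: sqr_ge0.
move=> e he; have h := hs e he.
exact: (energy_transfer (sign_op_energy he fv) (sign_op_energy he fw) h
  (fock_norm_ge0 _) (fock_norm_ge0 _) C0).
Qed.

Lemma hull_pairing u y (c : R) : fock u -> fock y ->
  (forall e, is_sign e -> Re (inner u (sign_op e y)) <= c) ->
  forall k, sign_hull k -> Re (inner u (multiplier k y)) <= c.
Proof.
move=> fu fy hs k hk.
exact: (hull_upper_bound (hull_functional_inner fu fy) hs hk).
Qed.

End hull_estimates.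

(** * The Malliavin derivative *)

Section malliavin_derivative.
Variable R : realType.
Local Notation rT := (measurableTypeR R).
Local Notation mu := (@chain_measure R).
Local Notation nu := (@leb_pos R).
Local Notation leb n := (leb_tuple R n).
Local Notation Re := (@complex.Re R).
Implicit Types (u v w : vect R) (k : seq R -> R) (G : R -> vect R).
Local Notation ax := (@fock_hilbert R).

Definition chain_field G : vect R := fun s => if s is t :: s' then G t s' else 0.

Definition field_measurable G :=
  forall n, cmeasurable (fun x : n.+1.-tuple rT => G (thead x) (behead x)).

Lemma chain_field_measurable G : field_measurable G ->
  cmeasurable (chain_field G : chain R -> R[i]).
Proof.
move=> mG; apply/cmeasurable_level => -[|n].
  rewrite (_ : (fun x => _) = fun=> 0); first exact: cmeasurable_cst.
  by apply/funext => x; rewrite [x]tuple0.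
rewrite (_ : (fun x => _) = fun x : n.+1.-tuple rT => G (thead x) (behead x)); first exact: mG.
by apply/funext => x; case/tupleP: x => t y /=; rewrite theadE.
Qed.

Lemma cmeasurable_cons_section v t : cmeasurable (v : chain R -> R[i]) ->
  cmeasurable (fun s : chain R => v (t :: s)).
Proof.
move=> mv; exact: (@cmeasurable_comp _ _ _ _ _ (fun p : rT * chain R => v (p.1 :: p.2))
  (fun s : chain R => (t, s)) (cmeasurable_cons mv) (measurable_pair1 (t : rT))).
Qed.

Lemma measurable_weighted (f : nat -> R) v : cmeasurable (v : chain R -> R[i]) ->
  measurable_fun [set: chain R] (fun s => (f (size s) * sqn (v s))%:E).
Proof.
move=> mv; apply/measurable_EFinP; apply: measurable_funM; last exact: measurable_sqn.
exact: (measurable_size_fun f).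
Qed.

Lemma field_norm2E G : cmeasurable (chain_field G : chain R -> R[i]) ->
  field_norm2 G = (\int[mu]_s ((size s)%:R^-1 * sqn (chain_field G s))%:E)%E.
Proof.
move=> mG; rewrite -(integral_chain_cons (f := fun s => ((size s)%:R^-1 * sqn (chain_field G s))%:E)).
- apply: eq_integral => t _; rewrite norm2E; last exact: (cmeasurable_cons_section t mG).
  apply: eq_integral => s _; rewrite sqmodE -EFinM mulrA mulfV ?mul1r//.
- by move=> s; rewrite lee_fin mulr_ge0 ?sqn_ge0 ?invr_ge0.
- exact: (measurable_weighted (fun n => n%:R^-1) mG).
- by rewrite /= sqn0 mulr0.
Qed.

Definition energy v : \bar R := (\int[mu]_s ((size s)%:R * sqn (v s))%:E)%E.

Lemma chain_field_finite v s : chain_field (malliavin_finite v) s = (size s)%:R * v s.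
Proof. by case: s => [|t s] //=; rewrite mul0r. Qed.

Lemma cmeasurable_number v : cmeasurable (v : chain R -> R[i]) ->
  cmeasurable (chain_field (malliavin_finite v) : chain R -> R[i]).
Proof.
move=> mv; rewrite (_ : chain_field _ = fun s => (size s)%:R * v s); last first.
  by apply/funext => s; exact: chain_field_finite.
by apply: cmeasurableM => //; exact: (cmeasurable_size (fun n => n%:R)).
Qed.

Lemma field_norm2_finite v : cmeasurable (v : chain R -> R[i]) ->
  field_norm2 (malliavin_finite v) = energy v.
Proof.
move=> mv; rewrite field_norm2E; last exact: cmeasurable_number.
apply: eq_integral => s _; rewrite chain_field_finite sqn_nat; congr _%:E.
case: (size s) => [|n]; first by rewrite expr2 !mul0r mulr0.
by rewrite expr2 !mulrA mulVf ?mul1r// pnatr_eq0.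
Qed.

Lemma is_malliavin_ae v G : is_malliavin v G ->
  {ae mu, forall s, chain_field G s = (size s)%:R * v s}.
Proof.
move=> [fv [mG _ _] aG]; have mC := chain_field_measurable mG.
have mv := (fock_L2v fv).1.
pose D s := chain_field G s - (size s)%:R * v s.
have mN : cmeasurable (fun s : chain R => (size s)%:R * v s).
  by apply: cmeasurableM => //; exact: (cmeasurable_size (fun n => n%:R)).
have mD : cmeasurable (D : chain R -> R[i]) by exact: cmeasurableB.
pose X n (s : chain R) : \bar R := ((size s == n)%:R * sqn (D s))%:E.
have mX n : measurable_fun setT (X n) := measurable_weighted (fun j => (j == n)%:R) mD.
have X0 n s : (0 <= X n s)%E by rewrite lee_fin mulr_ge0 ?sqn_ge0.
have IX n : (\int[mu]_s X n s = 0)%E.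
  apply/eqP; rewrite eq_le integral_ge0// andbT.
  pose K : R := 2 * n%:R + 2 * n%:R ^+ 2.
  have K0 : 0 <= K by rewrite /K addr_ge0// mulr_ge0// sqr_ge0.
  apply/lee_addgt0Pr => e e0; rewrite add0e.
  have e'0 : 0 < e / (K + 1) by rewrite divr_gt0// ltr_wpDl.
  have [w [[fw _] vw Gw]] := aG _ e'0; have mw := (fock_L2v fw).1.
  pose A s := chain_field G s - (size s)%:R * w s.
  have mNw : cmeasurable (fun s : chain R => (size s)%:R * w s).
    by apply: cmeasurableM => //; exact: (cmeasurable_size (fun n => n%:R)).
  have mA : cmeasurable (A : chain R -> R[i]) by exact: cmeasurableB.
  have CA : chain_field (fun t => G t - malliavin_finite w t) = A.
    by apply/funext => -[|t s]; rewrite /A /= ?mul0r ?subr0.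
  rewrite field_norm2E in Gw; last by rewrite CA.
  rewrite norm2E in vw; last exact: cmeasurableB.
  rewrite CA in Gw.
  pose Y1 s : \bar R := ((size s)%:R^-1 * sqn (A s))%:E.
  pose Y2 s : \bar R := sqmod ((v - w) s).
  apply: (@le_trans _ _ (\int[mu]_s ((2 * n%:R)%:E * Y1 s + (2 * n%:R ^+ 2)%:E * Y2 s)%E)%E).
    have m1 : measurable_fun setT (fun s : chain R => ((size s)%:R^-1 * sqn (A s))%:E).
      exact: (measurable_weighted (fun j => j%:R^-1) mA).
    have m2 : measurable_fun setT (fun s : chain R => sqmod ((v - w) s)).
      by under eq_fun do rewrite sqmodE; apply: measurable_sqn_e; exact: cmeasurableB.
    apply: ge0_le_integral => //.
    + by apply: emeasurable_funD; exact: measurable_funeM.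
    + move=> s _; rewrite /X /Y1 /Y2 sqmodE -!EFinM -EFinD lee_fin.
      change (sqn ((v - w) s)) with (sqn (v s - w s)).
      have A0 := sqn_ge0 (A s); have B0 := sqn_ge0 (v s - w s).
      have [sn|sn] := eqVneq (size s) n; last first.
        by rewrite mul0r; apply: addr_ge0; rewrite !mulr_ge0 ?sqr_ge0 ?invr_ge0.
      rewrite mul1r; have -> : D s = A s + - (n%:R * (v s - w s)).
        by rewrite /D /A sn; ring.
      apply: le_trans (sqnD_le _ _) _; rewrite sqnN sqn_nat -mulrA sn.
      case: n sn {K K0 e'0 vw Gw} => [sn|n sn]; last by rewrite mulrA -mulrA [n.+1%:R * _]mulrA mulfV ?pnatr_eq0// mul1r.
      have -> : A s = 0 by rewrite /A sn; case: (s) sn => //= _; rewrite mul0r subr0.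
      by rewrite sqn0 expr2 !(mul0r, mulr0, addr0) lexx.
  have Y10 s : (0 <= Y1 s)%E by rewrite lee_fin mulr_ge0 ?sqn_ge0 ?invr_ge0.
  have Y20 s : (0 <= Y2 s)%E by rewrite /Y2 sqmodE lee_fin sqn_ge0.
  have mY1 : measurable_fun [set: chain R] Y1 := measurable_weighted (fun j => j%:R^-1) mA.
  have mY2 : measurable_fun [set: chain R] Y2.
    by rewrite /Y2; under eq_fun do rewrite sqmodE; apply: measurable_sqn_e; exact: cmeasurableB.
  have c1 : 0 <= 2 * n%:R :> R by rewrite mulr_ge0.
  have c2 : 0 <= 2 * n%:R ^+ 2 :> R by rewrite mulr_ge0// sqr_ge0.
  rewrite ge0_integralD//; last 4 first.
  - by move=> s _; rewrite mule_ge0.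
  - exact: measurable_funeM.
  - by move=> s _; rewrite mule_ge0.
  - exact: measurable_funeM.
  rewrite (ge0_integralZl_EFin mu measurableT (fun s _ => Y10 s) mY1 c1).
  rewrite (ge0_integralZl_EFin mu measurableT (fun s _ => Y20 s) mY2 c2).
  apply: (@le_trans _ _ ((2 * n%:R)%:E * (e / (K + 1))%:E + (2 * n%:R ^+ 2)%:E * (e / (K + 1))%:E)%E).
    apply: leeD; apply: lee_wpmul2l; rewrite ?lee_fin ?mulr_ge0 ?sqr_ge0//; exact: ltW.
  rewrite -!EFinM -EFinD lee_fin -mulrDl -/K mulrA ler_pdivrMr ?ltr_wpDl//.
  by rewrite mulrC; apply: ler_wpM2l; [exact: ltW | rewrite lerDl].
have aeX : {ae mu, forall s, forall n, X n s = 0%E}.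
  apply: ae_foralln => n.
  have : (\int[mu]_s `|X n s| = 0)%E.
    by rewrite -[RHS](IX n); apply: eq_integral => s _; rewrite gee0_abs.
  by move/(ae_eq_integral_abs mu measurableT (mX n)); apply: filterS => s /(_ Logic.I).
apply: filterS aeX => s /(_ (size s)) [].
rewrite eqxx mul1r => /sqn_eq0 /eqP; rewrite subr_eq0 => /eqP.
by [].
Qed.

Lemma is_malliavin_energy v G : is_malliavin v G -> (energy v < +oo)%E.
Proof.
move=> iG; have ae := is_malliavin_ae iG; have [fv [mG _ Goo] _] := iG.
have mC := chain_field_measurable mG; have mv := (fock_L2v fv).1.
rewrite -(field_norm2_finite mv); apply: le_lt_trans Goo.
rewrite field_norm2E; last exact: cmeasurable_number.
rewrite field_norm2E// le_eqVlt; apply/orP; left; apply/eqP.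
apply: ae_eq_integral => //.
- exact: (measurable_weighted (fun j => j%:R^-1) (cmeasurable_number mv)).
- exact: (measurable_weighted (fun j => j%:R^-1) mC).
- by apply: filterS ae => s es _; rewrite chain_field_finite es.
Qed.

Lemma malliavinP v : malliavin_dom v -> is_malliavin v (malliavin v).
Proof. by move=> [G iG]; rewrite /malliavin; apply: (xgetPex 0); exists G. Qed.

Lemma malliavin_ae v : malliavin_dom v ->
  {ae nu, forall t, fock (malliavin v t) /\ fock_eq (malliavin v t) (malliavin_finite v t)}.
Proof.
move=> /malliavinP iG; have [_ [_ fG _] _] := iG.
have [ae1 _] := ae_chain_cons_both (is_malliavin_ae iG).
apply: filterS2 fG ae1 => t ft et; split => //.
by apply/fock_eq_ae; exact: et.
Qed.

Lemma tail_integral_small (f : chain R -> R) : (forall s, 0 <= f s) ->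
  mu.-integrable setT (EFin \o f) -> forall e : R, 0 < e ->
  exists N, (\int[mu]_s ((N < size s)%:R * f s)%:E < e%:E)%E.
Proof.
move=> f0 fi e e0; have mf : measurable_fun setT f by apply/measurable_EFinP; exact: measurable_int fi.
pose F N (s : chain R) : \bar R := ((N < size s)%:R * f s)%:E.
have mF N : measurable_fun setT (F N).
  apply/measurable_EFinP; apply: measurable_funM => //.
  exact: (measurable_size_fun (fun n => (N < n)%:R : R)).
have [] := @dominated_convergence _ _ _ mu setT measurableT F (cst 0%E) (EFin \o f) mF
   (@measurable_cst _ _ _ _ setT 0%E).
- apply: aeW => s _; apply: cvg_near_cst; exists (size s) => // N /= sN.
  by rewrite /F ltnNge sN mul0r.
- exact: fi.
- apply: aeW => s N _; rewrite /F /= lee_fin ger0_norm ?mulr_ge0//.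
  by case: (_ < _)%N; rewrite ?mul1r ?mul0r.
move=> _ _; rewrite integral0 => h.
have h' : (fun N => fine (\int[mu]_s F N s)) @ \oo --> (0 : R) by exact: (fine_cvg h).
move/cvgrPdist_lt : h' => /(_ e e0)[N _ NP].
exists N; have := NP N (leqnn N); rewrite /= sub0r normrN => h1.
have I0 : (0 <= \int[mu]_s F N s)%E.
  by apply: integral_ge0 => s _; rewrite lee_fin mulr_ge0.
have Ioo : (\int[mu]_s F N s < +oo)%E.
  move: (fi) => /integrableP[_]; apply: le_lt_trans; apply: ge0_le_integral => //.
  - by move=> s _; rewrite lee_fin mulr_ge0.
  - exact: (measurableT_comp (@abse_measurable R setT) (measurable_int _ fi)).
  - move=> s _; rewrite /F /= lee_fin ger0_norm//.
    by case: (_ < _)%N; rewrite ?mul1r ?mul0r.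
rewrite ger0_norm ?fine_ge0// in h1.
by rewrite -[X in (X < _)%E]fineK ?ge0_fin_numE// lte_fin.
Qed.

Lemma is_malliavin_finite v : fock v -> (energy v < +oo)%E -> is_malliavin v (malliavin_finite v).
Proof.
move=> fv Eoo; have Lv := fock_L2v fv; have mv := Lv.1.
have mN := cmeasurable_number mv.
have E0 : mu.-integrable setT (EFin \o (fun s : chain R => (size s)%:R * sqn (v s))).
  apply/integrableP; split; first exact: (measurable_weighted (fun n => n%:R) mv).
  apply: le_lt_trans Eoo; rewrite le_eqVlt; apply/orP; left; apply/eqP.
  by apply: eq_integral => s _; rewrite gee0_abs// lee_fin mulr_ge0 ?sqn_ge0.
split => //.
- split.
  + move=> n; have : cmeasurable (fun x : n.+1.-tuple rT => chain_field (malliavin_finite v) x).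
      by move/cmeasurable_level : mN; exact.
    by congr cmeasurable; apply/funext => x; case/tupleP: x => t y /=; rewrite theadE.
  + have ae1 : {ae nu, forall t, (norm2 (malliavin_finite v t) < +oo)%E}.
      have Eoo' := Eoo; rewrite -(field_norm2_finite mv) in Eoo'.
      have msec t : cmeasurable (malliavin_finite v t : chain R -> R[i]).
        have := cmeasurable_cons_section t mN; congr cmeasurable.
      have mI : measurable_fun setT (fun t : rT => norm2 (malliavin_finite v t)).
        rewrite (_ : (fun t => _) = fun t => (\int[mu]_s sqmod (malliavin_finite v t s))%E); last first.
          by apply/funext => t; rewrite norm2E.
        apply: (measurable_fun_fubini_tonelli_F (m2 := mu)
          (fun p : rT * chain R => sqmod (chain_field (malliavin_finite v) (p.1 :: p.2)))).
          by under eq_fun do rewrite sqmodE; exact: (measurable_sqn_e (cmeasurable_cons mN)).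
        by move=> p; rewrite sqmodE lee_fin sqn_ge0.
      have iI : nu.-integrable setT (fun t : rT => norm2 (malliavin_finite v t)).
        apply/integrableP; split => //; apply: le_lt_trans Eoo'.
        rewrite le_eqVlt; apply/orP; left; apply/eqP; rewrite /field_norm2.
        by apply: eq_integral => t _; rewrite gee0_abs//; exact: norm2_ge0.
      have := integrable_ae measurableT iI; apply: filterS => t /(_ Logic.I).
      by rewrite ge0_fin_numE//; exact: norm2_ge0.
    have ae2 : {ae nu, forall t, antisym_fun (malliavin_finite v t)}.
      have [_ av _] := fv.
      have aes : {ae mu, forall s : chain R, forall n (p : 'S_n), size s = n.+1 ->
          v (permute (lift_perm ord0 ord0 p) (to_tuple n.+1 s)) = (-1) ^+ p * v s}.
        apply: ae_foralln => n; apply: filter_forall => p.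
        apply/ae_chainP => k; have [->|kn] := eqVneq k n.+1; last first.
          by apply: aeW => x /=; rewrite size_tuple => /eqP; rewrite (negbTE kn).
        have := av n.+1 (lift_perm ord0 ord0 p); apply: filterS => x vx _.
        by rewrite to_tupleK vx odd_lift_perm.
      have [h _] := ae_chain_cons_both aes; apply: filterS h => t ht n p.
      have /ae_chainP/(_ n) := ht; apply: filterS => x /(_ n p).
      rewrite /malliavin_finite !size_tuple => /(_ erefl) vx.
      rewrite mulrCA; congr (_ * _); rewrite -[RHS]vx; congr v.
      rewrite (_ : to_tuple n.+1 (t :: x) = pair_cons (t, x)); last exact: (to_tupleK (pair_cons (t, x))).
      have E := congr1 (@tval _ _) (permute_lift ord0 p (pair_cons (t, x))).
      apply: etrans (esym E) => /=; congr (_ :: map _ _).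
      by apply/funext => i; rewrite tnth_mktuple tnthS.
    apply: filterS2 ae1 ae2 => t n2 an; split => //.
    by apply/cmeasurable_level; have := cmeasurable_cons_section t mN; congr cmeasurable.
  + by rewrite field_norm2_finite.
- move=> e e0.
  have [N1 h1] := tail_integral_small (fun s => sqn_ge0 (v s)) Lv.2 e0.
  have f0 s : 0 <= (size s)%:R * sqn (v s) by rewrite mulr_ge0 ?sqn_ge0.
  have [N2 h2] := tail_integral_small f0 E0 e0.
  pose N := maxn N1 N2.
  pose w : vect R := multiplier (fun s => (size s <= N)%:R) v.
  have cw : contraction_multiplier (fun s : seq R => (size s <= N)%:R : R).
    by apply: (contraction_size (f := fun n => (n <= N)%:R)) => n; case: (_ <= _)%N; rewrite ?normr1 ?normr0.
  have fw : fock w by exact: multiplier_fock.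
  have mw := (fock_L2v fw).1.
  have vwE s : (v - w) s = (N < size s)%:R * v s.
    change (v s - ((size s <= N)%:R)%:C * v s = (N < size s)%:R * v s).
    by rewrite ltnNge; case: (_ <= _)%N; rewrite ?rmorph1 ?rmorph0 ?mul1r ?mul0r ?subrr ?subr0.
  have sqE s : sqmod ((v - w) s) = ((N < size s)%:R * sqn (v s))%:E.
    by rewrite vwE sqmodE sqn_nat; case: (_ < _)%N; rewrite ?expr1n ?expr0n.
  exists w; split.
  + split => //; exists N.+1 => n Nn; apply: aeW => x.
    by rewrite /w /multiplier size_tuple leqNgt Nn mul0r.
  + rewrite norm2E; last exact: cmeasurableB.
    under eq_integral do rewrite sqE.
    apply: le_lt_trans h1; apply: ge0_le_integral => //.
    * by move=> s _; rewrite lee_fin mulr_ge0 ?sqn_ge0.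
    * exact: (measurable_weighted (fun n => (N < n)%:R) mv).
    * exact: (measurable_weighted (fun n => (N1 < n)%:R) mv).
    * move=> s _; rewrite lee_fin; apply: ler_wpM2r; first exact: sqn_ge0.
      rewrite ler_nat; case: (ltnP N (size s)) => // h.
      by rewrite (leq_ltn_trans (leq_maxl _ _) h).
  + have mvw : cmeasurable ((v - w : vect R) : chain R -> R[i]) by exact: cmeasurableB.
    have -> : (fun t => malliavin_finite v t - malliavin_finite w t) = malliavin_finite (v - w).
      apply/funext => t; apply/funext => s; rewrite /malliavin_finite.
      by change ((size s).+1%:R * v (t :: s) - (size s).+1%:R * w (t :: s) =
         (size s).+1%:R * (v (t :: s) - w (t :: s))); rewrite mulrBr.
    rewrite field_norm2_finite//; apply: le_lt_trans h2; apply: ge0_le_integral => //.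
    * by move=> s _; rewrite lee_fin mulr_ge0 ?sqn_ge0.
    * exact: (measurable_weighted (fun n => n%:R) mvw).
    * under eq_fun do rewrite mulrA.
      exact: (measurable_weighted (fun n => (N2 < n)%:R * n%:R) mv).
    * move=> s _; rewrite lee_fin mulrCA; apply: ler_wpM2l => //.
      rewrite vwE sqn_nat; apply: ler_wpM2r; first exact: sqn_ge0.
      rewrite -natrX ler_nat; case: (ltnP N (size s)) => // h.
      by rewrite (leq_ltn_trans (leq_maxr _ _) h).
Qed.

End malliavin_derivative.

Section smoothness.
Variable R : realType.
Local Notation rT := (measurableTypeR R).
Local Notation mu := (@chain_measure R).
Local Notation nu := (@leb_pos R).
Local Notation Re := (@complex.Re R).
Implicit Types (u v w : vect R).
Local Notation ax := (@fock_hilbert R).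
Local Notation hbd := (hbounded (@fock R) (@fock_norm R) (@fock_eq R)).
Local Notation leo := (le_op (@fock R) (@fock_norm R)).

Lemma Re_conj_scale (c : R[i]) (a : R) : Re (conjc c * (a%:C * c)) = a * sqn c.
Proof. by case: c => x y; rewrite /sqn /=; ring. Qed.

Lemma multiplier_gap (k : seq R -> R) v : contraction_multiplier k -> fock v ->
  ((fock_norm v ^+ 2 - Re (inner v (multiplier k v)))%:E =
   \int[mu]_s ((1 - k s) * sqn (v s))%:E)%E.
Proof.
move=> ck fv; have Lv := fock_L2v fv; have Lk := fock_L2v (multiplier_fock ck fv).
have [i1 _] := csummable_dot Lv Lk.
have E1 : fock_norm v ^+ 2 = \int[mu]_s sqn (v s) := (L2v_norm2 Lv).2.
have E2 : Re (inner v (multiplier k v)) = \int[mu]_s (k s * sqn (v s)).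
  rewrite innerE// /cdot /=; congr fine; apply: eq_integral => s _.
  by rewrite /= Re_conj_scale.
have i2 : mu.-integrable setT (EFin \o (fun s : chain R => k s * sqn (v s))).
  apply: eq_integrable i1 => // s _; by rewrite /= Re_conj_scale.
rewrite E1 E2 -RintegralB//; last exact: Lv.2.
have i3 := integrableB measurableT Lv.2 i2.
rewrite /Rintegral fineK; last first.
  by apply: integrable_fin_num => //; exact: i3.
by apply: eq_integral => s _; rewrite mulrBl mul1r.
Qed.

Definition power_gap (n m : nat) : R := \sum_(j < m) (1 - n.+1%:R^-1) ^+ j.

Lemma power_gapE n k : 1 - (1 - n.+1%:R^-1) ^+ k = n.+1%:R^-1 * power_gap n k.
Proof.
have := subrX1 (1 - n.+1%:R^-1 : R) k; rewrite -/(power_gap n k) => e.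
apply: oppr_inj; rewrite opprB e; ring.
Qed.

Lemma power_ratio n : 0 <= (1 - n.+1%:R^-1 : R) <= 1.
Proof. by rewrite subr_ge0 lerBlDr lerDl invf_le1// ler1n invr_ge0 ler0n. Qed.

Lemma power_gap_bound n k : 0 <= power_gap n k <= k%:R.
Proof.
have /andP[r0 r1] := power_ratio n.
rewrite sumr_ge0/=; last by move=> j _; exact: exprn_ge0.
rewrite -[X in _ <= X%:R]card_ord -sumr_const; apply: ler_sum => j _.
exact: exprn_ile1.
Qed.

Lemma cvg_power_gap k : power_gap n k @[n --> \oo] --> (k%:R : R).
Proof.
elim: k => [|k IH].
  rewrite (_ : (fun n => _) = fun=> 0); first exact: cvg_cst.
  by apply/funext => n; rewrite /power_gap big_ord0.
rewrite (_ : (fun n => _) = fun n => power_gap n k + (1 - n.+1%:R^-1) ^+ k); last first.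
  by apply/funext => n; rewrite /power_gap big_ord_recr.
rewrite -natr1; apply: cvgD => //.
have c : (1 - n.+1%:R^-1 : R) @[n --> \oo] --> (1 - 0 : R).
  by apply: cvgB; [exact: cvg_cst|exact: cvg_harmonic].
rewrite subr0 in c; elim: k {IH} => [|k IH]; first by under eq_fun do rewrite expr0; exact: cvg_cst.
under eq_fun do rewrite exprS.
by have h := cvgM c IH; rewrite mulr1 in h; exact: h.
Qed.

Lemma energy_bound v w (C : R) : fock v -> fock w -> 0 <= C ->
  (forall e, is_sign e -> fock_norm (v - sign_op e v) <= C * fock_norm (w - sign_op e w)) ->
  (energy v <= (C ^+ 2)%:E * energy w)%E.
Proof.
move=> fv fw C0 h.
have mv := (fock_L2v fv).1; have mw := (fock_L2v fw).1.
pose X u n (s : chain R) : \bar R := (power_gap n (size s) * sqn (u s))%:E.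
have mX u n : cmeasurable (u : chain R -> R[i]) -> measurable_fun setT (X u n).
  by move=> mu0; exact: (measurable_weighted (power_gap n) mu0).
have X0 u n s : (0 <= X u n s)%E.
  by rewrite lee_fin mulr_ge0 ?sqn_ge0//; have /andP[] := power_gap_bound n (size s).
pose gap u n := fock_norm u ^+ 2 -
  Re (inner u (multiplier (fun s => (1 - n.+1%:R^-1) ^+ size s) u)).
have gap_le n : gap v n <= C ^+ 2 * gap w n := hull_energy fv fw C0 h (hull_power (power_ratio n)).
have gapE u n : fock u -> ((gap u n)%:E = (n.+1%:R^-1)%:E * \int[mu]_s X u n s)%E.
  move=> fu; have ck := hull_contraction (hull_power (power_ratio n)).
  rewrite /gap multiplier_gap// -ge0_integralZl_EFin ?invr_ge0//; last exact: (mX _ _ (fock_L2v fu).1).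
  by apply: eq_integral => s _; rewrite power_gapE /X -EFinM mulrA.
clearbody gap.
have bound n : (\int[mu]_s X v n s <= (C ^+ 2)%:E * energy w)%E.
  have := gap_le n; rewrite -lee_fin EFinM (gapE v n fv) (gapE w n fw) => h1.
  have h2 : (\int[mu]_s X v n s <= (C ^+ 2)%:E * \int[mu]_s X w n s)%E.
    move: h1; rewrite muleCA lee_pmul2l//.
  apply: le_trans h2 _; apply: lee_wpmul2l; first by rewrite lee_fin sqr_ge0.
  apply: ge0_le_integral => //; first exact: mX.
    exact: (measurable_weighted (fun j => j%:R) mw).
  move=> s _; rewrite lee_fin; apply: ler_wpM2r; first exact: sqn_ge0.
  by have /andP[] := power_gap_bound n (size s).
have lim s : limn_einf (fun n => X v n s) = ((size s)%:R * sqn (v s))%:E.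
  have cv : X v n s @[n --> \oo] --> ((size s)%:R * sqn (v s))%:E.
    apply: cvg_EFin; first exact: nearW.
    by apply: cvgMl; exact: cvg_power_gap.
  by have [] := cvg_limn_einf_sup cv.
have := @fatou _ _ _ mu setT measurableT (X v) (fun n => mX v n mv) (fun n s _ => X0 v n s).
under eq_integral do rewrite lim.
by move/le_trans; apply; exact: limn_einf_le_bound.
Qed.

End smoothness.

Section integral_nonmeasurable.
Context d (X : measurableType d) (R : realType) (m : {measure set X -> \bar R}).
Implicit Types f h : X -> \bar R.
Import HBNNSimple.

Lemma le_integral_measurable_left f h : measurable_fun setT f -> (forall x, 0 <= f x)%E ->
  (forall x, 0 <= h x)%E -> {ae m, forall x, (f x <= h x)%E} ->
  (\int[m]_x f x <= \int[m]_x h x)%E.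
Proof.
move=> mf f0 h0 [A [mA A0 NA]].
pose f' := f \_ (~` A).
have f'0 x : (0 <= f' x)%E by rewrite /f' patchE; case: ifP.
have mf' : measurable_fun setT f'.
  apply/(measurable_restrictT f (measurableC mA)).
  exact: measurable_funS mf.
have -> : (\int[m]_x f x = \int[m]_x f' x)%E.
  apply: ge0_ae_eq_integral => //; exists A; split => // x xf; apply: contrapT => nA; apply: xf => _.
  by rewrite /f' patchE mem_set.
rewrite !ge0_integralTE//; apply: ge_ereal_sup => _ [k kf <-].
apply: ereal_sup_ubound; exists k => // x; apply: le_trans (kf x) _.
rewrite /f' patchE; case: ifPn => // /set_mem nA.
by apply: contrapT => nfh; apply/nA/NA.
Qed.

Lemma integral_ae_eq0 h : (forall x, 0 <= h x)%E -> {ae m, forall x, h x = 0%E} ->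
  (\int[m]_x h x = 0)%E.
Proof.
move=> h0 ae0; apply/eqP; rewrite eq_le integral_ge0// andbT.
rewrite ge0_integralTE//; apply: ge_ereal_sup => _ [k kf <-].
have <- : (\int[m]_x (k x)%:E = sintegral m k)%E.
  by rewrite integral_nnsfun// patch_setT.
rewrite (ae_eq_integral (cst 0%E))//.
- by rewrite integral0.
- exact/measurable_EFinP.
apply: filterS ae0 => x hx _ /=; apply/eqP; rewrite eq_le lee_fin.
by have := kf x; rewrite hx lee_fin => ->; rewrite lee_fin fun_ge0.
Qed.

End integral_nonmeasurable.

Lemma le_of_forall_gt (R : realType) (r al c : R) : 0 <= c ->
  (forall a, al < a -> r <= a * c) -> r <= al * c.
Proof.
move=> c0 h; rewrite -subr_le0; apply: (le0_of_small c0) => e e0.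
by rewrite lerBlDr -mulrDl addrC; apply: h; rewrite ltrDl.
Qed.

Section pairing.
Variable R : realType.
Local Notation rT := (measurableTypeR R).
Local Notation mu := (@chain_measure R).
Local Notation nu := (@leb_pos R).
Local Notation Re := (@complex.Re R).
Implicit Types (u v w x y z : vect R).
Local Notation ax := (@fock_hilbert R).
Local Notation hbd := (hbounded (@fock R) (@fock_norm R) (@fock_eq R)).
Local Notation leo := (le_op (@fock R) (@fock_norm R)).

Lemma op_norm_le (T : operator R) a : hbd T -> 0 <= a -> (op_norm T <= a%:E)%E -> leo T a.
Proof.
move=> bT a0 Ta u fu; have fT := hbounded_H bT fu.
have := fock_norm_ge0 u; rewrite le_eqVlt => /predU1P[n0|np].
  have [M M0 TM] := hbounded_le ax bT.
  by rewrite -n0 mulr0; apply: le_trans (TM u fu) _; rewrite -n0 mulr0.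
pose c : R := (fock_norm u)^-1.
have c0 : 0 < c by rewrite invr_gt0.
have fc : fock (c%:C *: u) := HZ ax c%:C fu.
have nc : fock_norm (c%:C *: u) = 1.
  by rewrite (nmZ ax c%:C fu) normc_real (gtr0_norm c0) mulVf// gt_eqF.
have fTc := hbounded_H bT fc.
have e : fock_eq (T (c%:C *: u)) (c%:C *: T u).
  apply: (ip_ext ax fTc (HZ ax c%:C fT)) => z fz.
  by rewrite (op_Z ax c%:C bT fu fz) (ipZr ax c%:C fT fz).
have : fock_norm (T (c%:C *: u)) <= a.
  rewrite -lee_fin; apply: le_trans Ta; apply: ereal_sup_ubound.
  by exists (c%:C *: u) => //; split => //; rewrite nc.
rewrite (nm_eqv ax fTc (HZ ax c%:C fT) e) (nmZ ax c%:C fT) normc_real (gtr0_norm c0).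
by rewrite /c mulrC ler_pdivrMr.
Qed.

Lemma fock_norm_vacuum : fock_norm (@vacuum R) = 1.
Proof.
have e := norm2_fock (fock_vacuum R).
have h0 : homogeneous 0 (@vacuum R) by case.
have e2 : norm2 (@vacuum R) = 1%E.
  rewrite (norm2_homogeneous h0) mul1e /=.
  rewrite integral_dirac//=; last first.
    under eq_fun do rewrite sqmodE; apply: (measurable_sqn_e (f := fun x : 0.-tuple rT => vacuum x)).
    by have [h _ _] := fock_vacuum R; exact: h.
  rewrite diracE in_setT mul1e /vacuum sqmodE /sqn /= expr1n expr0n addr0.
  by [].
move: e2; rewrite e => -[] /eqP.
by rewrite sqrf_eq1 => /orP[/eqP//|/eqP n1]; have := fock_norm_ge0 (@vacuum R); rewrite n1 ler0N1.
Qed.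

Lemma op_norm_ge0 (T : operator R) : (0 <= op_norm T)%E.
Proof.
apply: (@le_trans _ _ (fock_norm (T 0))%:E); first by rewrite lee_fin fock_norm_ge0.
apply: ereal_sup_ubound; exists 0 => //; split; first exact: (hilb0 ax).
by rewrite (nm0 ax).
Qed.

Lemma Linf_norm_ge0 z : (0 <= Linf_norm z)%E.
Proof. by apply: le_ereal_inf_tmp => _ [T _ <-]; exact: op_norm_ge0. Qed.

Lemma clifford_bounded (T : operator R) : clifford T -> hbd T.
Proof. by move=> cT; exact: (hvna_bounded (vacuum_tracial_vna R) (clifford_tracial cT)). Qed.

Lemma fock_norm_le_Linf z : fock z -> ((fock_norm z)%:E <= Linf_norm z)%E.
Proof.
move=> fz; apply: le_ereal_inf_tmp => _ [T [cT e] <-].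
have fT := hbounded_H (clifford_bounded cT) (fock_vacuum R).
rewrite -(nm_eqv ax fT fz e); apply: ereal_sup_ubound; exists vacuum => //.
by split; [exact: fock_vacuum|rewrite fock_norm_vacuum].
Qed.

Lemma Linf_norm_eq0 z : fock z -> fock_norm z = 0 -> Linf_norm z = 0%E.
Proof.
move=> fz z0; apply/eqP; rewrite eq_le Linf_norm_ge0 andbT.
pose T : operator R := fun u => -1 *: u + u.
have T0 u : T u = 0 by rewrite /T scaleN1r addNr.
have cT : clifford T.
  have V := clifford_vna R.
  exact: (hvna_lin V (-1) (hvna_id V) (hvna_id V)).
apply: (@le_trans _ _ (op_norm T)).
  apply: ereal_inf_lbound; exists T => //; split => //; rewrite T0.
  apply: (eqv_sym ax fz (hilb0 ax)); exact: (eqv_nm0 ax fz z0).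
by apply: ge_ereal_sup => _ [u _ <-]; rewrite T0 (nm0 ax).
Qed.

Lemma sign_op_selfadjoint e u v : inner (sign_op e u) v = inner u (sign_op e v).
Proof. exact: inner_multiplier. Qed.

Section exponential.
Variable F : operator R.
Hypotheses (cF : clifford F) (sF : selfadjoint F).
Local Notation ex s := (op_exp (s%:C *: F)).

Lemma exp_clifford s u : fock u ->
  exp_of (@fock R) (@fock_norm R) (fun u => s%:C *: F u) u (ex s u).
Proof.
move=> fu; rewrite (_ : s%:C *: F = fun u => s%:C *: F u); last exact/funext.
have [M M0 FM] := hbounded_le ax (clifford_bounded cF).
exact: (op_expP (scaled_bounded ax (clifford_bounded cF) FM s) fu).
Qed.

Lemma fock_exp s u : fock u -> fock (ex s u).
Proof. by move=> fu; have [] := exp_clifford s fu. Qed.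

Definition laplace s := Re (inner vacuum (ex s vacuum)).

Lemma laplace_gt0 s : 0 < laplace s.
Proof.
have [M M0 FM] := hbounded_le ax (clifford_bounded cF).
apply: (group_state_gt0 ax (fock_vacuum R) (@right_Psi_bounded R) (@right_Psi_star R)
  (@L2_starK R) (clifford_tracial cF) M0 FM sF exp_clifford).
by rewrite fock_norm_vacuum.
Qed.

Lemma sign_pairing e s (A B : operator R) a b : is_sign e -> clifford A -> clifford B ->
  leo A a -> leo B b -> 0 <= a -> 0 <= b ->
  Re (inner (A vacuum) (sign_op e (ex s (B vacuum)))) <= a * b * laplace s.
Proof.
move=> se cA cB Aa Bb a0 b0; have [M M0 FM] := hbounded_le ax (clifford_bounded cF).
rewrite -sign_op_selfadjoint; apply: le_trans (ler_norm _) _.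
apply: le_trans (Re_normc _) _.
apply: (sign_pairing_bound ax (fock_vacuum R) (@right_Psi_bounded R) (@right_Psi_star R)
  (@L2_starK R) (clifford_tracial cF) M0 FM sF exp_clifford (sign_op_bounded se) _ _ _ _ s
  (clifford_tracial cA) (clifford_tracial cB) a0 b0 Aa Bb).
- by move=> u fu; rewrite sign_opK//; exact: fock_eq_refl.
- by move=> u v fu fv; exact: sign_op_selfadjoint.
- by rewrite sign_op_vacuum; exact: fock_eq_refl.
- by move=> z; exact: right_Psi_covariant.
Qed.

Lemma exp_inverse s y : fock y -> fock_eq (ex s (ex (- s) y)) y.
Proof.
move=> fy; have [M M0 FM] := hbounded_le ax (clifford_bounded cF).
exact: (group_inv ax (clifford_bounded cF) M0 FM exp_clifford s fy).
Qed.

Lemma exp_hbounded s : hbd (ex s).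
Proof.
have [M M0 FM] := hbounded_le ax (clifford_bounded cF).
exact: (group_bounded ax (clifford_bounded cF) M0 FM exp_clifford s).
Qed.

Lemma weighted_pairing_real (k : seq R -> R) s x y a b : sign_hull k -> fock x -> fock y ->
  (Linf_norm x < a%:E)%E -> (Linf_norm (ex (- s) y) < b%:E)%E ->
  Re (inner x (multiplier k y)) <= a * b * laplace s.
Proof.
move=> hk fx fy /ereal_inf_lt[_ [A [cA eA] <-] Aa] /ereal_inf_lt[_ [B [cB eB] <-] Bb].
have a0 : 0 <= a by rewrite -lee_fin; apply: le_trans (op_norm_ge0 A) (ltW Aa).
have b0 : 0 <= b by rewrite -lee_fin; apply: le_trans (op_norm_ge0 B) (ltW Bb).
have bA := clifford_bounded cA; have bB := clifford_bounded cB.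
have lA := op_norm_le bA a0 (ltW Aa); have lB := op_norm_le bB b0 (ltW Bb).
have fA := hbounded_H bA (fock_vacuum R); have fB := hbounded_H bB (fock_vacuum R).
have fy' := fock_exp (- s) fy; have feB := fock_exp s fB.
have e1 : fock_eq (ex s (B vacuum)) y.
  apply: (eqv_trans ax feB (fock_exp s fy') fy _ (exp_inverse s fy)).
  exact: (op_eqv ax (exp_hbounded s) fB fy' eB).
apply: (hull_pairing fx fy) hk => e se.
have bG := sign_op_bounded se.
rewrite -(op_ip_eqv ax bG feB fy fx e1).
have := sign_pairing s se cA cB lA lB a0 b0.
by rewrite (ip_eql ax fA fx (hbounded_H bG feB) eA).
Qed.

Lemma weighted_pairing (k : seq R -> R) s x y : sign_hull k -> fock x -> fock y ->
  ((Re (inner x (multiplier k y)))%:E <=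
   (laplace s)%:E * (Linf_norm x * Linf_norm (ex (- s) y)))%E.
Proof.
move=> hk fx fy; have fy' := fock_exp (- s) fy.
have fk := multiplier_fock (hull_contraction hk) fy.
have CS := Re_ip_CS ax fx fk.
have L0 := laplace_gt0 s.
have := Linf_norm_ge0 x; rewrite le_eqVlt => /predU1P[x0|xp].
  have := fock_norm_le_Linf fx; rewrite -x0 lee_fin => nx.
  rewrite mul0e mule0 lee_fin; apply: le_trans (ler_norm _) _; apply: le_trans CS _.
  by rewrite (_ : fock_norm x = 0) ?mul0r//; apply/eqP; rewrite eq_le nx fock_norm_ge0.
have := Linf_norm_ge0 (ex (- s) y); rewrite le_eqVlt => /predU1P[y0|yp].
  have := fock_norm_le_Linf fy'; rewrite -y0 lee_fin => ny.
  rewrite !mule0 lee_fin; apply: le_trans (ler_norm _) _; apply: le_trans CS _.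
  have ny' : fock_norm (ex (- s) y) = 0 by apply/eqP; rewrite eq_le ny fock_norm_ge0.
  have [M M0 EM] := hbounded_le ax (exp_hbounded s).
  have n1 : fock_norm y <= 0.
    rewrite -(nm_eqv ax (fock_exp s fy') fy (exp_inverse s fy)).
    by apply: le_trans (EM _ fy') _; rewrite ny' mulr0.
  have n2 : fock_norm (multiplier k y) = 0.
    apply/eqP; rewrite eq_le fock_norm_ge0 andbT.
    exact: le_trans (multiplier_contraction (hull_contraction hk) fy) n1.
  by rewrite n2 mulr0.
have main (al be : R) : Linf_norm x = al%:E -> Linf_norm (ex (- s) y) = be%:E ->
    Re (inner x (multiplier k y)) <= laplace s * (al * be).
  move=> xe ye; have al0 : 0 < al by rewrite -lte_fin -xe.
  have be0 : 0 < be by rewrite -lte_fin -ye.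
  rewrite mulrCA; apply: le_of_forall_gt; first by rewrite mulr_ge0 ?ltW.
  move=> a ala; have a0 := lt_trans al0 ala.
  rewrite mulrCA [X in _ <= X]mulrCA [X in _ <= X]mulrC -mulrA mulrC.
  rewrite [X in _ <= X](_ : _ = be * (a * laplace s)); last by ring.
  apply: le_of_forall_gt; first by rewrite mulr_ge0 ?ltW.
  move=> b beb; rewrite [X in _ <= X](_ : _ = a * b * laplace s); last by ring.
  by apply: (weighted_pairing_real hk fx fy); rewrite ?xe ?ye lte_fin.
case xe : (Linf_norm x) xp => [al| |] // al0; last first.
  by rewrite gt0_mulye// gt0_muley ?lte_fin// leey.
case ye : (Linf_norm (ex (- s) y)) yp => [be| |] // be0; last first.
  by rewrite gt0_muley// gt0_muley ?lte_fin// leey.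
by rewrite -!EFinM lee_fin; exact: main.
Qed.

End exponential.
End pairing.

Section disintegrated_pairing.
Variable R : realType.
Local Notation rT := (measurableTypeR R).
Local Notation mu := (@chain_measure R).
Local Notation nu := (@leb_pos R).
Local Notation Re := (@complex.Re R).
Implicit Types (u v w x y z : vect R).
Local Notation ax := (@fock_hilbert R).

Lemma inner_vacuum u : fock u -> inner vacuum u = u [::].
Proof.
move=> fu; have LO := fock_L2v (fock_vacuum R).
rewrite (innerE LO (fock_L2v fu)) /cdot.
rewrite (_ : (fun s => _) = fun s : chain R => u [::] * (conjc (vacuum s) * vacuum s)); last first.
  apply/funext => -[|t s]; first by rewrite /vacuum /= mulr1 mulrC.
  by rewrite /vacuum /= !mulr0 conj0M.
rewrite (cintegralZ _ (csummable_dot LO LO)).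
have := inner_self (fock_vacuum R); rewrite (innerE LO LO) /cdot => ->.
by rewrite fock_norm_vacuum expr1n mulr1.
Qed.

Lemma maxe_weight n (r : R) : (Order.max (n.+1%:R * r)%:E 0 = n.+1%:R%:E * Order.max r%:E 0)%E.
Proof.
have [r0|r0] := leP 0 r.
  by rewrite !max_l ?lee_fin// mulr_ge0.
by rewrite !max_r ?mule0 ?lee_fin// ?ltW// pmulr_rlt0.
Qed.

Lemma le_integral_disintegrated (f : chain R -> R) (Phi : R -> \bar R) (L : R) :
  mu.-integrable setT (EFin \o f) -> f [::] = 0 -> 0 < L -> (forall t, 0 <= Phi t)%E ->
  {ae nu, forall t : rT, (\int[mu]_s ((size s).+1%:R * f (t :: s))%:E <= L%:E * Phi t)%E} ->
  ((\int[mu]_s f s)%:E <= L%:E * \int[nu]_t Phi t)%E.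
Proof.
move=> fi fn L0 Phi0 ae.
have mf := measurable_int _ fi.
pose Fp := (EFin \o f)^\+%E; pose Fn := (EFin \o f)^\-%E.
have mFp : measurable_fun setT Fp by exact: measurable_funepos.
have mFn : measurable_fun setT Fn by exact: measurable_funeneg.
have Fp0 s : (0 <= Fp s)%E by exact: funepos_ge0.
have Fn0 s : (0 <= Fn s)%E by exact: funeneg_ge0.
pose P (t : rT) := (\int[mu]_s ((size s).+1%:R%:E * Fp (t :: s)))%E.
pose N (t : rT) := (\int[mu]_s ((size s).+1%:R%:E * Fn (t :: s)))%E.
have mP : measurable_fun setT P.
  apply: (measurable_fun_fubini_tonelli_F (m2 := mu)
    (fun p : rT * chain R => ((size p.2).+1%:R%:E * Fp (p.1 :: p.2))%E)).
    exact: measurable_cons_weight.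
  by move=> p; rewrite mule_ge0.
have mN : measurable_fun setT N.
  apply: (measurable_fun_fubini_tonelli_F (m2 := mu)
    (fun p : rT * chain R => ((size p.2).+1%:R%:E * Fn (p.1 :: p.2))%E)).
    exact: measurable_cons_weight.
  by move=> p; rewrite mule_ge0.
have P0 t : (0 <= P t)%E by apply: integral_ge0 => s _; rewrite mule_ge0.
have N0 t : (0 <= N t)%E by apply: integral_ge0 => s _; rewrite mule_ge0.
have IP : (\int[nu]_t P t = \int[mu]_s Fp s)%E.
  by apply: integral_chain_cons => //; rewrite /Fp funeposE /= fn maxxx.
have IN : (\int[nu]_t N t = \int[mu]_s Fn s)%E.
  by apply: integral_chain_cons => //; rewrite /Fn funenegE /= fn oppr0 maxxx.
have iP : nu.-integrable setT P.
  apply/integrableP; split => //; under eq_integral do rewrite gee0_abs//.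
  by rewrite IP; have := integral_funepos_lt_pinfty measurableT fi.
have iN : nu.-integrable setT N.
  apply/integrableP; split => //; under eq_integral do rewrite gee0_abs//.
  by rewrite IN; have := integral_funeneg_lt_pinfty measurableT fi.
have -> : ((\int[mu]_s f s)%:E = \int[nu]_t (P t - N t))%E.
  rewrite (integralB measurableT iP iN) IP IN /Rintegral fineK; last first.
    exact: integrable_fin_num.
  by rewrite integralE.
pose phi t := (P t - N t)%E.
have mphi : measurable_fun setT (phi^\+)%E.
  by apply: measurable_funepos; exact: emeasurable_funB.
apply: (@le_trans _ _ (\int[nu]_t (phi^\+ t))%E).
  rewrite integralE leeBlDr ?leeDl//; first by apply: integral_ge0 => t _; exact: funeneg_ge0.
  rewrite ge0_fin_numE; last by apply: integral_ge0 => t _; exact: funeneg_ge0.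
  by have := integral_funeneg_lt_pinfty measurableT (integrableB measurableT iP iN).
have phiE t : phi t = (\int[mu]_s ((size s).+1%:R * f (t :: s))%:E)%E.
  rewrite /phi [RHS]integralE; congr (_ - _)%E; apply: eq_integral => s _.
    by rewrite /Fp !funeposE /= maxe_weight.
  by rewrite /Fn !funenegE /= -mulrN maxe_weight.
pose psi t := ((L^-1)%:E * phi^\+ t)%E.
have psi0 t : (0 <= psi t)%E by rewrite mule_ge0// lee_fin invr_ge0 ltW.
have LV : (L%:E * (L^-1)%:E = 1)%E by rewrite -EFinM mulfV// gt_eqF.
have -> : (\int[nu]_t phi^\+ t = L%:E * \int[nu]_t psi t)%E.
  rewrite -ge0_integralZl_EFin//; last 2 first.
  - exact: measurable_funeM.
  - exact: ltW.
  by apply: eq_integral => t _; rewrite muleA LV mul1e.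
apply: lee_wpmul2l; first by rewrite lee_fin ltW.
apply: le_integral_measurable_left => //; first exact: measurable_funeM.
apply: filterS ae => t; rewrite -phiE => ht.
rewrite /psi funeposE.
have -> : Phi t = ((L^-1)%:E * (L%:E * Phi t))%E.
  by rewrite muleA -EFinM mulVf ?gt_eqF// mul1e.
apply: lee_wpmul2l; first by rewrite lee_fin invr_ge0 ltW.
by rewrite ge_max ht/= mule_ge0// lee_fin ltW.
Qed.

Lemma malliavin_pairing w v (Phi : R -> \bar R) (L : R) :
  malliavin_dom w -> malliavin_dom v -> 0 < L -> (forall t, 0 <= Phi t)%E ->
  {ae nu, forall t : rT, fock (malliavin w t) -> fock (malliavin v t) ->
    ((Re (inner (malliavin w t) (multiplier (fun s => (size s).+1%:R^-1) (malliavin v t))))%:E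
      <= L%:E * Phi t)%E} ->
  ((Re (inner w v) - Re (conjc (w [::]) * v [::]))%:E <= L%:E * \int[nu]_t Phi t)%E.
Proof.
move=> dw dv L0 Phi0 ae.
have [fw _ _] := malliavinP dw; have [fv _ _] := malliavinP dv.
have Lw := fock_L2v fw; have Lv := fock_L2v fv; have LO := fock_L2v (fock_vacuum R).
have [i1 _] := csummable_dot Lw Lv.
pose g (s : chain R) := Re (conjc (w s) * v s).
pose d (s : chain R) := g [::] * sqn (vacuum s : R[i]).
pose f s := g s - d s.
have i2 : mu.-integrable setT (EFin \o d).
  have := integrableZl measurableT (g [::]) LO.2.
  by apply: eq_integrable => // s _; rewrite /d /= EFinM.
have fi : mu.-integrable setT (EFin \o f).
  have := integrableB measurableT i1 i2.
  by apply: eq_integrable => // s _.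
have dn t s : d (t :: s) = 0 by rewrite /d /vacuum /= sqn0 mulr0.
have f0 : f [::] = 0.
  by rewrite /f /d /vacuum /sqn /= expr1n expr0n addr0 mulr1 subrr.
have <- : \int[mu]_s f s = Re (inner w v) - Re (conjc (w [::]) * v [::]).
  rewrite /f RintegralB//; congr (_ - _); first by rewrite (innerE Lw Lv).
  rewrite /d RintegralZl//; last exact: LO.2.
  by rewrite -(L2v_norm2 LO).2 fock_norm_vacuum expr1n mulr1.
apply: le_integral_disintegrated => //.
have mf : measurable_fun setT (EFin \o f) := measurable_int _ fi.
have aw := malliavin_ae dw; have av := malliavin_ae dv.
apply: filterS3 aw av ae => t [fwt ew] [fvt ev] /(_ fwt fvt).
apply: le_trans; rewrite le_eqVlt; apply/orP; left; apply/eqP.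
have ck := hull_contraction (@hull_inverse_number R).
have fk := multiplier_fock ck fvt.
have Lwt := fock_L2v fwt; have Lkt := fock_L2v fk.
rewrite (innerE Lwt Lkt) /cdot /=.
have [i3 _] := csummable_dot Lwt Lkt.
rewrite /Rintegral fineK; last exact: integrable_fin_num.
move/fock_eq_ae : ew => ew; move/fock_eq_ae : ev => ev.
apply: ae_eq_integral => //.
- rewrite (_ : (fun s => _) = fun s : chain R => ((size s).+1%:R%:E * (EFin \o f) (t :: s))%E).
    exact: (measurableT_comp (measurable_cons_weight mf) (measurable_pair1 (t : rT))).
  by apply/funext => s; rewrite -EFinM.
- exact: measurable_int i3.
- apply: filterS2 ew ev => s es1 es2 _; congr _%:E.
  rewrite /multiplier es1 es2 /malliavin_finite /f dn subr0 /g.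
  have n0 : (size s).+1%:R != 0 :> R by rewrite pnatr_eq0.
  have -> : ((size s).+1%:R : R[i]) = ((size s).+1%:R : R)%:C by rewrite rmorph_nat.
  move: n0; move: ((size s).+1%:R : R) (w _) (v _) => n [a b] [p q] n0 /=.
  by field.
Qed.

End disintegrated_pairing.

Section log_laplace.
Variable R : realType.
Local Notation rT := (measurableTypeR R).
Local Notation mu := (@chain_measure R).
Local Notation nu := (@leb_pos R).
Local Notation Re := (@complex.Re R).
Local Notation ax := (@fock_hilbert R).
Variable F : operator R.
Hypotheses (cF : clifford F) (sF : selfadjoint F) (dF : malliavin_dom (F vacuum)).
Local Notation ex s := (op_exp (s%:C *: F)).

Let fO := fock_vacuum R.
Let bF := clifford_bounded cF.
Let fw : fock (F vacuum) := hbounded_H bF fO.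

Lemma malliavin_dom_exp s : malliavin_dom (ex s vacuum).
Proof.
have [M M0 FM] := hbounded_le ax bF; have fv := fock_exp cF s fO.
exists (malliavin_finite (ex s vacuum)); apply: is_malliavin_finite => //.
have C0 : 0 <= `|s| * expR (`|s| * M) by rewrite mulr_ge0 ?expR_ge0.
apply: le_lt_trans (energy_bound fv fw C0 _) _.
  move=> e se.
  apply: (exp_sign_difference ax fO (@right_Psi_bounded R) (@right_Psi_star R)
    (@L2_starK R) (clifford_tracial cF) M0 FM (exp_clifford cF) (sign_op_bounded se)).
  - by move=> u fu; rewrite sign_opK//; exact: fock_eq_refl.
  - by move=> u v fu fv'; exact: sign_op_selfadjoint.
  - by rewrite sign_op_vacuum; exact: fock_eq_refl.
  - by move=> z; exact: right_Psi_covariant.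
apply: lte_mul_pinfty; first by rewrite lee_fin sqr_ge0.
  by [].
exact: (is_malliavin_energy (malliavinP dF)).
Qed.

Lemma laplace_derive (s : R) :
  is_derive s 1 (fun r : R => laplace F r) (Re (inner (F vacuum) (ex s vacuum))).
Proof.
have [M M0 FM] := hbounded_le ax bF.
have h := group_derive ax bF M0 FM (exp_clifford cF) s fO fO.
have fv := fock_exp cF s fO.
by rewrite (sF fO fv).
Qed.

Lemma laplace0 : laplace F 0 = 1.
Proof.
have [M M0 FM] := hbounded_le ax bF.
have e := group0 ax bF M0 FM (exp_clifford cF) fO.
rewrite /laplace (ip_eqr ax (fock_exp cF 0 fO) fO fO e) (inner_self fO).
by rewrite fock_norm_vacuum expr1n.
Qed.

Lemma conc_fun0 : conc_fun F 0 = 0%E.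
Proof.
apply: integral_ae_eq0 => [t|]; first by apply: mule_ge0; exact: Linf_norm_ge0.
have [M M0 FM] := hbounded_le ax bF.
have fv := fock_exp cF 0 fO.
have /fock_eq_ae e := group0 ax bF M0 FM (exp_clifford cF) fO.
have [aes _] := ae_chain_cons_both e.
apply: filterS2 (malliavin_ae (malliavin_dom_exp 0)) aes => t [fm em] et.
rewrite [X in (_ * X)%E](_ : _ = 0%E) ?mule0//.
have f0 := hilb0 ax.
have e0 : fock_eq (malliavin (ex 0 vacuum) t) 0.
  apply: (fock_eq_trans em); apply/fock_eq_ae; apply: filterS et => s es.
  by rewrite /malliavin_finite es /vacuum /= mulr0.
have n0 : fock_norm (malliavin (ex 0 vacuum) t) = 0.
  by rewrite (nm_eqv ax fm f0 e0) (nm0 ax).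
apply: Linf_norm_eq0; first exact: (fock_exp cF).
have [K K0 EK] := hbounded_le ax (exp_hbounded cF (- 0)).
apply/eqP; rewrite eq_le fock_norm_ge0 andbT.
by apply: le_trans (EK _ fm) _; rewrite n0 mulr0.
Qed.

Lemma laplace_conc s :
  ((Re (inner (F vacuum) (ex s vacuum)) - Re (state F) * laplace F s)%:E <=
   (laplace F s)%:E * conc_fun F s)%E.
Proof.
have [M M0 FM] := hbounded_le ax bF; have fv := fock_exp cF s fO.
have L0 := laplace_gt0 cF sF s.
have vE : ex s vacuum [::] = (laplace F s)%:C.
  rewrite -(inner_vacuum fv) /laplace.
  have := group_state ax fO (@right_Psi_bounded R) (@right_Psi_star R)
    (@L2_starK R) (clifford_tracial cF) M0 FM sF (exp_clifford cF) s.
  by move=> ->.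
have wE : Re (conjc (F vacuum [::]) * ex s vacuum [::]) = Re (state F) * laplace F s.
  rewrite vE -(inner_vacuum fw) -/(state F).
  by case: (state F) => a b; rewrite /= mulr0 subr0.
rewrite -wE; apply: malliavin_pairing => //.
- exact: malliavin_dom_exp.
- by move=> t; apply: mule_ge0; exact: Linf_norm_ge0.
- apply: aeW => t fa fb.
  exact: (weighted_pairing cF sF s (@hull_inverse_number R) fa fb).
Qed.

End log_laplace.

(** * The Legendre transform *)

Section subgradient.
Variable R : realType.
Local Notation rT := (measurableTypeR R).
Local Notation leb := (@lebesgue_measure R).

Lemma nondecreasing_emeasurable (D : set R) (f : R -> \bar R) :
  measurable (D : set rT) -> {homo f : s t / s <= t >-> (s <= t)%E} ->
  measurable_fun (D : set rT) f.
Proof.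
move=> mD f_nd.
apply: (measurability (@ErealGenCInfty.G R)) => [|/= _ [_] [r] -> <-].
  exact: ErealGenCInfty.measurableE.
apply: measurableI => //; apply: is_interval_measurable => s t/=.
rewrite !in_itv/= !andbT => fs ft u /andP[su ut].
by rewrite in_itv/= andbT (le_trans fs)// f_nd.
Qed.

Variables (phi : R -> \bar R) (G : R -> R) (x B : R).
Hypothesis phi_nd : {homo phi : s t / s <= t >-> (s <= t)%E}.
Hypothesis phi_ge0 : forall y, 0 <= y -> (0 <= phi y)%E.
Hypothesis phiG : forall y y', 0 <= y -> y < y' -> y' <= x ->
  ((y' - y)%:E * phi y <= (G y' - G y)%:E)%E.
Hypothesis GB : forall y, 0 <= y -> y <= x -> G x - G y <= B.
Hypothesis x0 : 0 < x.

Let mphi D : measurable (D : set rT) -> measurable_fun (D : set rT) phi.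
Proof. by move=> mD; exact: nondecreasing_emeasurable. Qed.

Lemma integral_subgradient_step (de : R) (k : nat) : 0 < de -> k.+1%:R * de <= x ->
  (\int[leb]_(y in `[0%R, (k%:R * de)%R]) phi y <= (G (k.+1%:R * de) - G de)%:E)%E.
Proof.
move=> d0; elim: k => [|k IH] kx.
  by rewrite mul0r set_itv1 integral_set1 mul1r subrr.
have k1x : k.+1%:R * de <= x.
  by apply: le_trans kx; apply: ler_wpM2r; [exact: ltW|rewrite ler_nat].
have kk : k%:R * de <= k.+1%:R * de by apply: ler_wpM2r; [exact: ltW|rewrite ler_nat].
have k0 : 0 <= k%:R * de by rewrite mulr_ge0// ltW.
have ek : k.+1%:R * de - k%:R * de = de by rewrite -mulrBl -natr1 addrAC subrr add0r mul1r.
have ek1 : k.+2%:R * de - k.+1%:R * de = de.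
  by rewrite -mulrBl -[k.+2%:R]natr1 addrAC subrr add0r mul1r.
rewrite (@itv_bndbnd_setU _ _ _ (BRight (k%:R * de)))//; try by rewrite bnd_simp.
rewrite ge0_integral_setU//=; last 3 first.
- by apply: mphi; apply: measurableU.
- move=> y /= [|]; rewrite in_itv/= => /andP[h _]; apply: phi_ge0 => //.
  by apply: le_trans (ltW h).
- apply/disj_set2P/seteqP; split => // y [] /=; rewrite !in_itv/= => /andP[_ h1] /andP[h2 _].
  by move: (lt_le_trans h2 h1); rewrite ltxx.
have -> : G (k.+2%:R * de) - G de =
    (G (k.+1%:R * de) - G de) + (G (k.+2%:R * de) - G (k.+1%:R * de)) by ring.
rewrite EFinD; apply: leeD; first exact: IH.
have k10 : 0 <= k.+1%:R * de := le_trans k0 kk.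
have kk1 : k.+1%:R * de < k.+2%:R * de by rewrite ltr_pM2r// ltr_nat.
apply: le_trans (phiG k10 kk1 kx); rewrite ek1.
apply: (@le_trans _ _ (\int[leb]_(y in `](k%:R * de)%R, (k.+1%:R * de)%R]) phi (k.+1%:R * de)%R)%E).
  apply: ge0_le_integral => //.
  - by move=> y /=; rewrite in_itv/= => /andP[h _]; apply: phi_ge0; apply: le_trans (ltW h).
  - exact: mphi.
  - by move=> y /=; rewrite in_itv/= => /andP[_ h]; exact: phi_nd.
have klt : k%:R * de < k.+1%:R * de by rewrite ltr_pM2r// ltr_nat.
have le := @lebesgue_measure_itv R `](k%:R * de), (k.+1%:R * de)].
rewrite /= lte_fin klt -EFinB ek in le.
rewrite integral_cst//.
by rewrite [X in (_ * X)%E]le muleC.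
Qed.

Lemma integral_subgradient : (\int[leb]_(y in `[0%R, x]) phi y <= B%:E)%E.
Proof.
rewrite -integral_itv_bndo_bndc; last exact: mphi.
pose F n := [set` `[0%R, (x - x * n.+1%:R^-1)%R]] : set R.
have -> : [set` `[0%R, x[] = \bigcup_n F n.
  apply/seteqP; split => y /=.
    rewrite in_itv/= => /andP[y0 yx].
    have /ltr_add_invr[k ky] : y / x < 1 by rewrite ltr_pdivrMr// mul1r.
    exists k => //=; rewrite /F /= in_itv/= y0/= lerBrDr.
    have := ltW ky; rewrite -(ler_pM2l x0) mulrDr mulr1 mulrCA mulfV ?mulr1//.
    by rewrite gt_eqF.
  move=> [k _]; rewrite /F /= !in_itv/= => /andP[-> h] /=; apply: le_lt_trans h _.
  by rewrite ltrBlDr ltrDl mulr_gt0// invr_gt0.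
have mF n : measurable (F n : set rT) by exact: measurable_itv.
have nd : {homo F : n m / (n <= m)%N >-> (n <= m)%O}.
  move=> n m nm; apply/subsetPset => y; rewrite /F /= !in_itv/= => /andP[-> h] /=.
  apply: le_trans h _; rewrite lerD2l lerN2; apply: ler_wpM2l; first exact: ltW.
  by rewrite lef_pV2 ?posrE// ler_nat.
have F0 n y : F n y -> (0 <= phi y)%E.
  by rewrite /F /= in_itv/= => /andP[y0 _]; exact: phi_ge0.
have c := ge0_nondecreasing_set_cvg_integral (mu := lebesgue_measure) nd mF (fun n => mphi (mF n)) F0.
rewrite -(cvg_lim _ c)//; apply: lime_le; first by apply/cvg_ex; eexists; exact: c.
apply: nearW => n.
have de0 : 0 < x * n.+1%:R^-1 by rewrite mulr_gt0// invr_gt0.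
have n1 : n.+1%:R != 0 :> R by rewrite pnatr_eq0.
have nE : n.+1%:R * (x * n.+1%:R^-1) = x by rewrite mulrCA mulfV// mulr1.
have nE' : x - x * n.+1%:R^-1 = n%:R * (x * n.+1%:R^-1).
  by rewrite -{1}nE -natr1 mulrDl mul1r addrK.
rewrite /F nE'; apply: le_trans (integral_subgradient_step de0 _) _; first by rewrite nE.
rewrite nE lee_fin; apply: GB; first exact: ltW.
by rewrite -[leRHS]mulr1; apply: ler_wpM2l; [exact: ltW|rewrite invf_le1// ler1n].
Qed.

End subgradient.

Section legendre.
Variable R : realType.
Variables (L dL : R -> R) (h : R -> \bar R) (m x p : R).
Hypothesis L0 : forall s, 0 < L s.
Hypothesis L1 : L 0 = 1.
Hypothesis dLP : forall s : R, is_derive s 1 L (dL s).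
Hypothesis Lh : forall s, ((dL s - m * L s)%:E <= (L s)%:E * h s)%E.
Hypothesis h0 : h 0 = 0%E.
Hypotheses (x0 : 0 <= x) (p0 : 0 <= p) (p1 : p <= 1).
Hypothesis chernoff : forall s, 0 <= s -> p * expR (s * (m + x)) <= L s.

Let Lam s := ln (L s) - m * s.

Lemma log_derive (s : R) : is_derive s 1 Lam (dL s / L s - m).
Proof.
have d1 := is_derive1_comp (is_derive1_ln (L0 s)) (dLP s).
have d2 : is_derive s (1 : R) (fun r : R => m * r) m.
  have := is_deriveZ m (is_derive_id s (1 : R)); rewrite /GRing.scale/= mulr1; exact.
have := is_deriveB d1 d2; rewrite [_ * dL s]mulrC; exact.
Qed.

Lemma log_derive_le s y : (h s <= y%:E)%E -> dL s / L s - m <= y.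
Proof.
move=> hy; have := le_trans (Lh s) (lee_wpmul2l _ hy).
rewrite lee_fin => /(_ (ltW (L0 s))); rewrite -EFinM lee_fin => h1.
by rewrite lerBlDr ler_pdivrMr// mulrDl; lra.
Qed.

Lemma log_increment a b y : a <= b -> (forall r, a <= r <= b -> (h r <= y%:E)%E) ->
  Lam b - Lam a <= y * (b - a).
Proof.
move=> ab hy.
have hh r : a <= r <= b -> - y <= - (dL r / L r - m).
  by move=> rab; rewrite lerN2; apply: log_derive_le; exact: hy.
have := derive_ge_increment ab (fun r _ => is_deriveN (log_derive r)) hh.
change ((- Lam)%R b) with (- Lam b); change ((- Lam)%R a) with (- Lam a).
lra.
Qed.

Lemma log0 : Lam 0 = 0.
Proof. by rewrite /Lam L1 ln1 mulr0 subrr. Qed.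

Lemma log_chernoff s : 0 < p -> 0 <= s -> s * x - Lam s <= - ln p.
Proof.
move=> pp s0; have := chernoff s0.
rewrite -ler_ln ?posrE//; last by rewrite mulr_gt0// expR_gt0.
by rewrite lnM ?posrE ?expR_gt0// expRK /Lam; lra.
Qed.

Let S y := [set s : R | 0 <= s /\ (h s <= y%:E)%E].
Let g y s := s * y - Lam s.
Let G y := sup [set g y s | s in S y].

Let S0 y : 0 <= y -> S y 0.
Proof. by move=> y0; split => //; rewrite h0. Qed.

Let GS y : 0 < p -> 0 <= y -> y <= x -> has_sup [set g y s | s in S y].
Proof.
move=> pp y0 yx; split; first by exists (g y 0); exists 0 => //; exact: S0.
exists (- ln p) => _ [s [s0 hs] <-]; apply: le_trans (log_chernoff pp s0).
by rewrite lerD2r; exact: ler_wpM2l.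
Qed.

Let G_subgradient y y' s : (forall s s', 0 <= s -> s <= s' -> (h s <= h s')%E) ->
  0 < p -> 0 <= y -> y < y' -> y' <= x -> S y s -> (y' - y) * s <= G y' - G y.
Proof.
move=> h_nd pp y0 yy yx Ss; have y'0 := le_trans y0 (ltW yy).
rewrite lerBrDr addrC -lerBrDr; apply: ge_sup.
  by exists (g y 0); exists 0 => //; exact: S0.
move=> _ [s2 Ss2 <-].
have [s3 [S3 s3s s3s2]] : exists s3, [/\ S y s3, s <= s3 & s2 <= s3].
  by have [?|/ltW ?] := leP s s2; [exists s2|exists s].
have [s20 hs2] := Ss2; have [s30 hs3] := S3.
have inc : Lam s3 - Lam s2 <= y * (s3 - s2).
  apply: log_increment => // r /andP[r1 r2].
  by apply: le_trans hs3; apply: h_nd => //; exact: le_trans r1.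
have le3 : g y' s3 <= G y'.
  apply: sup_upper_bound; first exact: GS.
  by exists s3 => //; split => //; apply: le_trans hs3 _; rewrite lee_fin ltW.
have : (y' - y) * s <= (y' - y) * s3 by apply: ler_wpM2l; rewrite // subr_ge0 ltW.
move: le3; rewrite /g; lra.
Qed.

Lemma legendre_bound :
  (forall s s', 0 <= s -> s <= s' -> (h s <= h s')%E) \/
  (forall s s', 0 <= s -> s <= s' -> (h s' <= h s)%E) ->
  (p%:E <= expeR (- \int[@lebesgue_measure R]_(y in `[0%R, x]) gen_inverse h y))%E.
Proof.
have [xe|xn] := eqVneq x 0.
  by move=> _; rewrite xe set_itv1 integral_set1 oppe0 expeR0 lee_fin.
have xp : 0 < x by rewrite lt_neqAle eq_sym xn.
move: p0; rewrite le_eqVlt => /predU1P[<-|pp]; first by move=> _; exact: expeR_ge0.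
have pE : p%:E = expeR (ln p)%:E by rewrite /= lnK.
case=> mono; last first.
  have hs0 s : 0 <= s -> (h s <= 0%:E)%E by move=> s0; have := mono 0 s (lexx 0) s0; rewrite h0.
  have bnd s : 0 <= s -> s * x <= - ln p.
    move=> s0; apply: le_trans (log_chernoff pp s0); rewrite lerDl oppr_ge0.
    have := @log_increment 0 s 0 s0 (fun r hr => hs0 r (proj1 (andP hr))).
    by rewrite log0 subr0 mul0r.
  have lp : 0 <= - ln p by rewrite oppr_ge0; exact: ln_le0.
  have := bnd ((- ln p + 1) / x); rewrite mulfVK// => /(_ _)/wrap[].
    by rewrite divr_ge0// addr_ge0.
  by rewrite -subr_le0 addrAC subrr add0r ler10.
rewrite pE lee_expeR leeNr -EFinN.
apply: (@integral_subgradient R _ G x (- ln p)) => //.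
- move=> y y' yy; apply: ge_ereal_sup => _ [s [s0 hs] <-]; apply: ereal_sup_ubound.
  by exists s => //; split => //; apply: le_trans hs _; rewrite lee_fin.
- by move=> y y0; apply: ereal_sup_ubound; exists 0 => //; exact: S0.
- move=> y y' y0 yy yx; have d0 : 0 < y' - y by rewrite subr_gt0.
  have -> : (G y' - G y)%:E = ((y' - y)%:E * ((G y' - G y) / (y' - y))%:E)%E.
    by rewrite -EFinM mulrCA mulfV ?mulr1// gt_eqF.
  apply: lee_wpmul2l; first by rewrite lee_fin ltW.
  apply: ge_ereal_sup => _ [s Ss <-]; rewrite lee_fin ler_pdivlMr// mulrC.
  exact: G_subgradient.
- move=> y y0 yx.
  have g0 : 0 <= G y.
    apply: le_trans (sup_upper_bound (GS pp y0 yx) _); last first.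
      by exists 0 => //; exact: S0.
    by rewrite /g mul0r log0 subrr.
  rewrite lerBlDr; apply: le_trans (_ : - ln p <= _); last by rewrite lerDl.
  have [ne _] := GS pp x0 (lexx x); apply: ge_sup => //.
  by move=> _ [s [s0 _] <-]; exact: log_chernoff.
Qed.

End legendre.

Unset Implicit Arguments.

Theorem theorem4p15 (R : realType) (F : operator R) (E : set R -> operator R) :
  clifford F ->
  selfadjoint F ->
  malliavin_dom (F vacuum) ->
  (\int[@leb_pos R]_t (Linf_norm (malliavin (F vacuum) t) ^+ 2) < +oo)%E ->
  spectral_decomposition F E ->
  (forall s s' : R, 0 <= s -> s <= s' ->
     (conc_fun F s <= conc_fun F s')%E) \/
  (forall s s' : R, 0 <= s -> s <= s' ->
     (conc_fun F s' <= conc_fun F s)%E) ->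
  forall x : R, 0 <= x ->
  ((complex.Re (state (E `[(complex.Re (state F) + x)%R, +oo[%classic)))%:E <=
   expeR (- \int[@lebesgue_measure R]_(y in `[0%R, x])
              gen_inverse (conc_fun F) y))%E.
Proof.
move=> cF sF dF _ [EP ET Emu] mono x x0.
have ax := @fock_hilbert R; have fO := fock_vacuum R; have bF := clifford_bounded cF.
have [M M0 FM] := hbounded_le ax bF.
have Eb A : measurable (A : set (measurableTypeR R)) ->
    hbounded (@fock R) (@fock_norm R) (@fock_eq R) (E A).
  by move=> /EP[].
have Esa A : measurable (A : set (measurableTypeR R)) ->
    forall u v, fock u -> fock v -> inner (E A u) v = inner u (E A v).
  by move=> /EP[_ sa _] u v; exact: sa.
have EE A : measurable (A : set (measurableTypeR R)) ->
    forall u, fock u -> fock_eq (E A (E A u)) (E A u).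
  by move=> /EP[].
set a := complex.Re (state F) + x.
have mA : measurable (`[a, +oo[%classic : set (measurableTypeR R)) by exact: measurable_itv.
set p := complex.Re _.
have pE : p = fock_norm (E `[a, +oo[%classic vacuum) ^+ 2.
  exact: (proj_sqr ax Eb Esa EE mA fO).
have fE := hbounded_H (Eb _ mA) fO.
have p0 : 0 <= p by rewrite pE sqr_ge0.
have p1 : p <= 1.
  have := Re_ip_CS ax fO fE; rewrite -/p fock_norm_vacuum mul1r (ger0_norm p0).
  rewrite pE expr2 => h; rewrite -[X in _ <= X]mul1r.
  have := fock_norm_ge0 (E `[a, +oo[%classic vacuum); rewrite le_eqVlt => /predU1P[<-|n0].
    by rewrite mulr0 mul1r.
  have n1 : fock_norm (E `[a, +oo[%classic vacuum) <= 1 by rewrite -(ler_pM2r n0) mul1r.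
  by apply: ler_pM => //; exact: ltW.
apply: (legendre_bound (laplace_gt0 cF sF) (laplace0 cF) (laplace_derive cF sF)
  (laplace_conc cF sF dF) (conc_fun0 cF dF) x0 p0 p1 _ mono).
move=> s s0.
exact: (spectral_chernoff ax bF M0 FM (exp_clifford cF) sF Eb Esa EE ET Emu a fO s0).
Qed.
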